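(* Assume: (1) the law of $\epsilon_1$ is absolutely continuous with respect to Lebesgue measure, $F$ is twice continuously differentiable with $\sup_{x\in\mathbb{R}}|F''(x)|<\infty$, $\mathbf{E}\epsilon_1=0$, $\mathbf{E}|\epsilon_1|^4<\infty$, and $y_f=x_f^T\beta+\varepsilon_f$ where $\varepsilon_f$ is independent of $\epsilon$ and has the same distribution as $\epsilon_1$; (2) either (fixed design) $X$ and $x_f$ are non-random, or (random design) $X$ and $x_f$ are random, $x_f$ is independent of $(\epsilon,\varepsilon_f)$, and $X$ is independent of $(\epsilon,\varepsilon_f,x_f)$; (3) $X^TX$ is invertible for all $n\ge p$, $X^TX/n\to A$ and $\overline{x}_n\to b$ as $n\to\infty$, where $A$ is an invertible matrix and $b\in\mathbb{R}^p$, and there is a constant $M>0$ with $\|x_i\|_2\le M$ for $i=1,\dots,n$ and $\|x_f\|_2\le M$; (4) $F'(x)>0$ for all $x\in\mathbb{R}$ and $\mathcal{U}(x)>0$ for all $0<x<\infty$. Then for all $0<\alpha,\gamma<1$ and $\delta>0$, as $n\to\infty$, $$\mathbf{P}\Big(\big|\mathbf{P}^*\big(|y_f-x_f^T\widehat\beta|\le C^*(1-\alpha,1-\gamma)\big)-(1-\alpha)\big|\le\delta\Big)\to 1,$$ $$\mathbf{P}\Big(\mathbf{P}^*\big(|y_f-x_f^T\widehat\beta|\le C^*(1-\alpha,1-\gamma)\big)\ge 1-\alpha\Big)\to 1-\gamma .$$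
   Context: Model. $p$ is fixed. For each $n\ge p$, $X$ is an $n\times p$ full-rank design matrix with $X^T=(x_1,\dots,x_n)$, $x_i\in\mathbb{R}^p$, and $y=X\beta+\epsilon$ with $\beta\in\mathbb{R}^p$ and $\epsilon=(\epsilon_1,\dots,\epsilon_n)^T$ i.i.d. with mean $0$, variance $\sigma^2$ and cumulative distribution function $F$. $x_f\in\mathbb{R}^p$ is a new regressor and $y_f$ the corresponding future observation. $\overline{x}_n=\frac1n\sum_{i=1}^n x_i$, and $\|\cdot\|_2$ is the Euclidean norm. Probability notation. In the fixed design case, $\mathbf{P}$ and $\mathbf{E}$ are ordinary probability and expectation, and $\mathbf{P}^*(\cdot)=Prob(\cdot\mid y)$, $\mathbf{E}^*=E(\cdot\mid y)$. In the random design case, $\mathbf{P}(\cdot)=Prob(\cdot\mid X,x_f)$, $\mathbf{E}=E(\cdot\mid X,x_f)$, $\mathbf{P}^*(\cdot)=Prob(\cdot\mid y,X,x_f)$, $\mathbf{E}^*=E(\cdot\mid y,X,x_f)$; assumptions (3), (4) are then required for almost every $(X,x_f)$ and conclusions hold almost surely in $(X,x_f)$. Quantities. $H(x)=\mathbf{E}\,\epsilon_1\mathbf{1}_{\epsilon_1\le x}$; $$\mathcal{V}(x,z)=\sigma^2F'(x)F'(z)\big(x_f^TA^{-1}x_f+1-2x_f^TA^{-1}b\big)-\big(F'(x)H(z)+F'(z)H(x)\big)\big(x_f^TA^{-1}b-1\big)+F(\min(x,z))-F(x)F(z);$$ $\mathcal{U}(x)=\mathcal{V}(x,x)+\mathcal{V}(-x,-x)-2\mathcal{V}(x,-x)$.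 For a function $f$, $f^-(x)=\lim_{u\to x,\,u<x}f(u)$. Predictive residual bootstrap with unconditional guarantee (PRBUG). $\widehat\beta=(X^TX)^{-1}X^Ty$. The predictive (leave-one-out) residuals are $\widehat r_i'=y_i-x_i^T(X_{-i}^TX_{-i})^{-1}X_{-i}^Ty_{-i}$ and $\widehat r_i=\widehat r_i'-\frac1n\sum_{j=1}^n\widehat r_j'$, $i=1,\dots,n$, where $X_{-i}$ and $y_{-i}$ are $X$ and $y$ with the $i$th row removed (considered for $n$ large enough that all $X_{-i}^TX_{-i}$ are invertible). Let $\widehat{\mathcal F}(x)=\frac1n\sum_{i=1}^n\mathbf{1}_{\widehat r_i\le x}$. Conditionally on the data, $\epsilon_1^*,\dots,\epsilon_n^*,\varepsilon_f^*$ are i.i.d. with distribution $\widehat{\mathcal F}$; $\epsilon^*=(\epsilon_1^*,\dots,\epsilon_n^* )^T$, $y^*=X\widehat\beta+\epsilon^*$, $y_f^*=x_f^T\widehat\beta+\varepsilon_f^*$, $\widehat\beta^*=(X^TX)^{-1}X^Ty^*$. Also, conditionally on the data, $u^*=(u_1^*,\dots,u_n^* )^T$ has i.i.d. entries with distribution $\widehat{\mathcal F}$. Define $$\widehat{\mathcal N}(x)=\sqrt n\Big(\widehat{\mathcal F}\Big(x+x_f^T(X^TX)^{-1}X^Tu^*-\frac1n\sum_{i=1}^nu_i^*\Big)-\frac1n\sum_{i=1}^n\mathbf{1}_{u_i^*\le x}\Big),\qquad \widehat{\mathcal T}(x)=\widehat{\mathcal N}(x)-\widehat{\mathcal N}^-(-x),$$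 $\mathcal{G}^*(x)=\mathbf{P}^*(|y_f^*-x_f^T\widehat\beta^*|\le x)$, $C^*_\tau=\inf\{x\in\mathbb{R}:\mathcal{G}^*(x)\ge\tau\}$ (with $\inf\emptyset=+\infty$, $\inf\mathbb{R}=-\infty$), $D^*_{1-\gamma}(x)=\inf\{z\in\mathbb{R}:\mathbf{P}^*(-\widehat{\mathcal T}(x)\le z)\ge 1-\gamma\}$, and $$C^*(1-\alpha,1-\gamma)=C^*_{\,1-\alpha+D^*_{1-\gamma}(C^*_{1-\alpha})/\sqrt n}.$$ *)

(* Defs.v *)
From HB Require Import structures.
From mathcomp Require Import all_boot all_order all_algebra.
From mathcomp Require Import all_classical all_reals all_analysis.
Import Order.TTheory GRing.Theory Num.Theory.
Import numFieldNormedType.Exports.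

Set Implicit Arguments.
Unset Strict Implicit.
Unset Printing Implicit Defensive.

Local Open Scope classical_set_scope.
Local Open Scope ring_scope.

Section families_of_random_variables.
Context {d : measure_display} {Omega : measurableType d} {R : realType}.

Definition sigma_of (I : Type) (f : I -> Omega -> R) : set (set Omega) :=
  <<s \bigcup_i preimage_set_system setT (f i) measurable >>.

Definition join_fam (I J : Type) (f : I -> Omega -> R) (g : J -> Omega -> R)
    (k : I + J) : Omega -> R :=
  match k with inl i => f i | inr j => g j end.

Definition indep_fam (P : probability Omega R) (I J : Type)
    (f : I -> Omega -> R) (g : J -> Omega -> R) : Prop :=
  forall A B, sigma_of f A -> sigma_of g B -> P (A `&` B) = (P A * P B)%E.

Definition mutual_indep (P : probability Omega R) (f : nat -> Omega -> R) :
    Prop :=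
  forall (s : seq nat) (B : nat -> set R), uniq s ->
    (forall i, measurable (B i)) ->
    P (\bigcap_(i in [set` s]) (f i @^-1` B i)) =
    (\prod_(i <- s) P (f i @^-1` B i))%E.

(* g is a version of the conditional probability of E given the
   sigma-algebra G. *)
Definition cond_prob_version (P : probability Omega R) (G : set (set Omega))
    (E : set Omega) (g : Omega -> R) : Prop :=
  [/\ (forall B : set R, measurable B -> G (g @^-1` B)),
      P.-integrable setT (EFin \o g) &
      forall A, G A -> (\int[P]_(w in A) (g w)%:E = P (A `&` E))%E].

End families_of_random_variables.

Section regression.
Context {R : realType}.

Definition dot p (u v : 'cV[R]_p) : R := (u^T *m v) 0 0.

Definition norm2 p (v : 'cV[R]_p) : R := Num.sqrt (\sum_j v j 0 ^+ 2).

Definition mean n (v : 'cV[R]_n) : R := n%:R^-1 * \sum_i v i 0.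

(* The rows of the design matrix are the first n regressors, numbered from 0. *)
Definition design p (x : nat -> 'cV[R]_p) (n : nat) : 'M[R]_(n, p) :=
  \matrix_(i, j) x i j 0.

Definition ols n p (X : 'M[R]_(n, p)) (y : 'cV[R]_n) : 'cV[R]_p :=
  invmx (X^T *m X) *m X^T *m y.

Definition loo_resid n p (X : 'M[R]_(n, p)) (y : 'cV[R]_n) : 'cV[R]_n :=
  \col_i (y i 0 - (row i X *m ols (row' i X) (row' i y)) 0 0).

Definition pred_resid n p (X : 'M[R]_(n, p)) (y : 'cV[R]_n) : 'cV[R]_n :=
  \col_i (loo_resid X y i 0 - mean (loo_resid X y)).

Definition ecdf n (r : 'cV[R]_n) (x : R) : R :=
  n%:R^-1 * \sum_i (r i 0 <= x)%R%:R.

End regression.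

Section bootstrap.
Context {R : realType}.

(* Probability of Q under the law of m i.i.d. draws from the distribution with
   cdf ecdf r: a draw is r_s with s uniform over the n indices, so the index
   vector of the m draws is uniform over the n ^ m maps from 'I_m to 'I_n.
   Tied residuals keep their multiplicity. *)
Definition boot_prob n m (r : 'cV[R]_n) (Q : pred 'cV[R]_m) : R :=
  #|[pred s : {ffun 'I_m -> 'I_n} | Q (\col_i r (s i) 0)]|%:R / (n ^ m)%:R.

Variables (n p : nat) (X : 'M[R]_(n, p)) (xf : 'cV[R]_p) (y : 'cV[R]_n).

Let r := pred_resid X y.

(* The n + 1 draws are the n bootstrap errors followed by the bootstrap
   future error. *)
Definition Gstar (x : R) : R :=
  boot_prob r (fun e : 'cV[R]_(n + 1) =>
    let ystar := X *m ols X y + usubmx e in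
    let yfstar := dot xf (ols X y) + dsubmx e 0 0 in
    `|yfstar - dot xf (ols X ystar)| <= x).

Definition Cquant (tau : R) : \bar R :=
  ereal_inf [set x%:E | x in [set x : R | tau <= Gstar x]].

Definition Nhat (u : 'cV[R]_n) (x : R) : R :=
  Num.sqrt n%:R * (ecdf r (x + dot xf (ols X u) - mean u) - ecdf u x).

Definition That (u : 'cV[R]_n) (x : R) : R :=
  Nhat u x - lim (Nhat u @ at_left (- x)).

Definition Dstar (c : R) (x : R) : R :=
  inf [set z : R | c <= boot_prob r (fun u : 'cV[R]_n => - That u x <= z)].

(* For 0 < a < 1, Cquant a is finite, so fine loses nothing; the level of the
   outer quantile may leave ]0, 1], in which case Cstar may be infinite. *)
Definition Cstar (a c : R) : \bar R :=
  Cquant (a + Dstar c (fine (Cquant a)) / Num.sqrt n%:R).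

End bootstrap.

Section assumptions.
Context {R : realType}.
Variables (F H : R -> R) (sigma : R) (p : nat).

Definition Vcov (xf : 'cV[R]_p) (A : 'M[R]_p) (b : 'cV[R]_p) (x z : R) : R :=
  sigma ^+ 2 * derive1 F x * derive1 F z *
    (dot xf (invmx A *m xf) + 1 - 2 * dot xf (invmx A *m b))
  - (derive1 F x * H z + derive1 F z * H x) * (dot xf (invmx A *m b) - 1)
  + F (Num.min x z) - F x * F z.

Definition Uvar (xf : 'cV[R]_p) (A : 'M[R]_p) (b : 'cV[R]_p) (x : R) : R :=
  Vcov xf A b x x + Vcov xf A b (- x) (- x) - 2 * Vcov xf A b x (- x).

Definition design_assumptions (x : nat -> 'cV[R]_p) (xf : 'cV[R]_p) : Prop :=
  (forall n, (p <= n)%N -> (design x n)^T *m design x n \in unitmx) /\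
  exists (A : 'M[R]_p) (b : 'cV[R]_p) (M : R),
    [/\ A \in unitmx,
        n%:R^-1 *: ((design x n)^T *m design x n) @[n --> \oo] --> A,
        n%:R^-1 *: (\sum_(i < n) x i) @[n --> \oo] --> b,
        [/\ 0 < M, forall i, norm2 (x i) <= M & norm2 xf <= M] &
        (forall t, 0 < derive1 F t) /\ (forall t, 0 < t -> 0 < Uvar xf A b t)].

End assumptions.

Section model.
Context {d : measure_display} {Omega : measurableType d} {R : realType}.
Variables (p : nat) (eps : nat -> Omega -> R) (epsf : Omega -> R).
Variables (beta : 'cV[R]_p).

(* The design is a function of the sample point; a fixed design is a constant
   one. *)
Variables (x : Omega -> nat -> 'cV[R]_p) (xf : Omega -> 'cV[R]_p).

Definition obs (n : nat) (w : Omega) : 'cV[R]_n :=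
  design (x w) n *m beta + \col_i eps i w.

Definition future_obs (w : Omega) : R := dot (xf w) beta + epsf w.

Definition coverage_event (a c : R) (n : nat) : set Omega :=
  [set w | let X := design (x w) n in
    (`|future_obs w - dot (xf w) (ols X (obs n w))|%:E
       <= Cstar X (xf w) (obs n w) a c)%E].

Definition obs_fam (n : nat) (i : 'I_n) (w : Omega) : R := obs n w i 0.

Definition design_fam (n : nat) (ij : 'I_n * 'I_p) (w : Omega) : R :=
  design (x w) n ij.1 ij.2.

Definition xf_fam (j : 'I_p) (w : Omega) : R := xf w j 0.

Definition regressor_fam (ij : nat * 'I_p) (w : Omega) : R :=
  x w ij.1 ij.2 0.

End model.

Section random_variables.
Context {d : measure_display} {Omega : measurableType d} {R : realType}.
Variable P : probability Omega R.

Definition real_cdf (e : {RV P >-> R}) (t : R) : R := fine (cdf e t).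

Definition truncated_mean (e : {RV P >-> R}) (t : R) : R :=
  fine 'E_P[fun w => e w * (e w <= t)%R%:R].

End random_variables.

(* Main.v *)
Require Import Defs.
From HB Require Import structures.
From mathcomp Require Import all_boot all_order all_algebra.
From mathcomp Require Import all_classical all_reals all_analysis.
From mathcomp Require Import measurable_realfun.
From mathcomp Require Import ring lra.
Import Order.TTheory GRing.Theory Num.Theory.
Import numFieldNormedType.Exports.
Local Open Scope classical_set_scope.
Local Open Scope ring_scope.
Set Implicit Arguments.
Unset Strict Implicit.
Unset Printing Implicit Defensive.

(** Let c > 0 satisfy F c - F (- c) = 1 - alpha, let f1 and f2 be the densities
    at c and - c, and write zeta for the estimation error of the least squares
    estimator. Given the data, an interval of half-width C covers the future
    observation with probability F (xf . zeta + C) - F (xf . zeta - C), where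
    xf . zeta is the weighted sum of the errors with the prediction weights
    w i = pred_weight n i. The theorem follows from the expansion

      sqrt n * (coverage - (1 - alpha)) = Q + S + o(1)   in probability,

    where S is the sum over i of
      (f1 - f2) * (sqrt n * w i - 1 / sqrt n) * eps i
        - (1 [ - c < eps i <= c ] - (1 - alpha)) / sqrt n,
    a sum of independent centred variables whose variance tends to V = U(c), and
    where Q is the (1 - gamma)-quantile of the centred Gaussian law of variance
    V. The coverage therefore tends to 1 - alpha in probability, and it is at
    least 1 - alpha with probability close to that of - S <= Q, which tends to
    1 - gamma because - S is asymptotically Gaussian (coverage_guarantee).

    The expansion rests on two facts. First, a predictive residual differs from
    its error by an affine function of the regressor at scale 1 / sqrt n: deleting
    one observation is invisible at that scale since the leverages are O(1 / n)
    (loo_close, resid_expansion). Hence the distribution function of the residuals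
    is, near c and near - c and at scale 1 / sqrt n, an affine function with a
    random intercept (window_affine_limit), and the bootstrap quantile is found
    by inverting it (Cquant_cvg). Second, the law of - That under the bootstrap is
    asymptotically Gaussian with the same variance V (That_cvg), so the corrected
    level contains Q / sqrt n (Cstar_cvg). In the coverage the random
    intercepts combine into S (coverage_expansion).

    Probabilistic limits are taken along ultrafilters on pairs (sample size,
    outcome) that contain every set of high probability. Along such an
    ultrafilter every tight quantity converges, so the whole analysis of the
    bootstrap becomes a deterministic statement about limits, without
    extraction of subsequences; whp_ultra carries the conclusion back to
    probabilities.

    Both Gaussian limits come from one form of Lindeberg's argument
    (lindeberg_telescope): the Gaussian averages of smooth functions form a
    semigroup (gopD), each summand is replaced by a Gaussian one at the cost of a
    third moment, and smooth functions squeeze the indicator of a half-line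
    (cvg_gcdf). It is applied to the uniform draws of the bootstrap
    (bavg_lindeberg) and to the errors (psum_lindeberg).

    Conditional probabilities are identified by freezing the conditioning
    variables, which is Fubini's theorem for independent maps, and by uniqueness
    of versions. In a random design they reduce the claim to the fixed-design
    limits for almost every value of the design (random_transfer). *)

(** * Gaussian integrals: rotation, reflection and moments *)

Section gaussian_mean.
Context {R : realType}.
Notation mu := (@lebesgue_measure R).
Notation phi := (normal_pdf 0 1 : R -> R).
Notation gam := (@normal_prob R 0 1).

Lemma ge0_integral_gauss (f : R -> \bar R) : measurable_fun setT f ->
  (forall x, 0 <= f x)%E ->
  (\int[gam]_x f x = \int[mu]_x (f x * (phi x)%:E))%E.
Proof.
move=> mfE f0.
have dom := @normal_prob_dominates R 0 1.
have mphi := measurable_normal_pdf (0 : R) 1.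
rewrite -(Radon_Nikodym_SigmaFinite.change_of_variables dom)//.
apply: ae_eq_integral => //.
- apply: emeasurable_funM => //; apply: (measurable_int mu).
  exact: Radon_Nikodym_SigmaFinite.f_integrable.
- by apply: emeasurable_funM => //; exact/measurable_EFinP.
- apply: ae_eqe_mul2l; apply: integral_ae_eq => //.
  + exact: Radon_Nikodym_SigmaFinite.f_integrable.
  + exact/measurable_EFinP.
  + move=> E _ mE; rewrite -Radon_Nikodym_SigmaFinite.f_integral//.
Qed.

Lemma normal_pdf01E (x : R) : phi x = normal_peak 1 * expR (- x ^+ 2 / 2).
Proof. by rewrite normal_pdfE ?oner_neq0// /normal_fun subr0 expr1n. Qed.

(** Completing the square in the exponent of a product of two densities. *)
Lemma normal_pdf_rotation (s t r w y : R) : 0 < t -> 0 < r ->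
  r ^+ 2 = s ^+ 2 + t ^+ 2 ->
  phi y * phi ((r * w - s * y) / t) * (r / t) =
  phi w * normal_pdf (s / r * w) (t / r) y.
Proof.
move=> t0 r0 rE.
have tr0 : 0 < t / r by rewrite divr_gt0.
rewrite !normal_pdf01E normal_pdfE ?gt_eqF// /normal_fun.
have -> : normal_peak (t / r) = normal_peak 1 * (r / t) :> R.
  rewrite /normal_peak expr1n mul1r -(mulr_natr (_ ^+ 2 * _)) -mulrA mulr_natr.
  rewrite sqrtrM ?sqr_ge0// sqrtr_sqr gtr0_norm// invfM mulrC; congr (_ * _).
  by rewrite invf_div.
have tN0 : t != 0 by rewrite gt_eqF.
have rN0 : r != 0 by rewrite gt_eqF.
have expE : expR (- y ^+ 2 / 2) * expR (- ((r * w - s * y) / t) ^+ 2 / 2) =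
    expR (- w ^+ 2 / 2) * expR (- (y - s / r * w) ^+ 2 / ((t / r) ^+ 2 *+ 2)).
  rewrite -!expRD; congr expR.
  have -> : - y ^+ 2 / 2 + - ((r * w - s * y) / t) ^+ 2 / 2 =
      - (y ^+ 2 * t ^+ 2 + (r * w - s * y) ^+ 2) / (2 * t ^+ 2).
    by field.
  have -> : - w ^+ 2 / 2 + - (y - s / r * w) ^+ 2 / ((t / r) ^+ 2 *+ 2) =
      - (w ^+ 2 * t ^+ 2 + (r * y - s * w) ^+ 2) / (2 * t ^+ 2).
    by field; rewrite tN0.
  congr (- _ / _); have -> : t ^+ 2 = r ^+ 2 - s ^+ 2 by rewrite rE addrC addKr.
  by ring.
transitivity (normal_peak 1 * normal_peak 1 * (r / t) *
  (expR (- y ^+ 2 / 2) * expR (- ((r * w - s * y) / t) ^+ 2 / 2))).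
  by move: (expR _) (expR _) => ? ?; ring.
by rewrite expE; move: (expR _) (expR _) => ? ?; ring.
Qed.

Lemma is_derive_affine (a b z : R) : is_derive z 1 (fun x : R => a + b * x) b.
Proof.
have -> : (fun x : R => a + b * x) = cst a + b *: (@idfun R) by apply/funext.
apply: (is_derive_eq (is_deriveD (is_derive_cst a z 1)
  (is_deriveZ b (is_derive_id z 1)))).
by rewrite add0r scaler1.
Qed.

Lemma continuous_affine (a b : R) : continuous (fun x : R => a + b * x).
Proof.
move=> z; apply: differentiable_continuous; apply/derivable1_diffP.
by have [] := is_derive_affine a b z.
Qed.

Lemma continuous_comp_affine (h : R -> R) (a b : R) :
  continuous h -> continuous (fun x : R => h (a + b * x)).
Proof.
move=> ch z; apply: (@continuous_comp _ _ _ (fun z : R => a + b * z) h); first exact: continuous_affine.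
exact: ch.
Qed.

(** The integral of a function of s * y + t * z depends on the pair (s, t) only
    through its norm: this is the stability of the Gaussian law under sums. *)
Lemma ge0_gauss_rotation (f : R -> R) (s t r : R) : continuous f ->
  (forall x, 0 <= f x) -> 0 < t -> 0 < r -> r ^+ 2 = s ^+ 2 + t ^+ 2 ->
  (\int[gam]_y \int[gam]_z (f (s * y + t * z))%:E = \int[gam]_w (f (r * w))%:E)%E.
Proof.
move=> cf f0 t0 r0 rE.
have tN0 : t != 0 by rewrite gt_eqF.
have rN0 : r != 0 by rewrite gt_eqF.
have mphi := measurable_normal_pdf (0 : R) 1.
have cphi := @continuous_normal_pdf R 0 1 (oner_neq0 _).
have phi0 x : 0 <= phi x by exact: normal_pdf_ge0.
have rt0 : 0 <= r / t by rewrite divr_ge0 ?ltW.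
have mcont (h : R -> R) : continuous h -> measurable_fun setT h.
  exact: continuous_measurable_fun.
have mfr (a b : R) : measurable_fun setT (fun w : R => f (a + b * w)).
  by apply: mcont; exact: continuous_comp_affine.
have mfr0 : measurable_fun setT (fun w : R => f (r * w)).
  by have := mfr 0 r; under eq_fun do rewrite add0r.
have inner (y : R) : (\int[gam]_z (f (s * y + t * z))%:E =
   \int[mu]_w (f (r * w) * (phi ((r * w - s * y) / t) * (r / t)))%:E)%E.
  rewrite ge0_integral_gauss; [|exact/measurable_EFinP|by move=> z; rewrite lee_fin].
  under eq_integral do rewrite -EFinM.
  have cG : continuous (fun w : R => f (r * w) * (phi ((r * w - s * y) / t) * (r / t))).
    move=> w; apply: (@continuousM _ _ (fun w : R => f (r * w))).
      by have := continuous_comp_affine (a := 0) (b := r) cf; under eq_fun do rewrite add0r; exact.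
    apply: (@continuousM _ _ (fun w : R => phi ((r * w - s * y) / t))); last exact: cst_continuous.
    rewrite (_ : (fun z : R => _) = (fun z : R => phi (- (s * y) / t + r / t * z))).
      exact: continuous_comp_affine.
    by apply/funext => z; congr phi; field.
  have dF (z : R) := is_derive_affine (s / r * y) (t / r) z.
  have dF' : (fun z : R => s / r * y + t / r * z)^`()%classic = cst (t / r).
    by apply/funext => z; rewrite derive1E; apply: derive_val.
  rewrite [RHS](@increasing_ge0_integration_by_substitutionT _
    (fun z : R => (s / r * y) + t / r * z) _).
  - apply: eq_integral => z _; congr EFin; rewrite !fctE dF' /=.
    have -> : r * (s / r * y + t / r * z) = s * y + t * z by field.
    have -> : (s * y + t * z - s * y) / t = z by field.
    by rewrite -!mulrA; congr (_ * _); move: (phi z) => P; field; rewrite rN0.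
  - by move=> x z xz; rewrite ltrD2l ltr_pM2l// divr_gt0.
  - by rewrite dF'; exact: cst_continuous.
  - by rewrite dF'; exact: is_cvg_cst.
  - by rewrite dF'; exact: is_cvg_cst.
  - by move=> x; have [] := dF x.
  - apply/cvgrNyPle => A.
    apply: filterS (nbhs_ninfty_le (num_real ((A - s / r * y) / (t / r)))) => z.
    by rewrite ler_pdivlMr ?divr_gt0// mulrC lerBrDl.
  - apply/cvgryPge => A.
    apply: filterS (nbhs_pinfty_ge (num_real ((A - s / r * y) / (t / r)))) => z.
    by rewrite ler_pdivrMr ?divr_gt0// lerBlDl [z * _]mulrC.
  - exact: cG.
  - by move=> w; rewrite mulr_ge0// mulr_ge0.
under eq_integral do rewrite inner.
pose h (yw : R * R) : R := f (r * yw.2) * (phi ((r * yw.2 - s * yw.1) / t) * (r / t)).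
have mh : measurable_fun setT h.
  have m1 : measurable_fun setT (fun yw : R * R => yw.1) by exact: measurable_fst.
  have m2 : measurable_fun setT (fun yw : R * R => yw.2) by exact: measurable_snd.
  apply: measurable_funM; first exact: (measurableT_comp mfr0 m2).
  apply: measurable_funM => //; apply: (measurableT_comp mphi).
  by apply: measurable_funM => //; apply: measurable_funB; apply: measurable_funM.
have h0 yw : 0 <= h yw by rewrite /h mulr_ge0// mulr_ge0.
have mhE : measurable_fun setT (fun yw => (h yw)%:E) by exact/measurable_EFinP.
rewrite [LHS]ge0_integral_gauss; first last.
- by move=> y; apply: integral_ge0 => w _; rewrite lee_fin (h0 (y, w)).
- apply: (@measurable_fun_fubini_tonelli_F _ _ (measurableTypeR R) (measurableTypeR R) R mu (fun yw => (h yw)%:E)) => //.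
transitivity (\int[mu]_y \int[mu]_w (h (y, w) * phi y)%:E)%E.
  apply: eq_integral => y _; rewrite -ge0_integralZr//.
  - by apply/measurable_EFinP; exact: (measurableT_comp mh (measurable_pair1 y)).
  - by move=> w _; rewrite lee_fin (h0 (y, w)).
  - by rewrite lee_fin phi0.
pose k (yw : R * R) : \bar R := (h yw * phi yw.1)%:E.
have mk : measurable_fun setT k.
  apply/measurable_EFinP; apply: measurable_funM => //.
  exact: (measurableT_comp mphi measurable_fst).
have k0 yw : (0 <= k yw)%E by rewrite lee_fin mulr_ge0.
transitivity (\int[mu]_y \int[mu]_w k (y, w))%E; first by [].
rewrite (@fubini_tonelli _ _ (measurableTypeR R) (measurableTypeR R) R mu mu k mk k0).
rewrite ge0_integral_gauss; [|exact/measurable_EFinP|by move=> z; rewrite lee_fin].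
apply: eq_integral => w _; rewrite /k /=.
under eq_integral => y _.
  rewrite (_ : h (y, w) * phi y =
    f (r * w) * phi w * normal_pdf (s / r * w) (t / r) y); last first.
    rewrite -mulrA -(normal_pdf_rotation _ _ t0 r0 rE) /h/=; ring.
  rewrite EFinM; over.
rewrite ge0_integralZl//=.
- by rewrite integral_normal_pdf mule1.
- by apply/measurable_EFinP; exact: measurable_normal_pdf.
- by move=> y _; rewrite lee_fin normal_pdf_ge0.
- by rewrite lee_fin mulr_ge0.
Qed.

Lemma ge0_integral_fold (f : R -> R) : continuous f -> (forall x, 0 <= f x) ->
  (\int[mu]_x (f x)%:E = \int[mu]_(x in `[0%R, +oo[) (f x)%:E +
    \int[mu]_(x in `[0%R, +oo[) (f (- x))%:E)%E.
Proof.
move=> cf f0.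
have mf : measurable_fun [set: R] f by exact: continuous_measurable_fun.
rewrite -(setUv [set` `[0%R, +oo[]) ge0_integral_setU//= ; last 4 first.
- exact: measurableC.
- by apply/measurable_EFinP; rewrite setUv.
- by move=> x _; rewrite lee_fin.
- exact/disj_setPCl.
congr (_ + _)%E.
rewrite setCitvr integral_itv_bndo_bndc; last exact/measurable_EFinP/measurable_funTS.
rewrite -{1}oppr0 ge0_integration_by_substitutionNy//.
exact: continuous_subspaceT.
Qed.

Lemma ge0_gauss_reflection (f : R -> R) : continuous f -> (forall x, 0 <= f x) ->
  (\int[gam]_x (f (- x))%:E = \int[gam]_x (f x)%:E)%E.
Proof.
move=> cf f0.
have cphi := @continuous_normal_pdf R 0 1 (oner_neq0 _).
have cfN : continuous (fun x => f (- x)).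
  by move=> x; apply: (@continuous_comp _ _ _ -%R f); [exact: opp_continuous|exact: cf].
have phiN x : phi (- x) = phi x by rewrite !normal_pdf01E sqrrN.
rewrite !ge0_integral_gauss//; try (by apply/measurable_EFinP; exact: continuous_measurable_fun);
  try (by move=> x; rewrite lee_fin).
under eq_integral do rewrite -EFinM.
under [RHS]eq_integral do rewrite -EFinM.
have phi0 x : 0 <= phi x by exact: normal_pdf_ge0.
rewrite (@ge0_integral_fold (fun x => f (- x) * phi x)); last first.
- by move=> x; rewrite mulr_ge0.
- by move=> x; apply: continuousM; [exact: cfN|exact: cphi].
rewrite (@ge0_integral_fold (fun x => f x * phi x)); last first.
- by move=> x; rewrite mulr_ge0.
- by move=> x; apply: continuousM; [exact: cf|exact: cphi].
rewrite addeC.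
under [X in (X + _ = _)%E]eq_integral do rewrite opprK phiN.
by under [X in (_ = _ + X)%E]eq_integral do rewrite phiN.
Qed.
End gaussian_mean.

Section bounded_mean.
Context {R : realType} d (T : measurableType d) (P : probability T R).

Definition bounded_mfun (f : T -> R) :=
  measurable_fun setT f /\ exists M : R, forall x, `|f x| <= M.

Lemma bounded_mfun_integrable f : bounded_mfun f -> P.-integrable setT (EFin \o f).
Proof.
move=> [mf [M fM]]; apply: measurable_bounded_integrable => //.
  exact: (le_lt_trans (probability_le1 P measurableT) (ltry _)).
exists M; split; first exact: num_real.
by move=> x Mx y _; exact: le_trans (fM y) (ltW Mx).
Qed.

Lemma bounded_mean_cst (c : R) : \int[P]_x c = c.
Proof. by rewrite Rintegral_cst// [X in fine X](@probability_setT _ _ _ P) mulr1. Qed.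

Lemma bounded_mfun_cst (c : R) : bounded_mfun (cst c).
Proof. by split => //; exists `|c|. Qed.

Lemma bounded_mean_le f M : bounded_mfun f -> (forall x, `|f x| <= M) ->
  `|\int[P]_x f x| <= M.
Proof.
move=> bf fM; apply: le_trans (le_normr_Rintegral _ _) _ => //.
  exact: bounded_mfun_integrable.
rewrite -[leRHS]bounded_mean_cst; apply: le_Rintegral => //.
- by apply: integrable_norm; exact: bounded_mfun_integrable.
- by apply: bounded_mfun_integrable; exact: bounded_mfun_cst.
Qed.

Lemma bounded_mean_dist f g e : bounded_mfun f -> bounded_mfun g ->
  (forall x, `|f x - g x| <= e) -> `|\int[P]_x f x - \int[P]_x g x| <= e.
Proof.
move=> bf bg fg; rewrite -RintegralB//; try exact: bounded_mfun_integrable.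
apply: bounded_mean_le => //; case: bf bg => [mf [M fM]] [mg [N gN]].
split; first exact: measurable_funB.
by exists (M + N) => x; rewrite (le_trans (ler_normB _ _))// lerD.
Qed.

Lemma fin_bounded_mean f : bounded_mfun f ->
  (\int[P]_x f x)%:E = (\int[P]_x (f x)%:E)%E.
Proof.
by move=> bf; rewrite /Rintegral fineK//; apply: integrable_fin_num => //;
  exact: bounded_mfun_integrable.
Qed.
End bounded_mean.

Section gaussian_moments.
Context {R : realType}.
Notation mu := (@lebesgue_measure R).
Notation phi := (normal_pdf 0 1 : R -> R).
Notation gam := (@normal_prob R 0 1).

Let measurable_absX n : measurable_fun setT (fun y : R => `|y| ^+ n).
Proof. by apply: measurable_funX; exact: normr_measurable. Qed.

Lemma abs_cube_le_expR (y : R) : `|y| ^+ 3 <= 29 * expR (3 / 8 * y ^+ 2).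
Proof.
have h : 1 + 9 / 256 * y ^+ 4 <= expR (3 / 8 * y ^+ 2).
  have -> : 3 / 8 * y ^+ 2 = 3 / 16 * y ^+ 2 + 3 / 16 * y ^+ 2 by lra.
  rewrite expRD; set u := 3 / 16 * y ^+ 2.
  have u0 : 0 <= u by rewrite mulr_ge0// sqr_ge0.
  have := expR_ge1Dx u => h.
  have -> : 9 / 256 * y ^+ 4 = u * u by rewrite /u; field.
  by nra.
have yy : `|y| ^+ 2 = y ^+ 2 by rewrite real_normK// num_real.
have -> : `|y| ^+ 3 = `|y| * y ^+ 2 by rewrite -yy exprS.
have y4 : y ^+ 4 = `|y| ^+ 2 * `|y| ^+ 2 by rewrite yy; ring.
rewrite -yy; have a0 : 0 <= `|y| by [].
apply: (@le_trans _ _ (1 + y ^+ 4)); last first.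
  have : 0 <= y ^+ 4 by rewrite y4 mulr_ge0// sqr_ge0.
  by rewrite yy; move: (expR _) (y ^+ 4) h => E q; lra.
rewrite y4; move: (`|y|) a0 => a a0; have [a1|/ltW a1] := leP a 1.
  have : a * a ^+ 2 <= 1 by rewrite -exprS exprn_ile1.
  have : 0 <= a ^+ 2 * a ^+ 2 by rewrite mulr_ge0// sqr_ge0.
  lra.
rewrite (le_trans (_ : _ <= a ^+ 2 * a ^+ 2)) ?lerDr//.
by rewrite ler_wpM2r ?sqr_ge0// expr2 ler_peMl.
Qed.

Lemma gauss_cube_integrable : gam.-integrable setT (fun y => (`|y| ^+ 3)%:E).
Proof.
have m3 : measurable_fun setT (fun y : R => (`|y| ^+ 3)%:E).
  apply/measurable_EFinP; exact: measurable_absX.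
apply/integrableP.
split.
  exact: m3.
under eq_integral do rewrite /= ger0_norm ?exprn_ge0//.
rewrite ge0_integral_gauss//.
pose K : R := 29 * normal_peak 1 / normal_peak 2.
have p2 : 0 < normal_peak (2 : R) by apply: normal_peak_gt0; rewrite gt_eqF.
apply: (@le_lt_trans _ _ (\int[mu]_y (K%:E * (normal_pdf 0 2 y)%:E))%E); last first.
  rewrite ge0_integralZl//=; last first.
  - by rewrite lee_fin /K divr_ge0 ?mulr_ge0 ?normal_peak_ge0.
  - by move=> y _; rewrite lee_fin normal_pdf_ge0.
  - by apply/measurable_EFinP; exact: measurable_normal_pdf.
  by rewrite integral_normal_pdf mule1 ltry.
apply: ge0_le_integral => //.
- by move=> y _; rewrite mule_ge0// lee_fin ?exprn_ge0 ?normal_pdf_ge0.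
- by apply/measurable_EFinP; apply: measurable_funM => //; try exact: measurable_absX; exact: measurable_normal_pdf.
- by apply/measurable_EFinP; apply: measurable_funM => //; try exact: measurable_absX; exact: measurable_normal_pdf.
- move=> y _; rewrite -!EFinM lee_fin normal_pdf01E normal_pdfE; last by rewrite gt_eqF.
  rewrite /K /normal_fun subr0.
  have e12 : `|y| ^+ 3 * expR (- y ^+ 2 / 2) <= 29 * expR (- y ^+ 2 / (2 ^+ 2 *+ 2)).
    have -> : - y ^+ 2 / 2 = - (3 / 8 * y ^+ 2) + - y ^+ 2 / (2 ^+ 2 *+ 2) by field.
    rewrite expRD expRN mulrA ler_wpM2r ?expR_ge0// ler_pdivrMr ?expR_gt0//.
    exact: abs_cube_le_expR.
  rewrite mulrCA [leRHS](_ : _ = normal_peak 1 * (29 * expR (- y ^+ 2 / (2 ^+ 2 *+ 2)))).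
    by rewrite ler_wpM2l ?normal_peak_ge0.
  by move: (expR _) => E; field; rewrite gt_eqF.
Qed.

Lemma gauss_sqr_integrable : gam.-integrable setT (fun y => (y ^+ 2)%:E).
Proof.
apply: (@le_integrable _ _ _ gam setT measurableT (fun y : R => (y ^+ 2)%:E)
  (fun y : R => (1 + `|y| ^+ 3)%:E)).
- by apply/measurable_EFinP; exact: measurable_funX.
- move=> y _ /=; rewrite lee_fin normrX [leRHS]ger0_norm ?addr_ge0 ?exprn_ge0//.
  move: (`|y|) (normr_ge0 y) => a a0; have [a1|/ltW a1] := leP a 1.
    by rewrite (le_trans (exprn_ile1 _ _ _))// lerDl exprn_ge0.
  by rewrite (le_trans (ler_weXn2l a1 (leqnSn 2)))// lerDr.
- have h1 : gam.-integrable setT (EFin \o cst (1 : R)).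
    by apply: bounded_mfun_integrable; exact: bounded_mfun_cst.
  exact: (integrableD measurableT h1 gauss_cube_integrable).
Qed.

Lemma gauss_itv_le (a b : R) : a <= b -> (gam `]a, b] <= ((b - a) * normal_peak 1)%:E)%E.
Proof.
move=> ab; rewrite /normal_prob.
apply: (@le_trans _ _ (\int[mu]_(x in `]a, b]) (normal_peak 1)%:E)%E).
  apply: ge0_le_integral => //.
  - by move=> y _; rewrite lee_fin normal_pdf_ge0.
  - by apply/measurable_EFinP/measurable_funTS; exact: measurable_normal_pdf.
  - by move=> y _; rewrite lee_fin normal_pdf_ub// oner_neq0.
rewrite integral_cst//= lebesgue_measure_itv/= lte_fin.
have [ab'|] := ltP a b; first by rewrite -EFinD -EFinM lee_fin mulrC.
by rewrite mule0 lee_fin mulr_ge0 ?subr_ge0 ?normal_peak_ge0.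
Qed.

Lemma gauss_itv_gt0 (a b : R) : a < b -> (0 < gam `]a, b])%E.
Proof.
move=> ab; rewrite /normal_prob; pose m := `|a| + `|b|.
have ph x : x \in `]a, b] -> phi m <= phi x.
  rewrite in_itv/= => /andP[ax xb]; rewrite !normal_pdf01E.
  rewrite ler_wpM2l ?normal_peak_ge0// ler_expR ler_wpM2r// lerN2.
  rewrite -(real_normK (num_real x)) ler_sqr ?nnegrE ?addr_ge0// ler_norml.
  apply/andP; split; rewrite /m.
    by have := ler_norm (- a); rewrite normrN => ?; have := normr_ge0 b; lra.
  by have := ler_norm b => ?; have := normr_ge0 a; lra.
apply: (@lt_le_trans _ _ (\int[mu]_(x in `]a, b]) (phi m)%:E)%E).
  rewrite integral_cst//= lebesgue_measure_itv/= lte_fin ab -EFinD -EFinM lte_fin.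
  by rewrite mulr_gt0 ?subr_gt0// normal_pdf01E mulr_gt0 ?expR_gt0// normal_peak_gt0 ?oner_neq0.
apply: ge0_le_integral => //.
- by move=> y _; rewrite lee_fin normal_pdf_ge0.
- by apply/measurable_EFinP/measurable_funTS; exact: measurable_normal_pdf.
Qed.

(** Every limit law below is a rescaling of the standard Gaussian law by the
    ratio of the wanted variance to this one. *)
Definition gauss_m2 : R := \int[gam]_y (y ^+ 2).
Definition gauss_m3 : R := \int[gam]_y (`|y| ^+ 3).

Lemma gauss_m3_ge0 : 0 <= gauss_m3.
Proof. by apply: Rintegral_ge0 => y _; rewrite exprn_ge0. Qed.

Lemma gauss_m2_gt0 : 0 < gauss_m2.
Proof.
rewrite -lte_fin /gauss_m2 /Rintegral fineK; last first.
  by apply: integrable_fin_num => //; exact: gauss_sqr_integrable.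
apply: (@lt_le_trans _ _ (gam `]1, 2])); first by apply: gauss_itv_gt0; rewrite ltr1n.
have mE : measurable_fun setT (fun y : R => (y ^+ 2)%:E).
  by apply/measurable_EFinP; exact: measurable_funX.
have -> : gam `]1, 2] = (\int[gam]_(x in `]1%R, 2%R]) 1)%E by rewrite integral_cst// mul1e.
apply: (@le_trans _ _ (\int[gam]_(x in `]1%R, 2%R]) (x ^+ 2)%:E)%E); last first.
  by apply: ge0_subset_integral => // y _; rewrite lee_fin sqr_ge0.
apply: ge0_le_integral => //; first exact: measurable_funTS.
move=> y; rewrite /= in_itv/= => /andP[y1 _]; rewrite lee_fin.
by rewrite expr_ge1 ?ltW// (lt_trans _ y1).
Qed.
End gaussian_moments.

(** * Gaussian smoothing operators *)

Section bounded_mean_linear.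
Context {R : realType} d (T : measurableType d) (P : probability T R).

Lemma bounded_mean_comb4 (a b c e : T -> R) (h k : R) :
  bounded_mfun a -> bounded_mfun b -> bounded_mfun c -> bounded_mfun e ->
  \int[P]_x (a x - b x - c x * h - e x * k) =
  \int[P]_x a x - \int[P]_x b x - \int[P]_x c x * h - \int[P]_x e x * k.
Proof.
move=> ba bb bc be.
have i f : bounded_mfun f -> P.-integrable setT (EFin \o f).
  by move=> bf; exact: bounded_mfun_integrable.
have iZ f r : bounded_mfun f -> P.-integrable setT (EFin \o (fun x => f x * r)).
  by move=> bf; apply: (integrableZr measurableT r (i _ bf)).
have iB f g : P.-integrable setT (EFin \o f) -> P.-integrable setT (EFin \o g) ->
    P.-integrable setT (EFin \o (fun x => f x - g x)).
  by move=> intf intg; exact: (integrableB measurableT intf intg).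
have iab := iB _ _ (i _ ba) (i _ bb); have iabc := iB _ _ iab (iZ _ h bc).
rewrite (RintegralB measurableT iabc (iZ _ k be)).
rewrite (RintegralB measurableT iab (iZ _ h bc)).
rewrite (RintegralB measurableT (i _ ba) (i _ bb)).
by rewrite (RintegralZr h measurableT (i _ bc)) (RintegralZr k measurableT (i _ be)).
Qed.
End bounded_mean_linear.

Section smooth_functions.
Context {R : realType}.
Notation gam := (@normal_prob R 0 1).
Implicit Types (f : R -> R) (C : R).

(** Bounded by C and Lipschitz with the same constant C, so that a single
    constant is carried through all the estimates. *)
Definition blip C f :=
  (forall x, `|f x| <= C) /\ (forall x y, `|f x - f y| <= C * `|x - y|).

Lemma blip_ge0 C f : blip C f -> 0 <= C.
Proof. by case=> fC _; exact: le_trans (normr_ge0 _) (fC 0). Qed.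

Lemma blip_continuous C f : blip C f -> continuous f.
Proof.
move=> bf x; have C0 := blip_ge0 bf; case: bf => fC fL.
apply/(@cvgrPdist_le _ R) => e e0; near=> y.
apply: (le_trans (fL x y)); rewrite (@le_trans _ _ ((C + 1) * `|x - y|))//.
  by rewrite ler_wpM2r// lerDl.
rewrite mulrC -ler_pdivlMr ?ltr_wpDl//.
near: y; apply: (@cvgr_dist_le _ _ _ _ _ id x) => //.
by rewrite divr_gt0// ltr_wpDl.
Unshelve. all: by end_near. Qed.

Lemma blip_measurable C f : blip C f -> measurable_fun setT f.
Proof. by move=> /blip_continuous cf; exact: continuous_measurable_fun. Qed.

Lemma blip_bounded_mfun C f d (T : measurableType d) (h : T -> R) : blip C f ->
  measurable_fun setT h -> bounded_mfun (fun t => f (h t)).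
Proof.
move=> bf mh; split; last by exists C => t; case: bf.
exact: (measurableT_comp (blip_measurable bf) mh).
Qed.

(** The two auxiliary functions are the first derivative and half of the second
    one; a third-order Taylor bound replaces differentiability, because it is
    directly preserved by Gaussian averages. *)
Definition smooth C f := exists f1 f2, [/\ blip C f, blip C f1, blip C f2 &
  forall x h, `|f (x + h) - f x - f1 x * h - f2 x * h ^+ 2| <= C * `|h| ^+ 3].

Definition gop (v : R) f (x : R) := \int[gam]_y f (x + Num.sqrt v * y).

Lemma gop_bounded_mfun C f v x : blip C f -> bounded_mfun (fun y : R => f (x + Num.sqrt v * y)).
Proof.
move=> bf; apply: (blip_bounded_mfun bf).
by apply: continuous_measurable_fun; exact: continuous_affine.
Qed.

Lemma gop_blip C f v : blip C f -> blip C (gop v f).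
Proof.
move=> bf; split => [x|x y].
  by apply: bounded_mean_le => [|y]; [exact: gop_bounded_mfun bf|case: bf].
apply: bounded_mean_dist => [||z]; try exact: gop_bounded_mfun bf.
by case: bf => _ /(_ (x + Num.sqrt v * z) (y + Num.sqrt v * z)); rewrite opprD addrACA subrr addr0.
Qed.

Lemma gop0 f : gop 0 f = f.
Proof.
apply/funext => x; rewrite /gop sqrtr0.
under eq_Rintegral do rewrite mul0r addr0.
exact: bounded_mean_cst.
Qed.

Lemma gop_dist C f g v x e : blip C f -> blip C g -> (forall y, `|f y - g y| <= e) ->
  `|gop v f x - gop v g x| <= e.
Proof. by move=> bf bg fg; apply: bounded_mean_dist => //; apply: gop_bounded_mfun; eauto. Qed.

(** The sum of two independent Gaussian variables is Gaussian. *)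
Lemma gopD C f s t : 0 <= s -> 0 <= t -> blip C f -> gop s (gop t f) = gop (s + t) f.
Proof.
move=> s0; rewrite le_eqVlt => /predU1P[<- bf|t0 bf]; first by rewrite gop0 addr0.
apply/funext => x; have C0 := blip_ge0 bf.
pose h z := f (x + z) + C.
have h0 z : 0 <= h z.
  by rewrite /h -lerBlDr sub0r; case: bf => /(_ (x + z)); rewrite ler_norml => /andP[].
have ch : continuous h.
  move=> z; apply: continuousD; last exact: cst_continuous.
  have := @continuous_comp_affine _ f x 1 (blip_continuous bf) z.
  by under eq_fun do rewrite mul1r.
have bint g v z : blip C g -> (\int[gam]_y (g (z + Num.sqrt v * y) + C)%:E)%E = (gop v g z + C)%:E.
  move=> bg; rewrite /gop EFinD (fin_bounded_mean gam (gop_bounded_mfun v z bg)).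
  under eq_integral do rewrite EFinD.
  rewrite integralD//=; first last.
  - by apply: bounded_mfun_integrable; exact: bounded_mfun_cst.
  - by apply: bounded_mfun_integrable; exact: gop_bounded_mfun bg.
  by rewrite integral_cst// [X in (_ * X)%E](@probability_setT _ _ _ gam) mule1.
have r0 : 0 < Num.sqrt (s + t) by rewrite sqrtr_gt0 ltr_wpDl.
have st : Num.sqrt (s + t) ^+ 2 = Num.sqrt s ^+ 2 + Num.sqrt t ^+ 2.
  by rewrite !sqr_sqrtr ?addr_ge0// ltW.
have t0' : 0 < Num.sqrt t by rewrite sqrtr_gt0.
have := ge0_gauss_rotation ch h0 t0' r0 st.
rewrite /h; under eq_integral => y _.
  under eq_integral => z _ do rewrite addrA.
  rewrite bint//; over.
rewrite (bint (gop t f))//; last exact: gop_blip.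
by rewrite bint// => -[] /addIr.
Qed.

Lemma gop_smooth C f v : smooth C f -> smooth C (gop v f).
Proof.
move=> [f1 [f2 [bf bf1 bf2 fT]]]; exists (gop v f1), (gop v f2); split; try exact: gop_blip.
move=> x h; have C0 := blip_ge0 bf.
have b g z := @gop_bounded_mfun C g v z.
rewrite /gop -bounded_mean_comb4; try exact: b.
rewrite -[leLHS]/(`|_|); apply: bounded_mean_le => [|y].
  split.
    have m g z : blip C g -> measurable_fun setT (fun y : R => g (z + Num.sqrt v * y)).
      by move=> bg; have [] := b g z bg.
    by do 3?[apply: measurable_funB]; try apply: measurable_funM => //; exact: m.
  exists (C * `|h| ^+ 3) => y; rewrite (addrAC x h); exact: fT.
by rewrite (addrAC x h); exact: fT.
Qed.

(** The law is symmetric. *)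
Lemma gop_reflection C f v x : blip C f ->
  \int[gam]_y f (x - Num.sqrt v * y) = gop v f x.
Proof.
move=> bf; have C0 := blip_ge0 bf.
pose h z := f (x + Num.sqrt v * z) + C.
have h0 z : 0 <= h z.
  by rewrite /h -lerBlDr sub0r; case: bf => /(_ (x + Num.sqrt v * z)); rewrite ler_norml => /andP[].
have ch : continuous h.
  move=> z; apply: continuousD; last exact: cst_continuous.
  exact: (continuous_comp_affine (blip_continuous bf)).
have bint (g : R -> R) : bounded_mfun g -> (\int[gam]_y (g y + C)%:E)%E = (\int[gam]_y g y + C)%:E.
  move=> bg; rewrite EFinD (fin_bounded_mean gam bg).
  under eq_integral do rewrite EFinD.
  rewrite integralD//=; try exact: bounded_mfun_integrable.
    by rewrite integral_cst// [X in (_ * X)%E](@probability_setT _ _ _ gam) mule1.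
  by apply: bounded_mfun_integrable; exact: bounded_mfun_cst.
have bf2 : bounded_mfun (fun y : R => f (x - Num.sqrt v * y)).
  apply: (blip_bounded_mfun bf); apply: continuous_measurable_fun.
  by under eq_fun do rewrite -mulNr; exact: continuous_affine.
have := ge0_gauss_reflection ch h0; rewrite /h.
under eq_integral do rewrite mulrN.
by rewrite (bint _ bf2) (bint _ (gop_bounded_mfun v x bf)) => -[] /addIr.
Qed.

(** Averaging the two reflected expansions cancels the odd term, so only the
    second and third moments of the Gaussian law are involved. *)
Lemma gop_taylor C f v x f1 f2 : 0 <= v -> blip C f -> 
  (forall x h, `|f (x + h) - f x - f1 x * h - f2 x * h ^+ 2| <= C * `|h| ^+ 3) ->
  `|gop v f x - f x - f2 x * gauss_m2 * v| <= C * gauss_m3 * (v * Num.sqrt v).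
Proof.
move=> v0 bf fT; have C0 := blip_ge0 bf.
set s := Num.sqrt v.
have s0 : 0 <= s by exact: sqrtr_ge0.
have sv : s ^+ 2 = v by rewrite sqr_sqrtr.
pose a (y : R) := f (x + s * y) / 2 + f (x - s * y) / 2 - f x.
pose b (y : R) := y ^+ 2 * (f2 x * v).
have bf1 := gop_bounded_mfun v x bf.
have bf2 : bounded_mfun (fun y : R => f (x - s * y)).
  apply: (blip_bounded_mfun bf); apply: continuous_measurable_fun.
  by under eq_fun do rewrite -mulNr; exact: continuous_affine.
have i1 : gam.-integrable setT (EFin \o (fun y : R => f (x + s * y))) := bounded_mfun_integrable gam bf1.
have i2 : gam.-integrable setT (EFin \o (fun y : R => f (x - s * y))) := bounded_mfun_integrable gam bf2.
have i12 : gam.-integrable setT (EFin \o (fun y : R => f (x + s * y) / 2 + f (x - s * y) / 2)).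
  exact: (integrableD measurableT (integrableZr measurableT 2^-1 i1) (integrableZr measurableT 2^-1 i2)).
have ic : gam.-integrable setT (EFin \o cst (f x)).
  by apply: bounded_mfun_integrable; exact: bounded_mfun_cst.
have ia : gam.-integrable setT (EFin \o a) by exact: (integrableB measurableT i12 ic).
have ib : gam.-integrable setT (EFin \o b).
  exact: (integrableZr measurableT (f2 x * v) (@gauss_sqr_integrable R)).
have iab : gam.-integrable setT (EFin \o (fun y => a y - b y)) := integrableB measurableT ia ib.
have -> : gop v f x - f x - f2 x * gauss_m2 * v = \int[gam]_y (a y - b y).
  rewrite (RintegralB measurableT ia ib) (RintegralZr _ measurableT (@gauss_sqr_integrable R)).
  rewrite (RintegralB measurableT i12 ic) bounded_mean_cst.
  rewrite (RintegralD measurableT (integrableZr measurableT 2^-1 i1) (integrableZr measurableT 2^-1 i2)).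
  rewrite (RintegralZr _ measurableT i1) (RintegralZr _ measurableT i2).
  rewrite (gop_reflection v x bf) -/(gop v f x) -mulrDr -/gauss_m2.
  by move: (gop v f x) gauss_m2 => G m; field.
apply: (le_trans (le_normr_Rintegral measurableT iab)).
pose c (y : R) := `|y| ^+ 3 * (C * (v * s)).
have icc : gam.-integrable setT (EFin \o c).
  exact: (integrableZr measurableT (C * (v * s)) (@gauss_cube_integrable R)).
have -> : C * gauss_m3 * (v * s) = \int[gam]_y c y.
  by rewrite (RintegralZr _ measurableT (@gauss_cube_integrable R)) -/gauss_m3; move: gauss_m3 => m; ring.
apply: le_Rintegral => //; first exact: integrable_norm.
move=> y _; rewrite /a /b /c.
have := fT x (s * y); have := fT x (- (s * y)).
rewrite normrN normrM (ger0_norm s0) sqrrN exprMn sv.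
have -> : (s * `|y|) ^+ 3 = v * s * `|y| ^+ 3 by rewrite -sv; ring.
rewrite !ler_norml => /andP[h1 h2] /andP[h3 h4]; apply/andP.
by split; lra.
Qed.
End smooth_functions.

(** * Lindeberg exchange and convergence of distribution functions *)

Section real_convergence.
Context {R : realType}.

Lemma cvgRP (T : Type) (F : set_system T) {FF : Filter F} (f : T -> R) (l : R) :
  f t @[t --> F] --> l <-> forall e : R, 0 < e -> \forall t \near F, `|f t - l| <= e.
Proof.
split=> [/cvgrPdist_le h e e0|h].
  by apply: filterS (h e e0) => t; rewrite distrC.
by apply/cvgrPdist_le => e e0; apply: filterS (h e e0) => t; rewrite distrC.
Qed.

Lemma cvgR_near (T : Type) (F : set_system T) {FF : Filter F} (f : T -> R) (l e : R) :
  f t @[t --> F] --> l -> 0 < e -> \forall t \near F, `|f t - l| <= e.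
Proof. by move=> /cvgRP; exact. Qed.

Lemma cvgR_ball (f : R -> R) (x e : R) : {for x, continuous f} -> 0 < e ->
  exists2 d, 0 < d & forall y, `|y - x| <= d -> `|f y - f x| <= e.
Proof.
move=> cf e0.
have H : \forall y \near x, `|f x - f y| <= e by move/cvgrPdist_le : cf; apply.
have /nbhs_ballP[d d0 hd] := H; exists (d / 2); first by rewrite divr_gt0.
move=> y yd; rewrite distrC; apply: hd; rewrite /ball/= distrC (le_lt_trans yd)//.
by rewrite ltr_pdivrMr// ltr_pMr// ltr1n.
Qed.
End real_convergence.

Section taylor.
Context {R : realType}.
Implicit Types (f : R -> R) (M : R).

Lemma mean_value_bound f (df : R -> R) (x y : R) M : (forall z : R, is_derive z 1 f (df z)) ->
  (forall z, Num.min x y <= z <= Num.max x y -> `|df z| <= M) ->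
  `|f y - f x| <= M * `|y - x|.
Proof.
move=> dfE.
have cf a b : {within `[a, b], continuous f}.
  apply: derivable_within_continuous => z _; by have [] := dfE z.
wlog xy : x y / x <= y.
  move=> W dM; have [xy|/ltW yx] := leP x y; first exact: W.
  by rewrite distrC (distrC y); apply: W => // z; rewrite minC maxC; exact: dM.
move=> dM; have [c] := MVT_segment xy (fun z _ => dfE z) (cf x y).
rewrite in_itv/= => cxy ->; rewrite normrM ler_wpM2r//; apply: dM.
by rewrite (min_idPl xy) (max_idPr xy).
Qed.

Lemma smooth_of_derive f (d1 d2 d3 : R -> R) M : (forall x : R, is_derive x 1 f (d1 x)) ->
  (forall x : R, is_derive x 1 d1 (d2 x)) -> (forall x : R, is_derive x 1 d2 (d3 x)) ->
  (forall x, [/\ `|f x| <= M, `|d1 x| <= M, `|d2 x| <= M & `|d3 x| <= M]) ->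
  smooth M f.
Proof.
move=> fd1 d12 d23 B; have M0 : 0 <= M by have [/(le_trans (normr_ge0 _))] := B 0.
have lip (g dg : R -> R) : (forall x : R, is_derive x 1 g (dg x)) -> (forall x, `|dg x| <= M) ->
    forall x y, `|g x - g y| <= M * `|x - y|.
  by move=> gd gM x y; apply: mean_value_bound gd _ => z _.
exists d1, (fun x => d2 x / 2); split.
- by split; [move=> x; case: (B x)|apply: (lip _ _ fd1) => x; case: (B x)].
- by split; [move=> x; case: (B x)|apply: (lip _ _ d12) => x; case: (B x)].
- split=> [x|x y].
    rewrite normf_div (normr_nat R 2) ler_pdivrMr//; case: (B x) => _ _ h _.
    by apply: (le_trans h); rewrite ler_peMr// ler1n.
  rewrite -mulrBl normrM normfV (normr_nat R 2) ler_pdivrMr//.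
  have d3M z : `|d3 z| <= M by case: (B z).
  apply: (le_trans (lip _ _ d23 d3M x y)).
  by rewrite ler_peMr ?ler1n// mulr_ge0.
move=> x h.
have dshift (g dg : R -> R) (z : R) : (forall x : R, is_derive x 1 g (dg x)) ->
    is_derive z 1 (fun h : R => g (x + h)) (dg (x + z)).
  move=> gd; have dz : is_derive z 1 (fun h : R => x + h) 1.
    have := is_derive_affine x 1 z; by under eq_fun do rewrite mul1r.
  by apply: (is_derive_eq (is_derive1_comp (gd (x + z)) dz)); rewrite mulr1.
pose psi (k : R) := d1 (x + k) - (d1 x + d2 x * k).
have dpsi (z : R) : is_derive z 1 psi (d2 (x + z) - d2 x).
  exact: (is_deriveB (dshift _ _ z d12) (is_derive_affine (d1 x) (d2 x) z)).
pose phi (k : R) := f (x + k) - (f x + d1 x * k) - d2 x / 2 * k ^+ 2.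
have dphi (z : R) : is_derive z 1 phi (psi z).
  have dsq : is_derive z 1 (fun k : R => d2 x / 2 * k ^+ 2) (d2 x * z).
    apply: (is_derive_eq (is_deriveZ (d2 x / 2) (is_deriveX 2 (is_derive_id z 1)))).
    by rewrite /= expr1 /GRing.scale/=; field.
  apply: (is_derive_eq (is_deriveB
    (is_deriveB (dshift _ _ z fd1) (is_derive_affine (f x) (d1 x) z)) dsq)).
  by rewrite /psi; ring.
have between0 (k z : R) : Num.min 0 k <= z <= Num.max 0 k -> `|z| <= `|k|.
  move=> /andP[]; rewrite ge_min le_max => /orP[z1|z1] /orP[z2|z2].
  - by rewrite (@le_anti _ _ z 0) ?normr0// z2.
  - by rewrite (ger0_norm z1) (le_trans z2)// ler_norm.
  - by rewrite (ler0_norm z2) -normrN (le_trans _ (ler_norm _))// lerN2.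
  - by rewrite (@le_anti _ _ z k)// z2.
have psiB k : `|psi k| <= M * `|k| * `|k|.
  have := @mean_value_bound psi _ 0 k (M * `|k|) dpsi.
  have -> : psi 0 = 0 by rewrite /psi addr0 mulr0 addr0 subrr.
  rewrite !subr0; apply=> z /between0 zk.
  have d3M w : `|d3 w| <= M by case: (B w).
  apply: (le_trans (lip _ _ d23 d3M (x + z) x)).
  by rewrite addrAC subrr add0r ler_wpM2l.
have := @mean_value_bound phi _ 0 h (M * `|h| * `|h|) dphi.
have -> : phi 0 = 0 by rewrite /phi addr0 mulr0 addr0 subrr expr0n mulr0 subr0.
rewrite !subr0 /phi opprD addrA => H.
rewrite (_ : M * `|h| ^+ 3 = M * `|h| * `|h| * `|h|); last by ring.
apply: H => z /between0 zh; apply: (le_trans (psiB z)).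
by rewrite -!mulrA ler_wpM2l// ler_pM.
Qed.

(** The logistic function solves g' = g ^ 2 - g, which bounds all its
    derivatives at once. *)
Definition logistic (x : R) : R := (1 + expR x)^-1.

Lemma logistic_in01 x : 0 < logistic x < 1.
Proof.
have e0 := expR_gt0 x; rewrite /logistic invr_gt0 addr_gt0//=.
by rewrite invf_lt1 ?ltrDl// addr_gt0.
Qed.

Lemma logistic_is_derive (x : R) : is_derive x 1 logistic (logistic x ^+ 2 - logistic x).
Proof.
have e0 := expR_gt0 x; have n0 : 1 + expR x != 0 by rewrite gt_eqF// addr_gt0.
have de : is_derive x 1 (fun y : R => 1 + expR y) (0 + expR x).
  exact: (is_deriveD (is_derive_cst (1 : R) x 1) (is_derive_expR x)).
apply: (@is_derive_eq _ _ _ logistic x 1 _ _ (@is_deriveV R (fun y : R => 1 + expR y) x (0 + expR x) 1 n0 de)).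
by rewrite /logistic /GRing.scale/= add0r; field.
Qed.

Definition sstep (K z x : R) : R := logistic (K * (x - z)).

Lemma sstep_smooth K z : exists M, smooth M (sstep K z).
Proof.
pose g (x : R) := sstep K z x.
have g1 (x : R) : is_derive x 1 g (K * (g x ^+ 2 - g x)).
  have da : is_derive x 1 (fun x : R => K * (x - z)) K.
    have := is_derive_affine (- (K * z)) K x.
    by under eq_fun do rewrite addrC -mulrBr.
  apply: (@is_derive_eq _ _ _ g x 1 _ _ (@is_derive1_comp R logistic
    (fun x : R => K * (x - z)) x _ _ (logistic_is_derive (K * (x - z))) da)).
  by rewrite mulrC.
have gX n (x : R) : is_derive x 1 (fun x : R => g x ^+ n)
    (n%:R * g x ^+ n.-1 * (K * (g x ^+ 2 - g x))).
  have -> : (fun x0 : R => g x0 ^+ n) = g ^+ n by rewrite exprfctE.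
  exact: (is_deriveX n (g1 x)).
pose d1 (x : R) : R := K * (g x ^+ 2 - g x).
pose d2 (x : R) : R := K ^+ 2 * (2 * g x ^+ 3 - 3 * g x ^+ 2 + g x).
pose d3 (x : R) : R := K ^+ 3 * ((6 * g x ^+ 2 - 6 * g x + 1) * (g x ^+ 2 - g x)).
have d12 (x : R) : is_derive x 1 d1 (d2 x).
  apply: (is_derive_eq (is_deriveZ K (is_deriveB (gX 2 x) (g1 x)))).
  by rewrite /d2 /GRing.scale/=; ring.
have d23 (x : R) : is_derive x 1 d2 (d3 x).
  apply: (is_derive_eq (is_deriveZ (K ^+ 2) (is_deriveD
    (is_deriveB (is_deriveZ 2 (gX 3 x)) (is_deriveZ 3 (gX 2 x))) (g1 x)))).
  by rewrite /d3 /GRing.scale/=; ring.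
pose L : R := 1 + `|K|; have L1 : 1 <= L by rewrite lerDl.
have KL n : `|K ^+ n| <= L ^+ n by rewrite normrX lerXn2r ?nnegrE ?addr_ge0// lerDr.
have LX n : (n <= 3)%N -> L ^+ n <= L ^+ 3 by move=> n3; exact: ler_weXn2l.
have LM n u : (n <= 3)%N -> `|u| <= 13 -> `|K ^+ n * u| <= 13 * L ^+ 3.
  move=> n3 u13; rewrite normrM mulrC ler_pM//.
  exact: le_trans (KL n) (LX n n3).
exists (13 * L ^+ 3); apply: (smooth_of_derive g1 d12 d23) => x.
have /andP[g0 g1'] : 0 < g x < 1 by exact: logistic_in01.
have ga : 0 <= g x by exact: ltW.
have gb : g x <= 1 by exact: ltW.
have q1 : 0 <= g x ^+ 2 <= g x by rewrite sqr_ge0 expr2 ler_piMl.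
have q2 : 0 <= g x ^+ 3 <= g x ^+ 2 by rewrite exprn_ge0// [g x ^+ 3]exprS ler_piMl// sqr_ge0.
move: q1 q2; rewrite /d1 /d2 /d3 => /andP[q1 q2] /andP[q3 q4]; split.
- by rewrite -[g x]mul1r -(expr0 K); apply: LM => //; rewrite ger0_norm//; lra.
- by rewrite -{1}(expr1 K); apply: LM => //; rewrite ler_norml; apply/andP; split; lra.
- by apply: LM => //; rewrite ler_norml; apply/andP; split; lra.
- apply: LM => //; rewrite normrM; apply: le_trans (_ : 13 * 1 <= _); last by rewrite mulr1.
  by apply: ler_pM => //; rewrite ler_norml; apply/andP; split; lra.
Qed.

Lemma sstep_le (K z x e : R) : 0 < e -> 0 < K -> z + e <= x -> sstep K z x <= (K * e)^-1.
Proof.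
move=> e0 K0 zx; have Ke0 : 0 < K * e by exact: mulr_gt0.
rewrite /sstep /logistic lef_pV2 ?posrE ?addr_gt0 ?expR_gt0//.
have := expR_ge1Dx (K * (x - z)) => h.
have : K * e <= K * (x - z) by rewrite ler_pM2l//; lra.
by lra.
Qed.

Lemma sstep_ge (K z x e : R) : 0 < e -> 0 < K -> x <= z - e -> 1 - (K * e)^-1 <= sstep K z x.
Proof.
move=> e0 K0 zx; have := @sstep_le K (- z) (- x) e e0 K0.
rewrite (_ : sstep K (- z) (- x) = 1 - sstep K z x); last first.
  rewrite /sstep /logistic (_ : K * (- x - - z) = - (K * (x - z))); last by ring.
  rewrite expRN; have := expR_gt0 (K * (x - z)); move: (expR _) => E E0.
  by field; rewrite !gt_eqF// ?addr_gt0.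
have xz : - z + e <= - x by lra.
by move=> /(_ xz); lra.
Qed.

Lemma sstep_in01 K z x : 0 < sstep K z x < 1.
Proof. exact: logistic_in01. Qed.
End taylor.

Section lindeberg.
Context {R : realType}.
Notation gam := (@normal_prob R 0 1).
Implicit Types (f : R -> R) (C : R).

(** Lindeberg's exchange argument: the summands are replaced one at a time by
    Gaussian ones, and a Gaussian average of a smooth function is smooth with
    the same constant, so the error of each exchange does not accumulate in
    the constants. *)
Lemma lindeberg_telescope (E : nat -> (R -> R) -> R) (w err : nat -> R) C n f :
  (forall k, (k < n)%N -> 0 <= w k) -> (forall f, E 0%N f = f 0) ->
  (forall k f, (k < n)%N -> smooth C f -> `|E k.+1 f - E k (gop (w k) f)| <= err k) ->
  smooth C f ->
  `|E n f - gop (\sum_(k < n) w k) f 0| <= \sum_(k < n) err k.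
Proof.
move=> + E0; elim: n f => [|n IH] f w0 Estep sf.
  by rewrite !big_ord0 gop0 E0 subrr normr0.
rewrite !big_ord_recr /= -(@gopD _ C)//; first last.
- by have [? [? []]] := sf.
- by apply: w0.
- by apply: sumr_ge0 => i _; apply: w0; rewrite ltnW// ltnS ltn_ord.
have h1 := Estep n f (ltnSn n) sf.
have h2 : `|E n (gop (w n) f) - gop (\sum_(k < n) w k) (gop (w n) f) 0| <= \sum_(k < n) err k.
  apply: IH => [k kn|k g kn sg|]; last exact: gop_smooth.
  - by apply: w0; exact: ltnW.
  - by apply: Estep => //; exact: ltnW.
rewrite -[_ - _](subrKA (E n (gop (w n) f))) addrC.
by apply: (le_trans (ler_normD _ _)); rewrite lerD.
Qed.

Lemma gop_continuous_var C f x : smooth C f -> exists K : R, forall s u, 0 <= s -> 0 <= u -> u <= 1 ->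
  `|gop (s + u) f x - gop s f x| <= K * u.
Proof.
move=> sf; have [f1 [f2 [bf bf1 bf2 fT]]] := sf; have C0 := blip_ge0 bf.
exists (C * gauss_m2 + C * gauss_m3) => s u s0 u0 u1.
have m2 := @gauss_m2_gt0 R; have m3 := @gauss_m3_ge0 R.
rewrite -(gopD s0 u0 bf); apply: (gop_dist _ _ (gop_blip _ bf) bf) => y.
have := gop_taylor y u0 bf fT => h.
have e1 : `|f2 y * gauss_m2 * u| <= C * gauss_m2 * u.
  rewrite !normrM (ger0_norm u0) (gtr0_norm m2) ler_wpM2r// ler_wpM2r ?(ltW m2)//.
  by case: bf2.
have e2 : C * gauss_m3 * (u * Num.sqrt u) <= C * gauss_m3 * u.
  rewrite ler_wpM2l ?mulr_ge0// ler_piMr// -[leRHS]sqrtr1 ler_wsqrtr//.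
rewrite mulrDl; move: h e1; rewrite !ler_norml => /andP[h1 h2] /andP[h3 h4].
by apply/andP; split; lra.
Qed.

Lemma cvg_gop (T : Type) (F : set_system T) {FF : Filter F} (v : T -> R) (V : R) C f (x : R) :
  (forall t, 0 <= v t) -> 0 <= V -> v t @[t --> F] --> V -> smooth C f ->
  gop (v t) f x @[t --> F] --> gop V f x.
Proof.
move=> v0 V0 vV sf; have [K hK] := gop_continuous_var x sf.
have K0 : 0 <= K.
  by have := hK 0 1 (lexx _) ler01 (lexx _); rewrite mulr1; exact: le_trans.
apply/cvgRP => e e0.
have d0 : 0 < Num.min 1 (e / (K + 1)) by rewrite lt_min ltr01 divr_gt0 ?ltr_wpDl.
apply: filterS ((cvgRP v V).1 vV _ d0) => t.
rewrite le_min => /andP[h1 h2].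
have h3 : K * `|v t - V| <= e.
  move: h2; rewrite ler_pdivlMr ?ltr_wpDl//; apply: le_trans.
  by rewrite mulrC ler_wpM2l// lerDl.
have [Vv|/ltW vV'] := leP V (v t).
  have vV0 : 0 <= v t - V by rewrite subr_ge0.
  rewrite ger0_norm// in h1; rewrite ger0_norm// in h3.
  by have := hK V (v t - V) V0 vV0 h1; rewrite (addrC V) subrK => /le_trans; apply.
have vV0 : 0 <= V - v t by rewrite subr_ge0.
rewrite distrC ger0_norm// in h1; rewrite distrC ger0_norm// in h3.
have := hK (v t) (V - v t) (v0 t) vV0 h1; rewrite (addrC (v t)) subrK distrC.
by move/le_trans; apply.
Qed.

(** The law with this distribution function has variance v * gauss_m2, so a limit
    variance V corresponds to the parameter V / gauss_m2. *)
Definition gcdf (v z : R) : R := fine (gam `]-oo, z / Num.sqrt v]).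


Lemma gcdf_fin z v : (gcdf v z)%:E = gam `]-oo, z / Num.sqrt v].
Proof. by rewrite /gcdf fineK// fin_num_measure. Qed.

Lemma gcdfB v a b : 0 < v -> a <= b ->
  (gcdf v b - gcdf v a)%:E = gam `]a / Num.sqrt v, b / Num.sqrt v].
Proof.
move=> v0 ab; have s0 : 0 < Num.sqrt v by rewrite sqrtr_gt0.
rewrite EFinB !gcdf_fin.
have -> : `]-oo, b / Num.sqrt v]%classic =
    `]-oo, a / Num.sqrt v]%classic `|` `]a / Num.sqrt v, b / Num.sqrt v]%classic.
  by rewrite -itv_bndbnd_setU// bnd_simp ler_pM2r ?invr_gt0.
rewrite measureU//.
  by rewrite addeAC subee ?add0e// fin_num_measure.
rewrite -subset0 => x [] /=; rewrite !in_itv/= => xa /andP[ax _].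
by move: ax; rewrite ltNge xa.
Qed.

Lemma gcdf_lt v a b : 0 < v -> a < b -> gcdf v a < gcdf v b.
Proof.
move=> v0 ab; rewrite -subr_gt0 -lte_fin (gcdfB v0 (ltW ab)).
by apply: gauss_itv_gt0; rewrite ltr_pM2r ?invr_gt0 ?sqrtr_gt0.
Qed.

Lemma gcdf_lip v a b : 0 < v -> a <= b ->
  gcdf v b - gcdf v a <= (b - a) * (normal_peak 1 / Num.sqrt v).
Proof.
move=> v0 ab; rewrite -lee_fin (gcdfB v0 ab).
apply: le_trans (gauss_itv_le _) _; first by rewrite ler_pM2r ?invr_gt0 ?sqrtr_gt0.
by rewrite lee_fin -mulrBl -mulrA (mulrC (normal_peak 1)) mulrA.
Qed.

Lemma gcdf_continuous v : 0 < v -> continuous (gcdf v).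
Proof.
move=> v0 x; apply/cvgRP => e e0; pose L := normal_peak 1 / Num.sqrt v : R.
have L0 : 0 < L by rewrite divr_gt0 ?sqrtr_gt0// normal_peak_gt0// oner_neq0.
near=> y.
have yx : `|y - x| * L <= e.
  rewrite -ler_pdivlMr//; near: y.
  by apply: (cvgRP (fun y : R => y) x).1 => //; rewrite divr_gt0.
apply: le_trans yx; have [xy|/ltW yx] := leP x y.
  rewrite !ger0_norm ?subr_ge0//; first exact: gcdf_lip.
  by move: xy; rewrite le_eqVlt => /predU1P[->//|xy]; exact/ltW/gcdf_lt.
rewrite distrC (distrC y) !ger0_norm ?subr_ge0//; first exact: gcdf_lip.
by move: yx; rewrite le_eqVlt => /predU1P[->//|yx]; exact/ltW/gcdf_lt.
Unshelve. all: by end_near. Qed.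

Lemma gcdf_surj v c : 0 < v -> 0 < c < 1 -> exists q, gcdf v q = c.
Proof.
move=> v0 /andP[c0 c1]; have s0 : 0 < Num.sqrt v by rewrite sqrtr_gt0.
have cvg1 (A : nat -> set R) : (forall n, measurable (A n)) -> nondecreasing_seq A ->
    \bigcup_n A n = setT -> fine (gam (A n)) @[n --> \oo] --> (1 : R).
  move=> mA ndA AT; have := nondecreasing_cvg_mu (mu := gam) mA _ ndA.
  rewrite AT => /(_ measurableT); rewrite [X in _ --> X](@probability_setT _ _ _ gam).
  exact: fine_cvg.
have gE z : gcdf v (z * Num.sqrt v) = fine (gam `]-oo, z]).
  by rewrite /gcdf mulfK ?gt_eqF.
have [a ca] : exists a, gcdf v a < c.
  have := cvg1 (fun n => `]- n%:R, +oo[%classic) _ _ _.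
  have c1' : 1 - c < 1 by rewrite ltrBlDr ltrDl.
  move=> h; have {h} : fine (gam `]- n%:R, +oo[) @[n --> \oo] --> (1 : R).
    apply: h => //; first by move=> m n mn; apply/subsetPset => x /=; rewrite !in_itv/= !andbT; apply: le_lt_trans; rewrite lerN2 ler_nat.
    rewrite -subTset => x _; exists (Num.truncn `|x|).+1 => //=; rewrite in_itv/= andbT.
    by rewrite ltrNl (le_lt_trans (ler_norm _))// normrN truncnS_gt.
  move=> /cvgr_gt /(_ _ c1') /filter_ex[n hn]; exists (- n%:R * Num.sqrt v).
  rewrite gE; have := probability_setC gam (measurable_itv `]- n%:R, +oo[).
  rewrite setCitvr => ->; rewrite fineB ?fin_num_measure//=; lra.
have [b cb] : exists b, c < gcdf v b.
  have := cvg1 (fun n => `]-oo, n%:R]%classic) _ _ _.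
  move=> h; have {h} : fine (gam `]-oo, n%:R]) @[n --> \oo] --> (1 : R).
    apply: h => //; first by move=> m n mn; apply/subsetPset => x /=; rewrite !in_itv/= => /le_trans; apply; rewrite ler_nat.
    rewrite -subTset => x _; exists (Num.truncn `|x|).+1 => //=; rewrite in_itv/=.
    by rewrite (le_trans (ler_norm _))// ltW// truncnS_gt.
  move=> /cvgr_gt /(_ _ c1) /filter_ex[n hn]; exists (n%:R * Num.sqrt v).
  by rewrite gE.
have ab : a <= b.
  rewrite leNgt; apply/negP => ba; have := gcdf_lt v0 ba.
  by rewrite ltNge => /negP; apply; rewrite ltW// (lt_trans ca).
have cg : {within `[a, b], continuous (gcdf v)}.
  exact: continuous_subspaceT (gcdf_continuous v0).
have cab : Num.min (gcdf v a) (gcdf v b) <= c <= Num.max (gcdf v a) (gcdf v b).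
  by rewrite ge_min le_max (ltW ca) (ltW cb) orbT.
by have [q _ qc] := IVT ab cg cab; exists q.
Qed.

Lemma bounded_mean_indic d (T : measurableType d) (P : probability T R) (A : set T) :
  measurable A -> \int[P]_x \1_A x = fine (P A).
Proof. by move=> mA; rewrite /Rintegral integral_indic// setIT. Qed.

Lemma indic_le_bounded d (T : measurableType d) (A : set T) (k : R) : measurable A ->
  bounded_mfun (fun x => \1_A x + k).
Proof.
move=> mA; split; first by apply: measurable_funD => //; exact: measurable_indic.
exists (1 + `|k|) => x; apply: (le_trans (ler_normD _ _)); rewrite lerD2r.
by rewrite indicE; case: (_ \in _); rewrite ?normr1 ?normr0.
Qed.

Lemma bounded_mean_indicD d (T : measurableType d) (P : probability T R) (A : set T) (k : R) :
  measurable A -> \int[P]_x (\1_A x + k) = fine (P A) + k.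
Proof.
move=> mA; rewrite RintegralD//.
- by rewrite bounded_mean_cst bounded_mean_indic.
- by have := bounded_mfun_integrable P (indic_le_bounded 0 mA); under eq_fun do rewrite addr0.
- by apply: bounded_mfun_integrable; exact: bounded_mfun_cst.
Qed.

Lemma indic_itvNyc (v z y : R) : 0 < v ->
  \1_(`]-oo, z / Num.sqrt v]) y = (0 + Num.sqrt v * y <= z)%R%:R :> R.
Proof.
move=> v0; rewrite indicE add0r; congr (nat_of_bool _)%:R.
apply/idP/idP; rewrite inE/= in_itv/= ler_pdivlMr ?sqrtr_gt0// mulrC//.
Qed.

(** A Gaussian average of a function squeezed by a step function lies on the
    same side of the Gaussian distribution function. *)
Lemma gop_le_gcdf C f v z k : 0 < v -> blip C f ->
  (forall x, f x <= (x <= z)%R%:R + k) -> gop v f 0 <= gcdf v z + k.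
Proof.
move=> v0 bf fz; rewrite /gcdf -bounded_mean_indicD//; apply: le_Rintegral => //.
- by apply: bounded_mfun_integrable; exact: gop_bounded_mfun bf.
- by apply: bounded_mfun_integrable; exact: indic_le_bounded.
- by move=> y _; rewrite (indic_itvNyc z y v0).
Qed.

Lemma gop_ge_gcdf C f v z k : 0 < v -> blip C f ->
  (forall x, (x <= z)%R%:R - k <= f x) -> gcdf v z - k <= gop v f 0.
Proof.
move=> v0 bf fz; rewrite /gcdf -bounded_mean_indicD//; apply: le_Rintegral => //.
- by apply: bounded_mfun_integrable; exact: indic_le_bounded.
- by apply: bounded_mfun_integrable; exact: gop_bounded_mfun bf.
- by move=> y _; rewrite (indic_itvNyc z y v0).
Qed.

Lemma squeeze_arith (e p g gu gl E1 E2 G1 G2 : R) :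
  `|E1 - G1| <= e / 4 -> `|E2 - G2| <= e / 4 -> E1 <= p + e / 4 -> p - e / 4 <= E2 ->
  gl - e / 4 <= G1 -> G2 <= gu + e / 4 -> gu - g <= e / 4 -> g - gl <= e / 4 ->
  `|p - g| <= e.
Proof. by rewrite !ler_norml => /andP[? ?] /andP[? ?] *; apply/andP; split; lra. Qed.

(** Convergence of smooth averages to Gaussian ones gives convergence of
    distribution functions; E t and p t are the mean and the distribution
    function of one and the same law, tied by the two comparisons below. *)
Lemma cvg_gcdf (T : Type) (F : set_system T) {FF : Filter F}
    (E : T -> (R -> R) -> R) (p : T -> R -> R) (V z : R) : 0 < V ->
  (forall t C f z k, blip C f -> (forall x, f x <= (x <= z)%R%:R + k) -> E t f <= p t z + k) ->
  (forall t C f z k, blip C f -> (forall x, (x <= z)%R%:R - k <= f x) -> p t z - k <= E t f) ->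
  (forall C f, smooth C f -> E t f @[t --> F] --> gop V f 0) ->
  p t z @[t --> F] --> gcdf V z.
Proof.
move=> V0 Ele Ege Ecvg; apply/cvgRP => e e0.
pose L := normal_peak 1 / Num.sqrt V : R.
have L0 : 0 < L by rewrite divr_gt0 ?sqrtr_gt0// normal_peak_gt0// oner_neq0.
pose n := e / 8 / L; have n0 : 0 < n by rewrite divr_gt0// divr_gt0.
pose K := (n * (e / 4))^-1; have K0 : 0 < K by rewrite invr_gt0 mulr_gt0// divr_gt0.
have Kn : (K * n)^-1 = e / 4.
  by rewrite /K invfM invrK mulrC mulKf ?gt_eqF.
have stepU a x : sstep K (a - n) x <= (x <= a)%R%:R + e / 4.
  have /andP[_ s1] := sstep_in01 K (a - n) x.
  have [xa|xa] := leP x a; first by rewrite (le_trans (ltW s1))// lerDl divr_ge0 ?ltW.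
  by rewrite add0r -Kn; apply: sstep_le => //; rewrite subrK ltW.
have stepL a x : (x <= a)%R%:R - e / 4 <= sstep K (a + n) x.
  have /andP[s1 _] := sstep_in01 K (a + n) x.
  have [xa|xa] := leP x a; first by rewrite -Kn; apply: sstep_ge => //; rewrite addrK.
  by rewrite (le_trans _ (ltW s1))// sub0r oppr_le0 divr_ge0 ?ltW.
have blipS a : exists C, smooth C (sstep K a) /\ blip C (sstep K a).
  by have [C sC] := @sstep_smooth R K a; exists C; split => //; case: sC => ? [? []].
have [C1 [s1 b1]] := blipS (z - n); have [C2 [s2 b2]] := blipS (z + n).
have e4 : 0 < e / 4 by rewrite divr_gt0.
have gz a b : a <= b -> b - a <= 2 * n -> gcdf V b - gcdf V a <= e / 4.
  move=> ab ba; apply: (le_trans (gcdf_lip V0 ab)); rewrite -/L.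
  rewrite (_ : e / 4 = 2 * n * L); first by rewrite ler_pM2r.
  by rewrite /n; field; rewrite gt_eqF.
clear Kn; clearbody n K L.
have up := gz z (z + n + n) _ _; have lo := gz (z - n - n) z _ _.
have stepU2 x : sstep K (z + n) x <= (x <= z + n + n)%R%:R + e / 4.
  by have := stepU (z + n + n) x; rewrite addrK.
have stepL2 x : (x <= z - n - n)%R%:R - e / 4 <= sstep K (z - n) x.
  by have := stepL (z - n - n) x; rewrite subrK.
have g1 := gop_ge_gcdf V0 b1 stepL2; have g2 := gop_le_gcdf V0 b2 stepU2.
have N1 := (cvgRP _ _).1 (Ecvg _ _ s1) _ e4.
have N2 := (cvgRP _ _).1 (Ecvg _ _ s2) _ e4.
apply: filterS2 (N1 FF) (N2 FF) => t h1 h2.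
have h3 := Ele t _ _ z _ b1 (stepU z); have h4 := Ege t _ _ z _ b2 (stepL z).
have up' : gcdf V (z + n + n) - gcdf V z <= e / 4.
  apply: up; first by rewrite -addrA lerDl addr_ge0 ?ltW.
  by rewrite (_ : z + n + n - z = 2 * n)//; ring.
have lo' : gcdf V z - gcdf V (z - n - n) <= e / 4.
  apply: lo; first by rewrite -addrA gerDl -opprD oppr_le0 addr_ge0 ?ltW.
  by rewrite (_ : z - (z - n - n) = 2 * n)//; ring.
exact: (squeeze_arith h1 h2 h3 h4 g1 g2 up' lo').
Qed.
End lindeberg.

(** * Averages over bootstrap draws *)

Section bootstrap_mean.
Context {R : realType}.

Definition bavg n m (phi : {ffun 'I_m -> 'I_n} -> R) : R :=
  (\sum_s phi s) / (n ^ m)%:R.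

Definition fmean n (xi : 'I_n -> R) : R := n%:R^-1 * \sum_j xi j.

Lemma boot_probE n m (r : 'cV[R]_n) (Q : pred 'cV[R]_m) :
  boot_prob r Q = bavg (fun s : {ffun 'I_m -> 'I_n} => (Q (\col_i r (s i) 0))%:R).
Proof.
rewrite /boot_prob /bavg; congr (_ / _).
by rewrite -sum1_card natr_sum [LHS]big_mkcond/=; apply: eq_bigr => s _; rewrite inE; case: (Q _).
Qed.

Section linearity.
Variables (n m : nat) (n0 : (0 < n)%N).
Implicit Types phi psi : {ffun 'I_m -> 'I_n} -> R.

Lemma bavg_cst (c : R) : bavg (fun _ : {ffun 'I_m -> 'I_n} => c) = c.
Proof.
rewrite /bavg sumr_const card_ffun !card_ord -[c *+ _]mulr_natr mulfK//.
by rewrite pnatr_eq0 -lt0n expn_gt0 n0.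
Qed.

Lemma bavgD phi psi : bavg (fun s => phi s + psi s) = bavg phi + bavg psi.
Proof. by rewrite /bavg big_split/= mulrDl. Qed.

Lemma bavgZ (c : R) phi : bavg (fun s => c * phi s) = c * bavg phi.
Proof. by rewrite /bavg -mulr_sumr mulrA. Qed.

Lemma bavgB phi psi : bavg (fun s => phi s - psi s) = bavg phi - bavg psi.
Proof. by rewrite /bavg -mulrBl -sumrB. Qed.

Lemma le_bavg phi psi : (forall s, phi s <= psi s) -> bavg phi <= bavg psi.
Proof.
by move=> h; rewrite /bavg ler_wpM2r ?invr_ge0 ?ler0n//; apply: ler_sum.
Qed.

Lemma bavg_abs phi : `|bavg phi| <= bavg (fun s => `|phi s|).
Proof.
rewrite /bavg normrM (ger0_norm (_ : 0 <= (_)^-1)) ?invr_ge0 ?ler0n//.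
by rewrite ler_wpM2r ?invr_ge0 ?ler0n//; exact: ler_norm_sum.
Qed.

Lemma eq_bavg phi psi : phi =1 psi -> bavg phi = bavg psi.
Proof. by move=> /funext ->. Qed.

Lemma bavg_dist phi psi e : (forall s, `|phi s - psi s| <= e) -> `|bavg phi - bavg psi| <= e.
Proof.
move=> h; rewrite -bavgB; apply: (le_trans (bavg_abs _)).
by rewrite -[leRHS](bavg_cst e); exact: le_bavg.
Qed.
End linearity.

Lemma bavg_cst_diag n (c : R) : bavg (fun _ : {ffun 'I_n -> 'I_n} => c) = c.
Proof.
case: n => [|n]; last exact: bavg_cst.
by rewrite /bavg sumr_const card_ffun !card_ord expn0 divr1.
Qed.

Definition ext_last n m (s : {ffun 'I_m -> 'I_n}) (j : 'I_n) : {ffun 'I_(m + 1) -> 'I_n} :=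
  [ffun i : 'I_(m + 1) => if fintype.split i is inl a then s a else j].

Lemma bavg_last n m (phi : {ffun 'I_(m + 1) -> 'I_n} -> R) :
  bavg phi = bavg (fun s : {ffun 'I_m -> 'I_n} => fmean (fun j => phi (ext_last s j))).
Proof.
rewrite /bavg /fmean -mulr_sumr [n%:R^-1 * _]mulrC -mulrA; congr (_ * _); last first.
  by rewrite expnD expn1 natrM invfM mulrC.
rewrite pair_big/= (reindex (fun sj : {ffun 'I_m -> 'I_n} * 'I_n => ext_last sj.1 sj.2))//=.
exists (fun s => ([ffun i : 'I_m => s (lshift 1 i)], s (rshift m ord0))) => [[s j]|s] _ /=.
  congr (_, _); last by rewrite ffunE (unsplitK (inr _)).
  by apply/ffunP => i; rewrite !ffunE (unsplitK (inl _)).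
apply/ffunP => i; rewrite ffunE; case: fintype.splitP => k ik.
  by rewrite ffunE; congr (s _); apply/val_inj.
by congr (s _); apply/val_inj => /=; rewrite ik ord1.
Qed.

(** Draws are independent: averaging over the last draw first is the exchange
    step of the Lindeberg argument. *)
Lemma bavg_sumS n m (xi : nat -> 'I_n -> R) (f : R -> R) :
  bavg (fun s : {ffun 'I_m.+1 -> 'I_n} => f (\sum_(i < m.+1) xi i (s i))) =
  bavg (fun s : {ffun 'I_m -> 'I_n} => fmean (fun j => f (\sum_(i < m) xi i (s i) + xi m j))).
Proof.
rewrite -[in LHS]addn1 bavg_last; apply: eq_bavg => s; rewrite /fmean.
congr (_ * _); apply: eq_bigr => j _; congr f.
rewrite big_split_ord/= big_ord1 /ext_last ffunE (unsplitK (inr _)) /= addn0; congr (_ + _).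
by apply: eq_bigr => i _; rewrite ffunE (unsplitK (inl _)).
Qed.

Section fmean_linear.
Variables (n : nat) (n0 : (0 < n)%N).
Implicit Types xi : 'I_n -> R.

Lemma fmean_cst (c : R) : fmean (fun _ : 'I_n => c) = c.
Proof. by rewrite /fmean sumr_const card_ord -[c *+ _]mulr_natl mulKf// pnatr_eq0 -lt0n. Qed.
Lemma fmeanD xi zeta : fmean (fun j => xi j + zeta j) = fmean xi + fmean zeta.
Proof. by rewrite /fmean big_split/= mulrDr. Qed.
Lemma fmeanB xi zeta : fmean (fun j => xi j - zeta j) = fmean xi - fmean zeta.
Proof. by rewrite /fmean -mulrBr -sumrB. Qed.
Lemma fmeanZ (c : R) xi : fmean (fun j => c * xi j) = c * fmean xi.
Proof. by rewrite /fmean -mulr_sumr mulrCA. Qed.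
Lemma le_fmean xi zeta : (forall j, xi j <= zeta j) -> fmean xi <= fmean zeta.
Proof.
by move=> h; rewrite /fmean ler_wpM2l ?invr_ge0 ?ler0n//; apply: ler_sum.
Qed.
Lemma fmean_abs xi : `|fmean xi| <= fmean (fun j => `|xi j|).
Proof.
rewrite /fmean normrM (ger0_norm (_ : 0 <= (_)^-1)) ?invr_ge0 ?ler0n//.
by rewrite ler_wpM2l ?invr_ge0 ?ler0n//; exact: ler_norm_sum.
Qed.
Lemma fmean_ge0 xi : (forall j, 0 <= xi j) -> 0 <= fmean xi.
Proof. by move=> h; rewrite mulr_ge0 ?invr_ge0 ?ler0n ?sumr_ge0. Qed.
Lemma eq_fmean xi zeta : xi =1 zeta -> fmean xi = fmean zeta.
Proof. by move=> /funext ->. Qed.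
End fmean_linear.

Section sums_of_draws.
Variables (n : nat) (n0 : (0 < n)%N) (xi : nat -> 'I_n -> R).
Hypothesis xi0 : forall k, fmean (xi k) = 0.

Lemma bavg_sum0 m : bavg (fun s : {ffun 'I_m -> 'I_n} => \sum_(i < m) xi i (s i)) = 0.
Proof.
elim: m => [|m IH]; first by under eq_bavg do rewrite big_ord0; rewrite bavg_cst.
rewrite (bavg_sumS m xi id) -[RHS]IH; apply: eq_bavg => s.
by rewrite fmeanD fmean_cst// xi0 addr0.
Qed.

Lemma bavg_sum_sqr m : bavg (fun s : {ffun 'I_m -> 'I_n} => (\sum_(i < m) xi i (s i)) ^+ 2) =
  \sum_(i < m) fmean (fun j => xi i j ^+ 2).
Proof.
elim: m => [|m IH].
  by under eq_bavg do rewrite big_ord0; rewrite bavg_cst// expr0n big_ord0.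
rewrite (bavg_sumS m xi (fun x => x ^+ 2)) big_ord_recr/= -IH.
rewrite -[X in _ + X](bavg_cst m n0) -bavgD; apply: eq_bavg => s.
under eq_fmean do rewrite sqrrD.
rewrite 2!fmeanD fmean_cst//; congr (_ + _); rewrite -[RHS]addr0 addrC -[RHS]addrC; congr (_ + _).
by under eq_fmean do rewrite -mulrnAl; rewrite fmeanZ xi0 mulr0.
Qed.

Lemma bavg_sum_tail m (K : R) : 0 < K ->
  bavg (fun s : {ffun 'I_m -> 'I_n} => (K < `|\sum_(i < m) xi i (s i)|)%R%:R) <=
  (\sum_(i < m) fmean (fun j => xi i j ^+ 2)) / K ^+ 2.
Proof.
move=> K0; rewrite -bavg_sum_sqr mulrC -bavgZ; apply: le_bavg => s.
set S := \sum_(i < m) _; case: (ltP K `|S|) => /= h; last first.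
  by rewrite mulr_ge0 ?invr_ge0 ?sqr_ge0.
rewrite mulrC ler_pdivlMr ?exprn_gt0// mul1r -[S ^+ 2]real_normK ?num_real//.
by rewrite ler_sqr ?nnegrE// ltW.
Qed.

(** The summands are not identically distributed since the weights depend on
    the index, so each one is replaced by a Gaussian variable of its own
    variance. *)
Lemma bavg_lindeberg C f m (w : nat -> R) : smooth C f -> (forall k, 0 <= w k) ->
  (forall k, fmean (fun j => xi k j ^+ 2) = w k * gauss_m2) ->
  `|bavg (fun s : {ffun 'I_m -> 'I_n} => f (\sum_(i < m) xi i (s i))) -
    gop (\sum_(k < m) w k) f 0| <=
  \sum_(k < m) C * (fmean (fun j => `|xi k j| ^+ 3) + gauss_m3 * (w k * Num.sqrt (w k))).
Proof.
move=> sf w0 wE.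
apply: (@lindeberg_telescope R (fun k f => bavg (fun s : {ffun 'I_k -> 'I_n} => f (\sum_(i < k) xi i (s i))))
  w (fun k => C * (fmean (fun j => `|xi k j| ^+ 3) + gauss_m3 * (w k * Num.sqrt (w k)))) C) => //.
  by move=> g; under eq_bavg do rewrite big_ord0; rewrite bavg_cst.
move=> {sf}k {}f _ sf; rewrite (bavg_sumS k xi f); apply: bavg_dist => // s.
move: (\sum_(i < k) _) => x; have [f1 [f2 [bf bf1 bf2 fT]]] := sf.
have C0 := blip_ge0 bf.
have h1 := gop_taylor x (w0 k) bf fT.
have h2 : `|fmean (fun j => f (x + xi k j)) - f x - f2 x * gauss_m2 * w k| <=
    C * fmean (fun j => `|xi k j| ^+ 3).
  rewrite -fmeanZ.
  have -> : fmean (fun j => f (x + xi k j)) - f x - f2 x * gauss_m2 * w k =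
      fmean (fun j => f (x + xi k j) - f x - f1 x * xi k j - f2 x * xi k j ^+ 2).
    rewrite !fmeanB !fmeanZ fmean_cst// xi0 mulr0 subr0 wE.
    by congr (_ - _); rewrite -mulrA [gauss_m2 * _]mulrC.
  by apply: (le_trans (fmean_abs _)); apply: le_fmean => j; exact: fT.
rewrite mulrDr mulrA -[X in `|X|](subrKA (f x + f2 x * gauss_m2 * w k)).
apply: (le_trans (ler_normD _ _)); rewrite lerD//; first by rewrite opprD addrA.
by rewrite distrC opprD addrA.
Qed.
End sums_of_draws.
End bootstrap_mean.

(** * Limits along ultrafilters *)

Section ultrafilter_limits.
Context {R : realType} (T : Type) (U : set_system T) {UU : UltraFilter U}.
Implicit Types (f : T -> R) (K : R).

Let near_dist := @cvgR_near R T U _.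

(** Along an ultrafilter bounded quantities converge, which replaces all
    extractions of subsequences and all uniformity over compact sets. *)
Lemma ultra_bounded_cvg f : (exists K, \forall t \near U, `|f t| <= K) ->
  exists l : R, f t @[t --> U] --> l.
Proof.
move=> [K fK]; have := @segment_compact R (- K) K => /(_ (f t @[t --> U]) _).
have fin : (f t @[t --> U]) `[- K, K]%classic.
  by apply: filterS fK => t; rewrite ler_norml /= in_itv.
move=> /(_ fin)[l [_ cl]]; exists l => B lB.
have [//|nB] := in_ultra_setVsetC (f @^-1` B) UU.
by have [z [Bz nBz]] := cl (~` B) B nB lB.
Qed.

Lemma ultra_choose (P : T -> R -> Prop) : (\forall t \near U, exists s, P t s) ->
  exists s : T -> R, \forall t \near U, P t (s t).
Proof.
move=> h; have /choice[s hs] : forall t, exists s, (exists s, P t s) -> P t s.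
  move=> t; have [[s Ps]|nP] := pselect (exists s, P t s); first by exists s.
  by exists 0 => h'.
by exists s; apply: filterS h => t; exact: hs.
Qed.

(** For monotone functions pointwise convergence to a continuous limit is locally
    uniform, so that the argument may move. *)
Lemma mono_cvg (psi : T -> R -> R) (L : R -> R) (s : T -> R) (s0 : R) :
  (forall t, {homo psi t : x y / x <= y}) -> continuous L ->
  (forall x, psi t x @[t --> U] --> L x) -> s t @[t --> U] --> s0 ->
  psi t (s t) @[t --> U] --> L s0.
Proof.
move=> mono cL cpsi cs; apply/cvgRP => e e0.
have e2 : 0 < e / 2 by rewrite divr_gt0.
have [d d0 hd] := cvgR_ball (cL s0) e2.
have Ld1 : `|L (s0 + d) - L s0| <= e / 2 by apply: hd; rewrite addrAC subrr add0r gtr0_norm.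
have Ld2 : `|L (s0 - d) - L s0| <= e / 2.
  by apply: hd; rewrite addrAC subrr add0r normrN gtr0_norm.
have N1 := near_dist cs d0; have N2 := near_dist (cpsi (s0 + d)) e2.
have N3 := near_dist (cpsi (s0 - d)) e2.
apply: filterS3 N1 N2 N3 => t.
rewrite ler_distl => /andP[h1 h2] h3 h4; have := mono t _ _ h1; have := mono t _ _ h2.
move: Ld1 Ld2 h3 h4; move: (psi t (s0 + d)) (psi t (s0 - d)) (psi t (s t)) (L _) (L _) (L _).
move=> a b c g h k; clear; rewrite !ler_norml => /andP[? ?] /andP[? ?] /andP[? ?] /andP[? ?] ? ?.
by apply/andP; split; lra.
Qed.

Lemma mono_cvg_unif (psi : T -> R -> R) (L : R -> R) K e :
  (forall t, {homo psi t : x y / x <= y}) -> continuous L ->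
  (forall x, psi t x @[t --> U] --> L x) -> 0 < e ->
  \forall t \near U, forall s, `|s| <= K -> `|psi t s - L s| <= e.
Proof.
move=> mono cL cpsi e0.
have [//|bad] := in_ultra_setVsetC [set t | forall s, `|s| <= K -> `|psi t s - L s| <= e] UU.
have [s hs] : exists s : T -> R, \forall t \near U, `|s t| <= K /\ e < `|psi t (s t) - L (s t)|.
  apply: (@ultra_choose (fun t s => `|s| <= K /\ e < `|psi t s - L s|)).
  apply: filterS bad => t /existsNP[s /not_implyP[sK /negP]].
  by rewrite -ltNge; exists s.
have [l sl] : exists l : R, s t @[t --> U] --> l.
  by apply: ultra_bounded_cvg; exists K; apply: filterS hs => t [].
have h1 := mono_cvg mono cL cpsi sl.
have h2 : L (s t) @[t --> U] --> L l by exact: (continuous_cvg _ (cL l) sl).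
have e2 : 0 < e / 2 by rewrite divr_gt0.
have N1 := near_dist h1 e2; have N2 := near_dist h2 e2.
have [t [ht [h3 h4]]] := filter_ex (filterI hs (filterI N1 N2)).
exfalso; case: ht => _; move: h3 h4; move: (psi t _) (L _) (L _) => a b c.
rewrite !ler_norml ltNge => /andP[? ?] /andP[? ?] /negP; apply; rewrite ler_norml.
by apply/andP; split; lra.
Qed.
End ultrafilter_limits.

Section affine_limits.
Context {R : realType} (T : Type) (U : set_system T) {UU : UltraFilter U}.
Implicit Types (psi phi : T -> R -> R) (a b : R).

Let near_dist := @cvgR_near R T U _.

(** A monotone random function that looks affine on compact sets and is
    negligible with respect to the square at infinity: its averages are then
    controlled by first and second moments. *)
Definition affine_limit psi a b :=
  [/\ forall t, {homo psi t : x y / x <= y},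
      forall s, psi t s @[t --> U] --> a + b * s &
      forall rho, 0 < rho -> exists K, \forall t \near U,
        forall z, K <= `|z| -> `|psi t z| <= rho * z ^+ 2].

Lemma affine_limit_unif psi a b K e : affine_limit psi a b -> 0 < e ->
  \forall t \near U, forall s, `|s| <= K -> `|psi t s - (a + b * s)| <= e.
Proof.
move=> [mono lim _] e0; apply: (@mono_cvg_unif _ _ _ _ psi (fun s => a + b * s)) => //.
exact: continuous_affine.
Qed.

Lemma affine_limit_cvg psi a b (s : T -> R) s0 : affine_limit psi a b ->
  s t @[t --> U] --> s0 -> psi t (s t) @[t --> U] --> a + b * s0.
Proof.
move=> [mono lim _]; apply: (@mono_cvg _ _ _ _ psi (fun s => a + b * s)) => //.
exact: continuous_affine.
Qed.

Lemma affine_limit_shift psi a b s : affine_limit psi a b ->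
  affine_limit (fun t z => psi t (s + z)) (a + b * s) b.
Proof.
move=> [mono lim grow]; split=> [t x y xy|z|rho rho0].
- by apply: mono; rewrite lerD2l.
- by rewrite -addrA -mulrDr; exact: lim.
have rho4 : 0 < rho / 4 by rewrite divr_gt0.
have [K hK] := grow _ rho4; exists (Num.max (`|K| + `|s|) 0).
apply: filterS hK => t ht z; rewrite ge_max => /andP[zK _].
have h1 : K <= `|s + z|.
  apply: (le_trans (ler_norm K)); rewrite -(lerD2r `|s|) (le_trans zK)//.
  by rewrite -[in X in X <= _](addKr s z) addrC (le_trans (ler_normD _ _))// normrN.
apply: (le_trans (ht _ h1)).
have sz : `|s| <= `|z| by apply: le_trans zK; rewrite lerDr.
have : (s + z) ^+ 2 <= 4 * z ^+ 2.
  rewrite -[(s + z) ^+ 2]real_normK ?num_real// -[z ^+ 2]real_normK ?num_real//.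
  have : `|s + z| <= 2 * `|z|.
    by rewrite (le_trans (ler_normD _ _))// mulr_natl mulr2n lerD2r.
  rewrite -(@ler_sqr _ `|_|) ?nnegrE ?mulr_ge0// => /le_trans -> //.
  by rewrite exprMn -natrX.
rewrite -(ler_pM2l (_ : 0 < rho / 4))// => /le_trans; apply.
by rewrite mulrA divfK.
Qed.

Lemma affine_limit_squeeze psi phi a b : affine_limit psi a b ->
  (forall t, {homo phi t : x y / x <= y}) -> (forall t z, phi t z <= psi t z) ->
  (forall t z e, 0 < e -> psi t (z - e) <= phi t z) -> affine_limit phi a b.
Proof.
move=> [mono lim grow] mono' le1 le2; split=> [//|s|rho rho0].
  apply/cvgRP => e e0; pose d := e / 2 / (`|b| + 1).
  have b1 : 0 < `|b| + 1 by rewrite ltr_wpDl.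
  have d0 : 0 < d by rewrite divr_gt0// divr_gt0.
  have e2 : 0 < e / 2 by rewrite divr_gt0.
  apply: filterS2 (near_dist (lim s) e2) (near_dist (lim (s - d)) e2) => t.
  have := le1 t s; have := le2 t s d d0.
  have : `|b * d| <= e / 2.
    rewrite normrM (gtr0_norm d0) /d mulrCA -[leRHS]mulr1 ler_pM2l//.
    by rewrite ler_pdivrMr// mul1r lerDl.
  rewrite mulrBr; move: (b * d) (b * s) (psi _ _) (psi _ _) (phi _ _) => u v w y g.
  clear; rewrite !ler_norml => /andP[? ?] ? ? /andP[? ?] /andP[? ?].
  by apply/andP; split; lra.
have rho4 : 0 < rho / 4 by rewrite divr_gt0.
have [K hK] := grow _ rho4; exists (`|K| + 1).
apply: filterS hK => t ht z zK.
have z1 : 1 <= `|z| by apply: le_trans zK; rewrite lerDr.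
have zz : `|z| ^+ 2 = z ^+ 2 by rewrite real_normK// num_real.
have h1 : `|psi t z| <= rho * z ^+ 2.
  apply: (le_trans (ht z _)); first by apply: le_trans zK; rewrite (le_trans (ler_norm K))// lerDl.
  by rewrite ler_wpM2r ?sqr_ge0// ler_pdivrMr// ler_pMr// ler1n.
have zm : `|z| - 1 <= `|z - 1| by rewrite -{1}(@normr1 R) lerB_dist.
have zp : `|z - 1| <= 2 * `|z|.
  by rewrite (le_trans (ler_normB _ _))// normr1 mulr_natl mulr2n lerD2l.
have h2 : `|psi t (z - 1)| <= rho * z ^+ 2.
  apply: (le_trans (ht (z - 1) _)).
    by apply: le_trans zm; rewrite lerBrDr (le_trans _ zK)// lerD2r ler_norm.
  rewrite -mulrA ler_wpM2l ?(ltW rho0)// mulrC ler_pdivrMr// -zz mulrC.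
  rewrite -[(z - 1) ^+ 2]real_normK ?num_real//.
  by move: zp; rewrite -(@ler_sqr _ `|_|) ?nnegrE ?mulr_ge0// exprMn -natrX.
have := le1 t z; have := le2 t z 1 ltr01.
move: h1 h2; move: (psi _ _) (psi _ _) (phi _ _) (rho * _) => u v w y; clear.
rewrite !ler_norml => /andP[? ?] /andP[? ?] ? ?.
by apply/andP; split; lra.
Qed.

(** The quadratic growth bound makes the contribution of large arguments to
    the average uniformly small. *)
Lemma bavg_affine_limit (psi : T -> R -> R) a b C2 (m n : T -> nat)
    (z : forall t, {ffun 'I_(m t) -> 'I_(n t)} -> R) :
  affine_limit psi a b -> (\forall t \near U, (0 < n t)%N) ->
  (\forall t \near U, bavg (z t) = 0) ->
  (\forall t \near U, bavg (fun s => z t s ^+ 2) <= C2) ->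
  bavg (fun s => psi t (z t s)) @[t --> U] --> a.
Proof.
move=> al n0 z0 z2; apply/cvgRP => e e0.
pose rho := e / 4 / (`|C2| + 1).
have C1 : 0 < `|C2| + 1 by rewrite ltr_wpDl.
have rho0 : 0 < rho by rewrite divr_gt0// divr_gt0.
have [_ _ /(_ _ rho0)[K1 hK1]] := al.
pose K2 := Num.max 1 ((`|a| + `|b|) / rho).
have hL w : K2 <= `|w| -> `|a + b * w| <= rho * w ^+ 2.
  rewrite ge_max => /andP[w1 w2].
  have ww : `|w| ^+ 2 = w ^+ 2 by rewrite real_normK// num_real.
  apply: (@le_trans _ _ ((`|a| + `|b|) * `|w|)).
    rewrite (le_trans (ler_normD _ _))// normrM mulrDl lerD2r.
    by rewrite ler_peMr.
  rewrite -ww expr2 mulrA ler_wpM2r//.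
  by move: w2; rewrite ler_pdivrMr// mulrC.
pose K := Num.max K1 K2; have e2 : 0 < e / 2 by rewrite divr_gt0.
have := affine_limit_unif K al e2; move: hK1 => /[swap] hK hK1.
apply: filterS3 n0 (filterI hK hK1) (filterI z0 z2) => t nt [h1 h2] [h3 h4].
have key w : `|psi t w - (a + b * w)| <= e / 2 + 2 * rho * w ^+ 2.
  have [wK|/ltW] := leP `|w| K.
    by rewrite (le_trans (h1 w wK))// lerDl mulr_ge0 ?sqr_ge0// mulr_ge0// ltW.
  rewrite ge_max => /andP[wK1 wK2]; have := h2 w wK1; have := hL w wK2.
  move=> p1 p2; apply: (le_trans (ler_normB _ _)).
  apply: (le_trans (lerD p2 p1)); rewrite -mulr2n -[_ *+ 2]mulr_natl mulrA lerDr.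
  exact: ltW.
have -> : a = bavg (fun s => a + b * z t s).
  by rewrite bavgD bavgZ h3 mulr0 addr0 bavg_cst.
rewrite -bavgB; apply: (le_trans (bavg_abs _)).
apply: (@le_trans _ _ (bavg (fun s => e / 2 + 2 * rho * z t s ^+ 2))).
  by apply: le_bavg => s; exact: key.
rewrite bavgD (bavgZ (2 * rho)) bavg_cst//.
have h5 : bavg (fun s => z t s ^+ 2) <= `|C2| + 1.
  by rewrite (le_trans h4)// (le_trans (ler_norm _))// lerDl.
have h6 : 2 * rho * bavg (fun s => z t s ^+ 2) <= 2 * rho * (`|C2| + 1).
  by rewrite ler_wpM2l// mulr_ge0// ltW.
apply: (@le_trans _ _ (e / 2 + 2 * rho * (`|C2| + 1))); first by rewrite lerD2l.
rewrite -mulrA /rho divfK ?gt_eqF//.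
by rewrite (_ : e / 2 + 2 * (e / 4) = e)//; field.
Qed.
End affine_limits.

(** * Bootstrap quantiles along an ultrafilter *)

Section finite_sample.
Context {R : realType}.

Lemma dotE p (u v : 'cV[R]_p) : dot u v = \sum_j u j 0 * v j 0.
Proof. by rewrite /dot mxE; apply: eq_bigr => j _; rewrite mxE. Qed.

Lemma dotDr p (u v w : 'cV[R]_p) : dot u (v + w) = dot u v + dot u w.
Proof. by rewrite /dot mulmxDr mxE. Qed.

Definition ecdfl n (r : 'cV[R]_n) (x : R) : R := n%:R^-1 * \sum_i (r i 0 < x)%R%:R.

Lemma ecdf_homo n (r : 'cV[R]_n) : {homo ecdf r : x y / x <= y}.
Proof.
move=> x y xy; rewrite /ecdf ler_wpM2l ?invr_ge0 ?ler0n//; apply: ler_sum => i _.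
by rewrite ler_nat; case: (leP (r i 0) x) => // /le_trans ->.
Qed.

Lemma ecdfl_homo n (r : 'cV[R]_n) : {homo ecdfl r : x y / x <= y}.
Proof.
move=> x y xy; rewrite /ecdfl ler_wpM2l ?invr_ge0 ?ler0n//; apply: ler_sum => i _.
by rewrite ler_nat; case: (ltP (r i 0) x) => // /lt_le_trans ->.
Qed.

Lemma ecdfl_le n (r : 'cV[R]_n) x : ecdfl r x <= ecdf r x.
Proof.
rewrite /ecdfl ler_wpM2l ?invr_ge0 ?ler0n//; apply: ler_sum => i _.
by rewrite ler_nat; case: (ltP (r i 0) x) => // /ltW ->.
Qed.

Lemma ecdf_lt_ecdfl n (r : 'cV[R]_n) x y : x < y -> ecdf r x <= ecdfl r y.
Proof.
move=> xy; rewrite /ecdf ler_wpM2l ?invr_ge0 ?ler0n//; apply: ler_sum => i _.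
by rewrite ler_nat; case: (leP (r i 0) x) => // /le_lt_trans ->.
Qed.

Lemma ols_model n p (X : 'M[R]_(n, p)) (beta : 'cV[R]_p) (e : 'cV[R]_n) :
  X^T *m X \in unitmx -> ols X (X *m beta + e) = beta + ols X e.
Proof. by move=> uX; rewrite /ols mulmxDr -!mulmxA (mulmxA X^T) mulKmx. Qed.

(** The last of the n + 1 bootstrap draws is the future error; the symmetric
    interval event is counted by the distribution function of the residuals
    at one end and by its left limit at the other. *)
Lemma Gstar_bavg n p (X : 'M[R]_(n, p)) (xf : 'cV[R]_p) (y : 'cV[R]_n) (x : R) :
  let r := pred_resid X y in
  X^T *m X \in unitmx -> 0 <= x ->
  Gstar X xf y x = bavg (fun s : {ffun 'I_n -> 'I_n} =>
    let z := dot xf (ols X (\col_i r (s i) 0)) in ecdf r (x + z) - ecdfl r (- x + z)).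
Proof.
move=> r uX x0; rewrite /Gstar boot_probE bavg_last; apply: eq_bavg => s /=.
rewrite /fmean /ecdf /ecdfl -mulrBr -sumrB; congr (_ * _); apply: eq_bigr => j _.
set u := usubmx _; set v := dsubmx _.
have -> : u = \col_i r (s i) 0.
  by apply/colP => i; rewrite !mxE /ext_last ffunE (unsplitK (inl _)).
have -> : v 0 0 = r j 0 by rewrite !mxE /ext_last ffunE (unsplitK (inr _)).
rewrite (ols_model _ _ uX) dotDr opprD addrACA subrr add0r.
set z := dot _ (ols X (\col__ _)); rewrite -/r.
rewrite ler_distl [z + x]addrC [z - x]addrC; case: (leP (r j 0) (x + z)) => h1; case: (ltP (r j 0) (- x + z)) => h2 //=.
all: try by rewrite ?subr0 ?subrr.
by move: h1; rewrite ltNge => /negP[]; rewrite (le_trans (ltW h2))// lerD2r (le_trans _ x0)// oppr_le0.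
Qed.

Lemma Nhat_left_lim n p (X : 'M[R]_(n, p)) (xf : 'cV[R]_p) (y u : 'cV[R]_n) (x : R) :
  lim (Nhat X xf y u @ at_left x) =
  Num.sqrt n%:R * (ecdfl (pred_resid X y) (x + dot xf (ols X u) - mean u) - ecdfl u x).
Proof.
apply/cvg_lim => //; apply: cvg_near_cst.
have step (d a : R) : \forall y \near x^'-, (a <= y + d)%R = (a < x + d)%R.
  case: (ltP a (x + d)) => h.
    near=> w; have : a - d < w.
      by near: w; apply: nbhs_left_gt; rewrite ltrBlDr.
    by rewrite ltrBlDr => /ltW.
  near=> w; apply/negbTE; rewrite -ltNge (lt_le_trans _ h)// ltrD2r.
  by near: w; exact: nbhs_left_lt.
have stepF m (v : 'cV[R]_m) (d : R) : \forall y \near x^'-, ecdf v (y + d) = ecdfl v (x + d).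
  have H : \forall y \near x^'-, forall i, (v i 0 <= y + d)%R = (v i 0 < x + d)%R.
    by apply: filter_forall => i; exact: step.
  apply: filterS H => w hw; rewrite /ecdf /ecdfl; congr (_ * _).
  by apply: eq_bigr => i _; rewrite hw.
apply: filterS2 (stepF _ (pred_resid X y) (dot xf (ols X u) - mean u)) (stepF _ u 0) => w h1 h2.
by rewrite /Nhat -!addrA h1; rewrite !addr0 in h2; rewrite h2.
Unshelve. all: by end_near. Qed.

Lemma pred_resid_sum0 n p (X : 'M[R]_(n, p)) (y : 'cV[R]_n) : (0 < n)%N ->
  \sum_i pred_resid X y i 0 = 0.
Proof.
move=> n0; under eq_bigr do rewrite mxE.
rewrite sumrB sumr_const card_ord /mean -mulrnAl -[n%:R^-1 *+ n]mulr_natr mulVf ?mul1r ?subrr//.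
by rewrite pnatr_eq0 -lt0n.
Qed.
End finite_sample.

Section scaled_comparison.
Context {R : realType}.
Implicit Types q G a d dl g : R.

Lemma scaled_above q G a (d0 : R) dl g : 0 < q -> 0 < g ->
  `|q * (G - a) - (d0 + g)| <= g / 4 -> `|dl - d0| <= g / 4 -> a + dl / q < G.
Proof.
move=> q0 g0; rewrite !ler_norml => /andP[h1 h2] /andP[h3 h4].
rewrite -ltrBrDl ltr_pdivrMr// mulrC; lra.
Qed.

Lemma scaled_below q G a (d0 : R) dl g : 0 < q -> 0 < g ->
  `|q * (G - a) - (d0 - g)| <= g / 4 -> `|dl - d0| <= g / 4 -> G < a + dl / q.
Proof.
move=> q0 g0; rewrite !ler_norml => /andP[h1 h2] /andP[h3 h4].
rewrite -ltrBlDl ltr_pdivlMr// mulrC; lra.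
Qed.

Lemma four_term_bound (k l f m h s z a1 a2 b1 b2 : R) :
  `|a1 - (l + f * s)| <= k / 4 -> `|a2 - (l + f * (s + z))| <= k / 4 ->
  `|b1 - (m + h * - s)| <= k / 4 -> `|b2 - (m + h * (- s + z))| <= k / 4 ->
  `|a2 - a1 - f * z - (b2 - b1 - h * z)| <= k.
Proof.
rewrite !mulrDr !mulrN !ler_norml.
move: (f * s) (f * z) (h * s) (h * z) => x1 x2 x3 x4.
by move=> /andP[? ?] /andP[? ?] /andP[? ?] /andP[? ?]; apply/andP; split; lra.
Qed.

Lemma indic_shift (a b z k : R) : `|a - b| <= k -> ((a <= z)%R <= (b <= z + k)%R)%N.
Proof.
rewrite ler_norml => /andP[h1 h2]; case: (leP a z) => // az.
by case: (leP b (z + k)) => //; rewrite ltNge => /negP[]; lra.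
Qed.

Lemma cdf_sandwich (e H a b z g ga gb : R) : H <= a + z -> b - z <= H -> z <= e / 4 ->
  `|a - ga| <= e / 4 -> `|b - gb| <= e / 4 -> `|ga - g| <= e / 4 -> `|gb - g| <= e / 4 ->
  `|H - g| <= e.
Proof.
rewrite !ler_norml => ? ? ? /andP[? ?] /andP[? ?] /andP[? ?] /andP[? ?].
by apply/andP; split; lra.
Qed.
End scaled_comparison.

Section bootstrap_limit.
Context {R : realType} (T : Type) (U : set_system T) {UU : UltraFilter U}.
Variables (p : nat) (N : T -> nat) (X : forall t, 'M[R]_(N t, p)) (xf : 'cV[R]_p).
Variables (y : forall t, 'cV[R]_(N t)) (F : R -> R) (c alpha l1 l2 f1 f2 : R).
Variables (cw : T -> nat -> R) (s2 mu v1 v2 K3 Cw : R).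

Let near_dist := @cvgR_near R T U _.
Let bavg_limit := @bavg_affine_limit R T U UU.
Let shift := @affine_limit_shift R T U UU.
Let r t := pred_resid (X t) (y t).
Let q t : R := Num.sqrt (N t)%:R.

Hypothesis Ny : forall m, \forall t \near U, (m <= N t)%N.
Hypothesis uX : \forall t \near U, (X t)^T *m X t \in unitmx.
Hypothesis cwE : forall t (u : 'cV[R]_(N t)),
  dot xf (ols (X t) u) = \sum_(i < N t) cw t i * u i 0.
Hypothesis Psi1 : affine_limit U (fun t s => q t * (ecdf (r t) (c + s / q t) - F c)) l1 f1.
Hypothesis Psi2 : affine_limit U (fun t s => q t * (ecdf (r t) (- c + s / q t) - F (- c))) l2 f2.
Hypotheses (c0 : 0 < c) (f10 : 0 < f1) (f20 : 0 < f2) (Fc : F c - F (- c) = 1 - alpha).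
Hypothesis r2 : fmean (fun j => r t j 0 ^+ 2) @[t --> U] --> s2.
Hypothesis cw2 : (N t)%:R * \sum_(i < N t) cw t i ^+ 2 @[t --> U] --> v1.

Let N0 : \forall t \near U, (0 < N t)%N. Proof. exact: Ny. Qed.

Lemma sqrtN_gt0 t : (0 < N t)%N -> 0 < q t.
Proof. by move=> n0; rewrite sqrtr_gt0 ltr0n. Qed.

Let q_sqr t : q t ^+ 2 = (N t)%:R.
Proof. by rewrite sqr_sqrtr// ler0n. Qed.

Lemma sqrtN_unbounded K : \forall t \near U, K <= q t.
Proof.
have := Ny (Num.truncn (K ^+ 2)).+1; apply: filterS => t nt.
apply: (le_trans (ler_norm K)); rewrite -sqrtr_sqr ler_wsqrtr//.
by rewrite ltW// (lt_le_trans (truncnS_gt _))// ler_nat.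
Qed.

Lemma cvg_div_sqrtN (s : T -> R) (s0 : R) : s t @[t --> U] --> s0 -> s t / q t @[t --> U] --> (0 : R).
Proof.
move=> ss; apply/cvgRP => e e0.
have K0 : 0 < `|s0| + 1 by rewrite ltr_wpDl.
apply: filterS3 N0 (near_dist ss ltr01) (sqrtN_unbounded ((`|s0| + 1) / e)) => t nt h1 h2.
have qt := sqrtN_gt0 nt.
rewrite subr0 normrM normfV (gtr0_norm qt) ler_pdivrMr// mulrC.
move: h2; rewrite ler_pdivrMr// => /(le_trans _); apply.
by rewrite -lerBlDl (le_trans _ h1)// lerB_dist.
Qed.

Lemma ecdfl_affine_limit a l f :
  affine_limit U (fun t s => q t * (ecdf (r t) (a + s / q t) - F a)) l f ->
  affine_limit U (fun t s => q t * (ecdfl (r t) (a + s / q t) - F a)) l f.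
Proof.
move=> al; apply: (affine_limit_squeeze al) => [t x z xz|t z|t z e e0].
- rewrite ler_wpM2l ?sqrtr_ge0// lerD2r; apply: ecdfl_homo.
  by rewrite lerD2l ler_wpM2r// invr_ge0 sqrtr_ge0.
- by rewrite ler_wpM2l ?sqrtr_ge0// lerD2r ecdfl_le.
have [q0|q0] := leP (q t) 0.
  by rewrite (_ : q t = 0) ?mul0r//; apply/le_anti; rewrite q0 sqrtr_ge0.
rewrite ler_pM2l// lerD2r; apply: ecdf_lt_ecdfl.
by rewrite ltrD2l ltr_pM2r ?invr_gt0// gtrDl oppr_lt0.
Qed.

Lemma fmean_resid0 t : (0 < N t)%N -> fmean (fun j => r t j 0) = 0.
Proof. by move=> nt; rewrite /fmean pred_resid_sum0// mulr0. Qed.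

(** The scaled bootstrap prediction error: z / q is the fitted value at xf of a
    bootstrap error vector. *)
Let z t (s : {ffun 'I_(N t) -> 'I_(N t)}) : R :=
  \sum_(i < N t) (q t * cw t i) * r t (s i) 0.
Arguments z : clear implicits.

Lemma bavg_z0 : \forall t \near U, bavg (z t) = 0.
Proof.
apply: filterS N0 => t nt.
apply: (bavg_sum0 nt (xi := fun i j => (q t * cw t i) * r t j 0)) => i.
by rewrite fmeanZ fmean_resid0 ?mulr0.
Qed.

Lemma bavg_z2 : \forall t \near U, bavg (fun s => z t s ^+ 2) <= `|v1 * s2| + 1.
Proof.
have h : ((N t)%:R * \sum_(i < N t) cw t i ^+ 2) * fmean (fun j => r t j 0 ^+ 2)
    @[t --> U] --> v1 * s2 by exact: cvgM.
apply: filterS2 N0 (near_dist h ltr01) => t nt h1.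
rewrite (bavg_sum_sqr nt (xi := fun i j => (q t * cw t i) * r t j 0)); last first.
  by move=> i; rewrite fmeanZ fmean_resid0 ?mulr0.
have -> : \sum_(i < N t) fmean (fun j => (q t * cw t i * r t j 0) ^+ 2) =
    (N t)%:R * (\sum_(i < N t) cw t i ^+ 2) * fmean (fun j => r t j 0 ^+ 2).
  rewrite mulr_sumr mulr_suml; apply: eq_bigr => i _.
  by under eq_fmean do rewrite exprMn; rewrite fmeanZ exprMn q_sqr.
rewrite -lerBlDl; apply: le_trans h1; apply: le_trans (ler_norm _).
by rewrite lerB// ler_norm.
Qed.

Lemma dot_ols_draw t (s : {ffun 'I_(N t) -> 'I_(N t)}) : (0 < N t)%N ->
  dot xf (ols (X t) (\col_i r t (s i) 0)) = z t s / q t.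
Proof.
move=> nt; rewrite cwE mulrC /z mulr_sumr; apply: eq_bigr => i _.
by rewrite mxE -mulrA mulKf// gt_eqF// sqrtN_gt0.
Qed.

Lemma Gstar_cvg (s : R) :
  q t * (Gstar (X t) xf (y t) (c + s / q t) - (1 - alpha)) @[t --> U] --> l1 - l2 + (f1 + f2) * s.
Proof.
have A1 := bavg_limit (shift s Psi1) N0 bavg_z0 bavg_z2.
have A2 := bavg_limit (shift (- s) (ecdfl_affine_limit Psi2)) N0 bavg_z0 bavg_z2.
have -> : l1 - l2 + (f1 + f2) * s = (l1 + f1 * s) - (l2 + f2 * - s) by ring.
apply: cvg_trans (cvgB A1 A2); apply: near_eq_cvg.
have cs : (fun _ : T => s) t @[t --> U] --> s by exact: cvg_cst.
have sc := near_dist (cvg_div_sqrtN cs) c0.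
apply: filterS3 N0 uX sc => t nt ut.
rewrite subr0 => st.
rewrite Gstar_bavg//; last first.
  by rewrite -lerBlDl sub0r; move: st; rewrite ler_norml => /andP[].
rewrite -[LHS]/(bavg _ - bavg _) -bavgB -Fc -(bavg_cst (N t) nt (F c - F (- c))) -bavgB -bavgZ.
apply: eq_bavg => u /=; rewrite dot_ols_draw// -mulrBr; congr (_ * _).
have -> : c + (s + z t u) / q t = c + s / q t + z t u / q t by rewrite mulrDl addrA.
have -> : - c + (- s + z t u) / q t = - (c + s / q t) + z t u / q t.
  by rewrite mulrDl mulNr opprD addrA.
rewrite -/(r t); move: (ecdf _ _) (ecdfl _ _) => e1 e2; ring.
Qed.

Lemma Gstar_homo n (W : 'M[R]_(n, p)) (xg : 'cV[R]_p) (v : 'cV[R]_n) :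
  {homo Gstar W xg v : a b / a <= b}.
Proof.
move=> a b ab; rewrite /Gstar !boot_probE; apply: le_bavg => s /=.
by rewrite ler_nat; case: leP => // /le_trans ->.
Qed.

(** The distribution function of the bootstrap prediction error is asymptotically
    affine around c with slope f1 + f2 at scale 1 / q, so its quantile at level
    1 - alpha + dl / q is obtained by solving a linear equation. The bootstrap
    prediction error has mean zero, so the intercepts are those of the residuals. *)
Lemma Cquant_cvg (dl : T -> R) (d0 : R) : dl t @[t --> U] --> d0 ->
  exists2 s : T -> R, s t @[t --> U] --> (d0 - (l1 - l2)) / (f1 + f2) &
    \forall t \near U, Cquant (X t) xf (y t) (1 - alpha + dl t / q t) = (c + s t / q t)%:E.
Proof.
move=> dd; set s0 := _ / _; have f0 : 0 < f1 + f2 by rewrite addr_gt0.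
pose s t := q t * (fine (Cquant (X t) xf (y t) (1 - alpha + dl t / q t)) - c).
have key (e : R) : 0 < e -> \forall t \near U, exists x : R,
    Cquant (X t) xf (y t) (1 - alpha + dl t / q t) = x%:E /\ `|q t * (x - c) - s0| <= e.
  move=> e0; have fe : 0 < (f1 + f2) * e by rewrite mulr_gt0.
  have fe4 : 0 < (f1 + f2) * e / 4 by rewrite divr_gt0.
  have h1 := near_dist (@Gstar_cvg (s0 + e)) fe4.
  have h2 := near_dist (@Gstar_cvg (s0 - e)) fe4.
  apply: filterS3 N0 (filterI h1 h2) (near_dist dd fe4) => t nt [{}h1 {}h2] h3.
  have qt := sqrtN_gt0 nt.
  have s0E : (f1 + f2) * s0 = d0 - (l1 - l2) by rewrite /s0 mulrC divfK ?gt_eqF.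
  have g1 : 1 - alpha + dl t / q t <= Gstar (X t) xf (y t) (c + (s0 + e) / q t).
    apply/ltW; apply: (scaled_above qt fe _ h3); move: h1.
    by have -> : l1 - l2 + (f1 + f2) * (s0 + e) = d0 + (f1 + f2) * e by rewrite mulrDr s0E; ring.
  have g2 : Gstar (X t) xf (y t) (c + (s0 - e) / q t) < 1 - alpha + dl t / q t.
    apply: (scaled_below qt fe _ h3); move: h2.
    by have -> : l1 - l2 + (f1 + f2) * (s0 - e) = d0 - (f1 + f2) * e by rewrite mulrBr s0E; ring.
  have lo : ((c + (s0 - e) / q t)%:E <= Cquant (X t) xf (y t) (1 - alpha + dl t / q t))%E.
    apply: le_ereal_inf_tmp => _ [x /= xG <-]; rewrite lee_fin leNgt; apply/negP => xm.
    have := Gstar_homo (X t) xf (y t) (ltW xm).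
    by move/(le_trans xG); rewrite leNgt g2.
  have up : (Cquant (X t) xf (y t) (1 - alpha + dl t / q t) <= (c + (s0 + e) / q t)%:E)%E.
    by apply: ereal_inf_lbound; exists (c + (s0 + e) / q t).
  move: lo up; case: (Cquant _ _ _ _) => [x| |] //= lo up.
  exists x; split => //; move: lo up; rewrite !lee_fin -lerBrDl -[x <= _]lerBlDl.
  rewrite ler_pdivrMr// ler_pdivlMr// mulrC ler_distl => -> /=.
  by rewrite mulrC.
exists s; last first.
  apply: filterS2 N0 (key 1 ltr01) => t nt [x [hx _]]; rewrite hx /s hx /=.
  congr EFin; rewrite [q t * _]mulrC mulfK ?gt_eqF ?sqrtN_gt0//.
  by rewrite [c + _]addrC subrK.
apply/cvgRP => e e0; apply: filterS (key e e0) => t [x [hx hs]].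
by rewrite /s hx.
Qed.

Hypothesis cw1 : \sum_(i < N t) cw t i @[t --> U] --> v2.
Hypothesis cwB : \forall t \near U, forall i, (i < N t)%N -> `|cw t i| <= Cw / (N t)%:R.
Hypothesis r3 : \forall t \near U, fmean (fun j => `|r t j 0| ^+ 3) <= K3.
Hypothesis rmu : forall (s : T -> R) (s0 : R), s t @[t --> U] --> s0 ->
  fmean (fun j => r t j 0 * ((r t j 0 <= c + s t / q t)%R%:R - (r t j 0 < - (c + s t / q t))%R%:R))
    @[t --> U] --> mu.

Let g := f1 - f2.
Let V := g ^+ 2 * s2 * (v1 + 1 - 2 * v2) - 2 * g * mu * (v2 - 1) + (1 - alpha) * alpha.

Section standardized_coverage.
Variables (s : T -> R) (s0 : R).
Hypothesis ss : s t @[t --> U] --> s0.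
Let xh t := c + s t / q t.
Let ind t j : R := (r t j 0 <= xh t)%R%:R - (r t j 0 < - xh t)%R%:R.
Arguments ind : clear implicits.
Let kap t (k : nat) : R := q t * cw t k - (q t)^-1.
Let xi t (k : nat) j : R := - (g * kap t k) * r t j 0 + (ind t j - fmean (ind t)) / q t.
Arguments xi : clear implicits.

Lemma near_xh : \forall t \near U, 0 <= xh t.
Proof.
apply: filterS (near_dist (cvg_div_sqrtN ss) c0) => t; rewrite subr0 => st.
by rewrite /xh -lerBlDl sub0r; move: st; rewrite ler_norml => /andP[].
Qed.

Lemma ind01 t j : 0 <= xh t -> ind t j = 0 \/ ind t j = 1.
Proof.
move=> x0; rewrite /ind; case: (leP (r t j 0) (xh t)) => h1; case: (ltP (r t j 0) (- xh t)) => h2.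
- by left; rewrite subrr.
- by right; rewrite subr0.
- by move: (lt_trans h1 h2); rewrite ltNge (le_trans _ x0)// oppr_le0.
- by left; rewrite subrr.
Qed.

Lemma fmean_ind t : fmean (ind t) = ecdf (r t) (xh t) - ecdfl (r t) (- xh t).
Proof. by rewrite /ind fmeanB. Qed.

Lemma fmean_ind_cvg : fmean (ind t) @[t --> U] --> 1 - alpha.
Proof.
have P2 := ecdfl_affine_limit Psi2.
have sN : - s t @[t --> U] --> - s0 by exact: cvgN.
have A1 := cvg_div_sqrtN (@affine_limit_cvg _ _ _ UU _ _ _ _ _ Psi1 ss).
have A2 := cvg_div_sqrtN (@affine_limit_cvg _ _ _ UU _ _ _ _ _ P2 sN).
have -> : 1 - alpha = (0 - 0) + (F c - F (- c)) by rewrite Fc subrr add0r.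
have cF : (fun _ : T => F c - F (- c)) t @[t --> U] --> F c - F (- c) by exact: cvg_cst.
apply: cvg_trans (cvgD (cvgB A1 A2) cF); apply: near_eq_cvg.
apply: filterS N0 => t nt; have qt := sqrtN_gt0 nt.
rewrite -[LHS]/(_ / _ - _ / _ + _) ![q t * _]mulrC !mulfK ?gt_eqF// fmean_ind /xh.
have -> : - (c + s t / q t) = - c + - s t / q t by rewrite opprD mulNr.
by move: (ecdf _ _) (ecdfl _ _) => a b; ring.
Qed.

Lemma fmean_xi0 t k : (0 < N t)%N -> fmean (xi t k) = 0.
Proof.
move=> nt; rewrite /xi fmeanD fmeanZ fmean_resid0// mulr0 add0r.
rewrite (_ : fmean _ = (q t)^-1 * (fmean (ind t) - fmean (ind t))); first by rewrite subrr mulr0.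
rewrite -[X in _ - X](fmean_cst nt (fmean (ind t))) -fmeanB -fmeanZ.
by apply: eq_fmean => j; rewrite mulrC.
Qed.

Lemma fmean_xi2 t k : (0 < N t)%N -> 0 <= xh t ->
  fmean (fun j => xi t k j ^+ 2) = (g * kap t k) ^+ 2 * fmean (fun j => r t j 0 ^+ 2)
    - 2 * (g * kap t k) / q t * fmean (fun j => r t j 0 * ind t j)
    + fmean (ind t) * (1 - fmean (ind t)) / (N t)%:R.
Proof.
move=> nt x0; set m := fmean (ind t).
transitivity (fmean (fun j => (g * kap t k) ^+ 2 * r t j 0 ^+ 2
    - 2 * (g * kap t k) / q t * (r t j 0 * ind t j)
    + (2 * (g * kap t k) / q t * m) * r t j 0
    + (1 - 2 * m) / (N t)%:R * ind t j + m ^+ 2 / (N t)%:R)).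
  apply: eq_fmean => j; rewrite /xi -/m -(q_sqr t).
  have qt := sqrtN_gt0 nt; move: (q t) (kap t k) (r t j 0) m qt => q' k' r' m qt.
  by have [->|->] := ind01 j x0; field; rewrite gt_eqF.
rewrite 3!fmeanD fmeanB !fmeanZ fmean_resid0// fmean_cst// -/m.
by ring.
Qed.

Lemma sum_kap2 t : (0 < N t)%N -> \sum_(k < N t) kap t k ^+ 2 =
  (N t)%:R * (\sum_(k < N t) cw t k ^+ 2) + 1 - 2 * \sum_(k < N t) cw t k.
Proof.
move=> nt; have qt := sqrtN_gt0 nt.
transitivity (\sum_(k < N t) ((N t)%:R * cw t k ^+ 2 + ((N t)%:R^-1 - 2 * cw t k))).
  by apply: eq_bigr => k _; rewrite /kap -(q_sqr t); field; rewrite gt_eqF.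
rewrite big_split/= sumrB sumr_const card_ord -!mulr_sumr -[_^-1 *+ _]mulr_natr.
by rewrite mulVf ?addrA// pnatr_eq0 -lt0n.
Qed.

Lemma sum_kap t : (0 < N t)%N -> \sum_(k < N t) kap t k / q t = \sum_(k < N t) cw t k - 1.
Proof.
move=> nt; have qt := sqrtN_gt0 nt.
transitivity (\sum_(k < N t) (cw t k - (N t)%:R^-1)).
  by apply: eq_bigr => k _; rewrite /kap -(q_sqr t); field; rewrite gt_eqF.
rewrite sumrB sumr_const card_ord -[_^-1 *+ _]mulr_natr.
by rewrite mulVf// pnatr_eq0 -lt0n.
Qed.

Lemma sum_xi2_cvg : \sum_(k < N t) fmean (fun j => xi t k j ^+ 2) @[t --> U] --> V.
Proof.
have cm := fmean_ind_cvg; have cr := rmu ss.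
have h : g ^+ 2 * fmean (fun j => r t j 0 ^+ 2) *
      ((N t)%:R * (\sum_(k < N t) cw t k ^+ 2) + 1 - 2 * \sum_(k < N t) cw t k)
    - 2 * g * fmean (fun j => r t j 0 * ind t j) * (\sum_(k < N t) cw t k - 1)
    + fmean (ind t) * (1 - fmean (ind t)) @[t --> U] --> V.
  rewrite /V (_ : (1 - alpha) * alpha = (1 - alpha) * (1 - (1 - alpha))); last by ring.
  apply: cvgD; last by apply: cvgM => //; apply: cvgB => //; exact: cvg_cst.
  apply: cvgB.
    apply: cvgM; first by apply: cvgM => //; exact: cvg_cst.
    apply: cvgB; last by apply: cvgM => //; exact: cvg_cst.
    by apply: cvgD => //; exact: cvg_cst.
  apply: cvgM; last by apply: cvgB => //; exact: cvg_cst.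
  by apply: cvgM => //; exact: cvg_cst.
apply: cvg_trans h; apply: near_eq_cvg; apply: filterS2 N0 near_xh => t nt x0.
under [RHS]eq_bigr do rewrite fmean_xi2//.
rewrite [RHS]big_split/=; congr (_ + _); last first.
  by rewrite sumr_const card_ord -[_ *+ _]mulr_natr divfK// pnatr_eq0 -lt0n.
rewrite -(sum_kap2 nt) -(sum_kap nt) !mulr_sumr -sumrB.
by apply: eq_bigr => k _; ring.
Qed.

Lemma indB t j : 0 <= xh t -> `|ind t j - fmean (ind t)| <= 1.
Proof.
move=> x0; have nt : (0 < N t)%N by case: (N t) j => // -[].
have i01 i : 0 <= ind t i <= 1 by have [->|->] := ind01 i x0; rewrite ?lexx ler01.
have m0 : 0 <= fmean (ind t) by apply: fmean_ge0 => i; case/andP: (i01 i).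
have m1 : fmean (ind t) <= 1.
  by rewrite -[leRHS](fmean_cst nt); apply: le_fmean => i; case/andP: (i01 i).
by rewrite ler_norml; have /andP[h1 h2] := i01 j; apply/andP; split; lra.
Qed.

Let B := `|g| * (`|Cw| + 1) + 1.

Let B1 : 1 <= B. Proof. by rewrite /B lerDr mulr_ge0// addr_ge0. Qed.

Lemma xi_bound t k j : (0 < N t)%N -> 0 <= xh t -> `|cw t k| <= Cw / (N t)%:R ->
  `|xi t k j| <= B / q t * (`|r t j 0| + 1).
Proof.
move=> nt x0 ck; have qt := sqrtN_gt0 nt.
have kB : `|kap t k| <= (`|Cw| + 1) / q t.
  rewrite /kap (le_trans (ler_normB _ _))// mulrDl mul1r normfV (gtr0_norm qt) lerD2r.
  rewrite normrM (gtr0_norm qt) ler_pdivlMr// mulrAC -expr2 q_sqr mulrC.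
  by move: ck; rewrite ler_pdivlMr ?ltr0n// => /le_trans; apply; exact: ler_norm.
rewrite /xi (le_trans (ler_normD _ _))// normrM normrN normrM normrM normfV (gtr0_norm qt).
have h1 : `|g| * `|kap t k| * `|r t j 0| <= `|g| * ((`|Cw| + 1) / q t) * `|r t j 0|.
  by rewrite ler_wpM2r// ler_wpM2l.
have h2 : `|ind t j - fmean (ind t)| / q t <= 1 / q t.
  by rewrite ler_pM2r ?invr_gt0//; exact: indB.
apply: (le_trans (lerD h1 h2)); rewrite -subr_ge0.
rewrite (_ : _ - _ = (`|g| * (`|Cw| + 1) + `|r t j 0|) / q t).
  by rewrite divr_ge0 ?(ltW qt)// addr_ge0// mulr_ge0// addr_ge0.
by rewrite /B; field; rewrite gt_eqF.
Qed.

Lemma sum_remainder_cvg0 : \sum_(k < N t) (fmean (fun j => `|xi t k j| ^+ 3) +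
    gauss_m3 * (fmean (fun j => xi t k j ^+ 2) / gauss_m2 *
      Num.sqrt (fmean (fun j => xi t k j ^+ 2) / gauss_m2))) @[t --> U] --> (0 : R).
Proof.
have m2 := @gauss_m2_gt0 R; have m3 := @gauss_m3_ge0 R.
pose D := 2 * B ^+ 2 * (`|s2| + 2) / gauss_m2.
pose M := 4 * B ^+ 3 * (`|K3| + 1) + gauss_m3 * (D * Num.sqrt D).
have B0 : 0 <= B by exact: le_trans ler01 B1.
have D0 : 0 <= D by rewrite /D divr_ge0 ?(ltW m2)// !mulr_ge0// ?exprn_ge0// addr_ge0.
have cM : (fun _ : T => M) t @[t --> U] --> M by exact: cvg_cst.
have h0 := cvg_div_sqrtN cM.
apply: (squeeze_cvgr _ (cvg_cst 0) h0).
apply: filterS3 N0 near_xh (filterI cwB (filterI r3 (near_dist r2 ltr01))) => t nt x0 [cB [r3t r2t]].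
have qt := sqrtN_gt0 nt.
have w0 k : 0 <= fmean (fun j => xi t k j ^+ 2) / gauss_m2.
  by rewrite divr_ge0 ?(ltW m2)// fmean_ge0// => j; rewrite sqr_ge0.
apply/andP; split.
  apply: sumr_ge0 => k _; rewrite addr_ge0//; last by rewrite mulr_ge0// mulr_ge0// sqrtr_ge0.
  by apply: fmean_ge0 => j; rewrite exprn_ge0.
have -> : M / q t = \sum_(k < N t) M / q t ^+ 3.
  rewrite sumr_const card_ord -[_ *+ _]mulr_natr -(q_sqr t); field; rewrite gt_eqF//.
apply: ler_sum => k _; have xB j := xi_bound j nt x0 (cB k (ltn_ord k)).
have bq : 0 <= B / q t by rewrite divr_ge0// ltW.
have bqr j : 0 <= B / q t * (`|r t j 0| + 1) by apply: mulr_ge0 => //; rewrite addr_ge0.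
have cube (a : R) : 0 <= a -> (a + 1) ^+ 3 <= 4 * (a ^+ 3 + 1).
  move=> a0; have : 0 <= (a - 1) ^+ 2 * (a + 1) by rewrite mulr_ge0 ?sqr_ge0 ?addr_ge0.
  rewrite (_ : (a - 1) ^+ 2 * (a + 1) = a ^+ 3 - a ^+ 2 - a + 1); last by ring.
  rewrite (_ : (a + 1) ^+ 3 = a ^+ 3 + 3 * a ^+ 2 + 3 * a + 1); last by ring.
  lra.
have sq2 (a : R) : (a + 1) ^+ 2 <= 2 * (a ^+ 2 + 1).
  have : 0 <= (a - 1) ^+ 2 by rewrite sqr_ge0.
  rewrite (_ : (a - 1) ^+ 2 = a ^+ 2 - 2 * a + 1); last by ring.
  rewrite (_ : (a + 1) ^+ 2 = a ^+ 2 + 2 * a + 1); last by ring.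
  lra.
have t3 : fmean (fun j => `|xi t k j| ^+ 3) <= 4 * B ^+ 3 * (`|K3| + 1) / q t ^+ 3.
  apply: (@le_trans _ _ (fmean (fun j => (B / q t) ^+ 3 * (4 * (`|r t j 0| ^+ 3 + 1))))).
    apply: le_fmean => j; apply: (@le_trans _ _ ((B / q t * (`|r t j 0| + 1)) ^+ 3)).
      by rewrite lerXn2r ?nnegrE ?bqr.
    by rewrite exprMn ler_wpM2l ?exprn_ge0// cube.
  rewrite fmeanZ fmeanZ fmeanD fmean_cst// expr_div_n.
  rewrite [leRHS](_ : _ = B ^+ 3 / q t ^+ 3 * (4 * (`|K3| + 1))); last by ring.
  rewrite ler_wpM2l ?divr_ge0 ?exprn_ge0 ?(ltW qt)// ler_wpM2l// lerD2r.
  exact: le_trans (ler_norm _).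
have t2 : fmean (fun j => xi t k j ^+ 2) / gauss_m2 <= D / q t ^+ 2.
  rewrite ler_pdivrMr//; apply: (@le_trans _ _ (fmean (fun j => (B / q t) ^+ 2 * (2 * (`|r t j 0| ^+ 2 + 1))))).
    apply: le_fmean => j; rewrite -[xi t k j ^+ 2]real_normK ?num_real//.
    apply: (@le_trans _ _ ((B / q t * (`|r t j 0| + 1)) ^+ 2)).
      by rewrite lerXn2r ?nnegrE ?bqr.
    by rewrite exprMn ler_wpM2l ?exprn_ge0// sq2.
  rewrite fmeanZ fmeanZ fmeanD fmean_cst// expr_div_n.
  rewrite [leRHS](_ : _ = B ^+ 2 / q t ^+ 2 * (2 * (`|s2| + 2))); last first.
    by rewrite /D; field; rewrite !gt_eqF.
  rewrite ler_wpM2l ?divr_ge0 ?exprn_ge0 ?(ltW qt)// ler_wpM2l//.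
  rewrite (eq_fmean (zeta := fun j => r t j 0 ^+ 2)); last by move=> j; rewrite real_normK ?num_real.
  have := ler_norm s2; move: r2t; rewrite ler_norml => /andP[_]; lra.
rewrite /M mulrDl lerD//.
rewrite [leRHS](_ : _ = gauss_m3 * ((D / q t ^+ 2) * (Num.sqrt D / q t))); last first.
  by field; rewrite gt_eqF.
rewrite ler_wpM2l// ler_pM ?sqrtr_ge0//.
have -> : Num.sqrt D / q t = Num.sqrt (D / q t ^+ 2).
  by rewrite [RHS]sqrtrM// -exprVn sqrtr_sqr ger0_norm ?invr_ge0 ?(ltW qt).
exact: ler_wsqrtr.
Qed.

Hypothesis V0 : 0 < V.

(** The centred sums below are sums of independent draws whose third absolute
    moments add up to something negligible, so Lindeberg applies. *)
Lemma draws_cdf_cvg (z0 : R) :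
  bavg (fun u : {ffun 'I_(N t) -> 'I_(N t)} =>
    (\sum_(i < N t) xi t i (u i) <= z0)%R%:R) @[t --> U] --> gcdf (V / gauss_m2) z0.
Proof.
have m2 := @gauss_m2_gt0 R.
pose E t (f : R -> R) := bavg (fun u : {ffun 'I_(N t) -> 'I_(N t)} => f (\sum_(i < N t) xi t i (u i))).
pose P t (z : R) := bavg (fun u : {ffun 'I_(N t) -> 'I_(N t)} => (\sum_(i < N t) xi t i (u i) <= z)%R%:R : R).
apply: (@cvg_gcdf R T U _ E P); first by rewrite divr_gt0.
- move=> t C f w k _ fz; rewrite /E /P -[in leRHS](bavg_cst_diag (N t) k) -bavgD.
  by apply: le_bavg => u; exact: fz.
- move=> t C f w k _ fz; rewrite /E /P -[in leLHS](bavg_cst_diag (N t) k) -bavgB.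
  by apply: le_bavg => u; exact: fz.
move=> C f sf.
pose w t (k : nat) := fmean (fun j => xi t k j ^+ 2) / gauss_m2.
have w0 t k : 0 <= w t k.
  by rewrite divr_ge0 ?(ltW m2)// fmean_ge0// => j; rewrite sqr_ge0.
have cW : \sum_(k < N t) w t k @[t --> U] --> V / gauss_m2.
  rewrite /w; under eq_fun do rewrite -mulr_suml.
  by apply: cvgM; [exact: sum_xi2_cvg|exact: cvg_cst].
have W0 t : 0 <= \sum_(k < N t) w t k by apply: sumr_ge0.
have VV : 0 <= V / gauss_m2 by rewrite divr_ge0 ?ltW.
have cG := cvg_gop W0 VV cW sf.
have cC : (fun _ : T => C) t @[t --> U] --> C by exact: cvg_cst.
have cR : C * (\sum_(k < N t) (fmean (fun j => `|xi t k j| ^+ 3) +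
    gauss_m3 * (w t k * Num.sqrt (w t k)))) @[t --> U] --> C * 0.
  exact: cvgM cC sum_remainder_cvg0.
rewrite mulr0 in cR.
apply/cvgRP => e e0; have e2 : 0 < e / 2 by rewrite divr_gt0.
apply: filterS3 N0 (near_dist (cG _ 0) e2) (near_dist cR e2) => t nt h1.
rewrite subr0 => h2.
have h3 := @bavg_lindeberg R _ nt (xi t) (fun k => fmean_xi0 k nt) C f (N t) (w t) sf (w0 t) _.
have h4 : `|E t f - gop (\sum_(k < N t) w t k) f 0| <= e / 2.
  apply: (le_trans (h3 _)); first by move=> k; rewrite /w divfK ?gt_eqF.
  by rewrite -mulr_sumr; apply: le_trans h2; exact: ler_norm.
rewrite -[X in `|X|](subrKA (gop (\sum_(k < N t) w t k) f 0)) (le_trans (ler_normD _ _))//.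
by rewrite [e](_ : _ = e / 2 + e / 2) ?lerD//; field.
Qed.

Let zeta t (u : {ffun 'I_(N t) -> 'I_(N t)}) : R := \sum_(i < N t) kap t i * r t (u i) 0.
Arguments zeta : clear implicits.
Let psi1 t (v : R) := q t * (ecdf (r t) (c + v / q t) - F c).
Let psi2 t (v : R) := q t * (ecdfl (r t) (- c + v / q t) - F (- c)).

Lemma That_draw t (u : {ffun 'I_(N t) -> 'I_(N t)}) : (0 < N t)%N ->
  - That (X t) xf (y t) (\col_i r t (u i) 0) (xh t) = \sum_(i < N t) xi t i (u i)
    - ((psi1 t (s t + zeta t u) - psi1 t (s t) - f1 * zeta t u)
       - (psi2 t (- s t + zeta t u) - psi2 t (- s t) - f2 * zeta t u)).
Proof.
move=> nt; have qt := sqrtN_gt0 nt; have n0 : (N t)%:R != 0 :> R by rewrite pnatr_eq0 -lt0n.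
set U' := \col_i r t (u i) 0.
have dE : dot xf (ols (X t) U') - mean U' = zeta t u / q t.
  rewrite (dot_ols_draw _ nt) /z /zeta /mean mulr_sumr !mulr_suml -sumrB.
  apply: eq_bigr => i _; have -> : U' i 0 = r t (u i) 0 by rewrite mxE.
  by rewrite /kap -(q_sqr t); field; rewrite gt_eqF.
have iE : ecdf U' (xh t) - ecdfl U' (- xh t) = (N t)%:R^-1 * \sum_(i < N t) ind t (u i).
  rewrite /ecdf /ecdfl -mulrBr -sumrB; congr (_ * _); apply: eq_bigr => i _.
  by have -> : U' i 0 = r t (u i) 0 by rewrite mxE.
rewrite /That Nhat_left_lim /Nhat.
have dA a : a + dot xf (ols (X t) U') - mean U' = a + zeta t u / q t by rewrite -addrA dE.
rewrite !dA -/(r t) -/(q t).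
have xiE : \sum_(i < N t) xi t i (u i) = - g * zeta t u +
    q t * (ecdf U' (xh t) - ecdfl U' (- xh t)) - q t * (ecdf (r t) (xh t) - ecdfl (r t) (- xh t)).
  rewrite iE -fmean_ind /xi big_split/= -mulr_suml sumrB sumr_const card_ord.
  rewrite -[fmean _ *+ _]mulr_natr /zeta mulr_sumr -addrA; congr (_ + _).
    by apply: eq_bigr => i _; ring.
  by rewrite -(q_sqr t); field; rewrite gt_eqF.
rewrite xiE /psi1 /psi2 /g.
have -> : c + (s t + zeta t u) / q t = xh t + zeta t u / q t by rewrite /xh mulrDl addrA.
have -> : - c + (- s t + zeta t u) / q t = - xh t + zeta t u / q t.
  by rewrite /xh mulrDl mulNr opprD addrA.
have -> : - c + - s t / q t = - xh t by rewrite /xh opprD mulNr.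
by rewrite -/(xh t); ring.
Qed.

Lemma zeta_tail (K : R) : 0 < K -> \forall t \near U,
  bavg (fun u => (K < `|zeta t u|)%R%:R) <= (`|s2 * (v1 + 1 - 2 * v2)| + 1) / K ^+ 2.
Proof.
move=> K0.
have h : fmean (fun j => r t j 0 ^+ 2) * \sum_(k < N t) kap t k ^+ 2 @[t --> U] -->
    s2 * (v1 + 1 - 2 * v2).
  apply: cvgM => //.
  have h : (N t)%:R * (\sum_(k < N t) cw t k ^+ 2) + 1 - 2 * \sum_(k < N t) cw t k
      @[t --> U] --> v1 + 1 - 2 * v2.
    apply: cvgB; last by apply: cvgM => //; exact: cvg_cst.
    by apply: cvgD => //; exact: cvg_cst.
  by apply: cvg_trans h; apply: near_eq_cvg; apply: filterS N0 => t nt; rewrite sum_kap2.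
apply: filterS2 N0 (near_dist h ltr01) => t nt h1.
have x0 k : fmean (fun j => kap t k * r t j 0) = 0 by rewrite fmeanZ fmean_resid0// mulr0.
apply: (le_trans (bavg_sum_tail nt x0 (N t) K0)).
rewrite ler_wpM2r ?invr_ge0 ?sqr_ge0//.
under eq_bigr => k _.
  rewrite (eq_fmean (zeta := fun j => kap t k ^+ 2 * r t j 0 ^+ 2)); last by move=> j; rewrite exprMn.
  rewrite fmeanZ mulrC; over.
rewrite -mulr_sumr -lerBlDl; apply: le_trans h1; apply: le_trans (ler_norm _).
by rewrite lerB// ler_norm.
Qed.

(** Up to a negligible remainder, - That is the linear statistic of the draws
    treated above; the remainder is controlled by the affine limits, the
    fluctuation of the inner argument having bounded second moment. *)
Lemma That_cvg (z0 : R) :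
  boot_prob (r t) (fun u : 'cV[R]_(N t) => - That (X t) xf (y t) u (xh t) <= z0) @[t --> U] -->
  gcdf (V / gauss_m2) z0.
Proof.
have vpos : 0 < V / gauss_m2 by rewrite divr_gt0 ?gauss_m2_gt0.
apply/cvgRP => e e0; have e4 : 0 < e / 4 by rewrite divr_gt0.
have [k k0 hk] := cvgR_ball (gcdf_continuous vpos (x := z0)) e4.
pose C2 := `|s2 * (v1 + 1 - 2 * v2)| + 1; have C20 : 0 < C2 by rewrite ltr_wpDl.
have [K K0 hK] : exists2 K : R, 0 < K & C2 / K ^+ 2 <= e / 4.
  exists (Num.sqrt (C2 / (e / 4))); first by rewrite sqrtr_gt0 divr_gt0.
  rewrite sqr_sqrtr; last by rewrite divr_ge0// ltW.
  by rewrite invf_div mulrC divfK// gt_eqF.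
have k4 : 0 < k / 4 by rewrite divr_gt0.
have P2 := ecdfl_affine_limit Psi2.
have U1 := @affine_limit_unif _ _ _ UU _ _ _ (K + (`|s0| + 1)) _ Psi1 k4.
have U2 := @affine_limit_unif _ _ _ UU _ _ _ (K + (`|s0| + 1)) _ P2 k4.
have D1 := near_dist (@draws_cdf_cvg (z0 + k)) e4.
have D2 := near_dist (@draws_cdf_cvg (z0 - k)) e4.
apply: filterS3 N0 (filterI U1 (filterI U2 (zeta_tail K0)))
  (filterI D1 (filterI D2 (near_dist ss ltr01))) => t nt [u1 [u2 zt]] [d1 [d2 st]].
have sB : `|s t| <= `|s0| + 1 by rewrite -lerBlDl (le_trans _ st)// lerB_dist.
have err u : `|zeta t u| <= K ->
   `|- That (X t) xf (y t) (\col_i r t (u i) 0) (xh t) - \sum_(i < N t) xi t i (u i)| <= k.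
  move=> zK; rewrite (That_draw u nt) addrAC subrr add0r normrN.
  have b1 : `|s t| <= K + (`|s0| + 1) by rewrite (le_trans sB)// lerDr ltW.
  have b2 : `|- s t| <= K + (`|s0| + 1) by rewrite normrN.
  have b3 : `|s t + zeta t u| <= K + (`|s0| + 1) by rewrite addrC (le_trans (ler_normD _ _))// lerD.
  have b4 : `|- s t + zeta t u| <= K + (`|s0| + 1).
    by rewrite addrC (le_trans (ler_normD _ _))// normrN lerD.
  move: (u1 _ b1) (u1 _ b3) (u2 _ b2) (u2 _ b4); rewrite -!/(psi1 t _) -!/(psi2 t _).
  exact: four_term_bound.
rewrite boot_probE; set H := bavg _.
have up : H <= bavg (fun u => (\sum_(i < N t) xi t i (u i) <= z0 + k)%R%:R) +
    bavg (fun u => (K < `|zeta t u|)%R%:R).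
  rewrite -bavgD; apply: le_bavg => u; rewrite -natrD ler_nat.
  case: (ltP K `|zeta t u|) => [_|zK]; first by rewrite addn1 (leq_trans (leq_b1 _)).
  by rewrite addn0; exact: indic_shift (err u zK).
have lo : bavg (fun u => (\sum_(i < N t) xi t i (u i) <= z0 - k)%R%:R) -
    bavg (fun u => (K < `|zeta t u|)%R%:R) <= H.
  rewrite lerBlDr -bavgD; apply: le_bavg => u; rewrite -natrD ler_nat.
  case: (ltP K `|zeta t u|) => [_|zK]; first by rewrite addn1 (leq_trans (leq_b1 _)).
  rewrite addn0 -{2}(subrK k z0); apply: indic_shift; rewrite distrC.
  exact: err.
have g1 : `|gcdf (V / gauss_m2) (z0 + k) - gcdf (V / gauss_m2) z0| <= e / 4.
  by apply: hk; rewrite addrAC subrr add0r gtr0_norm.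
have g2 : `|gcdf (V / gauss_m2) (z0 - k) - gcdf (V / gauss_m2) z0| <= e / 4.
  by apply: hk; rewrite addrAC subrr add0r normrN gtr0_norm.
exact: (cdf_sandwich up lo (le_trans zt hK) d1 d2 g1 g2).
Qed.

Variables (gam0 Q : R).
Hypothesis QE : gcdf (V / gauss_m2) Q = 1 - gam0.

Lemma Dstar_cvg : Dstar (X t) xf (y t) (1 - gam0) (xh t) @[t --> U] --> Q.
Proof.
have vpos : 0 < V / gauss_m2 by rewrite divr_gt0 ?gauss_m2_gt0.
apply/cvgRP => e e0; pose H t z0 :=
  boot_prob (r t) (fun u : 'cV[R]_(N t) => - That (X t) xf (y t) u (xh t) <= z0).
have Hmono t z1 z2 : z1 <= z2 -> H t z1 <= H t z2.
  move=> zz; rewrite /H !boot_probE; apply: le_bavg => u.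
  by rewrite ler_nat; case: leP => // /le_trans ->.
have q1 : gcdf (V / gauss_m2) (Q - e) < 1 - gam0.
  by rewrite -QE; apply: gcdf_lt => //; rewrite gtrDl oppr_lt0.
have q2 : 1 - gam0 < gcdf (V / gauss_m2) (Q + e).
  by rewrite -QE; apply: gcdf_lt => //; rewrite ltrDl.
have N1 := cvgr_lt _ (@That_cvg (Q - e)) _ q1.
have N2 := cvgr_gt _ (@That_cvg (Q + e)) _ q2.
apply: filterS2 (N1 _) (N2 _) => t h1 h2.
rewrite /Dstar; set S := [set z | _].
have SE : S (Q + e) by exact: ltW.
have Slb : lbound S (Q - e).
  move=> w Sw; rewrite leNgt; apply/negP => wQ.
  have := Hmono t _ _ (ltW wQ); rewrite leNgt => /negP; apply.
  exact: lt_le_trans h1 Sw.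
rewrite ler_distl; apply/andP; split.
  by apply: lb_le_inf => //; exists (Q + e).
by apply: ge_inf => //; exists (Q - e).
Qed.
End standardized_coverage.

Hypothesis V0 : 0 < V.

(** The corrected level is 1 - alpha + Dstar / q with Dstar tending to Q, to
    which the inversion of the bootstrap distribution function applies. *)
Lemma Cstar_cvg (gam0 Q : R) : gcdf (V / gauss_m2) Q = 1 - gam0 ->
  exists2 s : T -> R, s t @[t --> U] --> (Q - (l1 - l2)) / (f1 + f2) &
    \forall t \near U, Cstar (X t) xf (y t) (1 - alpha) (1 - gam0) = (c + s t / q t)%:E.
Proof.
move=> QE.
have c0' : (fun _ : T => 0 : R) t @[t --> U] --> (0 : R) by exact: cvg_cst.
have [s ss hs] := Cquant_cvg c0'.
have DQ := Dstar_cvg ss V0 QE.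
have [s' ss' hs'] := Cquant_cvg DQ.
exists s'; first exact: ss'.
apply: filterS2 hs hs' => t.
rewrite mul0r addr0 => h1 h2; rewrite /Cstar h1.
exact: h2.
Qed.
End bootstrap_limit.

(** * Leave-one-out residuals and limits of the design *)

Section leave_one_out.
Context {R : realType}.

(** Deleting a row is a rank-one perturbation of the Gram matrix; comparing the
    normal equations gives the classical residual identity. *)
Lemma loo_residE n p (X : 'M[R]_(n, p)) (y : 'cV[R]_n) (i : 'I_n) :
  let B := X^T *m X in
  let h := (row i X *m invmx B *m (row i X)^T) 0 0 in
  B \in unitmx -> h != 1 ->
  loo_resid X y i 0 = (y i 0 - (row i X *m ols X y) 0 0) / (1 - h).
Proof.
move=> B h uB h1; set v := row i X.
have gram : (row' i X)^T *m row' i X = B - v^T *m v.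
  apply/matrixP => j k; rewrite !mxE (bigD1_ord i)//= big_ord1 !mxE.
  rewrite addrAC subrr add0r; apply: eq_bigr => l _; by rewrite !mxE.
have cross : (row' i X)^T *m row' i y = X^T *m y - v^T *m (y i 0)%:M.
  apply/colP => j; rewrite !mxE (bigD1_ord i)//= big_ord1 !mxE eqxx mulr1n.
  rewrite addrAC subrr add0r; apply: eq_bigr => l _; by rewrite !mxE.
have h1' : 1 - h != 0 by rewrite subr_eq0 eq_sym.
have scal (w : 'cV[R]_p) : v^T *m (v *m w) = (v *m w) 0 0 *: v^T.
  by rewrite [v *m w in LHS]mx11_scalar mul_mx_scalar.
have uG : B - v^T *m v \in unitmx.
  rewrite -unitmx_tr -row_free_unit -kermx_eq0; apply/eqP/row_matrixP => k.
  rewrite row0; set z := row k _; have : z *m (B - v^T *m v)^T = 0.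
    by rewrite -row_mul mulmx_ker row0.
  move=> /(congr1 trmx); rewrite trmx_mul trmxK trmx0 mulmxBl -(mulmxA v^T) scal.
  set s := (v *m z^T) 0 0 => /eqP; rewrite subr_eq0 => /eqP Bz.
  have zE : z^T = s *: (invmx B *m v^T) by rewrite -(mulKmx uB z^T) Bz -scalemxAr.
  have : s = s * h by rewrite /s [in LHS]zE -scalemxAr mxE /h mulmxA.
  move=> /eqP; rewrite -subr_eq0 -{1}[s]mulr1 -mulrBr mulf_eq0 (negbTE h1') orbF => /eqP s0.
  by rewrite -[z]trmxK zE s0 scale0r trmx0.
pose b := ols (row' i X) (row' i y).
have nb : (B - v^T *m v) *m b = X^T *m y - v^T *m (y i 0)%:M.
  by rewrite /b /ols gram -(mulmxA (invmx _)) cross mulKVmx.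
pose rho := y i 0 - (v *m b) 0 0.
have bE : b = ols X y - rho *: (invmx B *m v^T).
  have : B *m b = X^T *m y - rho *: v^T.
    move: nb; rewrite mulmxBl -(mulmxA v^T) scal mul_mx_scalar => /eqP.
    rewrite subr_eq => /eqP ->; rewrite /rho scalerBl opprB addrA addrAC.
    by rewrite [X^T *m y + _]addrC -!addrA; congr (_ + _); rewrite addrC.
  move=> /(congr1 (mulmx (invmx B))); rewrite mulKmx// mulmxBr => ->.
  by rewrite -scalemxAr /ols mulmxA.
have rE : rho = y i 0 - (v *m ols X y) 0 0 + rho * h.
  rewrite {1}/rho bE mulmxBr -scalemxAr !mxE opprB addrA addrAC; congr (_ + _).
  by rewrite /h -mulmxA mxE.
have -> : loo_resid X y i 0 = rho by rewrite mxE.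
apply/(canRL (mulfK h1')); rewrite mulrBr mulr1 {1}rE; ring.
Qed.
End leave_one_out.

Section inverse_limit.
Context {R : realType} (T : Type) (U : set_system T) {FU : Filter U}.

Lemma cvgR_near_eq (f h : T -> R) (l : R) :
  (\forall t \near U, f t = h t) -> f t @[t --> U] --> l -> h t @[t --> U] --> l.
Proof.
move=> fh /cvgRP fl; apply/cvgRP => e e0; apply: filterS2 fh (fl e e0) => t <-.
exact.
Qed.

Lemma cvg_sumR (I : Type) (r : seq I) (P : pred I) (f : I -> T -> R) (l : I -> R) :
  (forall i, P i -> f i t @[t --> U] --> l i) ->
  \sum_(i <- r | P i) f i t @[t --> U] --> \sum_(i <- r | P i) l i.
Proof. by move=> h; apply: (@cvg_big R _ +%R 0 P (@add_continuous R)) => i; exact: h. Qed.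

Lemma cvg_prodR (I : Type) (r : seq I) (P : pred I) (f : I -> T -> R) (l : I -> R) :
  (forall i, P i -> f i t @[t --> U] --> l i) ->
  \prod_(i <- r | P i) f i t @[t --> U] --> \prod_(i <- r | P i) l i.
Proof. by move=> h; apply: (@cvg_big R _ *%R 1 P (@mul_continuous R)) => i; exact: h. Qed.

Lemma cvg_det n (A : T -> 'M[R]_n) (A0 : 'M[R]_n) :
  (forall i j, A t i j @[t --> U] --> (A0 i j : R)) ->
  \det (A t) @[t --> U] --> (\det A0 : R).
Proof.
move=> h; apply: cvg_sumR => s _.
apply: cvgM; first exact: cvg_cst.
by apply: cvg_prodR => i _; exact: h.
Qed.

Lemma cvg_invmx n (A : T -> 'M[R]_n) (A0 : 'M[R]_n) : A0 \in unitmx ->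
  (forall i j, A t i j @[t --> U] --> (A0 i j : R)) ->
  forall i j, invmx (A t) i j @[t --> U] --> (invmx A0 i j : R).
Proof.
move=> uA h i j; have d0 : \det A0 != 0 by rewrite -unitfE -unitmxE.
have hd := cvg_det h.
have nz : \forall t \near U, \det (A t) != 0.
  have e0 : 0 < `|\det A0| / 2 by rewrite divr_gt0 ?normr_gt0.
  apply: filterS (@cvgR_near _ _ U _ _ _ _ hd e0) => t; apply: contraTneq => ->.
  by rewrite sub0r normrN -ltNge ltr_pdivrMr// ltr_pMr ?normr_gt0// ltr1n.
have adj : (\adj (A t)) i j @[t --> U] --> ((\adj A0) i j : R).
  rewrite mxE; under eq_fun do rewrite mxE.
  apply: cvgM; first exact: cvg_cst.
  by apply: cvg_det => k l; rewrite !mxE; under eq_fun do rewrite !mxE; exact: h.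
rewrite {2}/invmx uA mxE; apply: cvg_trans (cvgM (cvgV d0 hd) adj).
apply: near_eq_cvg; apply: filterS nz => t nt.
by rewrite /invmx unitmxE unitfE nt [RHS]mxE.
Qed.

Lemma dot_mulE p (u v : 'cV[R]_p) (C : 'M[R]_p) :
  dot u (C *m v) = \sum_j \sum_k u j 0 * (C j k * v k 0).
Proof. by rewrite dotE; apply: eq_bigr => j _; rewrite mxE mulr_sumr. Qed.

Lemma cvg_dot_mul p (u : 'cV[R]_p) (v : T -> 'cV[R]_p) (v0 : 'cV[R]_p) (C : T -> 'M[R]_p) (C0 : 'M[R]_p) :
  (forall i j, C t i j @[t --> U] --> (C0 i j : R)) ->
  (forall i, v t i 0 @[t --> U] --> (v0 i 0 : R)) ->
  dot u (C t *m v t) @[t --> U] --> (dot u (C0 *m v0) : R).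
Proof.
move=> hC hv; rewrite dot_mulE; under eq_fun do rewrite dot_mulE.
apply: cvg_sumR => j _.
apply: cvg_sumR => k _.
apply: cvgM; first exact: cvg_cst.
exact: cvgM (hC _ _) (hv _).
Qed.
End inverse_limit.

Section design_limits.
Context {R : realType}.
Variables (p : nat) (x : nat -> 'cV[R]_p) (A : 'M[R]_p) (b : 'cV[R]_p) (M : R).
Hypothesis uX : forall n, (p <= n)%N -> (design x n)^T *m design x n \in unitmx.
Hypothesis uA : A \in unitmx.
Hypothesis XA : n%:R^-1 *: ((design x n)^T *m design x n) @[n --> \oo] --> A.
Hypothesis xb : n%:R^-1 *: (\sum_(i < n) x i) @[n --> \oo] --> b.
Hypothesis xM : forall i, norm2 (x i) <= M.

Definition gram n := (design x n)^T *m design x n.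

Lemma near_gram_unit : \forall n \near \oo, (0 < n)%N /\ gram n \in unitmx.
Proof. by exists p.+1 => // n /= pn; split; [exact: leq_trans pn|apply/uX/ltnW]. Qed.

Lemma cvg_scaled_inv i j : (n%:R *: invmx (gram n)) i j @[n --> \oo] --> (invmx A i j : R).
Proof.
have h i' j' : (n%:R^-1 *: gram n) i' j' @[n --> \oo] --> (A i' j' : R).
  by apply: (cvg_comp _ (fun C : 'M[R]_p => C i' j') XA); exact: coord_continuous.
apply: cvgR_near_eq (@cvg_invmx R nat \oo _ p _ A uA h i j).
apply: filterS near_gram_unit => n [n0 un].
by rewrite invmxZ ?invrK// unitmxZ// unitrV unitfE pnatr_eq0 -lt0n.
Qed.

Lemma norm2_coord q (v : 'cV[R]_q) j : `|v j 0| <= norm2 v.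
Proof.
rewrite -sqrtr_sqr ler_wsqrtr// (bigD1 j)//= lerDl; apply: sumr_ge0 => k _.
exact: sqr_ge0.
Qed.

(** The quadratic form of the inverse Gram matrix has order 1 / n, uniformly
    over bounded arguments. *)
Lemma inv_gram_bound (K : R) : exists C : R, \forall n \near \oo, forall u v : 'cV[R]_p,
  norm2 u <= K -> norm2 v <= K -> `|dot u (invmx (gram n) *m v)| <= C / n%:R.
Proof.
exists (\sum_j \sum_k (K * ((`|invmx A j k| + 1) * K))).
have h : \forall n \near \oo, forall j k, `|(n%:R *: invmx (gram n)) j k| <= `|invmx A j k| + 1.
  apply: filter_forall => j; apply: filter_forall => k.
  apply: filterS (@cvgR_near R nat \oo _ _ _ _ (@cvg_scaled_inv j k) ltr01) => n hn.
  rewrite -[X in `|X|](subrK (invmx A j k)) addrC (le_trans (ler_normD _ _))//.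
  by rewrite lerD2l.
apply: filterS2 h near_gram_unit => n hn [n0 _] u v uK vK.
have n0' : (0 : R) < n%:R by rewrite ltr0n.
rewrite ler_pdivlMr// mulrC -[in X in X * _](gtr0_norm n0') -normrM.
rewrite dot_mulE mulr_sumr (le_trans (ler_norm_sum _ _ _))//; apply: ler_sum => j _.
rewrite mulr_sumr (le_trans (ler_norm_sum _ _ _))//; apply: ler_sum => k _.
rewrite mulrCA mulrA -mulrA [_ * (_ * v k 0)]mulrA !normrM.
have := hn j k; rewrite mxE normrM => {}hn.
rewrite ler_pM ?mulr_ge0//; first exact: le_trans (norm2_coord u j) uK.
rewrite ler_pM ?mulr_ge0//; exact: le_trans (norm2_coord v k) vK.
Qed.

Variable xf : 'cV[R]_p.
Definition pred_weight n i := dot xf (invmx (gram n) *m x i).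

Lemma design_mul_tr n (u : 'cV[R]_n) : (design x n)^T *m u = \sum_(i < n) u i 0 *: x i.
Proof.
apply/colP => j; rewrite !mxE summxE; apply: eq_bigr => i _.
by rewrite !mxE mulrC.
Qed.

Lemma dot_sumr q n (u : 'cV[R]_q) (v : 'I_n -> 'cV[R]_q) (C : 'M[R]_q) (a : 'I_n -> R) :
  dot u (C *m \sum_i a i *: v i) = \sum_i a i * dot u (C *m v i).
Proof.
rewrite /dot !mulmx_sumr summxE; apply: eq_bigr => i _.
by rewrite -!scalemxAr mxE.
Qed.

Lemma dot_ols n (u : 'cV[R]_n) : dot xf (ols (design x n) u) = \sum_(i < n) pred_weight n i * u i 0.
Proof.
rewrite /ols -mulmxA design_mul_tr dot_sumr; apply: eq_bigr => i _.
by rewrite mulrC.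
Qed.

Lemma trmx_inv_gram n : (invmx (gram n))^T = invmx (gram n).
Proof. by rewrite trmx_inv trmx_mul trmxK. Qed.

Lemma cvg_sum_weight_sqr :
  n%:R * \sum_(i < n) pred_weight n i ^+ 2 @[n --> \oo] --> (dot xf (invmx A *m xf) : R).
Proof.
have h0 i : (fun _ : nat => xf i 0) n @[n --> \oo] --> (xf i 0 : R) by exact: cvg_cst.
apply: cvgR_near_eq (@cvg_dot_mul R nat \oo _ p xf (fun _ => xf) xf _ _ (@cvg_scaled_inv) h0).
apply: filterS near_gram_unit => n [n0 un].
rewrite -scalemxAl /dot -scalemxAr mxE; congr (_ * _).
pose v := \col_(i < n) pred_weight n i.
have vE : v = design x n *m (invmx (gram n) *m xf).
  apply/colP => i; rewrite mxE /pred_weight -/(dot _ _).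
  rewrite mulmxA; transitivity ((xf^T *m (invmx (gram n) *m x i))^T 0 0); first by rewrite [RHS]mxE.
  rewrite trmx_mul trmx_mul trmxK trmx_inv_gram !mxE; apply: eq_bigr => k _.
  congr (_ * _); rewrite !mxE; apply: eq_bigr => l _; by rewrite !mxE.
transitivity ((v^T *m v) 0 0).
  by rewrite vE trmx_mul trmx_mul trmx_inv_gram -!mulmxA (mulmxA (_^T) (design x n)) mulKmx.
by rewrite mxE; apply: eq_bigr => i _; rewrite !mxE expr2.
Qed.

Lemma cvg_sum_weight : \sum_(i < n) pred_weight n i @[n --> \oo] --> (dot xf (invmx A *m b) : R).
Proof.
have h : forall i, (n%:R^-1 *: \sum_(k < n) x k) i 0 @[n --> \oo] --> (b i 0 : R).
  by move=> i; apply: (cvg_comp _ (fun C : 'cV[R]_p => C i 0) xb); exact: coord_continuous.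
apply: cvgR_near_eq (@cvg_dot_mul R nat \oo _ p xf _ b _ _ (@cvg_scaled_inv) h).
apply: filterS near_gram_unit => n [n0 un].
rewrite -scalemxAl -scalemxAr scalerA divff ?pnatr_eq0 -?lt0n// scale1r.
have := dot_sumr xf (fun i : 'I_n => x i) (invmx (gram n)) (fun _ => 1).
by under eq_bigr do rewrite scale1r; move=> ->; apply: eq_bigr => i _; rewrite mul1r.
Qed.

Hypothesis xfM : norm2 xf <= M.

Lemma pred_weight_bound : exists C : R, \forall n \near \oo, forall i, `|pred_weight n i| <= C / n%:R.
Proof.
have [C hC] := inv_gram_bound M; exists C; apply: filterS hC => n h i.
exact: h.
Qed.
End design_limits.

(** * From errors to residuals *)

Section residual_arithmetic.
Context {R : realType}.
Implicit Types e r q a c s k z D : R.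

Lemma resid_le_shift q e r a k c s : 0 < q -> `|q * (e - r) - a| <= k ->
  ((r <= c + s / q)%R <= (e <= c + (a + (s + k)) / q)%R)%N.
Proof.
move=> q0; rewrite ler_norml => /andP[_ h]; case: (leP r (c + s / q)) => // h1.
case: (leP e (c + (a + (s + k)) / q)) => //; rewrite ltNge => /negP[].
have h2 : e - r <= (a + k) / q by rewrite ler_pdivlMr// mulrC; lra.
have -> : c + (a + (s + k)) / q = (c + s / q) + (a + k) / q by ring.
lra.
Qed.

Lemma resid_ge_shift q e r a k c s : 0 < q -> `|q * (e - r) - a| <= k ->
  ((e <= c + (a + (s - k)) / q)%R <= (r <= c + s / q)%R)%N.
Proof.
move=> q0; rewrite ler_norml => /andP[h _]; case: (leP e (c + (a + (s - k)) / q)) => // h1.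
case: (leP r (c + s / q)) => //; rewrite ltNge => /negP[].
have h2 : (a - k) / q <= e - r by rewrite ler_pdivrMr// mulrC; lra.
move: h1; have -> : c + (a + (s - k)) / q = (c + s / q) + (a - k) / q by ring.
lra.
Qed.

(** A change of indicator forces the error into a window around the
    threshold. *)
Lemma indic_window q e r c s D : 0 < q -> `|q * (e - r)| <= D ->
  `|(r <= c + s / q)%R%:R - (e <= c)%R%:R| <= (`|e - c| <= (`|s| + D) / q)%R%:R :> R.
Proof.
move=> q0 h; have [w|w] := leP `|e - c| _.
  by case: (r <= _)%R; case: (e <= c)%R; rewrite ?subrr ?subr0 ?sub0r ?normrN ?normr1 ?normr0.
have h1 : `|e - r| <= D / q.
  by rewrite ler_pdivlMr// mulrC; move: h; rewrite normrM (gtr0_norm q0).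
have h2 : `|s / q| <= `|s| / q by rewrite normrM normfV (gtr0_norm q0).
have -> : (r <= c + s / q)%R = (e <= c)%R; last by rewrite subrr normr0.
move: w h1 h2; rewrite mulrDl; move: (s / q) (`|s| / q) (D / q) => s' s1 d w.
rewrite !ler_norml => /andP[? ?] /andP[? ?]; move: w.
case: (ger0P (e - c)) => ? w; case: (leP r (c + s')) => ?; case: (leP e c) => ? //; lra.
Qed.

Lemma indic_window_lt q e r c s D : 0 < q -> `|q * (e - r)| <= D ->
  `|(r < c + s / q)%R%:R - (e <= c)%R%:R| <= (`|e - c| <= (`|s| + D) / q)%R%:R :> R.
Proof.
move=> q0 h; have [w|w] := leP `|e - c| _.
  by case: (r < _)%R; case: (e <= c)%R; rewrite ?subrr ?subr0 ?sub0r ?normrN ?normr1 ?normr0.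
have h1 : `|e - r| <= D / q.
  by rewrite ler_pdivlMr// mulrC; move: h; rewrite normrM (gtr0_norm q0).
have h2 : `|s / q| <= `|s| / q by rewrite normrM normfV (gtr0_norm q0).
have -> : (r < c + s / q)%R = (e <= c)%R; last by rewrite subrr normr0.
move: w h1 h2; rewrite mulrDl; move: (s / q) (`|s| / q) (D / q) => s' s1 d w.
rewrite !ler_norml => /andP[? ?] /andP[? ?]; move: w.
case: (ger0P (e - c)) => ? w; case: (ltP r (c + s')) => ?; case: (leP e c) => ? //; lra.
Qed.


Lemma scaled_cdf_sandwich (d H L L1 L2 w x1 x2 x3 : R) : `|H - w| <= d / 4 ->
  `|L1 - (x1 + (x2 + x3))| <= d / 4 -> `|L2 - (x1 + (x2 - x3))| <= d / 4 ->
  `|x3| <= d / 4 -> L <= L1 -> L2 <= L -> `|H + L - (w + x1 + x2)| <= d.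
Proof.
rewrite !ler_norml => /andP[? ?] /andP[? ?] /andP[? ?] /andP[? ?] ? ?.
by apply/andP; split; lra.
Qed.

Lemma le_sqr_shift (z D K rho : R) : 0 <= D -> 0 <= K -> 0 < rho -> D + K / rho + 1 <= z ->
  K + rho * (z + D) ^+ 2 <= 5 * rho * z ^+ 2.
Proof.
move=> D0 K0 r0 h.
have h1 : K <= rho * z ^+ 2.
  have kr : 0 <= K / rho by rewrite divr_ge0// ltW.
  have h3 : K / rho <= z ^+ 2.
    by rewrite expr2 (@le_trans _ _ (z * 1))// ?ler_wpM2l//; lra.
  by move: h3; rewrite ler_pdivrMr// mulrC.
have h2 : (z + D) ^+ 2 <= 4 * z ^+ 2.
  have kr : 0 <= K / rho by rewrite divr_ge0// ltW.
  by nra.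
have : rho * (z + D) ^+ 2 <= rho * (4 * z ^+ 2) by rewrite ler_pM2l.
lra.
Qed.
Lemma sqr_diff_bound (e r d D : R) : `|e - r| <= d -> d <= D -> 0 <= d ->
  `|r ^+ 2 - e ^+ 2| <= d * (2 + D + 2 * e ^+ 2).
Proof.
move=> h dD d0; have -> : r ^+ 2 - e ^+ 2 = (r - e) * (2 * e - (e - r)) by ring.
rewrite normrM distrC ler_pM// (le_trans (ler_normB _ _))//.
have h1 : `|2 * e| <= 2 + 2 * e ^+ 2.
  rewrite normrM ger0_norm//; have := sqr_ge0 (`|e| - 1); have := sqr_ge0 e.
  rewrite sqrrB real_normK ?num_real//; lra.
lra.
Qed.

Lemma cube_bound (e r D : R) : 0 <= D -> `|e - r| <= D ->
  `|r| ^+ 3 <= 1 + 8 * D ^+ 4 + 8 * e ^+ 4.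
Proof.
move=> D0 h; have h1 : `|r| <= `|e| + D.
  by rewrite -[r in X in X <= _](subKr e) (le_trans (ler_normB _ _))// lerD2l.
have -> : e ^+ 4 = `|e| ^+ 4.
  by rewrite !(exprM _ 2 2) real_normK ?num_real.
move: h1 (normr_ge0 e) (normr_ge0 r); move: `|e| `|r| => a b h1 a0 b0.
have h2 : b ^+ 3 <= 1 + b ^+ 4.
  have [b1|b1] := lerP b 1; first by rewrite ler_wpDr ?exprn_ge0// exprn_ile1.
  by rewrite [_ ^+ 4]exprS ler_wpDl// ler_peMl ?exprn_ge0// ltW.
have h3 : b ^+ 4 <= (a + D) ^+ 4 by rewrite lerXn2r ?nnegrE ?addr_ge0.
have sq (x y : R) : (x + y) ^+ 2 <= 2 * (x ^+ 2 + y ^+ 2).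
  have := sqr_ge0 (x - y); rewrite sqrrB sqrrD; lra.
have h4 : (a + D) ^+ 4 <= 8 * (a ^+ 4 + D ^+ 4).
  rewrite !(exprM _ 2 2).
  have h5 : ((a + D) ^+ 2) ^+ 2 <= (2 * (a ^+ 2 + D ^+ 2)) ^+ 2.
    by rewrite lerXn2r ?nnegrE ?mulr_ge0 ?addr_ge0 ?sqr_ge0.
  apply: (le_trans h5); rewrite exprMn; have := sq (a ^+ 2) (D ^+ 2); lra.
lra.
Qed.

Lemma truncated_bound (e r d c i j i0 j0 a b : R) : `|e - r| <= d -> `|i - j| <= 1 ->
  `|i - i0| <= a -> `|j - j0| <= b -> `|e| * a <= c * a -> `|e| * b <= c * b ->
  `|r * (i - j) - e * (i0 - j0)| <= d + c * a + c * b.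
Proof.
move=> h1 h2 h3 h4 h5 h6.
have -> : r * (i - j) - e * (i0 - j0) = (r - e) * (i - j) + e * (i - i0) - e * (j - j0) by ring.
rewrite (le_trans (ler_normB _ _))// (le_trans (lerD (ler_normD _ _) (lexx _)))// !normrM.
rewrite !lerD//; first by rewrite distrC -[d]mulr1 ler_pM.
- by apply: le_trans h5; rewrite ler_wpM2l.
- by apply: le_trans h6; rewrite ler_wpM2l.
Qed.

Lemma window_norm (e c w : R) : w <= 1 ->
  `|e| * (`|e - c| <= w)%R%:R <= (`|c| + 1) * (`|e - c| <= w)%R%:R.
Proof.
move=> w1; have [h|h] := leP `|e - c| w; rewrite ?mulr1n ?mulr0n ?mulr0 ?mulr1//.
rewrite -[X in `|X| <= _](subrK c) addrC (le_trans (ler_normD _ _))// lerD2l.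
exact: le_trans h w1.
Qed.
End residual_arithmetic.

Section residual_limits.
Context {R : realType} (T : Type) (U : set_system T) {UU : UltraFilter U}.
Variables (N : T -> nat) (e : T -> nat -> R) (r : forall t, 'cV[R]_(N t)) (a : nat -> R) (D m0 : R).
Let q t : R := Num.sqrt (N t)%:R.
Let near_dist := @cvgR_near R T U _.

Hypothesis Ny : forall m, \forall t \near U, (m <= N t)%N.
Hypothesis ra : forall k : R, 0 < k -> \forall t \near U, forall i : 'I_(N t), `|q t * (e t i - r t i 0) - a i| <= k.
Hypothesis aD : forall i, `|a i| <= D.

(** These counts bound the cost of replacing errors by residuals in an indicator,
    since errors and residuals differ by O(1 / sqrt n). *)
Definition window_count (c0 : R) t (z : R) : R :=
  (q t)^-1 * \sum_(i < N t) (`|e t i - c0| <= z / q t)%R%:R.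

Let N0 : \forall t \near U, (0 < N t)%N. Proof. exact: Ny. Qed.
Let q0 t : (0 < N t)%N -> 0 < q t. Proof. by move=> n0; rewrite sqrtr_gt0 ltr0n. Qed.

Lemma window_count_homo c0 t : {homo window_count c0 t : x y / x <= y}.
Proof.
move=> x y xy; rewrite ler_wpM2l ?invr_ge0 ?sqrtr_ge0//; apply: ler_sum => i _.
rewrite ler_nat; case: leP => // /le_trans -> //.
by rewrite ler_wpM2r// invr_ge0 sqrtr_ge0.
Qed.

Lemma near_resid : \forall t \near U, forall i : 'I_(N t), `|q t * (e t i - r t i 0)| <= D + 1.
Proof.
apply: filterS (ra ltr01) => t h i.
rewrite -[X in `|X|](subrK (a i)) addrC (le_trans (ler_normD _ _))// lerD//.
Qed.

Section one_threshold.
Variables (F : R -> R) (c0 w f : R).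
Hypothesis Wc : (q t)^-1 * \sum_(i < N t) ((e t i <= c0)%R%:R - F c0) @[t --> U] --> w.
Hypothesis Jc : forall eta : R,
  (q t)^-1 * \sum_(i < N t) ((e t i <= c0 + (a i + eta) / q t)%R%:R - (e t i <= c0)%R%:R)
    @[t --> U] --> f * (m0 + eta).
Hypothesis Gc : forall rho : R, 0 < rho -> exists K : R, \forall t \near U,
  forall z, K <= z -> window_count c0 t z <= rho * z ^+ 2.

Let Psi t (s : R) := q t * (ecdf (r t) (c0 + s / q t) - F c0).

Lemma PsiE t s : (0 < N t)%N -> Psi t s = (q t)^-1 * \sum_(i < N t) ((e t i <= c0)%R%:R - F c0) +
  (q t)^-1 * \sum_(i < N t) ((r t i 0 <= c0 + s / q t)%R%:R - (e t i <= c0)%R%:R).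
Proof.
move=> nt; rewrite -mulrDr -big_split/= /Psi /ecdf.
rewrite -[X in q t * (_ - X)](fmean_cst nt (F c0)) /fmean.
rewrite -mulrBr -sumrB mulrA; congr (_ * _).
  have -> : (N t)%:R = q t * q t :> R by rewrite -expr2 sqr_sqrtr// ler0n.
  by rewrite invfM mulrA mulfV ?mul1r// gt_eqF// q0.
by apply: eq_bigr => i _; ring.
Qed.

(** The slope comes from the density at the threshold and the intercept from the
    empirical process there plus the mean shift of the residuals; the growth
    condition at infinity is that of the window counts. *)
Lemma window_affine_limit : affine_limit U Psi (w + f * m0) f.
Proof.
split=> [t x z xz|s|rho rho0].
- rewrite ler_wpM2l ?sqrtr_ge0// lerD2r; apply: ecdf_homo.
  by rewrite lerD2l ler_wpM2r// invr_ge0 sqrtr_ge0.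
- apply/cvgRP => d d0.
  have d4 : 0 < d / 4 by rewrite divr_gt0.
  have [k k0 hk] : exists2 k : R, 0 < k & `|f| * k <= d / 4.
    exists (d / 4 / (`|f| + 1)); first by rewrite divr_gt0// ltr_wpDl.
    rewrite mulrA ler_pdivrMr ?ltr_wpDl// mulrC ler_pM2l//.
    by rewrite lerDl.
  have J1 := near_dist (@Jc (s + k)) d4; have J2 := near_dist (@Jc (s - k)) d4.
  apply: filterS3 (filterI N0 (near_dist Wc d4)) (filterI J1 J2) (ra k0) => t [nt hW] [h1 h2] hr.
  rewrite PsiE//; set H := _ * \sum_(i < N t) (_ - _); set L := _ * \sum_(i < N t) ((r t i 0 <= _)%R%:R - _).
  move: h1 h2; set L1 := _ * \sum_(i < N t) _; set L2 := _ * \sum_(i < N t) _ => h1 h2.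
  have le1 : L <= L1.
    rewrite ler_wpM2l ?invr_ge0 ?sqrtr_ge0//; apply: ler_sum => i _; rewrite lerD2r ler_nat.
    by apply: resid_le_shift (hr i); exact: q0.
  have le2 : L2 <= L.
    rewrite ler_wpM2l ?invr_ge0 ?sqrtr_ge0//; apply: ler_sum => i _; rewrite lerD2r ler_nat.
    by apply: resid_ge_shift (hr i); exact: q0.
  have fk : `|f * k| <= d / 4 by rewrite normrM (gtr0_norm k0).
  move: hW h1 h2 fk; rewrite -/H !mulrDr mulrN.
  move=> hW h1 h2 fk; exact: scaled_cdf_sandwich hW h1 h2 fk le1 le2.
have rho5 : 0 < rho / 5 by rewrite divr_gt0.
have [K hK] := Gc rho5.
exists (Num.max K (`|D| + 1 + (`|w| + 1) / (rho / 5) + 1)).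
apply: filterS3 (filterI N0 (near_dist Wc ltr01)) near_resid hK => t [nt hW] hr {}hK z.
rewrite ge_max => /andP[z1 z2].
have D1 : 0 <= `|D| + 1 by rewrite addr_ge0.
have hw : K <= `|z| + (`|D| + 1) by rewrite (le_trans z1)// lerDl.
have w1 : 0 <= `|w| + 1 by rewrite addr_ge0.
have := le_sqr_shift D1 w1 rho5 z2.
have -> : 5 * (rho / 5) * `|z| ^+ 2 = rho * z ^+ 2 by rewrite real_normK ?num_real//; field.
apply: le_trans; rewrite PsiE// (le_trans (ler_normD _ _))// lerD//.
  by rewrite -[X in `|X|](subrK w) addrC (le_trans (ler_normD _ _))// lerD2l.
apply: le_trans (hK _ hw).
rewrite normrM (ger0_norm (_ : 0 <= (q t)^-1)) ?invr_ge0 ?sqrtr_ge0// ler_wpM2l ?invr_ge0 ?sqrtr_ge0//.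
rewrite (le_trans (ler_norm_sum _ _ _))//; apply: ler_sum => i _.
apply: indic_window; first exact: q0.
by rewrite (le_trans (hr i))// lerD2r ler_norm.
Qed.
End one_threshold.

Lemma cvg_close (f g : T -> R) (l C : R) : g t @[t --> U] --> l ->
  (\forall t \near U, `|f t - g t| <= C / q t) -> f t @[t --> U] --> l.
Proof.
move=> gl fg; apply/cvgRP => d d0; have d2 : 0 < d / 2 by rewrite divr_gt0.
apply: filterS3 (filterI N0 fg) (near_dist gl d2) (sqrtN_unbounded Ny (2 * C / d)) => t [nt h1] h2 h3.
rewrite (splitr d) -[f t](subrK (g t)) -addrA (le_trans (ler_normD _ _))// lerD//.
apply: (le_trans h1); rewrite ler_pdivrMr ?q0//.
move: h3; rewrite ler_pdivrMr// mulrC -/(q t); nra.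
Qed.

Let near_diff : \forall t \near U, (0 < N t)%N /\ forall i : 'I_(N t),
  `|e t i - r t i 0| <= (D + 1) / q t.
Proof.
apply: filterS2 N0 near_resid => t nt h; split=> // i.
by rewrite ler_pdivlMr ?q0// mulrC -{1}(gtr0_norm (q0 nt)) -normrM.
Qed.

Let D0 : 0 <= D.
Proof. exact: le_trans (normr_ge0 _) (aD 0%N). Qed.

Lemma resid_sqr_cvg (s2 : R) : fmean (fun j : 'I_(N t) => e t j ^+ 2) @[t --> U] --> s2 ->
  fmean (fun j => r t j 0 ^+ 2) @[t --> U] --> s2.
Proof.
move=> h; have D1 : 0 <= D + 1 by rewrite addr_ge0.
apply: (@cvg_close _ _ _ ((D + 1) * (2 + (D + 1) + 2 * (`|s2| + 1))) h).
apply: filterS3 near_diff (near_dist h ltr01) (sqrtN_unbounded Ny 1) => t [nt hd] hs q1.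
rewrite -fmeanB (le_trans (fmean_abs _))//.
have qt := q0 nt; have q1' : 1 <= q t by exact: q1.
have dq : (D + 1) / q t <= D + 1 by rewrite ler_pdivrMr// ler_peMr.
have dq0 : 0 <= (D + 1) / q t by rewrite divr_ge0// ltW.
apply: (@le_trans _ _ (fmean (fun j : 'I_(N t) => (D + 1) / q t * (2 + (D + 1)) +
    (D + 1) / q t * 2 * e t j ^+ 2))).
  apply: le_fmean => j; have := sqr_diff_bound (hd j) dq dq0.
  by rewrite [_ / _ * (2 + _ + _)]mulrDr [_ / _ * (2 * _)]mulrA.
rewrite fmeanD fmean_cst// fmeanZ -(mulrA _ 2) -mulrDr mulrAC ler_pM2r ?invr_gt0//.
rewrite ler_wpM2l// lerD2l ler_pM2l//.
by move: hs; rewrite ler_distl => /andP[_ /le_trans]; apply; rewrite lerD2r ler_norm.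
Qed.

Lemma resid_cube_bound (K4 : R) : (\forall t \near U, fmean (fun j : 'I_(N t) => e t j ^+ 4) <= K4) ->
  \forall t \near U, fmean (fun j => `|r t j 0| ^+ 3) <= 1 + 8 * (D + 1) ^+ 4 + 8 * K4.
Proof.
move=> h; have D1 : 0 <= D + 1 by rewrite addr_ge0.
apply: filterS3 near_diff h (sqrtN_unbounded Ny 1) => t [nt hd] hK q1.
have q1' : 1 <= q t by exact: q1.
have dq : (D + 1) / q t <= D + 1 by rewrite ler_pdivrMr ?q0// ler_peMr.
apply: (@le_trans _ _ (fmean (fun j : 'I_(N t) => 1 + 8 * (D + 1) ^+ 4 + 8 * e t j ^+ 4))).
  by apply: le_fmean => j; apply: cube_bound => //; exact: le_trans (hd j) dq.
by rewrite fmeanD fmean_cst// fmeanZ lerD2l ler_pM2l.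
Qed.

Variables (c mu : R).
Hypothesis c0 : 0 < c.
Hypothesis Gp : forall rho : R, 0 < rho -> exists K : R, \forall t \near U,
  forall z, K <= z -> window_count c t z <= rho * z ^+ 2.
Hypothesis Gm : forall rho : R, 0 < rho -> exists K : R, \forall t \near U,
  forall z, K <= z -> window_count (- c) t z <= rho * z ^+ 2.
Hypothesis emu : fmean (fun j : 'I_(N t) => e t j * ((e t j <= c)%R%:R - (e t j <= - c)%R%:R))
  @[t --> U] --> mu.

Lemma resid_truncated_cvg (s : T -> R) (s0 : R) : s t @[t --> U] --> s0 ->
  fmean (fun j => r t j 0 * ((r t j 0 <= c + s t / q t)%R%:R - (r t j 0 < - (c + s t / q t))%R%:R))
    @[t --> U] --> mu.
Proof.
move=> ss; have [K1 hK1] := Gp ltr01; have [K2 hK2] := Gm ltr01.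
pose K := Num.max (Num.max K1 K2) (`|s0| + 1 + (D + 1)).
have D1 : 0 <= D + 1 by rewrite addr_ge0.
have Kp : 0 <= K by rewrite !le_max addr_ge0 ?orbT.
apply: (@cvg_close _ _ _ (D + 1 + (c + 1) * K ^+ 2 + (c + 1) * K ^+ 2) emu).
apply: filterS3 (filterI near_diff near_resid) (filterI hK1 hK2)
  (filterI (near_dist ss ltr01) (sqrtN_unbounded Ny (Num.max K (2 * K / c)))) =>
  t [[nt hd] hr] [{}hK1 {}hK2] [hs].
rewrite ge_max => /andP[qK _]; have qt := q0 nt.
have sK : `|s t| + (D + 1) <= K.
  rewrite le_max; apply/orP; right; rewrite lerD2r.
  by rewrite -[X in `|X|](subrK s0) addrC (le_trans (ler_normD _ _))// lerD2l.
rewrite -fmeanB (le_trans (fmean_abs _))//.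
pose wi c1 (j : 'I_(N t)) : R := (`|e t j - c1| <= K / q t)%R%:R.
apply: (@le_trans _ _ (fmean (fun j : 'I_(N t) => (D + 1) / q t + (c + 1) * wi c j + (c + 1) * wi (- c) j))).
  apply: le_fmean => j.
  have w1 : K / q t <= 1 by rewrite ler_pdivrMr// mul1r.
  have mon c1 : `|e t j - c1| <= (`|s t| + (D + 1)) / q t -> `|e t j - c1| <= K / q t.
    by move=> /le_trans; apply; rewrite ler_pM2r ?invr_gt0.
  have wm c1 : (`|e t j - c1| <= (`|s t| + (D + 1)) / q t)%R%:R <= wi c1 j.
    by rewrite /wi ler_nat; case: leP => // /mon ->.
  apply: truncated_bound; first exact: hd.
  - by case: (r t j 0 <= _)%R; case: (r t j 0 < _)%R; rewrite ?subrr ?subr0 ?sub0r ?normrN ?normr1 ?normr0.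
  - exact: le_trans (indic_window _ _ qt (hr j)) (wm c).
  - rewrite opprD -mulNr; apply: le_trans (indic_window_lt _ _ qt (hr j)) _.
    by rewrite normrN.
  - by have := window_norm (e t j) c w1; rewrite (gtr0_norm c0).
  - by have := window_norm (e t j) (- c) w1; rewrite normrN (gtr0_norm c0).
rewrite !fmeanD fmean_cst// !fmeanZ.
have wE c1 : fmean (wi c1) = window_count c1 t K / q t.
  rewrite /window_count mulrAC -invfM -expr2 sqr_sqrtr ?ler0n//.
rewrite !wE; clear wE.
have c1 : 0 <= c + 1 by rewrite addr_ge0// ltW.
have hh1 : window_count c t K <= K ^+ 2 by rewrite -[K ^+ 2]mul1r; apply: hK1; rewrite !le_max lexx.
have hh2 : window_count (- c) t K <= K ^+ 2 by rewrite -[K ^+ 2]mul1r; apply: hK2; rewrite !le_max lexx orbT.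
move: hh1 hh2; move: (window_count c t K) (window_count (- c) t K) (K ^+ 2) => x1 x2 k2 hh1 hh2.
have -> : (D + 1) / q t + (c + 1) * (x1 / q t) + (c + 1) * (x2 / q t) =
  (D + 1 + (c + 1) * x1 + (c + 1) * x2) / q t by ring.
by rewrite ler_pM2r ?invr_gt0// !lerD// ler_wpM2l.
Qed.
End residual_limits.

(** * Expansion of the coverage along an ultrafilter *)

Section coverage_arithmetic.
Context {R : realType}.

(** The factor 1 / (1 - h) relates deleted and full residuals, with leverage h. *)
Lemma inv_one_minus_bound (h d k : R) : `|h| <= k -> k <= 2^-1 ->
  1 - h != 0 /\ `|d / (1 - h) - d| <= 2 * k * `|d|.
Proof.
move=> hk k2; have h1 : 2^-1 <= 1 - h.
  by move: (le_trans (ler_norm h) hk) => h1; lra.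
have h0 : 0 < 1 - h by lra.
split; first by rewrite gt_eqF.
have -> : d / (1 - h) - d = d * h / (1 - h) by field; rewrite gt_eqF.
rewrite !normrM normfV (gtr0_norm h0) ler_pdivrMr// mulrC -!mulrA [`|d| * _]mulrC !mulrA.
rewrite ler_wpM2r// (le_trans hk)//.
have k0 : 0 <= k by exact: le_trans hk.
by nra.
Qed.

(** A bounded fourth moment makes the largest of n errors small with respect to
    sqrt n, here q; K bounds the mean of the fourth powers. *)
Lemma fourth_root_bound (e K k q : R) : 0 < q -> 0 < k -> K <= k ^+ 4 * q ^+ 2 ->
  e ^+ 4 <= q ^+ 2 * K -> `|e| <= k * q.
Proof.
move=> q0 k0 hK he; rewrite leNgt; apply/negP => lt.
have : (k * q) ^+ 4 < `|e| ^+ 4 by rewrite ltrXn2r// ?nnegrE// mulr_ge0// ltW.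
have -> : `|e| ^+ 4 = e ^+ 4 by rewrite !(exprM _ 2 2) real_normK ?num_real.
move=> /lt_le_trans/(_ he); rewrite ltNge => /negP; apply.
have -> : (k * q) ^+ 4 = q ^+ 2 * (k ^+ 4 * q ^+ 2) by ring.
by rewrite ler_pM2l// exprn_gt0.
Qed.
Lemma resid_four_terms (q k mL L z th et Z e : R) : `|Z - et| <= k / 4 ->
  `|q * mL - Z| <= k / 4 -> `|q * (L - (e - z))| <= k / 4 -> `|q * z - th| <= k / 4 ->
  `|q * (e - (L - mL)) - (th + et)| <= k.
Proof.
have -> : q * (L - (e - z)) = q * L - q * e + q * z by ring.
have -> : q * (e - (L - mL)) = q * e - q * L + q * mL by ring.
move: (q * mL) (q * L) (q * e) (q * z) => a1 a2 a3 a4.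
rewrite !ler_norml => /andP[? ?] /andP[? ?] /andP[? ?] /andP[? ?].
by apply/andP; split; lra.
Qed.
Lemma derive_expansion (F : R -> R) (a f k : R) : derivable F a 1 -> derive1 F a = f -> 0 < k ->
  exists2 d, 0 < d & forall h, `|h| <= d -> `|F (a + h) - F a - f * h| <= k * `|h|.
Proof.
move=> dF fE k0; have := dF; rewrite /derivable => /cvg_ex[l hl].
have lE : l = f by rewrite -fE derive1E; apply/esym/cvg_lim.
move: hl; rewrite {}lE => /cvgrPdist_le/(_ k k0); rewrite near_withinE => /nbhs_ballP[d /= d0 hd].
exists (d / 2); first by rewrite divr_gt0.
move=> h hh; have [->|h0] := eqVneq h 0; first by rewrite addr0 mulr0 subrr subr0 normr0 mulr0.
have bh : ball 0 d h by rewrite /ball /= sub0r normrN (le_lt_trans hh)// ltr_pdivrMr// ltr_pMr// ltr1n.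
have := hd h bh h0; rewrite /= [_ *: 1]mulr1 [h + a]addrC.
have -> : F (a + h) - F a - f * h = - (h * (f - h^-1 *: (F (a + h) - F a))).
  by rewrite /GRing.scale/=; field.
by move=> hk; rewrite normrN normrM [leRHS]mulrC; apply: ler_wpM2l.
Qed.

(** The slope f1 + f2 of the coverage cancels the slope of the quantile, leaving
    Q minus the random intercepts. *)
Lemma final_cancel (f1 f2 s z w m Q : R) : (f1 + f2) * s = Q - (w + (f1 - f2) * m) ->
  f1 * (s + z) - f2 * (z - s) - (Q + ((f1 - f2) * (z - m) - w)) = 0.
Proof. move=> h; have -> : Q = (f1 + f2) * s + (w + (f1 - f2) * m) by rewrite h; ring.
ring. Qed.
End coverage_arithmetic.

Section coverage_limit.
Context {R : realType}.
Variables (p : nat) (x : nat -> 'cV[R]_p) (A : 'M[R]_p) (b : 'cV[R]_p) (M : R).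
Hypothesis uX : forall n, (p <= n)%N -> (design x n)^T *m design x n \in unitmx.
Hypothesis uA : A \in unitmx.
Hypothesis XA : n%:R^-1 *: ((design x n)^T *m design x n) @[n --> \oo] --> A.
Hypothesis xb : n%:R^-1 *: (\sum_(i < n) x i) @[n --> \oo] --> b.
Hypothesis xM : forall i, norm2 (x i) <= M.
Variables (xf beta : 'cV[R]_p).
Hypothesis xfM : norm2 xf <= M.

Context (T : Type) (U : set_system T) {UU : UltraFilter U}.
Variables (N : T -> nat) (e : T -> nat -> R).
Let q t : R := Num.sqrt (N t)%:R.
Let near_dist := @cvgR_near R T U _.
Let E t : 'cV[R]_(N t) := \col_(i < N t) e t i.
Let X t := design x (N t).
Let y t := X t *m beta + E t.

Hypothesis Ny : forall m, \forall t \near U, (m <= N t)%N.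

Variables (K4 m0 : R) (xi0 : 'cV[R]_p).
Hypothesis e4 : \forall t \near U, fmean (fun j : 'I_(N t) => e t j ^+ 4) <= K4.
Hypothesis em : (q t)^-1 * \sum_(i < N t) e t i @[t --> U] --> m0.
Hypothesis exi : forall j, (q t)^-1 * \sum_(i < N t) x i j 0 * e t i @[t --> U] --> (xi0 j 0 : R).

Let N0 : \forall t \near U, (0 < N t)%N. Proof. exact: Ny. Qed.
Let q0 t : (0 < N t)%N -> 0 < q t. Proof. by move=> n0; rewrite sqrtr_gt0 ltr0n. Qed.
Let q_sqr t : q t ^+ 2 = (N t)%:R. Proof. by rewrite sqr_sqrtr// ler0n. Qed.
Let qV t : (0 < N t)%N -> q t * (N t)%:R^-1 = (q t)^-1.
Proof. by move=> nt; rewrite -q_sqr expr2 invfM mulrA mulfV ?mul1r// gt_eqF// q0. Qed.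

Lemma near_size (Q : nat -> Prop) : (\forall n \near \oo, Q n) -> \forall t \near U, Q (N t).
Proof. by move=> [m _ mQ]; apply: filterS (Ny m) => t; exact: mQ. Qed.

Lemma cvg_size (f : nat -> R) (l : R) : f n @[n --> \oo] --> l -> f (N t) @[t --> U] --> l.
Proof.
move=> /cvgRP fl; apply/cvgRP => k k0; apply: (near_size (Q := fun n => `|f n - l| <= k)).
exact: fl.
Qed.

Let theta0 := invmx A *m xi0.
Let zeta t := ols (X t) (E t).

Lemma scaled_ols_cvg j : q t * zeta t j 0 @[t --> U] --> (theta0 j 0 : R).
Proof.
have h i k : ((N t)%:R *: invmx (gram x (N t))) i k @[t --> U] --> (invmx A i k : R).
  exact: (cvg_size (@cvg_scaled_inv R p x A uX uA XA i k)).
have hs : \sum_k ((N t)%:R *: invmx (gram x (N t))) j k *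
    ((q t)^-1 * \sum_(i < N t) x i k 0 * e t i) @[t --> U] --> \sum_k invmx A j k * xi0 k 0.
  by apply: cvg_sumR => k _; apply: cvgM; [exact: h|exact: exi].
rewrite /theta0 mxE; apply: cvgR_near_eq hs; apply: filterS N0 => t nt.
rewrite /zeta /ols -mulmxA mxE mulr_sumr; apply: eq_bigr => k _.
rewrite mxE -q_sqr design_mul_tr summxE.
have -> : \sum_(i < N t) (E t i 0 *: x i) k 0 = \sum_(i < N t) x i k 0 * e t i.
  by apply: eq_bigr => i _; rewrite !mxE mulrC.
by rewrite mulrACA expr2 mulfK ?gt_eqF ?q0// mulrA.
Qed.

Let D t (i : nat) := e t i - dot (x i) (zeta t).

Lemma row_design n (i : 'I_n) : row i (design x n) = (x i)^T.
Proof. by apply/rowP => j; rewrite !mxE. Qed.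

Lemma loo_model t (i : 'I_(N t)) : gram x (N t) \in unitmx ->
  1 - dot (x i) (invmx (gram x (N t)) *m x i) != 0 ->
  loo_resid (X t) (y t) i 0 = D t i / (1 - dot (x i) (invmx (gram x (N t)) *m x i)).
Proof.
move=> u h1; have hE : (row i (X t) *m invmx ((X t)^T *m X t) *m (row i (X t))^T) 0 0 =
    dot (x i) (invmx (gram x (N t)) *m x i).
  by rewrite row_design trmxK -mulmxA.
rewrite (loo_residE (y t) u) hE; last by move: h1; rewrite subr_eq0 eq_sym.
congr (_ / _); rewrite row_design /y ols_model// mulmxDr.
rewrite mxE [in RHS]/D -/(zeta t) [X in _ - X]mxE -/(dot _ _).
have -> : (X t *m beta) i 0 = ((x i)^T *m beta) 0 0.
  by rewrite !mxE; apply: eq_bigr => k _; rewrite !mxE.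
by rewrite [E t i 0]mxE opprD addrACA subrr add0r.
Qed.

Lemma dot_bound (i : nat) (v : 'cV[R]_p) : `|dot (x i) v| <= M * \sum_j `|v j 0|.
Proof.
rewrite dotE mulr_sumr (le_trans (ler_norm_sum _ _ _))//; apply: ler_sum => j _.
by rewrite normrM ler_wpM2r// (le_trans (norm2_coord _ _) (xM i)).
Qed.

Lemma scaled_ols_sum_cvg : \sum_j `|q t * zeta t j 0 - theta0 j 0| @[t --> U] --> (0 : R).
Proof.
suff : \sum_j `|q t * zeta t j 0 - theta0 j 0| @[t --> U] --> \sum_(j < p) (0 : R) by rewrite big1_eq.
apply: cvg_sumR => j _; apply/cvgRP => k k0.
apply: filterS (near_dist (@scaled_ols_cvg j) k0) => t.
by rewrite subr0 normr_id.
Qed.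

Lemma scaled_fit_cvg (k : R) : 0 < k ->
  \forall t \near U, forall i, `|q t * dot (x i) (zeta t) - dot (x i) theta0| <= k.
Proof.
move=> k0; have M1 : 0 < `|M| + 1 by rewrite ltr_wpDl.
have k1 : 0 < k / (`|M| + 1) by rewrite divr_gt0.
apply: filterS (near_dist scaled_ols_sum_cvg k1) => t h i.
have -> : q t * dot (x i) (zeta t) - dot (x i) theta0 = dot (x i) (q t *: zeta t - theta0).
  by rewrite /dot mulmxBr -scalemxAr !mxE.
rewrite (le_trans (dot_bound _ _))//.
have S0 : 0 <= \sum_j `|q t * zeta t j 0 - theta0 j 0| by apply: sumr_ge0.
move: h; rewrite subr0 ger0_norm// ler_pdivlMr// mulrC; apply: le_trans.
have -> : \sum_j `|(q t *: zeta t - theta0) j 0| = \sum_j `|q t * zeta t j 0 - theta0 j 0|.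
  by apply: eq_bigr => j _; rewrite !mxE.
by rewrite ler_wpM2r// (le_trans (ler_norm _))// lerDl.
Qed.

(** The leverages have order 1 / n and no error exceeds o(sqrt n), so leaving
    one observation out is invisible at scale 1 / sqrt n. *)
Lemma loo_close (k : R) : 0 < k ->
  \forall t \near U, forall i : 'I_(N t), q t * `|loo_resid (X t) (y t) i 0 - D t i| <= k.
Proof.
move=> k0; have [C0 hC0] := inv_gram_bound uX uA XA M.
pose C := `|C0| + 1; have Cp : 0 < C by rewrite ltr_wpDl.
pose k1 := k / (4 * C); have k1p : 0 < k1 by rewrite divr_gt0// mulr_gt0.
pose B := M * \sum_j `|theta0 j 0| + 1.
have big (Z : R) : \forall t \near U, Z <= q t by exact: (sqrtN_unbounded Ny).
have bigN (Z : R) : \forall t \near U, Z <= (N t)%:R.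
  by apply: filterS2 (big Z) (big 1) => t h1 h2; rewrite -q_sqr expr2 (le_trans h1)// ler_peMr ?sqrtr_ge0.
have hG := near_size hC0; have hu := near_size (near_gram_unit uX).
apply: filterS3 (filterI (filterI N0 e4) (filterI hG hu)) (filterI (scaled_fit_cvg ltr01) (bigN (2 * C)))
  (filterI (bigN (K4 / k1 ^+ 4)) (bigN (B / k1))) => t [[nt h4] [{}hG [_ {}hu]]] [hfit n2] [n4 nB] i.
have qt := q0 nt; have n0 : (0 : R) < (N t)%:R by rewrite ltr0n.
have [||h1 h2] := @inv_one_minus_bound R (dot (x i) (invmx (gram x (N t)) *m x i)) (D t i) (C / (N t)%:R).
- apply: (le_trans (hG _ _ (xM i) (xM i))); rewrite ler_pM2r ?invr_gt0//.
  by rewrite (le_trans (ler_norm _))// lerDl.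
- by rewrite ler_pdivrMr// mulrC ler_pdivlMr// mulrC.
rewrite loo_model//.
have eb : `|e t i| <= k1 * q t.
  apply: (@fourth_root_bound _ _ K4) => //.
    by rewrite q_sqr mulrC -ler_pdivrMr// exprn_gt0.
  rewrite q_sqr mulrC -ler_pdivrMr// mulrC (le_trans _ h4)//.
  rewrite /fmean ler_pM2l ?invr_gt0// (bigD1 i)//= lerDl sumr_ge0// => j _.
  by rewrite (exprM _ 2 2) sqr_ge0.
have zb : `|dot (x i) (zeta t)| <= k1 * q t.
  have : q t * `|dot (x i) (zeta t)| <= B.
    rewrite -{1}(gtr0_norm qt) -normrM.
    rewrite -[X in `|X|](subrK (dot (x i) theta0)) (le_trans (ler_normD _ _))// addrC.
    by rewrite lerD// dot_bound.
  move: nB; rewrite ler_pdivrMr// -q_sqr => h3 /le_trans/(_ h3).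
  by rewrite expr2 -mulrA ler_pM2l// mulrC.
have Db : `|D t i| <= 2 * (k1 * q t).
  by rewrite (le_trans (ler_normB _ _))// mulr_natl mulr2n lerD.
apply: (@le_trans _ _ (q t * (2 * (C / (N t)%:R) * (2 * (k1 * q t))))).
  rewrite ler_pM2l// (le_trans h2)// ler_wpM2l// mulr_ge0// divr_ge0// ltW//.
rewrite -q_sqr /k1 le_eqVlt; apply/orP; left; apply/eqP; field.
by rewrite !gt_eqF.
Qed.

Let eta0 := m0 - dot b theta0.

Lemma scaled_mean_fit_cvg : (q t)^-1 * \sum_(i < N t) dot (x i) (zeta t) @[t --> U] --> (dot b theta0 : R).
Proof.
have h j : (n%:R^-1 *: \sum_(k < n) x k) j 0 @[n --> \oo] --> (b j 0 : R).
  by apply: (cvg_comp _ (fun C : 'cV[R]_p => C j 0) xb); exact: coord_continuous.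
have hs : \sum_j (((N t)%:R^-1 *: \sum_(k < N t) x k) j 0 * (q t * zeta t j 0)) @[t --> U] -->
    \sum_j b j 0 * theta0 j 0.
  apply: cvg_sumR => j _; apply: cvgM; last exact: scaled_ols_cvg.
  exact: (cvg_size (@h j)).
rewrite dotE; apply: cvgR_near_eq hs; apply: filterS N0 => t nt.
rewrite -qV// -mulrA; under [in RHS]eq_bigr do rewrite dotE.
rewrite exchange_big/= mulrA mulr_sumr; apply: eq_bigr => j _.
by rewrite mxE summxE -mulr_suml; ring.
Qed.

(** The centring of the residuals brings in the mean of the errors and the mean
    of the fitted increments, hence the constant added to the linear term. *)
Lemma resid_expansion (k : R) : 0 < k ->
  \forall t \near U, forall i : 'I_(N t),
    `|q t * (e t i - pred_resid (X t) (y t) i 0) - (dot (x i) theta0 + eta0)| <= k.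
Proof.
move=> k0; have k4 : 0 < k / 4 by rewrite divr_gt0.
have hm : (q t)^-1 * \sum_(i < N t) e t i - (q t)^-1 * \sum_(i < N t) dot (x i) (zeta t) @[t --> U] --> eta0.
  by apply: cvgB; [exact: em|exact: scaled_mean_fit_cvg].
apply: filterS3 (filterI N0 (loo_close k4)) (scaled_fit_cvg k4) (near_dist hm k4) => t [nt h1] h2 h3 i.
have qt := q0 nt.
pose L := loo_resid (X t) (y t).
have mL : `|q t * mean L - ((q t)^-1 * \sum_(i < N t) e t i - (q t)^-1 * \sum_(i < N t) dot (x i) (zeta t))| <= k / 4.
  rewrite -mulrBr -sumrB -qV// /mean -mulrA -mulrBr -mulrBr -sumrB.
  rewrite normrM (gtr0_norm qt) -(fmean_cst nt (k / 4)).
  rewrite -/(fmean (fun i : 'I_(N t) => L i 0 - D t i)).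
  apply: (@le_trans _ _ (q t * fmean (fun i : 'I_(N t) => `|L i 0 - D t i|))).
    by rewrite ler_pM2l// fmean_abs.
  by rewrite -fmeanZ; apply: le_fmean => j; exact: h1.
have := h1 i; rewrite -{1}(gtr0_norm qt) -normrM -/L => {}h1.
have := h2 i; rewrite mxE -/L -/(mean L); move: h3 mL h1; rewrite /D.
move: (mean L) (L i 0) (dot (x i) (zeta t)) (dot (x i) theta0) eta0 ((q t)^-1 * _ - _) => mL Li z th et Z.
exact: resid_four_terms.
Qed.

Variables (F : R -> R) (c alpha s2 mu w1 w2 : R).
Let f1 := derive1 F c.
Let f2 := derive1 F (- c).
Hypotheses (c0 : 0 < c) (f10 : 0 < f1) (f20 : 0 < f2).
Hypotheses (dF1 : derivable F c 1) (dF2 : derivable F (- c) 1).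
Hypothesis Fc : F c - F (- c) = 1 - alpha.
Hypothesis e2 : fmean (fun j : 'I_(N t) => e t j ^+ 2) @[t --> U] --> s2.
Hypothesis emu : fmean (fun j : 'I_(N t) => e t j * ((e t j <= c)%R%:R - (e t j <= - c)%R%:R))
  @[t --> U] --> mu.
Let W t a := (q t)^-1 * \sum_(i < N t) ((e t i <= a)%R%:R - F a).
Hypothesis W1 : W t c @[t --> U] --> w1.
Hypothesis W2 : W t (- c) @[t --> U] --> w2.
Let J t a (th : 'cV[R]_p) (et : R) := (q t)^-1 *
  \sum_(i < N t) ((e t i <= a + (dot (x i) th + et) / q t)%R%:R - (e t i <= a)%R%:R).
Hypothesis J1 : forall th et, J t c th et @[t --> U] --> f1 * (dot b th + et).
Hypothesis J2 : forall th et, J t (- c) th et @[t --> U] --> f2 * (dot b th + et).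
Hypothesis G1 : forall rho : R, 0 < rho -> exists K : R, \forall t \near U,
  forall z, K <= z -> window_count N e c t z <= rho * z ^+ 2.
Hypothesis G2 : forall rho : R, 0 < rho -> exists K : R, \forall t \near U,
  forall z, K <= z -> window_count N e (- c) t z <= rho * z ^+ 2.

Lemma scaled_increment_cvg a f (s : T -> R) (s0 : R) : derivable F a 1 -> derive1 F a = f ->
  s t @[t --> U] --> s0 -> q t * (F (a + s t / q t) - F a) @[t --> U] --> f * s0.
Proof.
move=> dF fE ss; have fs : f * s t @[t --> U] --> f * s0 by apply: cvgM => //; exact: cvg_cst.
apply/cvgRP => k k0; have k2 : 0 < k / 2 by rewrite divr_gt0.
have S0 : 0 < `|s0| + 1 by rewrite ltr_wpDl.
have k3 : 0 < k / 2 / (`|s0| + 1) by rewrite divr_gt0.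
have [d d0 hd] := derive_expansion dF fE k3.
have sq : s t / q t @[t --> U] --> (0 : R) by exact: cvg_div_sqrtN ss.
apply: filterS3 (filterI N0 (near_dist ss ltr01)) (near_dist fs k2) (near_dist sq d0) => t [nt h1] h2.
have qt := q0 nt; rewrite subr0 => /hd h3.
rewrite (splitr k) -[X in `|X - _|](subrK (f * s t)) -addrA (le_trans (ler_normD _ _))// lerD//.
have -> : q t * (F (a + s t / q t) - F a) - f * s t = q t * (F (a + s t / q t) - F a - f * (s t / q t)).
  by field; rewrite gt_eqF.
rewrite normrM (gtr0_norm qt); rewrite -(ler_pM2l qt) in h3; apply: (le_trans h3).
rewrite normrM normfV (gtr0_norm qt) mulrCA [q t * _]mulrC divfK ?gt_eqF//.
rewrite mulrAC ler_pdivrMr// ler_pM2l//.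
by rewrite -[s t](subrK s0) addrC (le_trans (ler_normD _ _))// lerD2l.
Qed.

Let v1 := dot xf (invmx A *m xf).
Let v2 := dot xf (invmx A *m b).
Let g := f1 - f2.
Let V := g ^+ 2 * s2 * (v1 + 1 - 2 * v2) - 2 * g * mu * (v2 - 1) + (1 - alpha) * alpha.
Hypothesis V0 : 0 < V.
Let cw t i := pred_weight x xf (N t) i.

(** The linear statistic that carries the fluctuation of the conditional
    coverage. *)
Definition coverage_score t : R := \sum_(i < N t) (g * (q t * cw t i - (q t)^-1) * e t i -
  (q t)^-1 * (((e t i <= c)%R%:R - F c) - ((e t i <= - c)%R%:R - F (- c)))).

Lemma coverage_scoreE t : coverage_score t =
  g * (q t * dot xf (zeta t) - (q t)^-1 * \sum_(i < N t) e t i) - (W t c - W t (- c)).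
Proof.
rewrite /coverage_score sumrB; congr (_ - _); last first.
  by rewrite /W -mulrBr -sumrB mulr_sumr.
rewrite /zeta dot_ols !mulr_sumr -sumrB mulr_sumr; apply: eq_bigr => i _.
have -> : E t i 0 = e t i by rewrite mxE.
by rewrite /cw; move: (pred_weight _ _ _ _) (q t) ((q t)^-1) (e t i) g => a1 a2 a3 a4 a5; ring.
Qed.

(** Both ends of the interval are expanded to first order; substituting the
    limit of the scaled half-width turns the random intercepts into the score. *)
Theorem coverage_expansion (gam0 Q : R) : gcdf (V / gauss_m2) Q = 1 - gam0 ->
  exists C : T -> R, (\forall t \near U, 0 < C t /\ Cstar (X t) xf (y t) (1 - alpha) (1 - gam0) = (C t)%:E) /\
    q t * (F (dot xf (zeta t) + C t) - F (dot xf (zeta t) - C t) - (1 - alpha)) - (Q + coverage_score t)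
      @[t --> U] --> (0 : R) /\
    F (dot xf (zeta t) + C t) - F (dot xf (zeta t) - C t) - (1 - alpha) @[t --> U] --> (0 : R).
Proof.
move=> QE; pose a i := dot (x i) theta0 + eta0.
have aD i : `|a i| <= M * \sum_j `|theta0 j 0| + `|eta0|.
  by rewrite (le_trans (ler_normD _ _))// lerD2r dot_bound.
have bm : dot b theta0 + eta0 = m0 by rewrite addrC subrK.
have Ja (J' : forall th et, J t c th et @[t --> U] --> f1 * (dot b th + et)) et :
    (q t)^-1 * \sum_(i < N t) ((e t i <= c + (a i + et) / q t)%R%:R - (e t i <= c)%R%:R)
    @[t --> U] --> f1 * (m0 + et).
  rewrite -bm -addrA; apply: cvg_trans (J' theta0 (eta0 + et)); apply: near_eq_cvg.
  by apply: filterS N0 => t _; rewrite /J; congr (_ * _); apply: eq_bigr => i _; rewrite addrA.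
have Jb et :
    (q t)^-1 * \sum_(i < N t) ((e t i <= - c + (a i + et) / q t)%R%:R - (e t i <= - c)%R%:R)
    @[t --> U] --> f2 * (m0 + et).
  rewrite -bm -addrA; apply: cvg_trans (@J2 theta0 (eta0 + et)); apply: near_eq_cvg.
  by apply: filterS N0 => t _; rewrite /J; congr (_ * _); apply: eq_bigr => i _; rewrite addrA.
pose r t := pred_resid (X t) (y t).
have ra : forall k : R, 0 < k -> \forall t \near U, forall i : 'I_(N t), `|q t * (e t i - r t i 0) - a i| <= k.
  exact: resid_expansion.
have P1 := window_affine_limit (UU := UU) Ny ra aD W1 (Ja J1) G1.
have P2 := window_affine_limit (UU := UU) Ny ra aD W2 Jb G2.
have r2 := resid_sqr_cvg (UU := UU) Ny ra aD e2.
have r3 := resid_cube_bound (UU := UU) Ny ra aD e4.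
have rmu := resid_truncated_cvg (UU := UU) Ny ra aD c0 G1 G2 emu.
have [Cw hCw] := pred_weight_bound uX uA XA xM xfM.
have cwB : \forall t \near U, forall i, (i < N t)%N -> `|cw t i| <= Cw / (N t)%:R.
  by apply: filterS (near_size hCw) => t ht i _; exact: ht.
have cw2 : (N t)%:R * \sum_(i < N t) cw t i ^+ 2 @[t --> U] --> v1.
  exact: (cvg_size (@cvg_sum_weight_sqr _ _ _ _ uX uA XA xf)).
have cw1 : \sum_(i < N t) cw t i @[t --> U] --> v2.
  exact: (cvg_size (@cvg_sum_weight _ _ _ _ _ uX uA XA xb xf)).
have ut : \forall t \near U, (X t)^T *m X t \in unitmx.
  by apply: filterS (near_size (near_gram_unit uX)) => t [].
have cwE t (u : 'cV[R]_(N t)) : dot xf (ols (X t) u) = \sum_(i < N t) cw t i * u i 0 by exact: dot_ols.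
have [s ss hs] := Cstar_cvg Ny ut cwE P1 P2 c0 f10 f20 Fc r2 cw2 cw1 cwB r3 rmu V0 QE.
exists (fun t => c + s t / q t); split.
  have c2 : 0 < c / 2 by rewrite divr_gt0.
  apply: filterS2 hs (near_dist (cvg_div_sqrtN Ny ss) c2) => t -> h; split=> //.
  move: h; rewrite subr0 ler_norml => /andP[h _]; rewrite -ltrBlDl sub0r (lt_le_trans _ h)//.
  by rewrite ltrN2 ltr_pdivrMr// ltr_pMr// ltr1n.
have z0 : q t * dot xf (zeta t) @[t --> U] --> (dot xf theta0 : R).
  rewrite dotE; have : \sum_j xf j 0 * (q t * zeta t j 0) @[t --> U] --> \sum_j xf j 0 * theta0 j 0.
    by apply: cvg_sumR => j _; apply: cvgM; [exact: cvg_cst|exact: scaled_ols_cvg].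
  apply: cvgR_near_eq; apply: filterS N0 => t nt.
  by rewrite dotE mulr_sumr; apply: eq_bigr => j _; rewrite mulrCA.
set s0 := (_ / _) in ss.
have ssz : s t + q t * dot xf (zeta t) @[t --> U] --> s0 + dot xf theta0 by exact: cvgD.
have szs : q t * dot xf (zeta t) - s t @[t --> U] --> dot xf theta0 - s0 by exact: cvgB.
have I1 := scaled_increment_cvg dF1 erefl ssz.
have I2 := scaled_increment_cvg dF2 erefl szs.
have Sc : coverage_score t @[t --> U] --> g * (dot xf theta0 - m0) - (w1 - w2).
  have : g * (q t * dot xf (zeta t) - (q t)^-1 * \sum_(i < N t) e t i) - (W t c - W t (- c))
      @[t --> U] --> g * (dot xf theta0 - m0) - (w1 - w2).
    apply: cvgB; last by apply: cvgB; [exact: W1|exact: W2].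
    by apply: cvgM; [exact: cvg_cst|apply: cvgB; [exact: z0|exact: em]].
  by apply: cvgR_near_eq; apply: filterS N0 => t _; rewrite coverage_scoreE.
have Qc : (fun _ : T => Q) t @[t --> U] --> Q by exact: cvg_cst.
have s0E : (f1 + f2) * s0 = Q - ((w1 - w2) + (f1 - f2) * m0).
  rewrite /s0 mulrC divfK ?gt_eqF ?addr_gt0//; ring.
have I3 : q t * (F (dot xf (zeta t) + (c + s t / q t)) - F (dot xf (zeta t) - (c + s t / q t)) - (1 - alpha))
    @[t --> U] --> f1 * (s0 + dot xf theta0) - f2 * (dot xf theta0 - s0).
  apply: cvgR_near_eq (cvgB I1 I2); apply: filterS N0 => t nt; have qt := q0 nt.
  rewrite -[LHS]/(q t * (F (c + (s t + q t * dot xf (zeta t)) / q t) - F c) -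
    q t * (F (- c + (q t * dot xf (zeta t) - s t) / q t) - F (- c))).
  have -> : c + (s t + q t * dot xf (zeta t)) / q t = dot xf (zeta t) + (c + s t / q t).
    by field; rewrite gt_eqF.
  have -> : - c + (q t * dot xf (zeta t) - s t) / q t = dot xf (zeta t) - (c + s t / q t).
    by field; rewrite gt_eqF.
  by rewrite -Fc; ring.
split.
  rewrite -(final_cancel (dot xf theta0) s0E).
  by apply: cvgR_near_eq (cvgB I3 (cvgD Qc Sc)); apply: filterS N0 => t nt.
apply: cvgR_near_eq (cvg_div_sqrtN Ny I3); apply: filterS N0 => t nt.
by rewrite mulrC mulKf// gt_eqF// q0.
Qed.
End coverage_limit.

(** * Independence and product measures *)

Section independent_maps.
Context {R : realType} {d d1 d2 : measure_display} {Omega : measurableType d}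
  {T1 : measurableType d1} {T2 : measurableType d2} (P : probability Omega R).

Definition indep_maps (X : Omega -> T1) (Y : Omega -> T2) : Prop := forall A B,
  measurable A -> measurable B -> P (X @^-1` A `&` Y @^-1` B) = (P (X @^-1` A) * P (Y @^-1` B))%E.

(** The joint law of independent maps is the product of their laws; the integral
    becomes iterated by Fubini. *)
Lemma ge0_integral_indep (X : Omega -> T1) (Y : Omega -> T2) (Phi : T1 * T2 -> \bar R) :
  measurable_fun setT X -> measurable_fun setT Y -> indep_maps X Y ->
  measurable_fun setT Phi -> (forall z, 0 <= Phi z)%E ->
  (\int[P]_w Phi (X w, Y w) = \int[P]_w1 \int[P]_w2 Phi (X w1, Y w2))%E.
Proof.
move=> mX mY XY mPhi Phi0.
pose X' : {mfun Omega >-> T1} := HB.pack X (isMeasurableFun.Build _ _ _ _ _ mX).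
pose Y' : {mfun Omega >-> T2} := HB.pack Y (isMeasurableFun.Build _ _ _ _ _ mY).
have mZ : measurable_fun setT (fun w => (X w, Y w)) by exact: measurable_fun_pair.
pose Z' : {mfun Omega >-> (T1 * T2)%type} := HB.pack (fun w => (X w, Y w)) (isMeasurableFun.Build _ _ _ _ _ mZ).
have eqm (W : set (T1 * T2)) : measurable W -> (distribution P X' \x distribution P Y')%E W = distribution P Z' W.
  move=> mW; apply: product_measure_unique => // A B mA mB; exact: XY.
transitivity (\int[distribution P Z']_z Phi z)%E.
  by rewrite ge0_integral_pushforward// => y _.
transitivity (\int[distribution P X' \x distribution P Y']_z Phi z)%E.
  by apply: eq_measure_integral => W mW _; exact/esym/eqm.
rewrite fubini_tonelli1//.
have h := measurable_fun_fubini_tonelli_F (m2 := distribution P Y') Phi mPhi Phi0.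
rewrite (@ge0_integral_pushforward _ _ _ _ _ _ mX P setT)//; last first.
  by move=> x _; apply: integral_ge0 => y _.
apply: eq_integral => w1 _ /=; rewrite /fubini_F.
rewrite (@ge0_integral_pushforward _ _ _ _ _ _ mY P setT)//.
exact: (measurableT_comp mPhi (measurable_pair1 _)).
Qed.
End independent_maps.

Section pi_systems.
Context {R : realType} {d : measure_display} {Omega : measurableType d} (P : probability Omega R).

(** Independence of two pi-systems extends to the sigma-algebras they generate,
    one system at a time. *)
Lemma indep_pi_left (G : set (set Omega)) (B : set Omega) :
  G `<=` measurable -> setI_closed G -> G setT -> measurable B ->
  (forall A, G A -> P (A `&` B) = (P A * P B)%E) ->
  forall A, <<s G >> A -> P (A `&` B) = (P A * P B)%E.
Proof.
move=> Gm GI GT mB h A sA.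
have mu2 : (0 <= fine (P B)) by apply: fine_ge0.
pose c : {nonneg R} := NngNum mu2.
have := @g_sigma_algebra_measure_unique _ _ _ G Gm (fun _ => setT) (fun _ => GT) _ (mrestr P mB) (mscale c P) GI.
have cov : \bigcup_(k : nat) (fun _ : nat => [set: Omega]) k = setT.
  by apply/seteqP; split=> // w _; exists 0%N.
have cE D : mscale c P D = (P D * P B)%E.
  by rewrite /mscale /= fineK ?fin_num_measure// muleC.
move=> /(_ cov) H; apply: etrans (H _ _ A sA) (cE A).
- by move=> D GD; apply: etrans (h D GD) (esym (cE D)).
- move=> k; have : (P (setT `&` B) < +oo)%E by rewrite setTI (le_lt_trans (probability_le1 P mB))// ltry.
  exact.
Qed.
End pi_systems.

Section iid_sequence.
Context {R : realType} {d : measure_display} {Omega : measurableType d} (P : probability Omega R).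
Variable eps : nat -> {RV P >-> R}.
Hypothesis eps_indep : mutual_indep P (fun i => eps i : Omega -> R).
Hypothesis eps_ident : forall i (B : set R), measurable B ->
  distribution P (eps i) B = distribution P (eps 0%N) B.

Let nu := distribution P (eps 0%N).

Lemma iota_set m : `I_m = [set` iota 0 m].
Proof. by apply/seteqP; split=> j /=; rewrite mem_iota add0n. Qed.

Definition past_cylinders (k : nat) : set (set Omega) := [set A | exists2 B : nat -> set R,
  forall i, measurable (B i) & A = \bigcap_(i in `I_k) (eps i @^-1` B i)].

Definition past k := g_sigma_algebraType (past_cylinders k).

Lemma past_cylinders_measurable k : past_cylinders k `<=` measurable.
Proof.
move=> _ [B mB ->]; apply: fin_bigcap_measurable => // i _.
by rewrite -[X in measurable X]setTI; exact: measurable_funP.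
Qed.

Lemma past_cylindersI k : setI_closed (past_cylinders k).
Proof.
move=> _ _ [B mB ->] [C mC ->]; exists (fun i => B i `&` C i) => [i|]; first exact: measurableI.
by rewrite bigcapI.
Qed.

Lemma past_cylindersT k : past_cylinders k setT.
Proof. by exists (fun _ => setT) => //; rewrite bigcapT. Qed.

Lemma past_measurable k i : (i < k)%N ->
  measurable_fun (setT : set (past k)) (eps i : past k -> R).
Proof.
move=> ik _ B mB; rewrite setTI; apply: sub_sigma_algebra.
exists (fun j => if j == i then B else setT) => [j|]; first by case: ifP.
apply/seteqP; split=> [w Bw j _ /=|w /(_ i)].
  by case: ifP => // /eqP ->.
by rewrite /= eqxx; exact.
Qed.

Lemma past_indep k d1 (T1 : measurableType d1) (S : Omega -> T1) :
  measurable_fun (setT : set (past k)) (S : past k -> T1) -> indep_maps P S (eps k : Omega -> R).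
Proof.
move=> mS A B mA mB.
have mEB : measurable (eps k @^-1` B).
  by rewrite -[X in measurable X]setTI; exact: measurable_funP.
apply: (indep_pi_left (G := past_cylinders k)) => //.
- exact: past_cylinders_measurable.
- exact: past_cylindersI.
- exact: past_cylindersT.
- move=> _ [C mC ->].
  pose D i := if (i < k)%N then C i else B.
  have mD i : measurable (D i) by rewrite /D; case: ifP.
  have cap : \bigcap_(i in `I_k) (eps i @^-1` C i) = \bigcap_(i in `I_k) (eps i @^-1` D i).
    by apply: eq_bigcapr => i /= ik; rewrite /D ik.
  have Dk : D k = B by rewrite /D ltnn.
  rewrite cap -Dk.
  have -> : \bigcap_(i in `I_k) (eps i @^-1` D i) `&` eps k @^-1` D k =
      \bigcap_(i in `I_k.+1) (eps i @^-1` D i).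
    apply/seteqP; split=> [w [h1 h2] i|w h].
      by rewrite /= ltnS leq_eqVlt => /orP[/eqP -> //|ik]; exact: h1.
    split; last by apply: h; rewrite /= ltnSn.
    by move=> i /= ik; apply: h; rewrite /= ltnS ltnW.
  rewrite !iota_set !eps_indep ?iota_uniq//.
  by rewrite -addn1 iotaD big_cat/= big_seq1.
- by have := mS measurableT A mA; rewrite setTI.
Qed.

Lemma law_ge0 i (phi : R -> \bar R) : measurable_fun setT phi -> (forall t, 0 <= phi t)%E ->
  (\int[P]_w phi (eps i w) = \int[nu]_t phi t)%E.
Proof.
move=> mphi phi0; transitivity (\int[distribution P (eps i)]_t phi t)%E.
  by rewrite ge0_integral_pushforward// => t _.
by apply: eq_measure_integral => B mB _; exact: eps_ident.
Qed.

Lemma law_integral i (phi : R -> R) : measurable_fun setT phi -> nu.-integrable setT (EFin \o phi) ->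
  P.-integrable setT (EFin \o (fun w => phi (eps i w))) /\ \int[P]_w phi (eps i w) = \int[nu]_t phi t.
Proof.
move=> mphi iphi; have mE : measurable_fun setT (fun t => (phi t)%:E) by exact/measurable_EFinP.
have h (f : R -> R) : measurable_fun setT f -> (forall t, 0 <= f t) ->
    (\int[P]_w (f (eps i w))%:E = \int[nu]_t (f t)%:E)%E.
  by move=> mf f0; apply: (law_ge0 i (phi := fun t => (f t)%:E)) => //; exact/measurable_EFinP.
have hi : P.-integrable setT (EFin \o (fun w => phi (eps i w))).
  apply/integrableP; split.
    by apply/measurable_EFinP; apply: measurableT_comp => //; exact: measurable_funP.
  have /integrableP[_] := iphi; rewrite -(h (fun t => `|phi t|))//.
  exact: measurableT_comp.
split; first exact: hi.
rewrite /Rintegral; congr fine; transitivity (\int[distribution P (eps i)]_t (phi t)%:E)%E.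
  have mei : measurable_fun setT (eps i) by exact: measurable_funP.
  by rewrite (integral_pushforward mei mE hi).
by apply: eq_measure_integral => B mB _; exact: eps_ident.
Qed.

Definition psum (psi : nat -> R -> R) k (w : Omega) : R := \sum_(i < k) psi i (eps i w).

(** A partial sum depends on the past errors only, hence is independent of the
    next one. *)
Lemma psum_past (psi : nat -> R -> R) k : (forall i, measurable_fun setT (psi i)) ->
  measurable_fun (setT : set (past k)) (psum psi k : past k -> R).
Proof.
move=> mpsi; apply: measurable_sum => i.
apply: measurableT_comp => //; exact: past_measurable.
Qed.

Lemma psum_measurable (psi : nat -> R -> R) k : (forall i, measurable_fun setT (psi i)) ->
  measurable_fun setT (psum psi k).
Proof.
move=> mpsi; apply: measurable_sum => i.
apply: measurableT_comp => //; exact: measurable_funP.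
Qed.

(** The variances of independent centred variables add up. *)
Lemma psum_second_moment (psi : nat -> R -> R) k : (forall i, measurable_fun setT (psi i)) ->
  (forall i, nu.-integrable setT (EFin \o psi i)) ->
  (forall i, nu.-integrable setT (EFin \o (fun t => psi i t ^+ 2))) ->
  (forall i, \int[nu]_t psi i t = 0) ->
  (\int[P]_w (psum psi k w ^+ 2)%:E = (\sum_(i < k) \int[nu]_t (psi i t ^+ 2))%:E)%E.
Proof.
move=> mpsi ipsi ipsi2 psi0; elim: k => [|k IH].
  rewrite big_ord0; under eq_integral do rewrite /psum big_ord0 expr0n/=.
  exact: integral0.
have -> : (fun w => (psum psi k.+1 w ^+ 2)%:E) = fun w => ((psum psi k w + psi k (eps k w)) ^+ 2)%:E.
  by apply/funext => w; rewrite /psum big_ord_recr.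
have mPhi : measurable_fun setT (fun z : R * R => ((z.1 + psi k z.2) ^+ 2)%:E).
  apply/measurable_EFinP; apply: measurable_funX; apply: measurable_funD; first exact: measurable_fst.
  by apply: measurableT_comp => //; exact: measurable_snd.
rewrite (@ge0_integral_indep _ _ _ _ _ _ _ P (psum psi k) (eps k) (fun z : R * R => ((z.1 + psi k z.2) ^+ 2)%:E))//=; first last.
- by move=> z; rewrite lee_fin sqr_ge0.
- by apply: past_indep; exact: psum_past.
- exact: psum_measurable.
have [i1 e1] := law_integral k (mpsi k) (ipsi k).
have [i2 e2] := law_integral k (measurable_funX 2 (mpsi k)) (ipsi2 k).
have inner (s : R) : (\int[P]_w ((s + psi k (eps k w)) ^+ 2)%:E = (s ^+ 2 + \int[nu]_t (psi k t ^+ 2))%:E)%E.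
  have -> : (fun w => ((s + psi k (eps k w)) ^+ 2)%:E) =
      fun w => ((s ^+ 2)%:E + ((2 * s)%:E * (psi k (eps k w))%:E + (psi k (eps k w) ^+ 2)%:E))%E.
    by apply/funext => w; rewrite -EFinM -!EFinD; congr EFin; ring.
  have i3 : P.-integrable setT (fun w => ((2 * s)%:E * (psi k (eps k w))%:E)%E) by exact: integrableZl.
  have i4 : P.-integrable setT (cst (s ^+ 2)%:E : Omega -> \bar R).
    exact: finite_measure_integrable_cst.
  have fin (f : Omega -> R) : P.-integrable setT (EFin \o f) -> (\int[P]_w (f w)%:E = (\int[P]_w f w)%:E)%E.
    by move=> jf; rewrite /Rintegral fineK//; exact: integrable_fin_num.
  rewrite integralD//; last exact: integrableD.
  rewrite integralD// integralZl// (fin _ i1) (fin _ i2) e1 e2 psi0 mule0 add0e.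
  by rewrite integral_cst// [X in (_ * X)%E](@probability_setT _ _ _ P) mule1 EFinD.
under eq_integral do rewrite inner EFinD.
rewrite ge0_integralD//; first last.
- by move=> w _; rewrite lee_fin Rintegral_ge0// => t _; exact: sqr_ge0.
- by apply/measurable_EFinP; apply: measurable_funX; exact: psum_measurable.
- by move=> w _; rewrite lee_fin sqr_ge0.
by rewrite IH integral_cst// [X in (_ * X)%E](@probability_setT _ _ _ P) mule1 -EFinD big_ord_recr.
Qed.
End iid_sequence.

(** * Lindeberg theorem for the errors *)

Section lindeberg_iid.
Context {R : realType} {d : measure_display} {Omega : measurableType d} (P : probability Omega R).
Variable eps : nat -> {RV P >-> R}.
Hypothesis eps_indep : mutual_indep P (fun i => eps i : Omega -> R).
Hypothesis eps_ident : forall i (B : set R), measurable B ->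
  distribution P (eps i) B = distribution P (eps 0%N) B.
Let nu := distribution P (eps 0%N).

Lemma bounded_mean_indep d1 d2 (T1 : measurableType d1) (T2 : measurableType d2)
    (X : Omega -> T1) (Y : Omega -> T2) (f : T1 * T2 -> R) (C : R) :
  measurable_fun setT X -> measurable_fun setT Y -> indep_maps P X Y ->
  measurable_fun setT f -> (forall z, `|f z| <= C) ->
  \int[P]_w f (X w, Y w) = \int[P]_w1 \int[P]_w2 f (X w1, Y w2).
Proof.
move=> mX mY XY mf fC; have C0 : 0 <= C by exact: le_trans (normr_ge0 _) (fC (X point, Y point)).
pose h z := f z + C; have mh : measurable_fun setT h by exact: measurable_funD.
have h0 z : 0 <= h z by have := fC z; rewrite ler_norml -lerBlDr sub0r => /andP[].
have h2C z : `|h z| <= C + C by rewrite (le_trans (ler_normD _ _))// lerD// ger0_norm.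
have mXY : measurable_fun setT (fun w => (X w, Y w)) by exact: measurable_fun_pair.
have b1 : bounded_mfun (fun w => h (X w, Y w)).
  by split; [exact: measurableT_comp mh mXY|exists (C + C)].
have mY2 x : measurable_fun setT (fun w => h (x, Y w)).
  apply: measurableT_comp => //; apply: measurable_fun_pair => //; exact: measurable_cst.
have b2 x : bounded_mfun (fun w2 => h (x, Y w2)) by split=> //; exists (C + C).
have mEh : measurable_fun setT (fun z => (h z)%:E) by exact/measurable_EFinP.
have bY x : bounded_mfun (fun w2 => f (x, Y w2)).
  split; last by exists C.
  apply: measurableT_comp => //; apply: measurable_fun_pair => //; exact: measurable_cst.
have mH : measurable_fun setT (fun w1 => \int[P]_w2 h (X w1, Y w2)).
  have := @measurable_fun_fubini_tonelli_F _ _ _ _ R P (fun z : T1 * Omega => (h (z.1, Y z.2))%:E).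
  have mm : measurable_fun setT (fun z : T1 * Omega => (h (z.1, Y z.2))%:E).
    apply: (measurableT_comp mEh); apply: measurable_fun_pair; first exact: measurable_fst.
    by apply: measurableT_comp => //; exact: measurable_snd.
  move=> /(_ mm) H; have : measurable_fun setT (fubini_F P (fun z : T1 * Omega => (h (z.1, Y z.2))%:E)).
    by apply: H => z; rewrite lee_fin.
  rewrite /fubini_F /= => mF; apply/measurable_EFinP.
  have -> : EFin \o (fun w1 => \int[P]_w2 h (X w1, Y w2)) =
      (fun x => \int[P]_y (h (x, Y y))%:E)%E \o X.
    by apply/funext => w1 /=; rewrite fin_bounded_mean//; exact: b2.
  exact: measurableT_comp mF mX.
have bH : bounded_mfun (fun w1 => \int[P]_w2 h (X w1, Y w2)).
  by split=> //; exists (C + C) => w1; apply: bounded_mean_le.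
have eqh : \int[P]_w h (X w, Y w) = \int[P]_w1 \int[P]_w2 h (X w1, Y w2).
  apply: EFin_inj; rewrite !fin_bounded_mean//.
  rewrite (ge0_integral_indep mX mY XY (Phi := fun z => (h z)%:E))//.
  by apply: eq_integral => w1 _; rewrite fin_bounded_mean.
have addC (g : Omega -> R) : bounded_mfun g -> \int[P]_w (g w + C) = \int[P]_w g w + C.
  move=> bg; rewrite RintegralD//; last 2 first.
  - exact: bounded_mfun_integrable.
  - exact: finite_measure_integrable_cst.
  by rewrite bounded_mean_cst.
have bf : bounded_mfun (fun w => f (X w, Y w)).
  by split; [exact: measurableT_comp mf mXY|exists C].
have HE : (fun w1 => \int[P]_w2 h (X w1, Y w2)) = fun w1 => \int[P]_w2 f (X w1, Y w2) + C.
  by apply/funext => w1; rewrite /h addC//; exact: bY.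
have bF : bounded_mfun (fun w1 => \int[P]_w2 f (X w1, Y w2)).
  split.
    have -> : (fun w1 => \int[P]_w2 f (X w1, Y w2)) = fun w1 => \int[P]_w2 h (X w1, Y w2) - C.
      by apply/funext => w1; have := congr1 (fun g => g w1) HE => /= ->; rewrite addrK.
    exact: measurable_funB.
  by exists C => w1; apply: bounded_mean_le => //; exact: bY.
apply: (addIr C); rewrite -addC// -addC//.
by have := eqh; rewrite HE.
Qed.

(** Independence enters only through the fact that the next error may be
    integrated out with the past held fixed. *)
Lemma psum_lindeberg C f m (psi : nat -> R -> R) (w : nat -> R) : smooth C f -> (forall k, 0 <= w k) ->
  (forall i, measurable_fun setT (psi i)) ->
  (forall i, nu.-integrable setT (EFin \o psi i)) ->
  (forall i, nu.-integrable setT (EFin \o (fun t => psi i t ^+ 2))) ->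
  (forall i, nu.-integrable setT (EFin \o (fun t => `|psi i t| ^+ 3))) ->
  (forall i, \int[nu]_t psi i t = 0) ->
  (forall i, \int[nu]_t (psi i t ^+ 2) = w i * gauss_m2) ->
  `|\int[P]_v f (psum eps psi m v) - gop (\sum_(k < m) w k) f 0| <=
  \sum_(k < m) C * (\int[nu]_t (`|psi k t| ^+ 3) + gauss_m3 * (w k * Num.sqrt (w k))).
Proof.
move=> sf w0 mpsi ipsi ipsi2 ipsi3 psi0 wE.
apply: (@lindeberg_telescope R (fun k f => \int[P]_v f (psum eps psi k v))
  w (fun k => C * (\int[nu]_t (`|psi k t| ^+ 3) + gauss_m3 * (w k * Num.sqrt (w k)))) C) => //.
  by move=> g; under eq_Rintegral do rewrite /psum big_ord0; rewrite bounded_mean_cst.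
move=> {sf}k {}f _ sf; have [f1 [f2 [bf bf1 bf2 fT]]] := sf.
have C0 := blip_ge0 bf; have fC : forall x, `|f x| <= C by case: bf.
have mf : measurable_fun setT f by exact: blip_measurable bf.
have mk : measurable_fun setT (eps k) by exact: measurable_funP.
have mS : measurable_fun setT (psum eps psi k) by exact: psum_measurable.
have mk2 : measurable_fun setT (fun z : R * R => f (z.1 + psi k z.2)).
  apply: measurableT_comp => //; apply: measurable_funD; first exact: measurable_fst.
  by apply: measurableT_comp => //; exact: measurable_snd.
have eqS : \int[P]_v f (psum eps psi k.+1 v) =
    \int[P]_v1 \int[P]_v2 f (psum eps psi k v1 + psi k (eps k v2)).
  rewrite -(@bounded_mean_indep _ _ _ _ (psum eps psi k) (eps k) (fun z : R * R => f (z.1 + psi k z.2)) C)//.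
    by apply: eq_Rintegral => v _; rewrite /psum big_ord_recr.
  by apply: past_indep => //; exact: psum_past.
have bk x : bounded_mfun (fun v => f (x + psi k (eps k v))).
  split; last by exists C.
  apply: measurableT_comp => //; apply: measurable_funD => //; exact: measurableT_comp.
have mT : measurable_fun setT (fun x : R => \int[P]_v2 f (x + psi k (eps k v2))).
  have mm : measurable_fun setT (fun z : R * Omega => (f (z.1 + psi k (eps k z.2)) + C)%:E).
    apply/measurable_EFinP; apply: measurable_funD => //; apply: measurableT_comp => //.
    apply: measurable_funD; first exact: measurable_fst.
    apply: measurableT_comp => //; apply: measurableT_comp => //; exact: measurable_snd.
  have H : measurable_fun setT (fubini_F P (fun z : R * Omega => (f (z.1 + psi k (eps k z.2)) + C)%:E)).
    apply: (measurable_fun_fubini_tonelli_F (m2 := P)) => // z.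
    by rewrite lee_fin; have := fC (z.1 + psi k (eps k z.2)); rewrite ler_norml -lerBlDr sub0r => /andP[].
  have -> : (fun x => \int[P]_v2 f (x + psi k (eps k v2))) =
      fun x => fine (fubini_F P (fun z : R * Omega => (f (z.1 + psi k (eps k z.2)) + C)%:E) x) - C.
    apply/funext => x; rewrite /fubini_F /= -[fine _]/(\int[P]_v2 (f (x + psi k (eps k v2)) + C)).
    rewrite RintegralD//; last 2 first.
    - exact: bounded_mfun_integrable.
    - exact: finite_measure_integrable_cst.
    by rewrite bounded_mean_cst addrK.
  by apply: measurable_funB => //; exact: measurableT_comp.
rewrite eqS; apply: bounded_mean_dist.
- split; first exact: measurableT_comp mT mS.
  by exists C => v1; apply: bounded_mean_le.
- have [mg [Mg hg]] : bounded_mfun (gop (w k) f).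
    have bg := gop_blip (w k) bf; split; first exact: blip_measurable bg.
    by exists C => x; case: bg.
  by split; [exact: measurableT_comp mg mS|exists Mg].
move=> v1; move: (psum eps psi k v1) => x.
have h1 := gop_taylor x (w0 k) bf fT.
have [i1 e1] := law_integral eps_ident k (mpsi k) (ipsi k).
have [i2 e2] := law_integral eps_ident k (measurable_funX 2 (mpsi k)) (ipsi2 k).
have m3 : measurable_fun setT (fun t => `|psi k t| ^+ 3).
  by apply: measurable_funX; exact: measurableT_comp.
have [i3 e3] := law_integral eps_ident k m3 (ipsi3 k).
have h2 : `|\int[P]_v f (x + psi k (eps k v)) - f x - f2 x * gauss_m2 * w k| <=
    C * \int[nu]_t (`|psi k t| ^+ 3).
  have ic (c : R) : P.-integrable setT (EFin \o (fun _ : Omega => c)) by exact: finite_measure_integrable_cst.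
  have iZ (g : Omega -> R) (c : R) : P.-integrable setT (EFin \o g) -> P.-integrable setT (EFin \o (fun v => c * g v)).
    by move=> ig; apply: (integrableZl measurableT c ig).
  have iB (g h : Omega -> R) : P.-integrable setT (EFin \o g) -> P.-integrable setT (EFin \o h) ->
      P.-integrable setT (EFin \o (fun v => g v - h v)).
    by move=> ig ih; apply: (integrableB measurableT ig ih).
  have i5 := iB _ _ (bounded_mfun_integrable P (bk x)) (ic (f x)).
  have i6 := iB _ _ i5 (iZ _ (f1 x) i1).
  have i7 := iB _ _ i6 (iZ _ (f2 x) i2).
  have -> : \int[P]_v f (x + psi k (eps k v)) - f x - f2 x * gauss_m2 * w k =
      \int[P]_v (f (x + psi k (eps k v)) - f x - f1 x * psi k (eps k v) - f2 x * psi k (eps k v) ^+ 2).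
    rewrite RintegralB//; last exact: iZ.
    rewrite RintegralB//; last exact: iZ.
    rewrite RintegralB//; last exact: bounded_mfun_integrable.
    rewrite bounded_mean_cst !RintegralZl// e1 e2 psi0 mulr0 subr0 wE.
    by congr (_ - _); rewrite -mulrA [gauss_m2 * _]mulrC.
  rewrite -e3 -RintegralZl//; apply: le_trans (le_normr_Rintegral _ _) _ => //.
  apply: le_Rintegral => //; [exact: integrable_norm i7|exact: iZ].
rewrite mulrDr mulrA -[X in `|X|](subrKA (f x + f2 x * gauss_m2 * w k)).
apply: (le_trans (ler_normD _ _)); rewrite lerD//; first by rewrite opprD addrA.
by rewrite distrC opprD addrA.
Qed.
End lindeberg_iid.

(** * Events of high probability *)

Section high_probability.
Context {R : realType} {d : measure_display} {Omega : measurableType d} (P : probability Omega R).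

(** The events B provide measurability, so that A itself may be any set: it
    often involves an existential quantifier. *)
Definition whp (A : set (nat * Omega)) : Prop := forall eta : R, 0 < eta ->
  exists B : nat -> set Omega, [/\ forall n, measurable (B n), forall n w, B n w -> A (n, w) &
    \forall n \near \oo, ((1 - eta)%:E <= P (B n))%E].

Lemma probC_le (B : set Omega) (eta : R) : measurable B -> ((1 - eta)%:E <= P B)%E ->
  (P (~` B) <= eta%:E)%E.
Proof.
move=> mB; rewrite probability_setC//.
have /fineK <- : P B \is a fin_num by exact: fin_num_measure.
by rewrite -EFinB !lee_fin lerBlDr lerBlDl addrC.
Qed.

Lemma prob_ge (B C : set Omega) (eta : R) : measurable B -> measurable C -> ~` C `<=` B ->
  (P B <= eta%:E)%E -> ((1 - eta)%:E <= P C)%E.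
Proof.
move=> mB mC CB h; have {h} h : (P (~` C) <= eta%:E)%E.
  exact: le_trans (le_measure P (mem_set (measurableC mC)) (mem_set mB) CB) h.
move: h; rewrite probability_setC//; have /fineK <- : P C \is a fin_num by exact: fin_num_measure.
by rewrite -EFinB !lee_fin; lra.
Qed.

Lemma prob_ge_setI (B D : set Omega) (eta : R) : measurable B -> measurable D ->
  ((1 - eta / 2)%:E <= P B)%E -> ((1 - eta / 2)%:E <= P D)%E -> ((1 - eta)%:E <= P (B `&` D))%E.
Proof.
move=> mB mD h1 h2; apply: (@prob_ge (~` B `|` ~` D)).
- by apply: measurableU; exact: measurableC.
- exact: measurableI.
- by rewrite setCI.
apply: le_trans (measureU2 _ _ _) _; try exact: measurableC.
by rewrite [eta]splitr EFinD; apply: leeD; exact: probC_le.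
Qed.

Lemma whp_setT : whp setT.
Proof.
move=> eta eta0; exists (fun _ => setT); split=> //.
by near=> n; rewrite probability_setT lee_fin lerBlDr lerDl ltW.
Unshelve. all: by end_near. Qed.

Lemma whp_setS A C : A `<=` C -> whp A -> whp C.
Proof.
move=> sAC hA eta /hA [B [mB BA PB]]; exists B; split=> // n w Bw; exact/sAC/BA.
Qed.

Lemma whp_setI A C : whp A -> whp C -> whp (A `&` C).
Proof.
move=> hA hC eta eta0; have e2 : 0 < eta / 2 by rewrite divr_gt0.
have [B [mB BA PB]] := hA _ e2; have [D [mD DC PD]] := hC _ e2.
exists (fun n => B n `&` D n); split=> [n|n w [Bw Dw]|].
- exact: measurableI.
- by split; [exact: BA|exact: DC].
apply: filterS2 PB PD => n h1 h2; exact: prob_ge_setI.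
Qed.

Global Instance whp_filter : Filter whp.
Proof.
split; [exact: whp_setT|exact: whp_setI|exact: whp_setS].
Qed.

Lemma whp_near (Q : nat -> Prop) : (\forall n \near \oo, Q n) -> whp [set t | Q t.1].
Proof.
move=> nQ eta eta0; exists (fun n => [set w | Q n]); split=> [n|n w|]//.
  by have [q|q] := pselect (Q n); [rewrite (_ : [set _ | _] = setT)//|rewrite (_ : [set _ | _] = set0)//];
    apply/seteqP; split.
apply: filterS nQ => n q; rewrite (_ : [set _ | _] = setT); last by apply/seteqP; split.
by rewrite probability_setT lee_fin lerBlDr lerDl ltW.
Qed.

Lemma markov_prob (f : Omega -> R) (K c : R) : measurable_fun setT f -> (forall w, 0 <= f w) -> 0 < c ->
  (\int[P]_w (f w)%:E <= K%:E)%E -> ((1 - K / c)%:E <= P [set w | f w <= c]%R)%E.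
Proof.
move=> mf f0 c0 fK; pose B := [set w | c < f w]%R.
have mB : measurable B.
  by rewrite -[B]setTI; have := mf measurableT `]c, +oo[%classic (measurable_itv _);
    congr (measurable (_ `&` _)); apply/seteqP; split=> w /=; rewrite in_itv/= andbT.
have mC : measurable [set w | f w <= c]%R.
  by rewrite -[X in measurable X]setTI; have := mf measurableT `]-oo, c]%classic (measurable_itv _);
    congr (measurable (_ `&` _)); apply/seteqP; split=> w /=; rewrite in_itv/=.
apply: (@prob_ge B) => //; first by move=> w /= /negP; rewrite -ltNge.
rewrite EFinM lee_pdivlMr//; apply: le_trans fK.
rewrite muleC -integral_cst//; apply: (@le_trans _ _ (\int[P]_(w in B) (f w)%:E)%E).
  apply: ge0_le_integral => //; [by move=> w _; rewrite lee_fin ltW| |by move=> w /ltW; rewrite lee_fin].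
  by apply/measurable_EFinP; apply: measurable_funTS.
by apply: ge0_subset_integral => //; [exact/measurable_EFinP|move=> w _; rewrite lee_fin].
Qed.

Lemma whp_cvg0 (Z : nat -> Omega -> R) (a : nat -> R) (k : R) : (forall n, measurable_fun setT (Z n)) ->
  (forall n w, 0 <= Z n w) -> (\forall n \near \oo, (\int[P]_w (Z n w)%:E <= (a n)%:E)%E) ->
  a n @[n --> \oo] --> (0 : R) -> 0 < k -> whp [set t | Z t.1 t.2 <= k]%R.
Proof.
move=> mZ Z0 aZ a0 k0 eta eta0; exists (fun n => [set w | Z n w <= k]%R); split=> // [n|].
  by rewrite -[X in measurable X]setTI; have := mZ n measurableT `]-oo, k]%classic (measurable_itv _);
    congr (measurable (_ `&` _)); apply/seteqP; split=> w /=; rewrite in_itv/=.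
have ke : 0 < k * eta by rewrite mulr_gt0.
apply: filterS2 aZ (@cvgR_near R nat \oo _ _ _ _ a0 ke) => n h1.
rewrite subr0 => /(le_trans (ler_norm _)) h2.
apply: le_trans (markov_prob (mZ n) (Z0 n) k0 h1).
by rewrite lee_fin lerD2l lerN2 ler_pdivrMr// mulrC.
Qed.

(** Only upper bounds are asked for: the definition serves nonnegative statistics,
    which are bounded along the ultrafilters considered later. *)
Definition tight (f : nat -> Omega -> R) : Prop := forall eta : R, 0 < eta ->
  exists (L : R) (B : nat -> set Omega), [/\ forall n, measurable (B n),
    forall n w, B n w -> f n w <= L & \forall n \near \oo, ((1 - eta)%:E <= P (B n))%E].

Lemma tightD f g : tight f -> tight g -> tight (fun n w => f n w + g n w).
Proof.
move=> hf hg eta eta0; have e2 : 0 < eta / 2 by rewrite divr_gt0.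
have [L [B [mB BA PB]]] := hf _ e2; have [K [D [mD DC PD]]] := hg _ e2.
exists (L + K), (fun n => B n `&` D n); split=> [n|n w [Bw Dw]|].
- exact: measurableI.
- by rewrite lerD//; [exact: BA|exact: DC].
apply: filterS2 PB PD => n h1 h2; exact: prob_ge_setI.
Qed.

Lemma tight_markov (Z : nat -> Omega -> R) (K : R) : (forall n, measurable_fun setT (Z n)) ->
  (forall n w, 0 <= Z n w) -> (\forall n \near \oo, (\int[P]_w (Z n w)%:E <= K%:E)%E) -> tight Z.
Proof.
move=> mZ Z0 ZK eta eta0; pose L := (`|K| + 1) / eta.
have L0 : 0 < L by rewrite divr_gt0// ltr_wpDl.
exists L, (fun n => [set w | Z n w <= L]%R); split=> // [n|].
  by rewrite -[X in measurable X]setTI; have := mZ n measurableT `]-oo, L]%classic (measurable_itv _);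
    congr (measurable (_ `&` _)); apply/seteqP; split=> w /=; rewrite in_itv/=.
apply: filterS ZK => n h; apply: le_trans (markov_prob (mZ n) (Z0 n) L0 h).
rewrite lee_fin lerD2l lerN2 ler_pdivrMr// /L mulrC divfK ?gt_eqF//.
by rewrite (le_trans (ler_norm _))// lerDl.
Qed.

Lemma tight_sum (I : Type) (r : seq I) (f : I -> nat -> Omega -> R) : (forall i, tight (f i)) ->
  tight (fun n w => \sum_(i <- r) f i n w).
Proof.
move=> h; elim: r => [|i r IH] eta eta0.
  exists 0, (fun _ => setT); split=> // [n w _|]; first by rewrite big_nil.
  by near=> n; rewrite probability_setT lee_fin lerBlDr lerDl ltW.
have [L [B [mB BA PB]]] := tightD (h i) IH eta0.
by exists L, B; split=> // n w Bw; rewrite big_cons; exact: BA.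
Unshelve. all: by end_near. Qed.

(** A property that holds along every ultrafilter finer than high probability
    on which a tight statistic is bounded, holds with high probability. *)
Lemma whp_ultra (Z : nat -> Omega -> R) (A : set (nat * Omega)) : tight Z ->
  (forall (U : set_system (nat * Omega)) (L : R), UltraFilter U -> whp `<=` U ->
    (\forall t \near U, Z t.1 t.2 <= L) -> U A) -> whp A.
Proof.
move=> tZ hU.
have key (L : R) : whp [set t | Z t.1 t.2 <= L -> A t].
  apply: contrapT => nA.
  pose Bd := [set t : nat * Omega | Z t.1 t.2 <= L /\ ~ A t].
  pose F := [set C : set (nat * Omega) | whp [set t | Bd t -> C t]].
  have FF : ProperFilter F.
    split; last first.
      split.
      - by apply: whp_setS whp_setT.
      - by move=> C D hC hD; apply: whp_setS (whp_setI hC hD) => t [h1 h2] b; split; [exact: h1|exact: h2].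
      - by move=> C D CD hC; apply: whp_setS hC => t h b; exact/CD/h.
    move=> h; apply: nA; apply: whp_setS h => t h Zt; apply: contrapT => nAt.
    exact: (h (conj Zt nAt)).
  have [U [UU FU]] := ultraFilterLemma FF.
  have UA : U A.
    apply: (hU U L UU).
      by move=> C hC; apply: FU; apply: whp_setS hC => t Ct _.
    by apply: FU; apply: whp_setS whp_setT => t _ [].
  have UB : U (~` A).
    by apply: FU; apply: whp_setS whp_setT => t _ [].
  have : U (A `&` ~` A) by exact: filterI.
  by rewrite setICr => /filter_ex[].
move=> eta eta0; have e2 : 0 < eta / 2 by rewrite divr_gt0.
have [L [C [mC CZ PC]]] := tZ _ e2.
have [B [mB BA PB]] := key L _ e2.
exists (fun n => B n `&` C n); split=> [n|n w [Bw Cw]|].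
- exact: measurableI.
- exact: (BA n w Bw (CZ n w Cw)).
by apply: filterS2 PB PC => n h1 h2; exact: prob_ge_setI.
Qed.

Lemma whp_le_prob (D E : nat -> set Omega) (eta : R) : (forall n, measurable (D n)) ->
  (forall n, measurable (E n)) -> whp [set t | D t.1 t.2 -> E t.1 t.2] -> 0 < eta ->
  \forall n \near \oo, (fine (P (D n)) <= fine (P (E n)) + eta).
Proof.
move=> mD mE h eta0; have [B [mB BA PB]] := h _ eta0; apply: filterS PB => n hn.
have sub : D n `<=` E n `|` ~` B n.
  by move=> w Dw; have [b|b] := pselect (B n w); [left; exact: (BA n w b)|right].
have mBC := measurableC (mB n).
rewrite -lee_fin EFinD !fineK ?fin_num_measure//.
apply: le_trans (le_measure P (mem_set (mD n)) (mem_set (measurableU _ _ (mE n) mBC)) sub) _.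
apply: le_trans (measureU2 _ _ _) _ => //.
by apply: leeD => //; exact: probC_le.
Qed.
End high_probability.

(** * Laws of large numbers and counts in small windows *)

Lemma near_nat_ge {R : realType} (K : R) : \forall n \near \oo, K <= n%:R.
Proof.
exists (Num.truncn `|K|).+1 => // n /= h; rewrite (le_trans (ler_norm _))// ltW//.
by rewrite (lt_le_trans (truncnS_gt _))// ler_nat.
Qed.

Lemma cvg_natV {R : realType} : (n%:R^-1 : R) @[n --> \oo] --> (0 : R).
Proof.
apply/cvgRP => k k0; apply: filterS2 (near_nat_ge k^-1) (nbhs_infty_gt 0) => n h n0.
rewrite subr0 ger0_norm ?invr_ge0//.
by rewrite -[k]invrK lef_pV2 ?posrE ?invr_gt0 ?ltr0n.
Qed.

Section law_of_large_numbers.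
Context {R : realType} {d : measure_display} {Omega : measurableType d} (P : probability Omega R).
Variable eps : nat -> {RV P >-> R}.
Hypothesis eps_indep : mutual_indep P (fun i => eps i : Omega -> R).
Hypothesis eps_ident : forall i (B : set R), measurable B ->
  distribution P (eps i) B = distribution P (eps 0%N) B.
Let nu := distribution P (eps 0%N).
Hypothesis nu4 : nu.-integrable setT (fun t => (t ^+ 4)%:E).
Let F (t : R) := real_cdf (eps 0%N) t.

Lemma nu_integrable (phi : R -> R) (C : R) : measurable_fun setT phi ->
  (forall t, `|phi t| <= C * (1 + t ^+ 4)) -> nu.-integrable setT (EFin \o phi).
Proof.
move=> mphi hC.
have i1 : nu.-integrable setT (EFin \o (fun t : R => C * (1 + t ^+ 4))).
  have -> : EFin \o (fun t : R => C * (1 + t ^+ 4)) = fun t => (C%:E * (1%:E + (t ^+ 4)%:E))%E by [].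
  apply: integrableZl => //; apply: integrableD => //.
  exact: finite_measure_integrable_cst.
apply: le_integrable i1 => //; first exact/measurable_EFinP.
by move=> t _ /=; rewrite lee_fin (le_trans (hC t))// ler_norm.
Qed.

Lemma sqr_le_quartic (t : R) : t ^+ 2 <= 1 + t ^+ 4.
Proof. by rewrite (exprM t 2 2); have := sqr_ge0 (t ^+ 2 - 1); have := sqr_ge0 (t ^+ 2); nra. Qed.

Lemma abs_le_sqr (t : R) : `|t| <= 1 + t ^+ 2.
Proof. rewrite -[t ^+ 2]real_normK ?num_real//; have := sqr_ge0 (`|t| - 1); have := normr_ge0 t; nra. Qed.

Lemma nu_integrable2 (phi : R -> R) (C : R) : measurable_fun setT phi ->
  (forall t, `|phi t| <= C * (1 + t ^+ 2)) ->
  nu.-integrable setT (EFin \o phi) /\ nu.-integrable setT (EFin \o (fun t => phi t ^+ 2)).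
Proof.
move=> mphi hC; have C0 : 0 <= C.
  by have := hC 0; rewrite expr0n/= addr0 mulr1; exact: le_trans.
split.
  apply: (nu_integrable (C := 2 * C)) => // t; apply: (le_trans (hC t)).
  rewrite [2 * C]mulrC -mulrA ler_wpM2l//; have := sqr_le_quartic t; have := sqr_ge0 (t ^+ 2).
  by rewrite -exprM; lra.
apply: (nu_integrable (C := 4 * C ^+ 2)); first exact: measurable_funX.
move=> t; rewrite normrX; apply: (@le_trans _ _ ((C * (1 + t ^+ 2)) ^+ 2)).
  by rewrite lerXn2r// ?nnegrE// mulr_ge0// addr_ge0// sqr_ge0.
have -> : 4 * C ^+ 2 * (1 + t ^+ 4) = C ^+ 2 * (4 * (1 + t ^+ 4)) by ring.
rewrite exprMn ler_wpM2l ?sqr_ge0//.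
have := sqr_le_quartic t; have := sqr_ge0 (t ^+ 2); rewrite -exprM => h1 h2.
have -> : (1 + t ^+ 2) ^+ 2 = 1 + 2 * t ^+ 2 + t ^+ 4 by ring.
lra.
Qed.

Section tame_triangular_array.
Variables (psi : nat -> nat -> R -> R) (C v : nat -> R).
Hypothesis mpsi : forall n i, measurable_fun setT (psi n i).
Hypothesis psiC : forall n i t, `|psi n i t| <= C n * (1 + t ^+ 2).
Hypothesis psi0 : forall n i, \int[nu]_t psi n i t = 0.
Hypothesis psiv : \forall n \near \oo, \sum_(i < n) \int[nu]_t (psi n i t ^+ 2) <= v n.

Let m2 n : (\int[P]_w (psum eps (psi n) n w ^+ 2)%:E = (\sum_(i < n) \int[nu]_t (psi n i t ^+ 2))%:E)%E.
Proof.
by apply: psum_second_moment => // i; have [] := nu_integrable2 (@mpsi n i) (@psiC n i).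
Qed.

Let ms n : measurable_fun setT (fun w => psum eps (psi n) n w ^+ 2).
Proof. by apply: measurable_funX; exact: psum_measurable. Qed.

(** Chebyshev inequality for sums with vanishing variance. *)
Lemma whp_psum (k : R) : v n @[n --> \oo] --> (0 : R) -> 0 < k ->
  whp P [set t | `|psum eps (psi t.1) t.1 t.2| <= k].
Proof.
move=> v0 k0; have k2 : 0 < k ^+ 2 by rewrite exprn_gt0.
have := @whp_cvg0 _ _ _ P (fun n w => psum eps (psi n) n w ^+ 2) v (k ^+ 2) ms _ _ v0 k2.
move=> h; apply: whp_setS (h _ _) => [t /=|n w|].
- by move=> ht; rewrite -(@ler_sqr _ `|_|) ?nnegrE ?(ltW k0)// real_normK ?num_real.
- exact: sqr_ge0.
- by apply: filterS psiv => n hn; rewrite m2 lee_fin.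
Qed.

Lemma tight_psum (K : R) : (\forall n \near \oo, v n <= K) ->
  tight P (fun n w => psum eps (psi n) n w ^+ 2).
Proof.
move=> vK; apply: (tight_markov (K := K)) => // [n w|]; first exact: sqr_ge0.
by apply: filterS2 psiv vK => n h1 h2; rewrite m2 lee_fin (le_trans h1).
Qed.
End tame_triangular_array.

Section centred_summand.
Variables (phi : R -> R) (C : R).
Hypothesis mphi : measurable_fun setT phi.
Hypothesis phiC : forall t, `|phi t| <= C * (1 + t ^+ 2).
Let m := \int[nu]_t phi t.

Lemma centred_bound t : `|phi t - m| <= (C + `|m|) * (1 + t ^+ 2).
Proof.
rewrite (le_trans (ler_normB _ _))// mulrDl lerD// ler_peMr//.
by rewrite lerDl sqr_ge0.
Qed.

Lemma centred_mean (a : R) : \int[nu]_t (a * (phi t - m)) = 0.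
Proof.
have [i1 _] := nu_integrable2 mphi phiC.
have ic : nu.-integrable setT (EFin \o (fun _ : R => m)) by exact: finite_measure_integrable_cst.
rewrite RintegralZl//; last by apply: (integrableB measurableT i1 ic).
by rewrite RintegralB// bounded_mean_cst subrr mulr0.
Qed.

Let V := \int[nu]_t ((phi t - m) ^+ 2).

Lemma scaled_sqr_mean (a : R) : \int[nu]_t ((a * (phi t - m)) ^+ 2) = a ^+ 2 * V.
Proof.
under eq_Rintegral do rewrite exprMn.
have mc : measurable_fun setT (fun t => phi t - m) by exact: measurable_funB.
by have [_ i2] := nu_integrable2 mc centred_bound; rewrite RintegralZl.
Qed.

Variable a : nat -> nat -> R.
Let psi n i t := (if (i < n)%N then a n i else 0) * (phi t - m).

Let psiE n w : psum eps (psi n) n w = \sum_(i < n) a n i * (phi (eps i w) - m).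
Proof. by apply: eq_bigr => i _; rewrite /psi ltn_ord. Qed.

Let mpsi n i : measurable_fun setT (psi n i).
Proof. by apply: measurable_funM => //; exact: measurable_funB. Qed.

Let psiB n i t : `|psi n i t| <= ((\sum_(i < n) `|a n i|) * (C + `|m|)) * (1 + t ^+ 2).
Proof.
rewrite /psi normrM -mulrA ler_pM//; last exact: centred_bound.
case: ifP => h; last by rewrite normr0 sumr_ge0.
by rewrite (bigD1 (Ordinal h))//= lerDl sumr_ge0.
Qed.

Let psiv n : \sum_(i < n) \int[nu]_t (psi n i t ^+ 2) = (\sum_(i < n) a n i ^+ 2) * V.
Proof. by rewrite mulr_suml; apply: eq_bigr => i _; rewrite /psi ltn_ord scaled_sqr_mean. Qed.

Lemma whp_weighted (k : R) : \sum_(i < n) a n i ^+ 2 @[n --> \oo] --> (0 : R) -> 0 < k ->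
  whp P [set t | `|\sum_(i < t.1) a t.1 i * (phi (eps i t.2) - m)| <= k].
Proof.
move=> a0 k0; have h0 : (\sum_(i < n) a n i ^+ 2) * V @[n --> \oo] --> (0 : R).
  have : (\sum_(i < n) a n i ^+ 2) * V @[n --> \oo] --> (0 * V : R) by apply: cvgM; [exact: a0|exact: cvg_cst].
  by rewrite mul0r.
have := whp_psum mpsi psiB (fun n i => centred_mean _) _ h0 k0.
move=> h; apply: whp_setS (h _) => [t /=|]; first by rewrite psiE.
by near=> n; rewrite psiv.
Unshelve. all: by end_near. Qed.

Lemma tight_weighted (K : R) : (\forall n \near \oo, \sum_(i < n) a n i ^+ 2 <= K) ->
  tight P (fun n w => (\sum_(i < n) a n i * (phi (eps i w) - m)) ^+ 2).
Proof.
move=> aK; have V0 : 0 <= V by apply: Rintegral_ge0 => t _; exact: sqr_ge0.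
have := tight_psum mpsi psiB (fun n i => centred_mean _) (v := fun n => (\sum_(i < n) a n i ^+ 2) * V) _ (K := K * V).
have -> : (fun n w => psum eps (psi n) n w ^+ 2) = fun n w => (\sum_(i < n) a n i * (phi (eps i w) - m)) ^+ 2.
  by apply/funext => n; apply/funext => w; rewrite psiE.
apply; first by near=> n; rewrite psiv.
by apply: filterS aK => n h; rewrite ler_wpM2r.
Unshelve. all: by end_near. Qed.
End centred_summand.

Lemma whp_fmean (phi : R -> R) (C k : R) : measurable_fun setT phi ->
  (forall t, `|phi t| <= C * (1 + t ^+ 2)) -> 0 < k ->
  whp P [set t | `|fmean (fun j : 'I_t.1 => phi (eps j t.2)) - \int[nu]_t phi t| <= k].
Proof.
move=> mphi phiC k0.
have a0 : \sum_(i < n) (n%:R^-1 : R) ^+ 2 @[n --> \oo] --> (0 : R).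
  apply: cvgR_near_eq (@cvg_natV R); exists 1%N => // n /= n0.
  rewrite sumr_const card_ord -[RHS]mulr_natl; field.
  by rewrite pnatr_eq0 -lt0n.
have n0 := whp_near P (nbhs_infty_gt 0).
apply: whp_setS (whp_setI n0 (whp_weighted (a := fun n _ => n%:R^-1) mphi phiC a0 k0)) => t [/= nt].
rewrite -mulr_sumr sumrB mulrBr; congr (`|_ - _| <= _).
by rewrite -/(fmean (fun _ => _)) fmean_cst.
Qed.

Lemma ind_measurable (a : R) : measurable_fun setT (fun t : R => (t <= a)%R%:R : R).
Proof.
have -> : (fun t : R => (t <= a)%R%:R : R) = \1_(`]-oo, a]).
  by apply/funext => t; rewrite indicE; congr (nat_of_bool _)%:R; apply/idP/idP; rewrite inE/= in_itv.
by apply: measurable_indic; exact: measurable_itv.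
Qed.

Lemma ind_mean (a : R) : \int[nu]_t ((t <= a)%R%:R : R) = F a.
Proof.
have -> : (fun t : R => (t <= a)%R%:R : R) = \1_(`]-oo, a]).
  by apply/funext => t; rewrite indicE; congr (nat_of_bool _)%:R; apply/idP/idP; rewrite inE/= in_itv.
by rewrite bounded_mean_indic//; exact: measurable_itv.
Qed.

Lemma ind_bound (a t : R) : `|(t <= a)%R%:R : R| <= 1 * (1 + t ^+ 2).
Proof. by rewrite mul1r; have := sqr_ge0 t; case: (t <= a)%R; rewrite ?normr1 ?normr0 /=; lra. Qed.

Section increments.
Variables (c0 l : R) (dl : nat -> nat -> R).
Hypothesis dl0 : forall k : R, 0 < k -> \forall n \near \oo, forall i, (i < n)%N -> `|F (c0 + dl n i) - F c0| <= k.
Hypothesis dl1 : (Num.sqrt n%:R)^-1 * \sum_(i < n) (F (c0 + dl n i) - F c0) @[n --> \oo] --> l.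

Let phi (h t : R) : R := (t <= c0 + h)%R%:R - (t <= c0)%R%:R.

Let mphi h : measurable_fun setT (phi h).
Proof. by apply: measurable_funB; exact: ind_measurable. Qed.

Let phiB h t : `|phi h t| <= 1 * (1 + t ^+ 2).
Proof.
have := sqr_ge0 t; rewrite /phi mul1r.
by case: (t <= c0 + h)%R; case: (t <= c0)%R; rewrite ?subrr ?subr0 ?sub0r ?normrN ?normr1 ?normr0 /=; lra.
Qed.

Let phi_mean h : \int[nu]_t phi h t = F (c0 + h) - F c0.
Proof.
rewrite RintegralB// ?ind_mean//.
- exact: (nu_integrable2 (ind_measurable _) (ind_bound _)).1.
- exact: (nu_integrable2 (ind_measurable _) (ind_bound _)).1.
Qed.

Let phi_sqr h : \int[nu]_t ((phi h t - \int[nu]_t phi h t) ^+ 2) <= `|F (c0 + h) - F c0|.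
Proof.
set m := \int[nu]_t phi h t; have [i1 i2] := nu_integrable2 (mphi h) (phiB h).
have ic (a : R) : nu.-integrable setT (EFin \o (fun _ : R => a)) by exact: finite_measure_integrable_cst.
have -> : \int[nu]_t ((phi h t - m) ^+ 2) = \int[nu]_t (phi h t ^+ 2) - m ^+ 2.
  transitivity (\int[nu]_t (phi h t ^+ 2 - (2 * m * phi h t - m ^+ 2))).
    by apply: eq_Rintegral => t _; ring.
  have i3 : nu.-integrable setT (EFin \o (fun t => 2 * m * phi h t)) by exact: (integrableZl measurableT (2 * m) i1).
  rewrite RintegralB//; last exact: (integrableB measurableT i3 (ic (m ^+ 2))).
  by rewrite RintegralB// RintegralZl// bounded_mean_cst -/m; ring.
apply: (@le_trans _ _ (\int[nu]_t (phi h t ^+ 2))); first by rewrite gerBl sqr_ge0.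
have [h0|h0] := lerP 0 h.
  have -> : (fun t => phi h t ^+ 2) = phi h.
    apply/funext => t; rewrite /phi; case: (leP t c0) => h1.
      by rewrite (le_trans h1) ?lerDl// subrr expr0n.
    by case: (t <= _)%R; rewrite subr0 ?expr1n ?expr0n.
  by rewrite phi_mean ler_norm.
have -> : (fun t => phi h t ^+ 2) = fun t => - 1 * phi h t.
  apply/funext => t; rewrite /phi; case: (leP t (c0 + h)) => h1.
    by rewrite (le_trans h1) ?subrr ?expr0n ?mulr0// gerDl ltW.
  by case: (t <= _)%R; rewrite sub0r ?sqrrN ?expr1n ?oppr0 ?expr0n ?mulr0// mulrNN mulr1.
by rewrite RintegralZl// phi_mean mulN1r -normrN ler_norm.
Qed.

Lemma whp_increments (k : R) : 0 < k -> whp P [set t |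
  `|(Num.sqrt t.1%:R)^-1 * \sum_(i < t.1) ((eps i t.2 <= c0 + dl t.1 i)%R%:R - (eps i t.2 <= c0)%R%:R) - l| <= k].
Proof.
move=> k0; have k2 : 0 < k / 2 by rewrite divr_gt0.
pose q n : R := Num.sqrt n%:R.
pose psi n i t := (if (i < n)%N then (q n)^-1 else 0) * (phi (dl n i) t - \int[nu]_t phi (dl n i) t).
have mpsi n i : measurable_fun setT (psi n i) by apply: measurable_funM => //; exact: measurable_funB.
have psi0 n i : \int[nu]_t psi n i t = 0 by apply: centred_mean (mphi _) (phiB _) _.
have F01 a : `|F a| <= 1.
  rewrite -ind_mean; apply: bounded_mean_le.
    by split; [exact: ind_measurable|exists 1 => t; case: (t <= a)%R; rewrite ?normr1 ?normr0].
  by move=> t; case: (t <= a)%R; rewrite ?normr1 ?normr0.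
have psiB n i t : `|psi n i t| <= ((q n)^-1 * (1 + 2)) * (1 + t ^+ 2).
  rewrite /psi normrM -mulrA ler_pM//.
    by case: ifP => _; rewrite ?normr0 ?invr_ge0 ?sqrtr_ge0// ger0_norm// invr_ge0 sqrtr_ge0.
  apply: (le_trans (centred_bound (phiB _) t)); rewrite ler_wpM2r ?addr_ge0 ?sqr_ge0//.
  by rewrite lerD2l phi_mean (le_trans (ler_normB _ _))// (_ : 2 = 1 + 1)// lerD.
have vE n : \sum_(i < n) \int[nu]_t (psi n i t ^+ 2) <= n%:R^-1 * \sum_(i < n) `|F (c0 + dl n i) - F c0|.
  rewrite mulr_sumr; apply: ler_sum => i _; rewrite /psi ltn_ord (scaled_sqr_mean (mphi _) (phiB _)).
  by rewrite exprVn sqr_sqrtr ?ler0n// ler_wpM2l ?invr_ge0 ?ler0n.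
have v0 : n%:R^-1 * \sum_(i < n) `|F (c0 + dl n i) - F c0| @[n --> \oo] --> (0 : R).
  apply/cvgRP => e e0; apply: filterS2 (dl0 e0) (nbhs_infty_gt 0) => n hn n0.
  rewrite subr0 ger0_norm; last by rewrite mulr_ge0 ?invr_ge0 ?ler0n// sumr_ge0.
  rewrite -/(fmean (fun i : 'I_n => `|F (c0 + dl n i) - F c0|)) -(fmean_cst n0 e).
  by apply: le_fmean => i; exact: hn.
have vN : \forall n \near \oo, \sum_(i < n) \int[nu]_t (psi n i t ^+ 2) <= n%:R^-1 * \sum_(i < n) `|F (c0 + dl n i) - F c0|.
  exact: nearW.
have w1 := whp_psum mpsi psiB psi0 vN v0 k2.
have w2' : \forall n \near \oo, `|(q n)^-1 * \sum_(i < n) (F (c0 + dl n i) - F c0) - l| <= k / 2.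
  exact: cvgR_near dl1 k2.
have w2 := whp_near P w2'.
apply: whp_setS (whp_setI w1 w2) => t [/= h1 h2].
rewrite (splitr k) -[X in `|X - _|](subrK ((Num.sqrt t.1%:R)^-1 * \sum_(i < t.1) (F (c0 + dl t.1 i) - F c0))).
rewrite -addrA (le_trans (ler_normD _ _))// lerD//.
rewrite -mulrBr -sumrB mulr_sumr; move: h1; rewrite /psum; congr (`|_| <= _).
by apply: eq_bigr => i _; rewrite /psi ltn_ord phi_mean.
Qed.
End increments.

Section dyadic_windows.
Variables (c0 L : R).
Hypothesis FL : forall h, 0 < h -> F (c0 + h) - F (c0 - 2 * h) <= L * h.

Let wc := window_count (fun t : nat * Omega => t.1) (fun t i => eps i t.2) c0.

(** A single statistic that controls the number of errors in all the windows
    around c0: the mean number of errors in a window is proportional to its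
    width, so weights decreasing faster than the dyadic widths increase keep
    the mean bounded. *)
Definition window_stat (n : nat) (w : Omega) : R := \sum_(k < n) (8 ^+ k)^-1 * wc (n, w) (4 ^+ k).

Let win_measurable (h : R) : measurable_fun setT (fun t : R => (`|t - c0| <= h)%R%:R : R).
Proof.
have -> : (fun t : R => (`|t - c0| <= h)%R%:R : R) = \1_(`[c0 - h, c0 + h]).
  apply/funext => t; rewrite indicE; congr (nat_of_bool _)%:R; rewrite ler_distl.
  by apply/idP/idP; rewrite inE/= in_itv.
by apply: measurable_indic; exact: measurable_itv.
Qed.

Let win_eps_measurable i (h : R) : measurable_fun setT (fun w => (`|eps i w - c0| <= h)%R%:R : R).
Proof. by apply: (measurableT_comp (win_measurable h)); exact: measurable_funP. Qed.

Let win_mean i (h : R) : 0 < h -> (\int[P]_w ((`|eps i w - c0| <= h)%R%:R)%:E <= (L * h)%:E)%E.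
Proof.
move=> h0; have i1 a := (nu_integrable2 (ind_measurable a) (ind_bound a)).1.
have mD : measurable_fun setT (fun t : R => (t <= c0 + h)%R%:R - (t <= c0 - 2 * h)%R%:R : R).
  by apply: measurable_funB; exact: ind_measurable.
have iD : nu.-integrable setT (EFin \o (fun t : R => (t <= c0 + h)%R%:R - (t <= c0 - 2 * h)%R%:R)).
  exact: (integrableB measurableT (i1 _) (i1 _)).
have le t : (`|t - c0| <= h)%R%:R <= (t <= c0 + h)%R%:R - (t <= c0 - 2 * h)%R%:R :> R.
  rewrite ler_distl; case: (leP t (c0 + h)) => h1; case: (leP t (c0 - 2 * h)) => h2; rewrite ?andbF ?andbT.
  - have -> : (c0 - h <= t)%R = false by apply/negbTE; rewrite -ltNge; lra.
    by rewrite subrr.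
  - by rewrite subr0; case: (c0 - h <= t)%R.
  - lra.
  - by rewrite subrr.
apply: (@le_trans _ _ (\int[P]_w ((eps i w <= c0 + h)%R%:R - (eps i w <= c0 - 2 * h)%R%:R)%:E)%E).
  have mDe : measurable_fun setT (fun w => (eps i w <= c0 + h)%R%:R - (eps i w <= c0 - 2 * h)%R%:R : R).
    by apply: (measurableT_comp mD); exact: measurable_funP.
  apply: ge0_le_integral => //; try exact/measurable_EFinP.
  by move=> w _; rewrite lee_fin (le_trans _ (le _)).
rewrite (law_ge0 eps_ident i (phi := fun t => ((t <= c0 + h)%R%:R - (t <= c0 - 2 * h)%R%:R)%:E)).
- rewrite -[leLHS]fineK; last exact: (integrable_fin_num measurableT iD).
  rewrite lee_fin -[fine _]/(\int[nu]_t ((t <= c0 + h)%R%:R - (t <= c0 - 2 * h)%R%:R)).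
  by rewrite RintegralB// !ind_mean FL.
- exact/measurable_EFinP.
- by move=> t; rewrite lee_fin (le_trans _ (le _)).
Qed.

Lemma sum_mean_le (m : nat) (g : nat -> Omega -> R) (b : nat -> R) :
  (forall i, measurable_fun setT (g i)) -> (forall i w, 0 <= g i w) ->
  (forall i, (\int[P]_w (g i w)%:E <= (b i)%:E)%E) ->
  (\int[P]_w (\sum_(i < m) g i w)%:E <= (\sum_(i < m) b i)%:E)%E.
Proof.
move=> mg g0 gb; elim: m => [|m IH].
  by under eq_integral do rewrite big_ord0; rewrite integral0 big_ord0.
under eq_integral do rewrite big_ord_recr/= EFinD.
rewrite ge0_integralD//.
- by rewrite big_ord_recr/= EFinD leeD.
- by move=> w _; rewrite lee_fin sumr_ge0.
- by apply/measurable_EFinP; apply: measurable_sum.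
- by move=> w _; rewrite lee_fin.
- exact/measurable_EFinP.
Qed.

Lemma scaled_mean_le (a : R) (g : Omega -> R) (b : R) : 0 <= a -> measurable_fun setT g ->
  (forall w, 0 <= g w) -> (\int[P]_w (g w)%:E <= b%:E)%E -> (\int[P]_w (a * g w)%:E <= (a * b)%:E)%E.
Proof.
move=> a0 mg g0 gb; under eq_integral do rewrite EFinM.
rewrite ge0_integralZl//; [|exact/measurable_EFinP|by move=> w _; rewrite lee_fin].
by rewrite EFinM lee_wpmul2l.
Qed.

Let wc_measurable n (z : R) : measurable_fun setT (fun w => wc (n, w) z).
Proof. rewrite /wc /window_count /=; apply: measurable_funM => //.
by apply: measurable_sum => i; exact: win_eps_measurable. Qed.

Lemma window_stat_measurable n : measurable_fun setT (window_stat n).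
Proof. by apply: measurable_sum => k; apply: measurable_funM => //; exact: wc_measurable. Qed.

Let wc_ge0 t z : 0 <= wc t z.
Proof. by rewrite mulr_ge0 ?invr_ge0 ?sqrtr_ge0// sumr_ge0. Qed.

Lemma window_stat_ge0 n w : 0 <= window_stat n w.
Proof. by apply: sumr_ge0 => k _; rewrite mulr_ge0// invr_ge0 exprn_ge0. Qed.

Lemma tight_window_stat : tight P window_stat.
Proof.
have L0 : 0 <= L.
  have := FL ltr01; rewrite [L * 1]mulr1; apply: le_trans; rewrite -!ind_mean subr_ge0.
  have bi a : bounded_mfun (fun t : R => (t <= a)%R%:R : R).
    by split; [exact: ind_measurable|exists 1 => t; case: (t <= a)%R; rewrite ?normr1 ?normr0].
  apply: le_Rintegral => //; try exact: (bounded_mfun_integrable nu (bi _)).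
  by move=> t _; rewrite ler_nat; case: leP => // h; rewrite (le_trans h)//; lra.
apply: (tight_markov (K := 2 * L)) => //; [exact: window_stat_measurable|exact: window_stat_ge0|].
exists 1%N => // n /= n0; have q0 : 0 < Num.sqrt n%:R :> R by rewrite sqrtr_gt0 ltr0n.
apply: (@le_trans _ _ (\sum_(k < n) (8 ^+ k)^-1 * (L * 4 ^+ k))%:E).
  apply: (sum_mean_le n (g := fun k w => (8 ^+ k)^-1 * wc (n, w) (4 ^+ k)) (b := fun k => (8 ^+ k)^-1 * (L * 4 ^+ k))) => k.
  - by apply: measurable_funM => //; exact: wc_measurable.
  - by move=> w; rewrite mulr_ge0// invr_ge0 exprn_ge0.
  apply: scaled_mean_le; [by rewrite invr_ge0 exprn_ge0|exact: wc_measurable|by []|].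
  have -> : L * 4 ^+ k = (Num.sqrt n%:R)^-1 * (\sum_(i < n) L * (4 ^+ k / Num.sqrt n%:R)).
    rewrite sumr_const card_ord -[X in _ = _ * X]mulr_natl.
    have := @sqr_sqrtr R n%:R (ler0n _ _); move: q0; move: (Num.sqrt n%:R) => q q0 <-.
    by field; rewrite gt_eqF.
  rewrite /wc /window_count /=; apply: scaled_mean_le; first by rewrite invr_ge0 sqrtr_ge0.
  - by apply: measurable_sum => i; exact: win_eps_measurable.
  - by move=> w; apply: sumr_ge0.
  apply: (sum_mean_le n (g := fun i w => (`|eps i w - c0| <= 4 ^+ k / Num.sqrt n%:R)%R%:R) (b := fun _ => L * (4 ^+ k / Num.sqrt n%:R))) => // i.
  by apply: win_mean; rewrite divr_gt0// exprn_gt0.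
rewrite lee_fin; have -> : \sum_(k < n) (8 ^+ k)^-1 * (L * 4 ^+ k) = L * \sum_(k < n) (2^-1 : R) ^+ k.
  rewrite mulr_sumr; apply: eq_bigr => k _; rewrite mulrCA; congr (_ * _).
  rewrite -exprVn -exprMn; congr (_ ^+ _); by field.
rewrite mulrC ler_wpM2r//; elim: (n) => [|m IH]; first by rewrite big_ord0.
rewrite big_ord_recl expr0; under eq_bigr do rewrite lift0 exprS.
rewrite -mulr_sumr; lra.
Qed.

(** A window of half-width z lies in the dyadic one with the least k such that
    z <= 4 ^ k; the bound on the statistic gives a multiple of 8 ^ k for its
    count, that is of the power 3 / 2 of z, which is negligible with respect to
    z ^ 2. When k >= n the total number of errors is already small enough. *)
Lemma window_growth (U : set_system (nat * Omega)) (Lb : R) : UltraFilter U ->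
  (forall m, \forall t \near U, (m <= t.1)%N) -> (\forall t \near U, window_stat t.1 t.2 <= Lb) ->
  forall rho : R, 0 < rho -> exists K : R, \forall t \near U, forall z, K <= z -> wc t z <= rho * z ^+ 2.
Proof.
move=> UU Ny GL rho rho0; have Lb0 : 0 <= `|Lb| by [].
pose S := 8 * `|Lb| / rho; have S0 : 0 <= S by rewrite divr_ge0 ?mulr_ge0// ltW.
exists (1 + rho^-1 + S ^+ 2); apply: filterS2 (Ny 1%N) GL => -[n w] /= n0 hG z hz.
have r0 : 0 < rho^-1 by rewrite invr_gt0.
have z1 : 1 < z by have := sqr_ge0 S; lra.
have z0 : 0 < z by lra.
have rz : 1 <= rho * z by rewrite mulrC -ler_pdivrMr// mul1r; have := sqr_ge0 S; lra.
have ex : exists k, z <= 4 ^+ k.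
  exists (Num.truncn z).+1; rewrite ltW// (lt_le_trans (truncnS_gt _))//.
  by rewrite -natrX ler_nat ltnW// ltn_expl.
have [k zk kmin] := ex_minnP ex; have k0 : (0 < k)%N.
  by rewrite lt0n; apply/eqP => kE; move: zk; rewrite kE expr0; lra.
have kz : 4 ^+ k.-1 < z.
  by rewrite ltNge; apply/negP => /kmin; rewrite leqNgt prednK// leqnn.
have [kn|nk] := ltnP k n.
  have g1 : (8 ^+ k)^-1 * wc (n, w) (4 ^+ k) <= `|Lb|.
    apply: le_trans (le_trans hG (ler_norm _)).
    rewrite /window_stat (bigD1 (Ordinal kn))//= lerDl; apply: sumr_ge0 => j _.
    by rewrite mulr_ge0// invr_ge0 exprn_ge0.
  apply: (le_trans (@window_count_homo _ _ _ _ c0 (n, w) _ _ zk)).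
  move: g1; rewrite mulrC ler_pdivrMr ?exprn_gt0// => /le_trans; apply.
  pose s := Num.sqrt z; have sE : z = s ^+ 2 by rewrite sqr_sqrtr// ltW.
  have s0 : 0 <= s by exact: sqrtr_ge0.
  have k2 : 2 ^+ k <= 2 * s :> R.
    have h2 : (2 ^+ k) ^+ 2 = 4 ^+ k :> R by rewrite -exprM mulnC exprM -natrX.
    have h4 : (2 * s) ^+ 2 = 4 * z by rewrite sE; ring.
    rewrite -ler_sqr ?nnegrE ?exprn_ge0 ?mulr_ge0// h2 h4.
    by rewrite -[k](prednK k0) exprS ler_pM2l// ltW.
  have k8 : 8 ^+ k <= 8 * s ^+ 3.
    have -> : 8 ^+ k = (2 ^+ k) ^+ 3 :> R by rewrite -exprM mulnC exprM; congr (_ ^+ _); ring.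
    have -> : 8 * s ^+ 3 = (2 * s) ^+ 3 by ring.
    by rewrite lerXn2r ?nnegrE ?exprn_ge0 ?mulr_ge0.
  have Ss : S <= s.
    by rewrite -ler_sqr ?nnegrE// -sE; lra.
  apply: (@le_trans _ _ (`|Lb| * (8 * s ^+ 3))); first by rewrite ler_wpM2l.
  move: Ss; rewrite /S ler_pdivrMr// => Ss; rewrite sE.
  have -> : `|Lb| * (8 * s ^+ 3) = (8 * `|Lb|) * s ^+ 3 by ring.
  have -> : rho * (s ^+ 2) ^+ 2 = (s * rho) * s ^+ 3 by ring.
  by rewrite ler_wpM2r// exprn_ge0.
have q0 : 0 < Num.sqrt n%:R :> R by rewrite sqrtr_gt0 ltr0n.
apply: (@le_trans _ _ z); last by rewrite expr2 mulrA ler_peMl// ltW.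
apply: (@le_trans _ _ n%:R).
  rewrite /wc /window_count /= ler_pdivrMl//; apply: (@le_trans _ _ (\sum_(i < n) 1)).
    by apply: ler_sum => i _; rewrite lern1; case: (_ <= _)%R.
  have q1 : 1 <= Num.sqrt n%:R :> R by rewrite -[leLHS]sqrtr1 ler_wsqrtr// ler1n.
  by rewrite sumr_const card_ord ler_peMl// ler0n.
apply: le_trans (ltW kz); rewrite -natrX ler_nat -(ltn_predK k0) /=.
have nk' : (n <= k.-1.+1)%N by rewrite prednK.
apply: (leq_trans nk'); by rewrite ltn_expl.
Qed.
End dyadic_windows.
End law_of_large_numbers.

(** * Gaussian limit of the coverage in a fixed design *)

Section fixed_design.
Context {R : realType} {d : measure_display} {Omega : measurableType d} (P : probability Omega R).
Variable eps : nat -> {RV P >-> R}.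
Hypothesis eps_indep : mutual_indep P (fun i => eps i : Omega -> R).
Hypothesis eps_ident : forall i (B : set R), measurable B ->
  distribution P (eps i) B = distribution P (eps 0%N) B.
Let nu := distribution P (eps 0%N).
Hypothesis nu4 : nu.-integrable setT (fun t => (t ^+ 4)%:E).
Let F := real_cdf (eps 0%N).
Let H := truncated_mean (eps 0%N).
Variable sigma : R.
Hypothesis nu_mean : \int[nu]_t t = 0.
Hypothesis nu_var : \int[nu]_t (t ^+ 2) = sigma ^+ 2.
Hypothesis dF : forall t, derivable F t 1.
Hypothesis nu_atom : forall a, nu [set a] = 0%E.

Let id_bound (t : R) : `|t| <= 1 * (1 + t ^+ 2).
Proof. by rewrite mul1r abs_le_sqr. Qed.
Let id_meas : measurable_fun setT (fun t : R => t). Proof. exact: measurable_id. Qed.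

Variables (p : nat) (x : nat -> 'cV[R]_p) (xf beta : 'cV[R]_p) (A : 'M[R]_p) (b : 'cV[R]_p) (M : R).
Hypothesis uX : forall n, (p <= n)%N -> (design x n)^T *m design x n \in unitmx.
Hypothesis uA : A \in unitmx.
Hypothesis XA : n%:R^-1 *: ((design x n)^T *m design x n) @[n --> \oo] --> A.
Hypothesis xb : n%:R^-1 *: (\sum_(i < n) x i) @[n --> \oo] --> b.
Hypothesis M0 : 0 < M.
Hypothesis xM : forall i, norm2 (x i) <= M.
Hypothesis xfM : norm2 xf <= M.

Let q (n : nat) : R := Num.sqrt n%:R.
Let q0 n : (0 < n)%N -> 0 < q n. Proof. by move=> n0; rewrite sqrtr_gt0 ltr0n. Qed.
Let q_sqr n : q n ^+ 2 = n%:R. Proof. by rewrite sqr_sqrtr// ler0n. Qed.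

Lemma near_sqrt_ge (K : R) : \forall n \near \oo, K <= q n.
Proof.
apply: filterS (near_nat_ge (K ^+ 2)) => n h.
by rewrite (le_trans (ler_norm K))// -sqrtr_sqr ler_wsqrtr.
Qed.

(** Moving the threshold by an affine function of the regressor, at scale
    1 / sqrt n, moves the mean count linearly. *)
Lemma design_increments (c0 et : R) (th : 'cV[R]_p) (dl := fun n i => (dot (x i) th + et) / q n) :
  (forall k : R, 0 < k -> \forall n \near \oo, forall i, (i < n)%N -> `|F (c0 + dl n i) - F c0| <= k) /\
  ((Num.sqrt n%:R)^-1 * \sum_(i < n) (F (c0 + dl n i) - F c0) @[n --> \oo] --> derive1 F c0 * (dot b th + et)).
Proof.
pose f := derive1 F c0; pose B := M * \sum_j `|th j 0| + `|et| + 1.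
have S0 : 0 <= \sum_j `|th j 0| by apply: sumr_ge0.
have B0 : 0 < B by rewrite ltr_wpDl// addr_ge0// mulr_ge0// ltW.
have bB i : `|dot (x i) th + et| <= B.
  apply: (le_trans (ler_normD _ _)); rewrite /B -addrA lerD//; last by rewrite lerDl.
  exact: dot_bound.
have dB n i : (0 < n)%N -> `|dl n i| <= B / q n.
  by move=> n0; rewrite normrM normfV (gtr0_norm (q0 n0)) ler_pM2r ?invr_gt0 ?q0.
have small (k dd : R) : 0 < k -> 0 < dd -> (forall h, `|h| <= dd -> `|F (c0 + h) - F c0 - f * h| <= k * `|h|) ->
    \forall n \near \oo, (0 < n)%N /\ forall i, `|F (c0 + dl n i) - F c0 - f * dl n i| <= k * (B / q n).
  move=> k0 d0 hd; apply: filterS2 (nbhs_infty_gt 0) (near_sqrt_ge (B / dd)) => n n0 hn; split=> // i.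
  have h1 : B / q n <= dd by rewrite ler_pdivrMr ?q0// mulrC -ler_pdivrMr.
  apply: (le_trans (hd _ (le_trans (dB n i n0) h1))); rewrite ler_wpM2l ?(ltW k0)//; exact: dB.
split.
  move=> k k0; have [dd d0 hd] := derive_expansion (@dF c0) erefl ltr01.
  apply: filterS2 (small 1 dd ltr01 d0 hd) (near_sqrt_ge ((1 + `|f|) * B / k)) => n [n0 hn] hk i _.
  rewrite -[X in `|X|](subrK (f * dl n i)) (le_trans (ler_normD _ _))//.
  apply: (@le_trans _ _ ((1 + `|f|) * (B / q n))).
    rewrite [leRHS]mulrDl; apply: lerD; first exact: hn.
    by rewrite normrM ler_wpM2l// dB.
  by move: hk; rewrite ler_pdivrMr// [q n * k]mulrC mulrA -ler_pdivrMr ?q0.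
have mean_lim : f * (dot (n%:R^-1 *: \sum_(i < n) x i) th + et) @[n --> \oo] --> f * (dot b th + et).
  have h j : (n%:R^-1 *: \sum_(k < n) x k) j 0 @[n --> \oo] --> (b j 0 : R).
    by apply: (cvg_comp _ (fun C : 'cV[R]_p => C j 0) xb); exact: coord_continuous.
  apply: cvgM; first exact: cvg_cst.
  apply: cvgD; last exact: cvg_cst.
  rewrite dotE; under eq_fun do rewrite dotE.
  apply: cvg_sumR => j _; apply: cvgM; [exact: h|exact: cvg_cst].
apply/cvgRP => k k0; have k2 : 0 < k / 2 by rewrite divr_gt0.
have kB : 0 < k / 2 / B by rewrite divr_gt0.
have [dd d0 hd] := derive_expansion (@dF c0) erefl kB.
have hm : \forall n \near \oo, `|f * (dot (n%:R^-1 *: \sum_(i < n) x i) th + et) - f * (dot b th + et)| <= k / 2.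
  exact: cvgR_near mean_lim k2.
apply: filterS2 (small _ dd kB d0 hd) hm => n [n0 hn] h2.
have meanE : f * (dot (n%:R^-1 *: \sum_(i < n) x i) th + et) = (q n)^-1 * \sum_(i < n) f * dl n i.
  have qn := q0 n0.
  have -> : dot (n%:R^-1 *: \sum_(i < n) x i) th + et = fmean (fun i : 'I_n => dot (x i) th + et).
    rewrite fmeanD fmean_cst//; congr (_ + _); rewrite dotE /fmean.
    under [in RHS]eq_bigr do rewrite dotE.
    rewrite exchange_big/= mulr_sumr; apply: eq_bigr => j _.
    by rewrite mxE summxE -mulr_suml mulrA.
  rewrite /fmean !mulr_sumr; apply: eq_bigr => i _; rewrite /dl -q_sqr; field.
  by rewrite gt_eqF.
move: h2; rewrite meanE => h2.
rewrite (splitr k) -[X in `|X - _|](subrK ((q n)^-1 * \sum_(i < n) f * dl n i)) -addrA.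
rewrite (le_trans (ler_normD _ _))// lerD// -mulrBr -sumrB normrM (gtr0_norm (_ : 0 < (q n)^-1)) ?invr_gt0 ?q0//.
rewrite ler_pdivrMl ?q0// (le_trans (ler_norm_sum _ _ _))//.
apply: (@le_trans _ _ (\sum_(i < n) k / 2 / B * (B / q n))).
  by apply: ler_sum => i _; exact: hn.
rewrite sumr_const card_ord -[leLHS]mulr_natl -q_sqr.
rewrite le_eqVlt; apply/orP; left; apply/eqP; field.
by rewrite !gt_eqF ?q0.
Qed.

(** Along an ultrafilter finer than high probability, a statistic converges to
    its limit in probability. *)
Lemma whp_cvg_ultra (U : set_system (nat * Omega)) (f : nat * Omega -> R) (l : R) :
  UltraFilter U -> whp P `<=` U -> (forall k, 0 < k -> whp P [set t | `|f t - l| <= k]) ->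
  f t @[t --> U] --> l.
Proof. by move=> UU WU h; apply/cvgRP => k k0; exact: WU (h k k0). Qed.

Let sqr_bound (s L : R) : s ^+ 2 <= L -> `|s| <= 1 + L.
Proof. by move=> h; apply: (le_trans (abs_le_sqr s)); rewrite lerD2l. Qed.

Let W c0 (t : nat * Omega) : R := (q t.1)^-1 * \sum_(i < t.1) ((eps i t.2 <= c0)%R%:R - F c0).

Let weight_sum (a : R) n : (0 < n)%N -> \sum_(i < n) ((q n)^-1 * a) ^+ 2 = a ^+ 2.
Proof.
move=> n0; rewrite sumr_const card_ord -[LHS]mulr_natl -q_sqr; field.
by rewrite gt_eqF ?q0.
Qed.

Lemma tight_counts c0 : tight P (fun n w => W c0 (n, w) ^+ 2).
Proof.
have := tight_weighted eps_indep eps_ident nu4 (ind_measurable c0) (ind_bound c0) (a := fun n _ => (q n)^-1) (K := 1).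
rewrite ind_mean => h; have {}h := h _.
have -> : (fun n w => W c0 (n, w) ^+ 2) = fun n w => (\sum_(i < n) (q n)^-1 * ((eps i w <= c0)%R%:R - F c0)) ^+ 2.
  by apply/funext => n; apply/funext => w; rewrite /W mulr_sumr.
apply: h; exists 1%N => // n /= n0.
by have := weight_sum 1 n0; rewrite expr1n => <-; apply: ler_sum => i _; rewrite mulr1.
Qed.

Lemma tight_linear (a : nat -> R) (K : R) : (forall i, `|a i| <= K) ->
  tight P (fun n w => ((q n)^-1 * \sum_(i < n) a i * eps i w) ^+ 2).
Proof.
move=> aK; have := tight_weighted eps_indep eps_ident nu4 id_meas id_bound (a := fun n i => (q n)^-1 * a i) (K := K ^+ 2).
rewrite nu_mean => h; have {}h := h _.
have -> : (fun n w => ((q n)^-1 * \sum_(i < n) a i * eps i w) ^+ 2) =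
    fun n w => (\sum_(i < n) (q n)^-1 * a i * (eps i w - 0)) ^+ 2.
  by apply/funext => n; apply/funext => w; rewrite mulr_sumr; congr (_ ^+ 2);
    apply: eq_bigr => i _; rewrite subr0 mulrA.
apply: h; exists 1%N => // n /= n0.
rewrite -(weight_sum K n0); apply: ler_sum => i _; rewrite !exprMn ler_wpM2l ?sqr_ge0//.
rewrite -[a i ^+ 2]real_normK ?num_real// -[K ^+ 2]real_normK ?num_real//.
by rewrite lerXn2r ?nnegrE// (le_trans (aK i))// ler_norm.
Qed.

Lemma tight_quartic : tight P (fun n w => fmean (fun j : 'I_n => eps j w ^+ 4)).
Proof.
pose m4 := \int[nu]_t (t ^+ 4).
have m4x : measurable_fun setT (fun t : R => t ^+ 4) by exact: measurable_funX.
have me i : measurable_fun setT (fun w => eps i w ^+ 4).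
  by apply: (measurableT_comp m4x); exact: measurable_funP.
have q4 (t : R) : 0 <= t ^+ 4 by rewrite (exprM t 2 2) sqr_ge0.
apply: (tight_markov (K := m4)).
- by move=> n; apply: measurable_funM => //; apply: measurable_sum => i; exact: me.
- by move=> n w; apply: fmean_ge0 => j; exact: q4.
exists 1%N => // n /= n0; have -> : m4 = n%:R^-1 * \sum_(i < n) m4 by rewrite -/(fmean (fun _ => m4)) fmean_cst.
apply: scaled_mean_le; first by rewrite invr_ge0 ler0n.
- by apply: measurable_sum => i; exact: me.
- by move=> w; apply: sumr_ge0 => i _; exact: q4.
apply: (@sum_mean_le _ _ _ P n (fun i w => eps i w ^+ 4) (fun _ => m4)) => // i.
rewrite (law_ge0 eps_ident i (phi := fun t => (t ^+ 4)%:E)).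
- by rewrite /m4 /Rintegral fineK//; exact: (integrable_fin_num measurableT nu4).
- exact/measurable_EFinP.
- by move=> t; rewrite lee_fin.
Qed.

Lemma near_increment_bound c0 : exists L, forall h, 0 < h -> F (c0 + h) - F (c0 - 2 * h) <= L * h.
Proof.
have [dd d0 hd] := derive_expansion (@dF c0) erefl ltr01.
have F01 a : 0 <= F a <= 1.
  apply/andP; split; first exact: fine_ge0.
  by rewrite -lee_fin fineK ?fin_num_measure//; exact: probability_le1.
set f := derive1 F c0 in hd; exists ((1 + `|f|) * 3 + 2 / dd) => h h0.
have d1 : 0 <= 2 / dd by rewrite divr_ge0// ltW.
have f0 : 0 <= (1 + `|f|) * 3 by rewrite mulr_ge0// addr_ge0.
have [hl|hl] := lerP (2 * h) dd; last first.
  have h1 : 1 <= 2 / dd * h by rewrite mulrAC ler_pdivlMr// mul1r ltW.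
  have /andP[u1 u2] := F01 (c0 + h); have /andP[u3 u4] := F01 (c0 - 2 * h).
  have : 0 <= (1 + `|f|) * 3 * h by rewrite mulr_ge0// ltW.
  by move=> h5; rewrite [leRHS]mulrDl; lra.
have g1 : `|F (c0 + h) - F c0 - f * h| <= h.
  by have := hd h; rewrite gtr0_norm// mul1r; apply; lra.
have g2 : `|F (c0 - 2 * h) - F c0 + f * (2 * h)| <= 2 * h.
  by have := hd (- (2 * h)); rewrite normrN gtr0_norm ?mulr_gt0// mul1r mulrN opprK; apply.
have fh : f * h <= `|f| * h by rewrite ler_wpM2r ?(ltW h0)// ler_norm.
have : 0 <= 2 / dd * h by rewrite mulr_ge0// ltW.
move=> h5; rewrite [leRHS]mulrDl; move: g1 g2; rewrite [f * (2 * h)]mulrCA !ler_norml => /andP[_ g1] /andP[g2 _].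
have -> : (1 + `|f|) * 3 * h = 3 * h + 3 * (`|f| * h) by ring.
move: (f * h) (`|f| * h) (2 / dd * h) fh g1 g2 h5 => y1 y2 y3 *; lra.
Qed.

Variables (c alpha gam0 Q : R).
Let f1 := derive1 F c.
Let f2 := derive1 F (- c).
Hypotheses (c0 : 0 < c) (f10 : 0 < f1) (f20 : 0 < f2).
Hypothesis Fc : F c - F (- c) = 1 - alpha.
Let mu := \int[nu]_t (t * ((t <= c)%R%:R - (t <= - c)%R%:R)).
Let s2 := sigma ^+ 2.
Let v1 := dot xf (invmx A *m xf).
Let v2 := dot xf (invmx A *m b).
Let g := f1 - f2.
Let V := g ^+ 2 * s2 * (v1 + 1 - 2 * v2) - 2 * g * mu * (v2 - 1) + (1 - alpha) * alpha.
Hypothesis V0 : 0 < V.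
Hypothesis QE : gcdf (V / gauss_m2) Q = 1 - gam0.

Let e (t : nat * Omega) i := eps i t.2.
Let y n w := obs eps beta (cst x) n w.
Let zeta n w := ols (design x n) (\col_(i < n) eps i w).
Definition error_score (t : nat * Omega) : R :=
  coverage_score x xf (fun t : nat * Omega => t.1) e F c t.

Let phimu (t : R) : R := t * ((t <= c)%R%:R - (t <= - c)%R%:R).
Lemma phimu_measurable : measurable_fun setT phimu.
Proof. by apply: measurable_funM => //; apply: measurable_funB; exact: ind_measurable. Qed.
Lemma phimu_bound t : `|phimu t| <= 1 * (1 + t ^+ 2).
Proof.
rewrite normrM (le_trans _ (id_bound t))// ler_piMr//.
by case: (t <= c)%R; case: (t <= - c)%R; rewrite ?subrr ?subr0 ?sub0r ?normrN ?normr1 ?normr0.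
Qed.

Lemma le_sum7 (a1 a2 a3 a4 a5 a6 a7 : R) : 0 <= a1 -> 0 <= a2 -> 0 <= a3 -> 0 <= a4 ->
  0 <= a5 -> 0 <= a6 -> 0 <= a7 -> let S := a1 + (a2 + (a3 + (a4 + (a5 + (a6 + a7))))) in
  [/\ a1 <= S, a2 <= S, a3 <= S & [/\ a4 <= S, a5 <= S, a6 <= S & a7 <= S]].
Proof. by move=> ? ? ? ? ? ? ? /=; split; [lra|lra|lra|split; lra]. Qed.

(** The tight statistics controlling errors, estimates and window counts are
    added into one, and the expansion along ultrafilters is transferred. *)
Lemma whp_coverage_expansion (k : R) : 0 < k -> whp P [set t | exists C : R,
  [/\ 0 < C, Cstar (design x t.1) xf (y t.1 t.2) (1 - alpha) (1 - gam0) = C%:E,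
    `|q t.1 * (F (dot xf (zeta t.1 t.2) + C) - F (dot xf (zeta t.1 t.2) - C) - (1 - alpha)) -
      (Q + error_score t)| <= k &
    `|F (dot xf (zeta t.1 t.2) + C) - F (dot xf (zeta t.1 t.2) - C) - (1 - alpha)| <= k]].
Proof.
move=> k0; have [L1 hL1] := near_increment_bound c; have [L2 hL2] := near_increment_bound (- c).
pose Zx j n w : R := ((q n)^-1 * \sum_(i < n) x i j 0 * eps i w) ^+ 2.
pose Ze n w : R := ((q n)^-1 * \sum_(i < n) 1 * eps i w) ^+ 2.
pose Z4 n w : R := fmean (fun j : 'I_n => eps j w ^+ 4).
pose Z n w := \sum_(j < p) Zx j n w + (Ze n w + (Z4 n w + (W c (n, w) ^+ 2 + (W (- c) (n, w) ^+ 2 +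
  (window_stat eps c n w + window_stat eps (- c) n w))))).
have tZ : tight P Z.
  have tS : tight P (fun n w => \sum_(j < p) Zx j n w).
    have tx j : tight P (Zx j).
      exact: (@tight_linear (fun i => x i j 0) M (fun i => le_trans (norm2_coord _ _) (xM i))).
    exact: (tight_sum _ tx).
  have tE : tight P Ze.
    by refine (@tight_linear (fun _ => 1) 1 _) => i; rewrite normr1.
  have tG1 := tight_window_stat eps_ident nu4 hL1; have tG2 := tight_window_stat eps_ident nu4 hL2.
  exact: (tightD tS (tightD tE (tightD tight_quartic (tightD (tight_counts c)
    (tightD (tight_counts (- c)) (tightD tG1 tG2)))))).
have Zx0 j n w : 0 <= Zx j n w by exact: sqr_ge0.
have SZ0 n w : 0 <= \sum_(j < p) Zx j n w by apply: sumr_ge0.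
have Ze0 n w : 0 <= Ze n w by exact: sqr_ge0.
have Z40 n w : 0 <= Z4 n w by apply: fmean_ge0 => j; rewrite (exprM _ 2 2) sqr_ge0.
have W0 a n w : 0 <= W a (n, w) ^+ 2 by exact: sqr_ge0.
have G0 a n w : 0 <= window_stat eps a n w by exact: window_stat_ge0.
apply: whp_ultra tZ _ => U L UU WU ZL.
have comp (f : nat -> Omega -> R) : (forall n w, f n w <= Z n w) -> \forall t \near U, f t.1 t.2 <= L.
  by move=> fZ; apply: filterS ZL => t; exact: le_trans (fZ _ _).
have bnd (f : nat -> Omega -> R) : (forall n w, f n w ^+ 2 <= Z n w) -> exists l : R, f t.1 t.2 @[t --> U] --> l.
  move=> fZ; apply: ultra_bounded_cvg; exists (1 + L).
  by apply: filterS (comp _ fZ) => t; exact: sqr_bound.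
have Ny m : \forall t \near U, (m <= t.1)%N by apply: WU; exact: (whp_near P (nbhs_infty_ge m)).
have S7 n w := le_sum7 (SZ0 n w) (Ze0 n w) (Z40 n w) (W0 c n w) (W0 (- c) n w) (G0 c n w) (G0 (- c) n w).
have [m0 hm0] : exists l : R, (q t.1)^-1 * \sum_(i < t.1) 1 * eps i t.2 @[t --> U] --> l.
  by apply: (bnd (fun n w => (q n)^-1 * \sum_(i < n) 1 * eps i w)) => n w; have [_ h _ _] := S7 n w.
have em : (q t.1)^-1 * \sum_(i < t.1) e t i @[t --> U] --> m0.
  apply: cvg_trans hm0; apply: near_eq_cvg; apply: filterS (Ny 0%N) => t _.
  by congr (_ * _); apply: eq_bigr => i _; rewrite mul1r.
have /choice[xi hxi] : forall j, exists l : R, (q t.1)^-1 * \sum_(i < t.1) x i j 0 * eps i t.2 @[t --> U] --> l.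
  move=> j; apply: (bnd (fun n w => (q n)^-1 * \sum_(i < n) x i j 0 * eps i w)) => n w.
  have [h _ _ _] := S7 n w; apply: le_trans h.
  by rewrite (bigD1 j)//= lerDl; apply: sumr_ge0 => l _; exact: Zx0.
pose xi0 : 'cV[R]_p := \col_j xi j.
have exi j : (q t.1)^-1 * \sum_(i < t.1) x i j 0 * e t i @[t --> U] --> (xi0 j 0 : R).
  by rewrite mxE; exact: hxi.
have [w1 hw1] : exists l : R, W c t @[t --> U] --> l.
  have [l hl] : exists l : R, W c (t.1, t.2) @[t --> U] --> l.
    by apply: (bnd (fun n w => W c (n, w))) => n w; have [_ _ _ [h _ _ _]] := S7 n w.
  by exists l; exact: hl.
have [w2 hw2] : exists l : R, W (- c) t @[t --> U] --> l.
  have [l hl] : exists l : R, W (- c) (t.1, t.2) @[t --> U] --> l.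
    by apply: (bnd (fun n w => W (- c) (n, w))) => n w; have [_ _ _ [_ h _ _]] := S7 n w.
  by exists l; exact: hl.
have e4 : \forall t \near U, fmean (fun j : 'I_t.1 => e t j ^+ 4) <= L.
  by apply: (comp Z4) => n w; have [_ _ h _] := S7 n w.
have g1 : \forall t \near U, window_stat eps c t.1 t.2 <= L.
  by apply: (comp (window_stat eps c)) => n w; have [_ _ _ [_ _ h _]] := S7 n w.
have g2 : \forall t \near U, window_stat eps (- c) t.1 t.2 <= L.
  by apply: (comp (window_stat eps (- c))) => n w; have [_ _ _ [_ _ _ h]] := S7 n w.
have m2 : measurable_fun setT (fun t : R => t ^+ 2) by exact: measurable_funX.
have b2 (t : R) : `|t ^+ 2| <= 1 * (1 + t ^+ 2) by rewrite mul1r ger0_norm ?sqr_ge0// lerDr.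
have e2 : fmean (fun j : 'I_t.1 => e t j ^+ 2) @[t --> U] --> s2.
  apply: whp_cvg_ultra WU _ => l l0; rewrite /s2 -nu_var.
  exact: (whp_fmean eps_indep eps_ident nu4 m2 b2 l0).
have emu : fmean (fun j : 'I_t.1 => e t j * ((e t j <= c)%R%:R - (e t j <= - c)%R%:R)) @[t --> U] --> mu.
  apply: whp_cvg_ultra WU _ => l l0.
  exact: (whp_fmean eps_indep eps_ident nu4 phimu_measurable phimu_bound l0).
have J a th et : (q t.1)^-1 * \sum_(i < t.1)
    ((e t i <= a + (dot (x i) th + et) / q t.1)%R%:R - (e t i <= a)%R%:R) @[t --> U] --> derive1 F a * (dot b th + et).
  apply: whp_cvg_ultra WU _ => l l0; have [d1 d2] := design_increments a et th.
  exact: (whp_increments eps_indep eps_ident nu4 d1 d2 l0).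
have gr1 := window_growth UU Ny g1; have gr2 := window_growth UU Ny g2.
have [C [hC [hD hF]]] := coverage_expansion (UU := UU) uX uA XA xb xM beta xfM Ny e4 em exi c0 f10 f20 (@dF c) (@dF (- c))
  Fc e2 emu hw1 hw2 (J c) (J (- c)) gr1 gr2 V0 QE.
have hk : \forall t \near U, `|q t.1 * (F (dot xf (zeta t.1 t.2) + C t) - F (dot xf (zeta t.1 t.2) - C t) - (1 - alpha)) -
    (Q + error_score t) - 0| <= k by exact: cvgR_near hD k0.
have hk2 : \forall t \near U, `|F (dot xf (zeta t.1 t.2) + C t) - F (dot xf (zeta t.1 t.2) - C t) - (1 - alpha) - 0| <= k.
  exact: cvgR_near hF k0.
apply: filterS3 hC hk hk2 => t [Ct hCt] h h'; exists (C t); split=> //.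
  by move: h; rewrite subr0.
by move: h'; rewrite subr0.
Qed.

Let kap n i := q n * pred_weight x xf n i - (q n)^-1.
Let m := F c - F (- c).
Let ind (t : R) : R := (t <= c)%R%:R - (t <= - c)%R%:R.
Let psi n i (t : R) := - (g * kap n i) * t + (q n)^-1 * (ind t - m).

Lemma ind01_measurable : measurable_fun setT ind.
Proof. by apply: measurable_funB; exact: ind_measurable. Qed.

Lemma ind01_cases t : ind t = 0 \/ ind t = 1.
Proof.
rewrite /ind; case: (leP t c) => h1; case: (leP t (- c)) => h2.
- by left; rewrite subrr.
- by right; rewrite subr0.
- by have := lt_le_trans h1 h2; rewrite ltNge (le_trans _ (ltW c0))// oppr_le0 ltW.
- by left; rewrite subrr.
Qed.

Lemma psi_measurable n i : measurable_fun setT (psi n i).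
Proof.
apply: measurable_funD; first exact: measurable_funM.
by apply: measurable_funM => //; apply: measurable_funB => //; exact: ind01_measurable.
Qed.

Lemma psum_score n w : psum eps (psi n) n w = - error_score (n, w).
Proof.
rewrite /error_score /coverage_score -sumrN; apply: eq_bigr => i _.
rewrite /psi /kap /g /f1 /f2 /ind /m /e /q /=.
move: (derive1 F c) (derive1 F (- c)) (F c) (F (- c)) (Num.sqrt n%:R) ((Num.sqrt n%:R)^-1)
  (pred_weight x xf n i) ((eps i w <= c)%R%:R : R) ((eps i w <= - c)%R%:R : R) (eps i w : R).
by move=> a1 a2 a3 a4 a5 a6 a7 a8 a9 a10; ring.
Qed.

Let m_bound : `|m| <= 1.
Proof.
have : 0 <= m /\ m <= 1; last by move=> [? ?]; rewrite ger0_norm.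
have <- : \int[nu]_t ind t = m.
  rewrite RintegralB// ?ind_mean//.
  - exact: (nu_integrable2 nu4 (ind_measurable _) (ind_bound _)).1.
  - exact: (nu_integrable2 nu4 (ind_measurable _) (ind_bound _)).1.
split; first by apply: Rintegral_ge0 => t _; case: (ind01_cases t) => ->.
apply: (le_trans (ler_norm _)); apply: bounded_mean_le => [|t].
  by split; [exact: ind01_measurable|exists 1 => t; case: (ind01_cases t) => ->; rewrite ?normr0 ?normr1].
by case: (ind01_cases t) => ->; rewrite ?normr0 ?normr1.
Qed.

Let psi_linear n i (K : R) : (0 < n)%N -> `|g * kap n i| <= K / q n -> 2 <= K ->
  forall t, `|psi n i t| <= K / q n * (1 + `|t|).
Proof.
move=> n0 hk K2 t; have qn := q0 n0; rewrite mulrDr mulr1 addrC.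
apply: (le_trans (ler_normD _ _)); apply: lerD.
  by rewrite normrM normrN ler_wpM2r.
rewrite normrM (gtr0_norm (_ : 0 < (q n)^-1)) ?invr_gt0// mulrC ler_pM2r ?invr_gt0//.
apply: le_trans K2; apply: (le_trans (ler_normB _ _)); rewrite (_ : 2 = 1 + 1)// lerD//.
by case: (ind01_cases t) => ->; rewrite ?normr0 ?normr1.
Qed.

Lemma cube_quartic (t : R) : (1 + `|t|) ^+ 3 <= 16 * (1 + t ^+ 4).
Proof.
have -> : t ^+ 4 = `|t| ^+ 4 by rewrite !(exprM _ 2 2) real_normK ?num_real.
move: (normr_ge0 t); move: `|t| => a a0.
have [a1|a1] := lerP a 1.
  apply: (@le_trans _ _ (2 ^+ 3)); first by rewrite lerXn2r ?nnegrE ?addr_ge0//; lra.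
  by have := exprn_ge0 4 a0; rewrite -natrX; lra.
apply: (@le_trans _ _ ((2 * a) ^+ 3)); first by rewrite lerXn2r ?nnegrE ?addr_ge0 ?mulr_ge0//; lra.
have : a ^+ 3 <= a ^+ 4 by rewrite [_ ^+ 4]exprS ler_peMl ?exprn_ge0// ltW.
rewrite exprMn -natrX; have := exprn_ge0 3 a0; lra.
Qed.

Let Dm := 16 * (1 + \int[nu]_t (t ^+ 4)).

Let nu_power (n i : nat) (K : R) (j : nat) : (forall t, `|psi n i t| <= K * (1 + `|t|)) -> 0 <= K -> (1 <= j <= 3)%N ->
  nu.-integrable setT (EFin \o (fun t => `|psi n i t| ^+ j)) /\ \int[nu]_t (`|psi n i t| ^+ j) <= K ^+ j * Dm.
Proof.
move=> hK K0 /andP[j1 j3].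
have mj : measurable_fun setT (fun t => `|psi n i t| ^+ j).
  by apply: measurable_funX; apply: measurableT_comp => //; exact: psi_measurable.
have bd t : `|psi n i t| ^+ j <= K ^+ j * (16 * (1 + t ^+ 4)).
  apply: (@le_trans _ _ ((K * (1 + `|t|)) ^+ j)); first by rewrite lerXn2r ?nnegrE ?mulr_ge0 ?addr_ge0.
  rewrite exprMn ler_wpM2l ?exprn_ge0//; apply: le_trans (cube_quartic t).
  by rewrite ler_weXn2l// lerDl.
have i1 : nu.-integrable setT (EFin \o (fun t => `|psi n i t| ^+ j)).
  apply: (nu_integrable nu4 (C := K ^+ j * 16)) => // t.
  by rewrite normrX normr_id (le_trans (bd t))// mulrA.
split=> //; have i4 : nu.-integrable setT (EFin \o (fun t : R => 1 + t ^+ 4)).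
  have i0 : nu.-integrable setT (EFin \o (fun _ : R => 1)) by exact: finite_measure_integrable_cst.
  exact: (integrableD measurableT i0 nu4).
have -> : K ^+ j * Dm = \int[nu]_t (K ^+ j * 16 * (1 + t ^+ 4)).
  rewrite RintegralZl// RintegralD//; last exact: finite_measure_integrable_cst.
  by rewrite bounded_mean_cst /Dm mulrA.
apply: le_Rintegral => //; first exact: (integrableZl measurableT (K ^+ j * 16) i4).
by move=> t _; rewrite -mulrA; exact: bd.
Qed.

Let psi_mean n i : \int[nu]_t psi n i t = 0.
Proof.
have i1 := (nu_integrable2 nu4 id_meas id_bound).1.
have i2 : nu.-integrable setT (EFin \o ind).
  exact: (integrableB measurableT (nu_integrable2 nu4 (ind_measurable _) (ind_bound _)).1
    (nu_integrable2 nu4 (ind_measurable _) (ind_bound _)).1).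
have ic (a : R) : nu.-integrable setT (EFin \o (fun _ : R => a)) by exact: finite_measure_integrable_cst.
have i3 : nu.-integrable setT (EFin \o (fun t => ind t - m)) by exact: (integrableB measurableT i2 (ic m)).
rewrite RintegralD//; [|exact: (integrableZl measurableT _ i1)|exact: (integrableZl measurableT _ i3)].
rewrite RintegralZl// nu_mean mulr0 add0r RintegralZl// RintegralB//.
rewrite RintegralB// ?ind_mean ?bounded_mean_cst -/m ?subrr ?mulr0//.
- exact: (nu_integrable2 nu4 (ind_measurable _) (ind_bound _)).1.
- exact: (nu_integrable2 nu4 (ind_measurable _) (ind_bound _)).1.
Qed.

Let psi_var n i : \int[nu]_t (psi n i t ^+ 2) = (g * kap n i) ^+ 2 * s2
  - 2 * (g * kap n i) / q n * mu + (q n)^-1 ^+ 2 * (m * (1 - m)).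
Proof.
have i1 := (nu_integrable2 nu4 id_meas id_bound).1.
have i1' := (nu_integrable2 nu4 id_meas id_bound).2.
have ii a := (nu_integrable2 nu4 (ind_measurable a) (ind_bound a)).1.
have i2 : nu.-integrable setT (EFin \o ind) by exact: (integrableB measurableT (ii _) (ii _)).
have im : nu.-integrable setT (EFin \o phimu) := (nu_integrable2 nu4 phimu_measurable phimu_bound).1.
have ic (a : R) : nu.-integrable setT (EFin \o (fun _ : R => a)) by exact: finite_measure_integrable_cst.
have iZ (h : R -> R) (a : R) : nu.-integrable setT (EFin \o h) -> nu.-integrable setT (EFin \o (fun t => a * h t)).
  by move=> ih; exact: (integrableZl measurableT a ih).
have iD (h k : R -> R) : nu.-integrable setT (EFin \o h) -> nu.-integrable setT (EFin \o k) ->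
    nu.-integrable setT (EFin \o (fun t => h t + k t)).
  by move=> ih ik; exact: (integrableD measurableT ih ik).
pose a1 := (g * kap n i) ^+ 2; pose a2 := - 2 * (g * kap n i) / q n; pose a3 := 2 * (g * kap n i) / q n * m.
pose a4 := (q n)^-1 ^+ 2 * (1 - 2 * m); pose a5 := (q n)^-1 ^+ 2 * m ^+ 2.
transitivity (\int[nu]_t (a1 * t ^+ 2 + (a2 * phimu t + (a3 * t + (a4 * ind t + a5))))).
  apply: eq_Rintegral => t _; rewrite /psi /phimu -/(ind t) /a1 /a2 /a3 /a4 /a5.
  by case: (ind01_cases t) => ->; ring.
have j1 := iD _ _ (iZ _ a4 i2) (ic a5); have j2 := iD _ _ (iZ _ a3 i1) j1.
have j3 := iD _ _ (iZ _ a2 im) j2.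
rewrite RintegralD//; last exact: iZ.
rewrite RintegralD//; last exact: iZ.
rewrite RintegralD//; last exact: iZ.
rewrite RintegralD//; last exact: iZ.
rewrite !RintegralZl// bounded_mean_cst nu_mean nu_var -/mu.
have -> : \int[nu]_t ind t = m by rewrite RintegralB// !ind_mean.
by rewrite /a1 /a2 /a3 /a4 /a5 /s2; ring.
Qed.

Let pwb := pred_weight_bound uX uA XA xM xfM.
Let w n i := (\int[nu]_t (psi n i t ^+ 2)) / gauss_m2.

Lemma quad_sum n (cw : nat -> R) (a b' d' N ni : R) :
  \sum_(i < n) (a * (N * cw i ^+ 2 + ni - 2 * cw i) - b' * (cw i - ni) + ni * d') =
  a * (N * \sum_(i < n) cw i ^+ 2 + n%:R * ni - 2 * \sum_(i < n) cw i) -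
    b' * (\sum_(i < n) cw i - n%:R * ni) + n%:R * ni * d'.
Proof.
elim: n => [|n IH]; first by rewrite !big_ord0; ring.
by rewrite !big_ord_recr/= IH -natr1; ring.
Qed.

(** The variance of the score is a quadratic expression in the prediction weights,
    whose sums of first and second powers converge. *)
Lemma score_variance_cvg : \sum_(i < n) w n i @[n --> \oo] --> V / gauss_m2.
Proof.
have h1 := @cvg_sum_weight_sqr _ _ _ _ uX uA XA xf; have h2 := @cvg_sum_weight _ _ _ _ _ uX uA XA xb xf.
have hc (a : R) : (fun _ : nat => a) n @[n --> \oo] --> a by exact: cvg_cst.
have h3 : (g ^+ 2 * s2 * (n%:R * \sum_(i < n) pred_weight x xf n i ^+ 2 + 1 - 2 * \sum_(i < n) pred_weight x xf n i) -
    2 * g * mu * (\sum_(i < n) pred_weight x xf n i - 1) + (1 - alpha) * alpha) / gauss_m2 @[n --> \oo] --> V / gauss_m2.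
  apply: cvgM; last exact: hc.
  apply: cvgD; last exact: hc.
  apply: cvgB.
    apply: cvgM; first exact: hc.
    apply: cvgB; first by apply: cvgD; [exact: h1|exact: hc].
    by apply: cvgM; [exact: hc|exact: h2].
  by apply: cvgM; [exact: hc|apply: cvgB; [exact: h2|exact: hc]].
apply: cvgR_near_eq h3; exists 1%N => // n /= n0; have qn := q0 n0.
rewrite -mulr_suml; congr (_ / _); under [RHS]eq_bigr do rewrite psi_var /kap.
have mE : m * (1 - m) = (1 - alpha) * alpha by rewrite /m Fc; ring.
transitivity (\sum_(i < n) (g ^+ 2 * s2 * (n%:R * pred_weight x xf n i ^+ 2 + n%:R^-1 - 2 * pred_weight x xf n i) -
   2 * g * mu * (pred_weight x xf n i - n%:R^-1) + n%:R^-1 * ((1 - alpha) * alpha))).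
  by rewrite quad_sum mulfV ?mul1r// pnatr_eq0 -lt0n.
by apply: eq_bigr => i _; rewrite mE -q_sqr; field; rewrite gt_eqF.
Qed.

Let kap_bound : exists K, 2 <= K /\ \forall n \near \oo, (0 < n)%N /\ forall i, `|g * kap n i| <= K / q n.
Proof.
have [C0 hC] := pwb; have g0 : 0 <= `|g| * (`|C0| + 1) by rewrite mulr_ge0// addr_ge0.
exists (`|g| * (`|C0| + 1) + 2); split; first by rewrite lerDr.
apply: filterS2 hC (nbhs_infty_gt 0) => n h n0; split=> // i; have qn := q0 n0.
apply: (@le_trans _ _ (`|g| * (`|C0| + 1) / q n)); last by rewrite ler_pM2r ?invr_gt0// lerDl.
rewrite normrM -mulrA ler_wpM2l// mulrDl mul1r (le_trans (ler_normB _ _))// lerD//.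
  rewrite normrM (gtr0_norm qn) mulrC -ler_pdivlMr// -mulrA -invfM -expr2 q_sqr.
  by rewrite (le_trans (h i))// ler_wpM2r ?invr_ge0 ?ler0n// ler_norm.
by rewrite gtr0_norm// invr_gt0.
Qed.

(** The third moments of the summands are of order n ^ (- 3 / 2), since the
    prediction weights are of order 1 / n. *)
Lemma score_smooth_cvg C f : smooth C f ->
  \int[P]_v f (psum eps (psi n) n v) @[n --> \oo] --> gop (V / gauss_m2) f 0.
Proof.
move=> sf; have [K [K2 hK]] := kap_bound; have K0 : 0 <= K by exact: le_trans K2.
have m20 := @gauss_m2_gt0 R; have Vm : 0 <= V / gauss_m2 by rewrite divr_ge0// ltW.
have w0 n i : 0 <= w n i by rewrite divr_ge0 ?(ltW m20)// Rintegral_ge0// => t _; exact: sqr_ge0.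
have D0 : 0 <= Dm.
  by rewrite mulr_ge0// addr_ge0// Rintegral_ge0// => t _; rewrite (exprM t 2 2) sqr_ge0.
have sw n : 0 <= \sum_(i < n) w n i by apply: sumr_ge0.
have gl : gop (\sum_(i < n) w n i) f 0 @[n --> \oo] --> gop (V / gauss_m2) f 0.
  exact: (@cvg_gop R nat \oo _ _ _ C f 0 sw Vm score_variance_cvg sf).
have C0 : 0 <= C by case: sf => [? [? [h _ _ _]]]; exact: blip_ge0 h.
pose B := C * (K ^+ 3 * Dm + gauss_m3 * (K ^+ 2 * Dm / gauss_m2 * Num.sqrt (K ^+ 2 * Dm / gauss_m2))).
have m30 := @gauss_m3_ge0 R.
have Dd0 : 0 <= K ^+ 2 * Dm / gauss_m2 by rewrite divr_ge0 ?(ltW m20)// mulr_ge0// exprn_ge0.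
have B0 : 0 <= B.
  have t1 : 0 <= K ^+ 3 * Dm by rewrite mulr_ge0// exprn_ge0.
  have t2 : 0 <= gauss_m3 * (K ^+ 2 * Dm / gauss_m2 * Num.sqrt (K ^+ 2 * Dm / gauss_m2)).
    by apply: mulr_ge0 => //; apply: mulr_ge0 => //; exact: sqrtr_ge0.
  exact: mulr_ge0 C0 (addr_ge0 t1 t2).
apply/cvgRP => k k0; have k2 : 0 < k / 2 by rewrite divr_gt0.
have hgl : \forall n \near \oo, `|gop (\sum_(i < n) w n i) f 0 - gop (V / gauss_m2) f 0| <= k / 2.
  exact: cvgR_near gl k2.
apply: filterS3 hK hgl (near_sqrt_ge (B / (k / 2))) => n [n0 hk] h1 h2; have qn := q0 n0.
have pl i := psi_linear n0 (hk i) K2; have Kq : 0 <= K / q n by rewrite divr_ge0// ltW.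
have p1 i := nu_power (j := 1) (pl i) Kq isT; have p2 i := nu_power (j := 2) (pl i) Kq isT.
have p3 i := nu_power (j := 3) (pl i) Kq isT.
have i1 i : nu.-integrable setT (EFin \o psi n i).
  apply: le_integrable (p1 i).1 => //; first by apply/measurable_EFinP; exact: psi_measurable.
  by move=> t _ /=; rewrite lee_fin expr1 normr_id.
have sqE i : (fun t => `|psi n i t| ^+ 2) = fun t => psi n i t ^+ 2.
  by apply/funext => t; rewrite real_normK ?num_real.
have i2 i : nu.-integrable setT (EFin \o (fun t => psi n i t ^+ 2)) by rewrite -sqE; exact: (p2 i).1.
have wE i : \int[nu]_t (psi n i t ^+ 2) = w n i * gauss_m2 by rewrite divfK// gt_eqF.
have L := psum_lindeberg eps_indep eps_ident n sf (w0 n) (@psi_measurable n) i1 i2 (fun i => (p3 i).1)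
  (@psi_mean n) wE.
rewrite (splitr k) -[X in `|X - _|](subrK (gop (\sum_(i < n) w n i) f 0)) -addrA.
rewrite (le_trans (ler_normD _ _))// lerD//; apply: (le_trans L).
have term i : C * (\int[nu]_t (`|psi n i t| ^+ 3) + gauss_m3 * (w n i * Num.sqrt (w n i))) <= B * (q n)^-1 ^+ 3.
  have w1 : w n i <= (K ^+ 2 * Dm / gauss_m2) * (q n)^-1 ^+ 2.
    have := (p2 i).2; rewrite sqE => h; rewrite /w mulrAC ler_pM2r ?invr_gt0//.
    by apply: (le_trans h); rewrite exprMn mulrAC.
  have w2 : Num.sqrt (w n i) <= Num.sqrt (K ^+ 2 * Dm / gauss_m2) * (q n)^-1.
    apply: (le_trans (ler_wsqrtr w1)); rewrite sqrtrM// sqrtr_sqr ger0_norm// invr_ge0 ltW//.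
  rewrite /B -[leRHS]mulrA ler_wpM2l// mulrDl lerD//.
    by apply: (le_trans (p3 i).2); rewrite exprMn mulrAC.
  rewrite -[leRHS]mulrA ler_wpM2l//.
  have -> : (q n)^-1 ^+ 3 = (q n)^-1 ^+ 2 * (q n)^-1 by rewrite exprSr.
  by rewrite mulrACA; apply: ler_pM => //; exact: sqrtr_ge0.
apply: (@le_trans _ _ (\sum_(i < n) B * (q n)^-1 ^+ 3)); first by apply: ler_sum => i _; exact: term.
rewrite sumr_const card_ord -[leLHS]mulr_natl -q_sqr.
have -> : q n ^+ 2 * (B * (q n)^-1 ^+ 3) = B / q n by field; rewrite gt_eqF.
by rewrite ler_pdivrMr// mulrC -ler_pdivrMr.
Qed.

Lemma score_measurable n : measurable_fun setT (fun v => - error_score (n, v)).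
Proof.
have -> : (fun v => - error_score (n, v)) = psum eps (psi n) n by apply/funext => v; rewrite psum_score.
by apply: psum_measurable => i; exact: psi_measurable.
Qed.

Lemma measurable_le (f : Omega -> R) (z : R) : measurable_fun setT f -> measurable [set v | f v <= z]%R.
Proof.
move=> mf; rewrite -[X in measurable X]setTI; have := mf measurableT `]-oo, z]%classic (measurable_itv _).
by congr (measurable (_ `&` _)); apply/seteqP; split=> v /=; rewrite in_itv/=.
Qed.

(** Convergence of smooth averages implies that of distribution functions. *)
Lemma score_cdf_cvg z : fine (P [set v | - error_score (n, v) <= z]%R) @[n --> \oo] --> gcdf (V / gauss_m2) z.
Proof.
have vpos : 0 < V / gauss_m2 by rewrite divr_gt0 ?gauss_m2_gt0.
have mA n z' : measurable [set v | psum eps (psi n) n v <= z']%R.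
  by apply: measurable_le; apply: psum_measurable => i; exact: psi_measurable.
have -> : (fun n => fine (P [set v | - error_score (n, v) <= z]%R)) =
    fun n => fine (P [set v | psum eps (psi n) n v <= z]%R).
  by apply/funext => n; congr (fine (P _)); apply/seteqP; split=> v /=; rewrite psum_score.
have bf n C f : blip C f -> bounded_mfun (fun v => f (psum eps (psi n) n v)).
  move=> bf; split; last by exists C => v; case: bf.
  apply: (measurableT_comp (blip_measurable bf)); apply: psum_measurable => i; exact: psi_measurable.
have indE n z' v : \1_([set v | psum eps (psi n) n v <= z']%R) v = (psum eps (psi n) n v <= z')%R%:R :> R.
  by rewrite indicE; congr (nat_of_bool _)%:R; apply/idP/idP; rewrite inE.
apply: (@cvg_gcdf R nat \oo _ (fun n f => \int[P]_v f (psum eps (psi n) n v))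
  (fun n z' => fine (P [set v | psum eps (psi n) n v <= z']%R)) (V / gauss_m2) z vpos).
- move=> n C f z' k bl fz; rewrite -(bounded_mean_indicD P k (mA n z')); apply: le_Rintegral => //.
  + by apply: bounded_mfun_integrable; exact: bf bl.
  + by apply: bounded_mfun_integrable; exact: indic_le_bounded.
  + by move=> v _; rewrite indE.
- move=> n C f z' k bl fz; rewrite -(bounded_mean_indicD P (- k) (mA n z')); apply: le_Rintegral => //.
  + by apply: bounded_mfun_integrable; exact: indic_le_bounded.
  + by apply: bounded_mfun_integrable; exact: bf bl.
  + by move=> v _; rewrite indE.
- exact: score_smooth_cvg.
Qed.

Variable cov : nat -> Omega -> R.
Hypothesis mcov : forall n, measurable_fun setT (cov n).
Hypothesis covE : forall n v C, (p <= n)%N -> 0 < C -> Cstar (design x n) xf (y n v) (1 - alpha) (1 - gam0) = C%:E ->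
  cov n v = F (dot xf (zeta n v) + C) - F (dot xf (zeta n v) - C).

Let whp_cov (k : R) : 0 < k -> whp P [set t | (0 < t.1)%N /\ [/\ `|cov t.1 t.2 - (1 - alpha)| <= k &
  `|q t.1 * (cov t.1 t.2 - (1 - alpha)) - (Q + error_score t)| <= k]].
Proof.
move=> k0; have n1 := whp_near P (nbhs_infty_gt 0); have n2 := whp_near P (nbhs_infty_ge p).
apply: whp_setS (whp_setI (whp_setI n1 n2) (whp_coverage_expansion k0)).
by move=> t [[n0 np] [C [C0 CE h1 h2]]]; split=> //; rewrite (covE np C0 CE).
Qed.

Lemma coverage_consistent (delta : R) : 0 < delta ->
  fine (P [set v | `|cov n v - (1 - alpha)| <= delta]%R) @[n --> \oo] --> (1 : R).
Proof.
move=> d0; have mD n : measurable [set v | `|cov n v - (1 - alpha)| <= delta]%R.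
  by apply: measurable_le; apply: measurableT_comp => //; exact: measurable_funB.
apply/cvgRP => k k0; have [B [mB BA PB]] := whp_cov d0 k0; apply: filterS PB => n hB.
have le1 : (P [set v | `|cov n v - (1 - alpha)| <= delta]%R <= 1)%E by exact: probability_le1.
have ge1 : ((1 - k)%:E <= P [set v | `|cov n v - (1 - alpha)| <= delta]%R)%E.
  apply: (le_trans hB); apply: le_measure; rewrite ?inE// => v Bv.
  by have [_ []] := BA n v Bv.
move: le1 ge1; rewrite -[P _]fineK ?fin_num_measure// !lee_fin => le1 ge1.
by rewrite ler_norml; apply/andP; split; lra.
Qed.

(** The coverage is at least 1 - alpha as soon as Q + error_score exceeds a
    small k, and fails to be when it is below - k; continuity of the Gaussian
    distribution function closes the gap. *)
Lemma coverage_guarantee : fine (P [set v | 1 - alpha <= cov n v]%R) @[n --> \oo] --> 1 - gam0.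
Proof.
have vpos : 0 < V / gauss_m2 by rewrite divr_gt0 ?gauss_m2_gt0.
have mE n : measurable [set v | 1 - alpha <= cov n v]%R.
  rewrite (_ : [set v | _] = [set v | - cov n v <= - (1 - alpha)]%R).
    by apply: measurable_le; exact: measurableT_comp.
  by apply/seteqP; split=> v /=; rewrite lerN2.
have mS n z : measurable [set v | - error_score (n, v) <= z]%R by apply: measurable_le; exact: score_measurable.
apply/cvgRP => k k0; have k4 : 0 < k / 4 by rewrite divr_gt0.
have [dd d0 hd] := cvgR_ball (@gcdf_continuous R _ vpos Q) k4.
have gp : `|gcdf (V / gauss_m2) (Q + dd) - gcdf (V / gauss_m2) Q| <= k / 4.
  by apply: hd; rewrite addrAC subrr add0r gtr0_norm.
have gm : `|gcdf (V / gauss_m2) (Q - dd) - gcdf (V / gauss_m2) Q| <= k / 4.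
  by apply: hd; rewrite addrAC subrr add0r normrN gtr0_norm.
have up : whp P [set t | [set v | 1 - alpha <= cov t.1 v]%R t.2 -> [set v | - error_score (t.1, v) <= Q + dd]%R t.2].
  apply: whp_setS (whp_cov d0) => -[n v] /= [n0 [_ h]] hv; have qn := q0 n0.
  have : 0 <= q n * (cov n v - (1 - alpha)) by rewrite mulr_ge0 ?(ltW qn)// subr_ge0.
  by move: h; rewrite ler_norml => /andP[_ h] h'; move: (error_score _) (q n * _) h h' => s u; lra.
have lo : whp P [set t | [set v | - error_score (t.1, v) <= Q - dd]%R t.2 -> [set v | 1 - alpha <= cov t.1 v]%R t.2].
  apply: whp_setS (whp_cov d0) => -[n v] /= [n0 [_ h]] hv; have qn := q0 n0.
  rewrite -subr_ge0 -(pmulr_rge0 _ qn).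
  by move: h; rewrite ler_norml => /andP[h _]; move: (error_score _) (q n * _) h hv => s u; lra.
have u1 := whp_le_prob mE (fun n => mS n (Q + dd)) up k4.
have l1 := whp_le_prob (fun n => mS n (Q - dd)) mE lo k4.
have c1 : \forall n \near \oo, `|fine (P [set v | - error_score (n, v) <= Q + dd]%R) - gcdf (V / gauss_m2) (Q + dd)| <= k / 4.
  exact: cvgR_near (@score_cdf_cvg (Q + dd)) k4.
have c2 : \forall n \near \oo, `|fine (P [set v | - error_score (n, v) <= Q - dd]%R) - gcdf (V / gauss_m2) (Q - dd)| <= k / 4.
  exact: cvgR_near (@score_cdf_cvg (Q - dd)) k4.
rewrite -QE; apply: filterS3 (filterI u1 l1) c1 c2 => n [].
move: (fine (P _)) (fine (P _)) (fine (P _)) => p1 p2 p3 h1 h2 h3 h4.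
move: gp gm h3 h4; rewrite !ler_norml => /andP[? ?] /andP[? ?] /andP[? ?] /andP[? ?].
by apply/andP; split; lra.
Qed.
End fixed_design.

(** * Measurability of bootstrap quantiles *)

Section measurable_matrices.
Context {R : realType} {d : measure_display} {T : measurableType d}.

Definition mx_measurable m n (A : T -> 'M[R]_(m, n)) := forall i j, measurable_fun setT (fun w => A w i j).

Lemma mx_measurable_mul m n l (A : T -> 'M[R]_(m, n)) (B : T -> 'M[R]_(n, l)) :
  mx_measurable A -> mx_measurable B -> mx_measurable (fun w => A w *m B w).
Proof.
move=> mA mB i j; under eq_fun do rewrite mxE.
by apply: measurable_sum => k; exact: measurable_funM.
Qed.

Lemma mx_measurable_tr m n (A : T -> 'M[R]_(m, n)) : mx_measurable A -> mx_measurable (fun w => (A w)^T).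
Proof. by move=> mA i j; under eq_fun do rewrite mxE; exact: mA. Qed.

Lemma mx_measurable_cst m n (A : 'M[R]_(m, n)) : mx_measurable (fun _ : T => A).
Proof. by move=> i j; exact: measurable_cst. Qed.

Lemma det_measurable n (A : T -> 'M[R]_n) : mx_measurable A -> measurable_fun setT (fun w => \det (A w)).
Proof.
move=> mA; rewrite /determinant; apply: measurable_sum => s; apply: measurable_funM => //.
by apply: measurable_prod => i _; exact: mA.
Qed.

Lemma measurable_real_inv (f : T -> R) : measurable_fun setT f -> measurable_fun setT (fun w => (f w)^-1).
Proof.
move=> mf; have -> : (fun w => (f w)^-1) = fun w => f w * ((f w ^+ 2) `^ (-1)).
  apply/funext => w; rewrite powR_inv1 ?sqr_ge0//.
  have [->|f0] := eqVneq (f w) 0; first by rewrite invr0 mul0r.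
  by rewrite expr2 invfM mulrA mulfV// mul1r.
apply: measurable_funM => //; apply: (measurableT_comp (measurable_powR _)).
exact: measurable_funX.
Qed.

Lemma mx_measurable_inv n (A : T -> 'M[R]_n) : mx_measurable A -> mx_measurable (fun w => invmx (A w)).
Proof.
move=> mA i j; have md := det_measurable mA.
have -> : (fun w => invmx (A w) i j) = fun w => if \det (A w) == 0 then A w i j else
    (\det (A w))^-1 * (\adj (A w)) i j.
  apply/funext => w; rewrite /invmx unitmxE unitfE.
  by have [->|d0] := eqVneq (\det (A w)) 0; rewrite ?eqxx ?(negbTE d0)//= mxE.
apply: measurable_fun_ifT => //; first by apply: measurable_fun_eqr.
apply: measurable_funM; first exact: measurable_real_inv.
under eq_fun do rewrite mxE; apply: measurable_funM => //.
by apply: det_measurable => k l; under eq_fun do rewrite !mxE; exact: mA.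
Qed.

Lemma ler_measurable (f g : T -> R) : measurable_fun setT f -> measurable_fun setT g ->
  measurable_fun setT (fun w => (f w <= g w)%R%:R : R).
Proof.
move=> mf mg; have -> : (fun w => (f w <= g w)%R%:R : R) = fun w => if (f w <= g w)%R then 1 else 0.
  by apply/funext => w; case: (_ <= _)%R.
by apply: measurable_fun_ifT => //; exact: measurable_fun_ler.
Qed.

Lemma ltr_measurable (f g : T -> R) : measurable_fun setT f -> measurable_fun setT g ->
  measurable_fun setT (fun w => (f w < g w)%R%:R : R).
Proof.
move=> mf mg; have -> : (fun w => (f w < g w)%R%:R : R) = fun w => 1 - (g w <= f w)%R%:R.
  by apply/funext => w; rewrite ltNge; case: (_ <= _)%R => /=; rewrite ?subrr ?subr0.
by apply: measurable_funB => //; exact: ler_measurable.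
Qed.

Lemma measurable_le_pair (f g : T -> R) : measurable_fun setT f -> measurable_fun setT g ->
  measurable [set w | f w <= g w]%R.
Proof.
move=> mf mg; have := measurable_fun_ler mf mg; move=> /(_ measurableT [set true]) => h.
by have := h I; rewrite setTI; congr measurable; apply/seteqP; split.
Qed.

(** A quantile of a nondecreasing function lies below a level exactly when a
    rational point does, which makes it measurable in the parameter. *)
Lemma measurable_quantile (K : T -> R -> R) (tau : T -> R) :
  (forall w x y, x <= y -> K w x <= K w y) -> (forall x, measurable_fun setT (K ^~ x)) ->
  measurable_fun setT tau ->
  measurable_fun setT (fun w => ereal_inf [set x%:E | x in [set x : R | tau w <= K w x]]).
Proof.
move=> homo mK mtau; apply: (measurability _ (ErealGenInftyO.measurableE R)) => _ /= -[_ [r ->] <-].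
rewrite setTI; have -> : (fun w => ereal_inf [set x%:E | x in [set x : R | tau w <= K w x]]) @^-1` `]-oo, r%:E[ =
    \bigcup_(s : rat) (if (ratr s < r :> R)%R then [set w | tau w <= K w (ratr s)]%R else set0).
  apply/seteqP; split=> [w /=|w [s _]].
    rewrite in_itv/= => /ereal_inf_lt [_ [y /= hy <-]]; rewrite lte_fin => yr.
    have [s] := rat_in_itvoo yr; rewrite in_itv/= => /andP[ys sr].
    by exists s => //; rewrite sr /=; apply: (le_trans hy); apply: homo; exact: ltW.
  case: ifP => // sr hs; rewrite /= in_itv/=; apply: le_lt_trans (_ : (_ <= (ratr s)%:E)%E) _.
    by apply: ereal_inf_lbound; exists (ratr s).
  by rewrite lte_fin.
by apply: bigcupT_measurable_rat => s; case: ifP => // _; exact: measurable_le_pair.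
Qed.
End measurable_matrices.

Section measurable_quantiles.
Context {R : realType} {d : measure_display} {T : measurableType d}.
Variables (n p : nat) (X : T -> 'M[R]_(n, p)) (xf : T -> 'cV[R]_p) (y : T -> 'cV[R]_n).
Hypotheses (mX : mx_measurable X) (mxf : mx_measurable xf) (my : mx_measurable y).
Hypothesis n0 : (0 < n)%N.

Lemma ols_measurable m k (Z : T -> 'M[R]_(m, k)) (u : T -> 'cV[R]_m) :
  mx_measurable Z -> mx_measurable u -> mx_measurable (fun w => ols (Z w) (u w)).
Proof.
move=> mZ mu; rewrite /ols; apply: mx_measurable_mul => //; apply: mx_measurable_mul.
  by apply: mx_measurable_inv; apply: mx_measurable_mul => //; exact: mx_measurable_tr.
exact: mx_measurable_tr.
Qed.

Lemma dot_measurable k (u v : T -> 'cV[R]_k) : mx_measurable u -> mx_measurable v ->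
  measurable_fun setT (fun w => dot (u w) (v w)).
Proof. by move=> mu mv; apply: mx_measurable_mul => //; exact: mx_measurable_tr. Qed.

Let r w := pred_resid (X w) (y w).

Lemma pred_resid_measurable : mx_measurable r.
Proof.
have ml : mx_measurable (fun w => loo_resid (X w) (y w)).
  move=> i j; under eq_fun do rewrite mxE; apply: measurable_funB; first exact: my.
  apply: mx_measurable_mul; first by move=> k l; under eq_fun do rewrite mxE; exact: mX.
  apply: ols_measurable; first by move=> k l; under eq_fun do rewrite mxE; exact: mX.
  by move=> k l; under eq_fun do rewrite mxE; exact: my.
move=> i j; under eq_fun do rewrite mxE; apply: measurable_funB; first exact: ml.
by apply: measurable_funM => //; apply: measurable_sum => k; exact: ml.
Qed.

Let stat_measurable m (Qs : T -> {ffun 'I_m -> 'I_n} -> R) (x : T -> R) :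
  (forall s, measurable_fun setT (Qs ^~ s)) -> measurable_fun setT x ->
  measurable_fun setT (fun w => bavg (fun s => (Qs w s <= x w)%R%:R) : R).
Proof.
move=> mQ mx; apply: measurable_funM => //; apply: measurable_sum => s.
exact: ler_measurable.
Qed.

Let draw m w (s : {ffun 'I_m -> 'I_n}) : 'cV[R]_m := \col_i r w (s i) 0.

Let draw_measurable m (s : {ffun 'I_m -> 'I_n}) : mx_measurable (fun w => draw w s).
Proof. by move=> i j; under eq_fun do rewrite mxE; exact: pred_resid_measurable. Qed.

Lemma Gstar_measurable (x : R) : measurable_fun setT (fun w => Gstar (X w) (xf w) (y w) x).
Proof.
pose Qs w (s : {ffun 'I_(n + 1) -> 'I_n}) := let e := draw w s in
  `|dot (xf w) (ols (X w) (y w)) + dsubmx e 0 0 - dot (xf w) (ols (X w) (X w *m ols (X w) (y w) + usubmx e))|.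
have -> : (fun w => Gstar (X w) (xf w) (y w) x) = fun w => bavg (fun s => (Qs w s <= x)%R%:R : R).
  by apply/funext => w; rewrite /Gstar boot_probE.
apply: stat_measurable => // s; apply: measurableT_comp => //; apply: measurable_funB.
  apply: measurable_funD; first by apply: dot_measurable => //; exact: ols_measurable.
  by under eq_fun do rewrite mxE; exact: draw_measurable.
apply: dot_measurable => //; apply: ols_measurable => // i j; under eq_fun do rewrite mxE.
apply: measurable_funD; first by apply: mx_measurable_mul => //; exact: ols_measurable.
by under eq_fun do rewrite mxE; exact: draw_measurable.
Qed.

Lemma Cquant_measurable (tau : T -> R) : measurable_fun setT tau ->
  measurable_fun setT (fun w => Cquant (X w) (xf w) (y w) (tau w)).
Proof.
move=> mtau; apply: (@measurable_quantile R d T (fun w => Gstar (X w) (xf w) (y w))) => //.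
- by move=> w a b ab; exact: Gstar_homo.
- exact: Gstar_measurable.
Qed.

Lemma ecdf_measurable m (u : T -> 'cV[R]_m) (x : T -> R) : mx_measurable u -> measurable_fun setT x ->
  measurable_fun setT (fun w => ecdf (u w) (x w)).
Proof. by move=> mu mx; apply: measurable_funM => //; apply: measurable_sum => i; exact: ler_measurable. Qed.

Lemma ecdfl_measurable m (u : T -> 'cV[R]_m) (x : T -> R) : mx_measurable u -> measurable_fun setT x ->
  measurable_fun setT (fun w => ecdfl (u w) (x w)).
Proof. by move=> mu mx; apply: measurable_funM => //; apply: measurable_sum => i; exact: ltr_measurable. Qed.

Lemma That_measurable (u : T -> 'cV[R]_n) (x : T -> R) : mx_measurable u -> measurable_fun setT x ->
  measurable_fun setT (fun w => That (X w) (xf w) (y w) (u w) (x w)).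
Proof.
move=> mu mx; rewrite /That; under eq_fun do rewrite Nhat_left_lim.
have mr := pred_resid_measurable.
have ms (z : T -> R) : measurable_fun setT z ->
    measurable_fun setT (fun w => z w + dot (xf w) (ols (X w) (u w)) - mean (u w)).
  move=> mz; apply: measurable_funB.
    by apply: measurable_funD => //; apply: dot_measurable => //; exact: ols_measurable.
  by apply: measurable_funM => //; apply: measurable_sum => i; exact: mu.
have mxN : measurable_fun setT (fun w => - x w) by exact: measurableT_comp.
apply: measurable_funB; apply: measurable_funM => //; apply: measurable_funB.
- by apply: ecdf_measurable => //; exact: ms.
- exact: ecdf_measurable.
- by apply: ecdfl_measurable => //; exact: ms.
- exact: ecdfl_measurable.
Qed.

(** The set defining the inner quantile is nonempty and bounded below, so that
    its infimum is an extended infimum. *)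
Lemma Dstar_measurable (c : R) (x : T -> R) : 0 < c < 1 -> measurable_fun setT x ->
  measurable_fun setT (fun w => Dstar (X w) (xf w) (y w) c (x w)).
Proof.
move=> /andP[c0 c1] mx.
pose Qs w (s : {ffun 'I_n -> 'I_n}) := - That (X w) (xf w) (y w) (draw w s) (x w).
pose K w z : R := bavg (fun s => (Qs w s <= z)%R%:R).
have KE w z : boot_prob (r w) (fun u : 'cV[R]_n => - That (X w) (xf w) (y w) u (x w) <= z) = K w z.
  by rewrite boot_probE.
have Kmono w a b : a <= b -> K w a <= K w b.
  by move=> ab; apply: le_bavg => s; rewrite ler_nat; case: leP => // /le_trans ->.
have mQ s : measurable_fun setT (Qs ^~ s).
  by apply: measurableT_comp => //; apply: That_measurable.
have bd w : exists B, forall s, `|Qs w s| <= B.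
  exists (\sum_s `|Qs w s|) => s; rewrite (bigD1 s)//= lerDl; exact: sumr_ge0.
have DE w : (Dstar (X w) (xf w) (y w) c (x w))%:E = ereal_inf [set z%:E | z in [set z : R | c <= K w z]].
  have [B hB] := bd w; rewrite ereal_inf_EFin.
  - rewrite /Dstar; congr (inf _)%:E; apply/seteqP; split=> z /=; by rewrite -/(r w) KE.
  - exists (- (B + 1)) => z /= cz; rewrite leNgt; apply/negP => zB.
    move: cz; rewrite leNgt => /negP; apply.
    have -> : K w z = 0; last exact: c0.
    rewrite /K -[RHS](bavg_cst n n0 0); apply: eq_bavg => s.
    case: leP => // h; have := hB s; rewrite ler_norml => /andP[h2 _]; lra.
  exists B => /=; have -> : K w B = 1; last exact: ltW.
  rewrite /K -[RHS](bavg_cst n n0 1); apply: eq_bavg => s.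
  by rewrite (le_trans (ler_norm _) (hB s)).
have -> : (fun w => Dstar (X w) (xf w) (y w) c (x w)) =
    fun w => fine (ereal_inf [set z%:E | z in [set z : R | c <= K w z]]).
  by apply/funext => w; rewrite -DE.
apply: measurableT_comp => //.
apply: (@measurable_quantile R d T K (fun _ => c)) => // z; exact: stat_measurable.
Qed.

Lemma Cstar_measurable (a c : R) : 0 < c < 1 ->
  measurable_fun setT (fun w => Cstar (X w) (xf w) (y w) a c).
Proof.
move=> hc; apply: Cquant_measurable; apply: measurable_funD => //; apply: measurable_funM => //.
apply: Dstar_measurable => //; apply: measurableT_comp => //.
exact: Cquant_measurable.
Qed.
End measurable_quantiles.

(** * Conditional probabilities *)

Section conditional_probabilities.
Context {R : realType} {d : measure_display} {Omega : measurableType d} (P : probability Omega R).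

Lemma sigma_of_sub (I : Type) (f : I -> Omega -> R) (C : set (set Omega)) : sigma_algebra setT C ->
  (forall i B, measurable B -> C (f i @^-1` B)) -> sigma_of f `<=` C.
Proof.
move=> sC fC; apply: smallest_sub => // A [i _ [B mB <-]].
by rewrite setTI; exact: fC.
Qed.

Definition fam_preimages (I : Type) (f : I -> Omega -> R) : set (set Omega) :=
  \bigcup_i preimage_set_system setT (f i) measurable.

Lemma fam_measurable (I : Type) (f : I -> Omega -> R) i :
  measurable_fun (setT : set (g_sigma_algebraType (fam_preimages f))) (f i).
Proof.
move=> _ B mB; rewrite setTI; apply: sub_sigma_algebra; exists i => //; exists B => //.
by rewrite setTI.
Qed.

Lemma ae_measure_eq (D E : set Omega) : measurable D -> measurable E ->
  {ae P, forall w, D w <-> E w} -> P D = P E.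
Proof.
move=> mD mE [N [mN N0 sub]].
have le (D' E' : set Omega) : measurable D' -> measurable E' -> (forall w, ~ N w -> D' w -> E' w) -> (P D' <= P E')%E.
  move=> mD' mE' h; apply: (@le_trans _ _ (P (E' `|` N))).
    apply: le_measure; rewrite ?inE//; first exact: measurableU.
    by move=> w Dw; have [Nw|Nw] := pselect (N w); [right|left; exact: h].
  by apply: (@le_trans _ _ (P E' + P N)%E); [exact: measureU2|rewrite N0 adde0].
have iff w : ~ N w -> (D w <-> E w) by move=> Nw; apply: contrapT => h; exact/Nw/sub.
by apply/eqP; rewrite eq_le; apply/andP; split; apply: le => // w /iff [].
Qed.

Section generated.
Variable G : set (set Omega).
Hypothesis Gm : G `<=` measurable.
Let TG := g_sigma_algebraType G.

Let sGm : <<s G >> `<=` (measurable : set (set Omega)).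
Proof. by apply: smallest_sub => //; exact: sigma_algebra_measurable. Qed.

Let mid : measurable_fun setT (id : Omega -> TG).
Proof. by move=> _ B mB; rewrite setTI; exact: sGm. Qed.

Lemma version_measurable E g : cond_prob_version P <<s G >> E g -> measurable_fun setT g.
Proof. by move=> [mg _ _] _ B mB; rewrite setTI; apply: sGm; exact: mg. Qed.

(** Both versions are densities of one measure on the sigma-algebra; the identity
    map onto the coarser space transports the uniqueness of densities. *)
Lemma version_unique E g h : cond_prob_version P <<s G >> E g -> cond_prob_version P <<s G >> E h ->
  {ae P, forall w, g w = h w}.
Proof.
move=> [mg ig eg] [mh ih eh].
pose I' : {mfun Omega >-> TG} := HB.pack (id : Omega -> TG) (isMeasurableFun.Build _ _ _ _ _ mid).
have mg' : measurable_fun (setT : set TG) (EFin \o g : TG -> \bar R).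
  by apply/measurable_EFinP => _ B mB; rewrite setTI; exact: mg.
have mh' : measurable_fun (setT : set TG) (EFin \o h : TG -> \bar R).
  by apply/measurable_EFinP => _ B mB; rewrite setTI; exact: mh.
have iG (f : Omega -> R) : measurable_fun (setT : set TG) (EFin \o f : TG -> \bar R) ->
    P.-integrable setT (EFin \o f) -> (distribution P I').-integrable setT (EFin \o f : TG -> \bar R).
  by move=> mf jf; exact: (integrable_pushforward mid mf jf measurableT).
have intG (f : Omega -> R) (A : set TG) : measurable_fun (setT : set TG) (EFin \o f : TG -> \bar R) ->
    P.-integrable setT (EFin \o f) -> measurable A ->
    (\int[distribution P I']_(w in A) (f w)%:E = \int[P]_(w in A) (f w)%:E)%E.
  move=> mf jf mA; apply: (integral_pushforward mid mf _ mA).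
  by apply: integrableS jf => //; exact: sGm.
have [N [mN N0 sub]] : ae_eq (distribution P I') setT (EFin \o g) (EFin \o h).
  apply: integral_ae_eq => //; first exact: iG.
  move=> A _ mA; rewrite intG// intG//.
  by rewrite eg// eh.
exists N; split=> // [|w /= nw]; first exact: sGm.
by apply: sub => /= /(_ I) [].
Qed.

(** Freezing: given the sigma-algebra, the probability of an event that
    depends on an independent variable is obtained by averaging over that
    variable alone. *)
Lemma freezing d3 (T3 : measurableType d3) (Y : Omega -> T3) (S : set (TG * T3)) :
  measurable_fun setT Y -> indep_maps P (id : Omega -> TG) Y -> measurable S ->
  cond_prob_version P <<s G >> [set w | S (w, Y w)] (fun w => fine (P [set v | S (w, Y v)])).
Proof.
move=> mY iY mS.
pose Y' : {mfun Omega >-> T3} := HB.pack Y (isMeasurableFun.Build _ _ _ _ _ mY).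
have secE w : P [set v | S (w, Y v)] = (distribution P Y' \o xsection S) w.
  by congr (P _); apply/seteqP; split=> v /=; rewrite /xsection /= inE.
have mh : measurable_fun (setT : set TG) (fun w : TG => fine (P [set v | S (w, Y v)])).
  under eq_fun do rewrite secE; apply: measurableT_comp => //.
  exact: (measurable_fun_xsection (distribution P Y') mS).
have msec w : measurable [set v | S (w, Y v)].
  rewrite (_ : [set v | _] = Y @^-1` xsection S w).
    by rewrite -[X in measurable X]setTI; exact: (mY measurableT _ (measurable_xsection _ mS)).
  by apply/seteqP; split=> v /=; rewrite /xsection /= inE.
have h01 w : 0 <= fine (P [set v | S (w, Y v)]) <= 1.
  rewrite fine_ge0//= -lee_fin fineK ?fin_num_measure//; exact: probability_le1.
have mhO : measurable_fun (setT : set Omega) (fun w : Omega => fine (P [set v | S (w, Y v)])).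
  by move=> _ B mB; rewrite setTI; apply: sGm; have := mh measurableT B mB; rewrite setTI.
split.
- by move=> B mB; have := mh measurableT B mB; rewrite setTI.
- apply: bounded_mfun_integrable; split=> //; exists 1 => w.
  by have /andP[a b] := h01 w; rewrite ger0_norm.
move=> A GA; have mA : measurable A by exact: sGm.
pose W : set (TG * T3) := (A `*` setT) `&` S.
have mW : measurable W by apply: measurableI => //; exact: measurableX.
have mE : measurable [set w | S (w, Y w)].
  have mid2 : measurable_fun setT (fun w : Omega => ((w : TG), Y w)) by exact: measurable_fun_pair.
  by have := mid2 measurableT S mS; rewrite setTI.
have := @ge0_integral_indep _ _ _ _ _ _ _ P (id : Omega -> TG) Y (fun z => (\1_W z)%:E) mid mY iY.
move=> /(_ _ _) H; have {H} : (\int[P]_w (\1_W ((w : TG), Y w))%:E = \int[P]_w1 \int[P]_w2 (\1_W ((w1 : TG), Y w2))%:E)%E.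
  apply: H; first by apply/measurable_EFinP; exact: measurable_indic.
  by move=> z; rewrite lee_fin.
have -> : (fun w => (\1_W ((w : TG), Y w))%:E : \bar R) = fun w => (\1_(A `&` [set w | S (w, Y w)]) w)%:E.
  apply/funext => w; rewrite !indicE; congr ((nat_of_bool _)%:R)%:E.
  by apply/idP/idP; rewrite !inE => -[] /=; [move=> [a _] b|move=> a b].
rewrite integral_indic ?setIT//; last exact: measurableI.
move=> ->; rewrite integral_mkcond; apply: eq_integral => w1 _.
rewrite patchE; case: ifPn => wA.
  rewrite fineK ?fin_num_measure// -[RHS]/(\int[P]_w2 (\1_W (w1, Y w2))%:E)%E.
  have -> : (fun w2 => (\1_W (w1, Y w2))%:E : \bar R) = fun w2 => (\1_([set v | S (w1, Y v)]) w2)%:E.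
    apply/funext => w2; rewrite !indicE; congr ((nat_of_bool _)%:R)%:E; move: wA; rewrite inE => wA.
    by apply/idP/idP; rewrite !inE; [case|move=> h; split].
  by rewrite integral_indic ?setIT.
have -> : (fun w2 => (\1_W (w1, Y w2))%:E : \bar R) = cst 0%E.
  apply/funext => w2; rewrite indicE memNset// => -[[/= a _] _].
  by move: wA; rewrite notin_setE.
by rewrite integral0.
Qed.
End generated.
End conditional_probabilities.

(** * Fixed and random designs *)

Section coverage_probability.
Context {R : realType} {d : measure_display} {Omega : measurableType d} (P : probability Omega R).
Variables (p : nat) (epsf : {RV P >-> R}) (beta : 'cV[R]_p).

Definition coverage_prob n (X : 'M[R]_(n, p)) (xf : 'cV[R]_p) (y : 'cV[R]_n) (a c : R) : R :=
  fine (P [set v | (`|dot xf beta + epsf v - dot xf (ols X y)|%:E <= Cstar X xf y a c)%E]).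

Section parameter.
Context {d1 : measure_display} {T1 : measurableType d1} (n : nat).
Variables (X : T1 -> 'M[R]_(n, p)) (xf : T1 -> 'cV[R]_p) (y : T1 -> 'cV[R]_n) (a c : R).
Hypotheses (mX : mx_measurable X) (mxf : mx_measurable xf) (my : mx_measurable y).
Hypotheses (n0 : (0 < n)%N) (hc : 0 < c < 1).

Definition cover_set : set (T1 * R) := [set z |
  (`|dot (xf z.1) beta + z.2 - dot (xf z.1) (ols (X z.1) (y z.1))|%:E <= Cstar (X z.1) (xf z.1) (y z.1) a c)%E].

Lemma cover_set_measurable : measurable cover_set.
Proof.
have m1 (f : T1 -> R) : measurable_fun setT f -> measurable_fun setT (fun z : T1 * R => f z.1).
  by move=> mf; apply: (measurableT_comp mf); exact: measurable_fst.
have mf : measurable_fun setT (fun z : T1 * R =>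
    (`|dot (xf z.1) beta + z.2 - dot (xf z.1) (ols (X z.1) (y z.1))|%:E : \bar R)).
  apply/measurable_EFinP; apply: measurableT_comp => //; apply: measurable_funB.
    apply: measurable_funD; last exact: measurable_snd.
    by apply: (m1 (fun w => dot (xf w) beta)); apply: dot_measurable => //; exact: mx_measurable_cst.
  by apply: (m1 (fun w => dot (xf w) (ols (X w) (y w)))); apply: dot_measurable => //; exact: ols_measurable.
have mg : measurable_fun setT (fun z : T1 * R => Cstar (X z.1) (xf z.1) (y z.1) a c).
  apply: (measurableT_comp (Cstar_measurable mX mxf my n0 a hc)); exact: measurable_fst.
have := measurable_fun_lee mf mg; move=> /(_ measurableT [set true] I); rewrite setTI => h.
by move: h; congr measurable; apply/seteqP; split.
Qed.

Lemma coverage_prob_measurable : measurable_fun setT (fun w => coverage_prob (X w) (xf w) (y w) a c).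
Proof.
have -> : (fun w => coverage_prob (X w) (xf w) (y w) a c) =
    fun w => fine ((distribution P epsf \o xsection cover_set) w).
  apply/funext => w; congr (fine (P _)); apply/seteqP; split=> v /=; by rewrite /xsection /= inE.
apply: measurableT_comp => //; exact: (measurable_fun_xsection (distribution P epsf) cover_set_measurable).
Qed.
End parameter.
End coverage_probability.

Section main.
Context (R : realType) (d : measure_display) (Omega : measurableType d) (P : probability Omega R) (p : nat).
Variables (eps : nat -> {RV P >-> R}) (epsf : {RV P >-> R}) (beta : 'cV[R]_p) (sigma : R).
Hypothesis p_gt0 : (0 < p)%N.
Hypothesis eps_indep : mutual_indep P (fun i => eps i : Omega -> R).
Hypothesis eps_ident : forall i (B : set R), measurable B ->
  distribution P (eps i) B = distribution P (eps 0%N) B.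
Hypothesis eps_mean : ('E_P[eps 0%N] = 0)%E.
Hypothesis eps_var : ('V_P[eps 0%N] = (sigma ^+ 2)%R%:E)%E.
Hypothesis eps_ac : distribution P (eps 0%N) `<< (@lebesgue_measure R).
Hypothesis F_derivable : forall t, derivable (real_cdf (eps 0%N)) t 1.
Hypothesis eps_moment4 : ('E_P[fun w => (`|eps 0%N w| ^+ 4)%R] < +oo)%E.
Hypothesis epsf_indep : indep_fam P (fun _ : unit => epsf : Omega -> R) (fun i => eps i : Omega -> R).
Hypothesis epsf_ident : forall B : set R, measurable B ->
  distribution P epsf B = distribution P (eps 0%N) B.
Let F := real_cdf (eps 0%N).
Let H := truncated_mean (eps 0%N).
Let nu := distribution P (eps 0%N).

Lemma law_moment4 : nu.-integrable setT (fun t => (t ^+ 4)%:E).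
Proof.
have m4 : measurable_fun setT (fun t : R => t ^+ 4) by exact: measurable_funX.
apply/integrableP; split; first exact/measurable_EFinP.
have := law_ge0 eps_ident 0 (phi := fun t : R => `|(t ^+ 4)%:E|%E) => <- //; last first.
  by apply: measurableT_comp => //; exact/measurable_EFinP.
move: eps_moment4; rewrite unlock; apply: le_lt_trans; rewrite le_eqVlt; apply/orP; left; apply/eqP.
by apply: eq_integral => w _; rewrite abse_EFin normrX.
Qed.

Let nu2 (phi : R -> R) (C : R) := @nu_integrable2 _ _ _ P eps law_moment4 phi C.
Let idm : measurable_fun setT (fun t : R => t). Proof. exact: measurable_id. Qed.
Let idb (t : R) : `|t| <= 1 * (1 + t ^+ 2). Proof. by rewrite mul1r abs_le_sqr. Qed.

Lemma law_mean : \int[nu]_t t = 0.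
Proof.
have [_ <-] := law_integral eps_ident 0 idm (nu2 idm idb).1.
by have := eps_mean; rewrite unlock => h; rewrite /Rintegral h.
Qed.

Lemma law_var : \int[nu]_t (t ^+ 2) = sigma ^+ 2.
Proof.
have m2 : measurable_fun setT (fun t : R => t ^+ 2) by exact: measurable_funX.
have [_ <-] := law_integral eps_ident 0 m2 (nu2 idm idb).2.
apply: EFin_inj; rewrite -eps_var /variance unlock eps_mean /=.
rewrite unlock /Rintegral fineK; last exact: (integrable_fin_num measurableT (law_integral eps_ident 0 m2 (nu2 idm idb).2).1).
by apply: eq_integral => w _; congr EFin; rewrite -[RHS]/((eps 0%N w - 0) * (eps 0%N w - 0)) subr0 expr2.
Qed.

Lemma truncated_meanE t0 : H t0 = \int[nu]_t (t * (t <= t0)%R%:R).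
Proof.
have mt : measurable_fun setT (fun t : R => t * (t <= t0)%R%:R).
  by apply: measurable_funM => //; exact: ind_measurable.
have bt (t : R) : `|t * (t <= t0)%R%:R| <= 1 * (1 + t ^+ 2).
  rewrite normrM (le_trans _ (idb t))// ler_piMr//.
  by case: (t <= t0)%R; rewrite ?normr1 ?normr0.
have [_ <-] := law_integral eps_ident 0 mt (nu2 mt bt).1.
by rewrite /H /truncated_mean unlock.
Qed.

Lemma law_atomless a : nu [set a] = 0%E.
Proof.
have N1 := (measure0_null_setP (@lebesgue_measure R) (measurable_set1 a)).2 (lebesgue_measure_set1 a).
exact: (eps_ac N1 (measurable_set1 a) (@subset_refl _ _)).
Qed.

Lemma law_interval u v : u <= v -> fine (nu `[u, v]) = F v - F u.
Proof.
move=> uv; have m1 : measurable (`]-oo, u] : set R) by exact: measurable_itv.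
have m2 : measurable (`]u, v] : set R) by exact: measurable_itv.
have e1 : (nu `]-oo, v] = nu `]-oo, u] + nu `]u, v])%E.
  rewrite -measureU//; last first.
    by apply/seteqP; split=> // t [/=]; rewrite !in_itv/= => h1 /andP[h2 _]; move: h1; rewrite leNgt h2.
  congr (nu _); apply/seteqP; split=> t /=; rewrite !in_itv/=.
    by move=> tv; have [h|h] := leP t u; [left|right].
  by case=> [/le_trans|/andP[_]] //; exact.
have e2 : (nu `[u, v] = nu [set u] + nu `]u, v])%E.
  rewrite -measureU//; last first.
    by apply/seteqP; split=> // t [/= ->]; rewrite in_itv/= ltxx.
  congr (nu _); apply/seteqP; split=> t /=; rewrite !in_itv/=.
    by move=> /andP[ut tv]; move: ut; rewrite le_eqVlt => /orP[/eqP <-|h]; [left|right; apply/andP].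
  by case=> [->|/andP[/ltW -> ->]//]; rewrite lexx.
rewrite e2 law_atomless add0e /F /real_cdf /cdf -/nu e1 fineD ?fin_num_measure//.
by rewrite addrAC subrr add0r.
Qed.

Lemma cdf_continuous : continuous F.
Proof. by move=> t; apply: differentiable_continuous; apply/derivable1_diffP. Qed.

(** The population quantile of the absolute error. *)
Lemma absolute_quantile (a : R) : 0 < a < 1 -> exists2 c, 0 < c & F c - F (- c) = a.
Proof.
move=> /andP[a0 a1]; pose k := (1 - a) / 2; have k0 : 0 < k by rewrite divr_gt0// subr_gt0.
have fc1 : F t @[t --> +oo] --> (1 : R) by apply: fine_cvg; exact: cvg_cdfy1.
have fc0 : F t @[t --> -oo] --> (0 : R) by apply: fine_cvg; exact: cvg_cdfNy0.
have [M1 [_ h1]] : \forall t \near +oo, `|F t - 1| <= k / 2 by apply: cvgR_near fc1 _; rewrite divr_gt0.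
have [M2 [_ h2]] : \forall t \near -oo, `|F t - 0| <= k / 2 by apply: cvgR_near fc0 _; rewrite divr_gt0.
pose b := `|M1| + `|M2| + 1.
have b1 : M1 < b by rewrite (le_lt_trans (ler_norm _))// /b -addrA ltrDl ltr_wpDl.
have b2 : - b < M2.
  by have := ler_norm (- M2); rewrite normrN /b; have := normr_ge0 M1; move: `|M1| `|M2| => y1 y2; lra.
have b0 : 0 <= b by rewrite !addr_ge0.
have Gb : a < F b - F (- b).
  have := h1 _ b1; have := h2 _ b2; rewrite subr0 !ler_norml => /andP[_ u1] /andP[u2 _].
  have k2 : k + k = 1 - a by rewrite /k -splitr.
  move: u1 u2; move: (F b) (F (- b)) => y1 y2 u1 u2; have k2' : k / 2 + k / 2 = k by rewrite -splitr.
  lra.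
have cG : continuous (fun t => F t - F (- t)).
  move=> t; apply: cvgB; first exact: cdf_continuous.
  by apply: (@continuous_comp _ _ _ (fun t => - t) F); [exact: opp_continuous|exact: cdf_continuous].
have cab : Num.min (F 0 - F (- 0)) (F b - F (- b)) <= a <= Num.max (F 0 - F (- 0)) (F b - F (- b)).
  by rewrite oppr0 subrr ge_min le_max (ltW a0) (ltW Gb) orbT.
have [c] := @IVT R (fun t => F t - F (- t)) 0 b a b0 (continuous_subspaceT cG) cab.
rewrite in_itv/= => /andP[c0 _] cE; exists c => //; rewrite lt_neqAle c0 andbT.
by apply/eqP => c0'; move: cE; rewrite -c0' oppr0 subrr => aE; move: a0; rewrite -aE ltxx.
Qed.

Variables (alpha gamma : R).
Hypotheses (ha : 0 < alpha < 1) (hg : 0 < gamma < 1).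

Let h1a : 0 < 1 - alpha < 1. Proof. by move/andP : ha => [? ?]; rewrite subr_gt0 gtrBl; apply/andP. Qed.
Let h1g : 0 < 1 - gamma < 1. Proof. by move/andP : hg => [? ?]; rewrite subr_gt0 gtrBl; apply/andP. Qed.

Let cov (x : nat -> 'cV[R]_p) (xf : 'cV[R]_p) n v := if (p <= n)%N then
  coverage_prob epsf beta (design x n) xf (obs eps beta (cst x) n v) (1 - alpha) (1 - gamma) else 0.

Lemma mx_measurable_add d1 (T1 : measurableType d1) m n (A B : T1 -> 'M[R]_(m, n)) :
  mx_measurable A -> mx_measurable B -> mx_measurable (fun w => A w + B w).
Proof. by move=> mA mB i j; under eq_fun do rewrite mxE; exact: measurable_funD. Qed.

(** The hypotheses on the law of the errors enter through its mean, its variance,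
    its truncated mean and its fourth moment; the variance V of the score at c is
    the positive quantity of the assumptions. *)
Theorem fixed_design_limits (x : nat -> 'cV[R]_p) (xf : 'cV[R]_p) : design_assumptions F H sigma x xf ->
  (forall delta, 0 < delta -> fine (P [set v | `|cov x xf n v - (1 - alpha)| <= delta]%R) @[n --> \oo] --> (1 : R)) /\
  fine (P [set v | 1 - alpha <= cov x xf n v]%R) @[n --> \oo] --> 1 - gamma.
Proof.
move=> [uX [A [b [M [uA XA xb [M0 xM xfM] [F'0 U0]]]]]].
have [c c0 Fc] := absolute_quantile h1a.
pose s2 := sigma ^+ 2; pose mu := \int[nu]_t (t * ((t <= c)%R%:R - (t <= - c)%R%:R)).
pose v1 := dot xf (invmx A *m xf); pose v2 := dot xf (invmx A *m b).
pose g := derive1 F c - derive1 F (- c).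
have muE : mu = H c - H (- c).
  have mt t0 : measurable_fun setT (fun t : R => t * (t <= t0)%R%:R).
    by apply: measurable_funM => //; exact: ind_measurable.
  have bt t0 (t : R) : `|t * (t <= t0)%R%:R| <= 1 * (1 + t ^+ 2).
    rewrite normrM (le_trans _ (idb t))// ler_piMr//.
    by case: (t <= t0)%R; rewrite ?normr1 ?normr0.
  rewrite !truncated_meanE -RintegralB//; [|exact: (nu2 (mt _) (bt _)).1|exact: (nu2 (mt _) (bt _)).1].
  by apply: eq_Rintegral => t _; rewrite mulrBr.
have VE : g ^+ 2 * s2 * (v1 + 1 - 2 * v2) - 2 * g * mu * (v2 - 1) + (1 - alpha) * alpha = Uvar F H sigma xf A b c.
  rewrite /Uvar /Vcov !minxx (min_r _ : Num.min c (- c) = - c); last by lra.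
  have -> : alpha = 1 - (F c - F (- c)) by rewrite Fc subKr.
  by rewrite muE /g /s2 -/v1 -/v2; ring.
have V0 : 0 < g ^+ 2 * s2 * (v1 + 1 - 2 * v2) - 2 * g * mu * (v2 - 1) + (1 - alpha) * alpha by rewrite VE U0.
have vpos := divr_gt0 V0 (@gauss_m2_gt0 R).
have [Q QE] : exists Q, gcdf ((g ^+ 2 * s2 * (v1 + 1 - 2 * v2) - 2 * g * mu * (v2 - 1) + (1 - alpha) * alpha) / gauss_m2) Q = 1 - gamma.
  by have /andP[q1 q2] := h1g; exact: gcdf_surj.
have mcov n : measurable_fun setT (cov x xf n).
  have [pn|pn] := leqP p n; last by rewrite /cov leqNgt pn; exact: measurable_cst.
  rewrite /cov pn; apply: (coverage_prob_measurable epsf beta (X := fun _ => design x n) (xf := fun _ => xf)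
    (y := fun v => obs eps beta (cst x) n v)) => //.
  - move=> i j; have -> : (fun w => obs eps beta (cst x) n w i j) = fun w => (design x n *m beta) i j + eps i w.
      by apply/funext => w; rewrite /obs mxE; congr (_ + _); rewrite mxE.
    by apply: measurable_funD => //; exact: measurable_funP.
  - exact: leq_trans p_gt0 pn.
have covE n v C : (p <= n)%N -> 0 < C ->
    Cstar (design x n) xf (obs eps beta (cst x) n v) (1 - alpha) (1 - gamma) = C%:E ->
    cov x xf n v = F (dot xf (ols (design x n) (\col_(i < n) eps i v)) + C) -
      F (dot xf (ols (design x n) (\col_(i < n) eps i v)) - C).
  move=> pn C0 CE; rewrite /cov pn /coverage_prob CE; set z := dot xf (ols _ (\col__ _)).
  have -> : dot xf (ols (design x n) (obs eps beta (cst x) n v)) = dot xf beta + z.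
    by rewrite /obs ols_model ?dotDr//; exact: uX.
  rewrite -law_interval; last by lra.
  rewrite /nu -epsf_ident; last exact: measurable_itv.
  congr (fine (P _)); apply/seteqP; split=> w /=; rewrite lee_fin in_itv/= opprD addrACA subrr add0r ler_distl//.
have main1 := coverage_consistent eps_indep eps_ident law_moment4 law_mean law_var F_derivable uX uA XA xb M0 xM xfM
  c0 (F'0 c) (F'0 (- c)) Fc V0 QE mcov covE.
have main2 := coverage_guarantee eps_indep eps_ident law_moment4 law_mean law_var F_derivable uX uA XA xb M0 xM xfM
  c0 (F'0 c) (F'0 (- c)) Fc V0 QE mcov covE.
by split; [exact: main1|exact: main2].
Qed.

Lemma observations_measurable d1 (T1 : measurableType d1) n (X : T1 -> 'M[R]_(n, p)) (ee : T1 -> 'cV[R]_n) :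
  mx_measurable X -> mx_measurable ee -> mx_measurable (fun w => X w *m beta + ee w).
Proof.
move=> mX me; apply: (mx_measurable_add (A := fun w => X w *m beta) (B := ee)) => //.
exact: (mx_measurable_mul mX (mx_measurable_cst beta)).
Qed.

Let mepsf : measurable_fun setT (epsf : Omega -> R). Proof. exact: measurable_funP. Qed.

Let epsf_sigma B : measurable B -> sigma_of (fun _ : unit => epsf : Omega -> R) (epsf @^-1` B).
Proof. by move=> mB; apply: sub_sigma_algebra; exists tt => //; exists B => //; rewrite setTI. Qed.

(** With a fixed design the conditional probability given the observations is
    the coverage probability with the observations held fixed. *)
Lemma fixed_version (x : nat -> 'cV[R]_p) (xf : 'cV[R]_p) n : (p <= n)%N ->
  cond_prob_version P (sigma_of (@obs_fam _ _ _ _ (fun i => eps i : Omega -> R) beta (cst x) n))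
    (coverage_event (fun i => eps i : Omega -> R) epsf beta (cst x) (cst xf) (1 - alpha) (1 - gamma) n) (cov x xf n).
Proof.
move=> pn; have n0 : (0 < n)%N by exact: leq_trans p_gt0 pn.
pose fm := @obs_fam _ _ _ _ (fun i => eps i : Omega -> R) beta (cst x) n.
have on_errors : sigma_of fm `<=` sigma_of (fun i => eps i : Omega -> R).
  apply: sigma_of_sub => [|i B mB]; first exact: smallest_sigma_algebra.
  pose TE := g_sigma_algebraType (fam_preimages (fun i => eps i : Omega -> R)).
  have mo : measurable_fun (setT : set TE) (fun w : TE => (design x n *m beta) i 0 + eps i w).
    by apply: measurable_funD => //; exact: (@fam_measurable _ _ _ _ (fun i => eps i : Omega -> R) i).
  have -> : fm i = fun w => (design x n *m beta) i 0 + eps i w.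
    by apply/funext => w; rewrite /fm /obs_fam /obs mxE; congr (_ + _); rewrite mxE.
  by have := mo measurableT B mB; rewrite setTI.
have eps_meas : sigma_of (fun i => eps i : Omega -> R) `<=` measurable.
  apply: sigma_of_sub => [|i B mB]; first exact: sigma_algebra_measurable.
  by rewrite -[X in measurable X]setTI; exact: measurable_funP.
have Gm : fam_preimages fm `<=` measurable.
  move=> A GA; have : sigma_of fm A by apply: sub_sigma_algebra.
  by move=> /on_errors /eps_meas.
have my : mx_measurable (fun w : g_sigma_algebraType (fam_preimages fm) => obs (fun i => eps i : Omega -> R) beta (cst x) n w).
  by move=> i j; rewrite (ord1 j); exact: (@fam_measurable _ _ _ _ fm i).
have mS := cover_set_measurable beta (X := fun _ : g_sigma_algebraType (fam_preimages fm) => design x n)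
  (xf := fun _ => xf) (1 - alpha) (mx_measurable_cst _) (mx_measurable_cst _) my n0 h1g.
have ind : indep_maps P (id : Omega -> g_sigma_algebraType (fam_preimages fm)) (epsf : Omega -> R).
  move=> A B mA mB; rewrite setIC muleC.
  by apply: epsf_indep; [exact: epsf_sigma|exact: on_errors].
have -> : cov x xf n = fun v => coverage_prob epsf beta (design x n) xf (obs (fun i => eps i : Omega -> R) beta (cst x) n v) (1 - alpha) (1 - gamma).
  by apply/funext => v; rewrite /cov pn.
exact: (freezing Gm mepsf ind mS).
Qed.

Lemma interval_measurable (delta : R) : measurable [set u : R | `|u - (1 - alpha)| <= delta]%R.
Proof.
by apply: measurable_le_pair => //; apply: measurableT_comp => //; exact: measurable_funB.
Qed.

Lemma ray_measurable : measurable [set u : R | 1 - alpha <= u]%R.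
Proof. exact: measurable_le_pair. Qed.

Lemma fixed_transfer (x : nat -> 'cV[R]_p) (xf : 'cV[R]_p) (g : nat -> Omega -> R) (Es : set R) (l : R) : measurable Es ->
  (forall n, (p <= n)%N -> cond_prob_version P (sigma_of (@obs_fam _ _ _ _ (fun i => eps i : Omega -> R) beta (cst x) n))
    (coverage_event (fun i => eps i : Omega -> R) epsf beta (cst x) (cst xf) (1 - alpha) (1 - gamma) n) (g n)) ->
  fine (P [set v | Es (cov x xf n v)]) @[n --> \oo] --> l ->
  P [set w | Es (g n w)] @[n --> \oo] --> l%:E.
Proof.
move=> mE hg' lim.
have Gm n : fam_preimages (@obs_fam _ _ _ _ (fun i => eps i : Omega -> R) beta (cst x) n) `<=` measurable.
  move=> A [i _ [B mB <-]]; rewrite setTI.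
  have mo : measurable_fun setT (fun w => (design x n *m beta) i 0 + eps i w).
    by apply: measurable_funD => //; exact: measurable_funP.
  have -> : obs_fam (fun i => eps i : Omega -> R) beta (cst x) i = fun w => (design x n *m beta) i 0 + eps i w.
    by apply/funext => w; rewrite /obs_fam /obs mxE; congr (_ + _); rewrite mxE.
  by have := mo measurableT B mB; rewrite setTI.
have eqP n : (p <= n)%N -> measurable [set w | Es (g n w)] /\ P [set w | Es (g n w)] = P [set v | Es (cov x xf n v)].
  move=> pn; have v1 := hg' n pn; have v2 := fixed_version x xf pn.
  have m1 := version_measurable (@Gm n) v1; have m2 := version_measurable (@Gm n) v2.
  have M1 : measurable [set w | Es (g n w)] by have := m1 measurableT Es mE; rewrite setTI.
  have M2 : measurable [set w | Es (cov x xf n w)] by have := m2 measurableT Es mE; rewrite setTI.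
  split=> //; apply: ae_measure_eq => //.
  by apply: filterS (version_unique (@Gm n) v1 v2) => w /= ->.
apply/fine_cvgP; split.
  by exists p => // n /= pn; have [m1 _] := eqP n pn; exact: fin_num_measure.
apply: cvgR_near_eq lim; exists p => // n /= pn; have [_ e] := eqP n pn.
by rewrite /= e.
Qed.

Section random_design.
Variables (x : Omega -> nat -> 'cV[R]_p) (xf : Omega -> 'cV[R]_p).
Hypothesis mx : forall i j, measurable_fun setT (fun w => x w i j 0).
Hypothesis mxf : forall j, measurable_fun setT (fun w => xf w j 0).
Let eta (i : nat) : Omega -> R := eps i.
Let ef (_ : unit) : Omega -> R := epsf.
Let errors := join_fam eta ef.
Hypothesis xf_indep : indep_fam P (xf_fam xf) errors.
Hypothesis x_indep : indep_fam P (regressor_fam x) (join_fam errors (xf_fam xf)).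

Let sI (I : Type) (f : I -> Omega -> R) A B : sigma_of f A -> sigma_of f B -> sigma_of f (A `&` B).
Proof. exact: (@measurableI _ (g_sigma_algebraType (fam_preimages f))). Qed.

Let sT (I : Type) (f : I -> Omega -> R) : sigma_of f setT.
Proof. exact: (@measurableT _ (g_sigma_algebraType (fam_preimages f))). Qed.

Let join_l (I J : Type) (f : I -> Omega -> R) (g : J -> Omega -> R) : sigma_of f `<=` sigma_of (join_fam f g).
Proof.
apply: sigma_of_sub => [|i B mB]; first exact: smallest_sigma_algebra.
by apply: sub_sigma_algebra; exists (inl i) => //; exists B => //; rewrite setTI.
Qed.

Let join_r (I J : Type) (f : I -> Omega -> R) (g : J -> Omega -> R) : sigma_of g `<=` sigma_of (join_fam f g).
Proof.
apply: sigma_of_sub => [|i B mB]; first exact: smallest_sigma_algebra.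
by apply: sub_sigma_algebra; exists (inr i) => //; exists B => //; rewrite setTI.
Qed.

(** The three independence relations combine into a product formula. *)
Lemma four_indep A1 A2 A3 B : sigma_of eta A1 -> sigma_of (xf_fam xf) A2 -> sigma_of (regressor_fam x) A3 ->
  measurable B -> P ((A1 `&` (A2 `&` A3)) `&` epsf @^-1` B) = (P A1 * (P A2 * P A3) * P (epsf @^-1` B))%E.
Proof.
move=> s1 s2 s3 mB; have sB := epsf_sigma mB.
have e1 : sigma_of errors (A1 `&` epsf @^-1` B) by apply: sI; [exact: join_l|exact: join_r].
have -> : A1 `&` (A2 `&` A3) `&` epsf @^-1` B = A3 `&` (A2 `&` (A1 `&` epsf @^-1` B)).
  by apply/seteqP; split=> [w [[a1 [a2 a3]] a4]|w [a3 [a2 [a1 a4]]]]; do ?split.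
rewrite x_indep//; last by apply: sI; [exact: join_r|exact: join_l].
rewrite xf_indep// [A1 `&` _]setIC epsf_indep//.
by rewrite (muleC (P A1)) (muleC (P A2) (P A3)) -!muleA (muleC (P A1)).
Qed.

Lemma three_indep A1 A2 A3 : sigma_of eta A1 -> sigma_of (xf_fam xf) A2 -> sigma_of (regressor_fam x) A3 ->
  P (A1 `&` (A2 `&` A3)) = (P A1 * (P A2 * P A3))%E.
Proof.
move=> s1 s2 s3; have := four_indep s1 s2 s3 measurableT.
by rewrite preimage_setT setIT probability_setT mule1.
Qed.

Let on_Omega (I : Type) (f : I -> Omega -> R) : (forall i, measurable_fun setT (f i)) -> sigma_of f `<=` measurable.
Proof.
move=> mf; apply: sigma_of_sub => [|i B mB]; first exact: sigma_algebra_measurable.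
by rewrite -[X in measurable X]setTI; exact: mf.
Qed.

Let m_eta : sigma_of eta `<=` measurable. Proof. by apply: on_Omega => i; exact: measurable_funP. Qed.
Let m_xf : sigma_of (xf_fam xf) `<=` measurable. Proof. by apply: on_Omega => j; exact: mxf. Qed.
Let m_x : sigma_of (regressor_fam x) `<=` measurable. Proof. by apply: on_Omega => ij; exact: mx. Qed.

Let Pi : set (set Omega) := [set A | exists A1 A2 A3, [/\ sigma_of eta A1, sigma_of (xf_fam xf) A2,
  sigma_of (regressor_fam x) A3 & A = A1 `&` (A2 `&` A3)]].
Let TPi := g_sigma_algebraType Pi.

Let PiI : setI_closed Pi.
Proof.
move=> _ _ [A1 [A2 [A3 [a1 a2 a3 ->]]]] [B1 [B2 [B3 [b1 b2 b3 ->]]]].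
exists (A1 `&` B1), (A2 `&` B2), (A3 `&` B3); split; try exact: sI.
by rewrite setIACA [X in _ `&` X]setIACA.
Qed.

Let PiT : Pi setT.
Proof. by exists setT, setT, setT; split; try exact: sT; rewrite !setIT. Qed.

Let Pim : Pi `<=` measurable.
Proof.
move=> _ [A1 [A2 [A3 [a1 a2 a3 ->]]]].
by apply: measurableI; [exact: m_eta|apply: measurableI; [exact: m_xf|exact: m_x]].
Qed.

Let pi_eta i : measurable_fun (setT : set TPi) (eta i).
Proof.
move=> _ B mB; rewrite setTI; apply: sub_sigma_algebra; exists (eta i @^-1` B), setT, setT.
split; try exact: sT; last by rewrite !setIT.
by apply: sub_sigma_algebra; exists i => //; exists B => //; rewrite setTI.
Qed.

Let pi_xf j : measurable_fun (setT : set TPi) (xf_fam xf j).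
Proof.
move=> _ B mB; rewrite setTI; apply: sub_sigma_algebra; exists setT, (xf_fam xf j @^-1` B), setT.
split; try exact: sT; last by rewrite setTI setIT.
by apply: sub_sigma_algebra; exists j => //; exists B => //; rewrite setTI.
Qed.

Let pi_x ij : measurable_fun (setT : set TPi) (regressor_fam x ij).
Proof.
move=> _ B mB; rewrite setTI; apply: sub_sigma_algebra; exists setT, setT, (regressor_fam x ij @^-1` B).
split; try exact: sT; last by rewrite !setTI.
by apply: sub_sigma_algebra; exists ij => //; exists B => //; rewrite setTI.
Qed.

Let fyX n := join_fam (@obs_fam _ _ _ _ eta beta x n) (join_fam (@design_fam _ _ _ _ x n) (xf_fam xf)).
Let fX n := join_fam (@design_fam _ _ _ _ x n) (xf_fam xf).

Let pi_design n ij : measurable_fun (setT : set TPi) (@design_fam _ _ _ _ x n ij).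
Proof.
have -> : @design_fam _ _ _ _ x n ij = regressor_fam x (ij.1 : nat, ij.2) by apply/funext => w; rewrite /design_fam mxE.
exact: pi_x.
Qed.

Let fyX_sub n : sigma_of (@fyX n) `<=` <<s Pi >>.
Proof.
apply: sigma_of_sub => [|[i|[ij|j]] B mB]; first exact: smallest_sigma_algebra.
- have mo : mx_measurable (fun w : TPi => design (x w) n *m beta + \col_(k < n) eta k w).
    apply: observations_measurable => k l; first by have := @pi_design n (k, l).
    by under eq_fun do rewrite mxE; exact: pi_eta.
  by have := mo i 0 measurableT B mB; rewrite setTI.
- by have := @pi_design n ij measurableT B mB; rewrite setTI.
- by have := @pi_xf j measurableT B mB; rewrite setTI.
Qed.

Let fyX_m n : fam_preimages (@fyX n) `<=` measurable.
Proof.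
move=> A GA; have /fyX_sub : sigma_of (@fyX n) A by apply: sub_sigma_algebra.
by apply: smallest_sub => //; exact: sigma_algebra_measurable.
Qed.

Let covR n w := coverage_prob epsf beta (design (x w) n) (xf w) (obs eta beta x n w) (1 - alpha) (1 - gamma).

Lemma random_version n : (p <= n)%N -> cond_prob_version P (sigma_of (@fyX n))
  (coverage_event eta epsf beta x xf (1 - alpha) (1 - gamma) n) (covR n).
Proof.
move=> pn; have n0 : (0 < n)%N by exact: leq_trans p_gt0 pn.
pose TG := g_sigma_algebraType (fam_preimages (@fyX n)).
have m1 : mx_measurable (fun w : TG => design (x w) n).
  by move=> i j; exact: (@fam_measurable _ _ _ _ (@fyX n) (inr (inl (i, j)))).
have m2 : mx_measurable (xf : TG -> _).
  by move=> i j; rewrite (ord1 j); exact: (@fam_measurable _ _ _ _ (@fyX n) (inr (inr i))).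
have m3 : mx_measurable (fun w : TG => obs eta beta x n w).
  by move=> i j; rewrite (ord1 j); exact: (@fam_measurable _ _ _ _ (@fyX n) (inl i)).
have mS := cover_set_measurable beta (1 - alpha) m1 m2 m3 n0 h1g.
have ind : indep_maps P (id : Omega -> TG) (epsf : Omega -> R).
  move=> A B mA mB; have mEB : measurable (epsf @^-1` B).
    by rewrite -[X in measurable X]setTI; exact: mepsf.
  apply: (indep_pi_left Pim PiI PiT mEB) => [_ [A1 [A2 [A3 [a1 a2 a3 ->]]]]|]; last exact: (@fyX_sub n A mA).
  by rewrite four_indep// three_indep.
exact: (freezing (@fyX_m n) mepsf ind mS).
Qed.

Let Pi2 : set (set Omega) := [set A | exists A2 A3, [/\ sigma_of (xf_fam xf) A2, sigma_of (regressor_fam x) A3 & A = A2 `&` A3]].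

Let fX_sub n : sigma_of (@fX n) `<=` <<s Pi2 >>.
Proof.
apply: sigma_of_sub => [|[ij|j] B mB]; first exact: smallest_sigma_algebra.
- apply: sub_sigma_algebra; exists setT, (regressor_fam x (ij.1 : nat, ij.2) @^-1` B); split; first exact: sT.
    by apply: sub_sigma_algebra; exists (ij.1 : nat, ij.2) => //; exists B => //; rewrite setTI.
  by rewrite setTI; apply/seteqP; split=> w /=; rewrite /design_fam mxE.
- apply: sub_sigma_algebra; exists (xf_fam xf j @^-1` B), setT; split; [|exact: sT|by rewrite setIT].
  by apply: sub_sigma_algebra; exists j => //; exists B => //; rewrite setTI.
Qed.

Let Pi2m : Pi2 `<=` measurable.
Proof. by move=> _ [A2 [A3 [a2 a3 ->]]]; apply: measurableI; [exact: m_xf|exact: m_x]. Qed.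

Let fX_m n : fam_preimages (@fX n) `<=` measurable.
Proof.
move=> A GA; have /fX_sub : sigma_of (@fX n) A by apply: sub_sigma_algebra.
by apply: smallest_sub => //; exact: sigma_algebra_measurable.
Qed.

(** Given the design, the conditional probability of the coverage event is that of
    the fixed design equal to the frozen value, for which the limit is known; the
    exceptional sets for each n are countably many. *)
Lemma random_transfer (g h : nat -> Omega -> R) (Es : set R) (l : R) : measurable Es ->
  {ae P, forall w, design_assumptions F H sigma (x w) (xf w)} ->
  (forall n, (p <= n)%N -> cond_prob_version P (sigma_of (@fyX n))
    (coverage_event eta epsf beta x xf (1 - alpha) (1 - gamma) n) (g n)) ->
  (forall n, (p <= n)%N -> cond_prob_version P (sigma_of (@fX n)) [set w | Es (g n w)] (h n)) ->
  (forall x0 xf0, design_assumptions F H sigma x0 xf0 -> fine (P [set v | Es (cov x0 xf0 n v)]) @[n --> \oo] --> l) ->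
  {ae P, forall w, h n w @[n --> \oo] --> l}.
Proof.
move=> mE hd hg' hh lim.
pose TE := g_sigma_algebraType (fam_preimages eta).
have version n : (p <= n)%N -> {ae P, forall w, h n w = fine (P [set v | Es (cov (x w) (xf w) n v)])}.
  move=> pn; have n0 : (0 < n)%N by exact: leq_trans p_gt0 pn.
  have v1 := hg' n pn; have v2 := random_version pn.
  have mg := version_measurable (@fyX_m n) v1; have mc := version_measurable (@fyX_m n) v2.
  have M1 : measurable [set w | Es (g n w)] by have := mg measurableT Es mE; rewrite setTI.
  have M2 : measurable [set w | Es (covR n w)] by have := mc measurableT Es mE; rewrite setTI.
  have v3 : cond_prob_version P (sigma_of (@fX n)) [set w | Es (covR n w)] (h n).
    have [ha' hb hc] := hh n pn; split=> // A sA; rewrite hc//.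
    have mA : measurable A by apply: (smallest_sub _ (@fX_m n)) sA; exact: sigma_algebra_measurable.
    apply: ae_measure_eq; [exact: measurableI|exact: measurableI|].
    by apply: filterS (version_unique (@fyX_m n) v1 v2) => w /= ->.
  pose TG := g_sigma_algebraType (fam_preimages (@fX n)).
  pose covS (z : TG * TE) := coverage_prob epsf beta (design (x z.1) n) (xf z.1)
    (design (x z.1) n *m beta + \col_(i < n) eta i z.2) (1 - alpha) (1 - gamma).
  have m1 : mx_measurable (fun z : TG * TE => design (x z.1) n).
    move=> i j; apply: (measurableT_comp (@fam_measurable _ _ _ _ (@fX n) (inl (i, j)))); exact: measurable_fst.
  have m2 : mx_measurable (fun z : TG * TE => xf z.1).
    move=> i j; rewrite (ord1 j); apply: (measurableT_comp (@fam_measurable _ _ _ _ (@fX n) (inr i))); exact: measurable_fst.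
  have m3 : mx_measurable (fun z : TG * TE => \col_(i < n) eta i z.2).
    move=> i j; under eq_fun do rewrite mxE.
    apply: (measurableT_comp (@fam_measurable _ _ _ _ eta i)); exact: measurable_snd.
  have mcov := coverage_prob_measurable epsf beta (1 - alpha) m1 m2 (observations_measurable m1 m3) n0 h1g.
  have mS : measurable (covS @^-1` Es) by have := mcov measurableT Es mE; rewrite setTI.
  have mid : measurable_fun setT (id : Omega -> TE) by move=> _ B mB; rewrite setTI; exact: m_eta.
  have ind : indep_maps P (id : Omega -> TG) (id : Omega -> TE).
    move=> A B mA mB; apply: (indep_pi_left Pi2m _ _ (m_eta mB)) => [||_ [A2 [A3 [a2 a3 ->]]]|]; last exact: (@fX_sub n A mA).
    - move=> _ _ [A2 [A3 [a2 a3 ->]]] [B2 [B3 [b2 b3 ->]]].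
      by exists (A2 `&` B2), (A3 `&` B3); split; try exact: sI; rewrite setIACA.
    - by exists setT, setT; split; try exact: sT; rewrite setIT.
    have := three_indep (@sT _ eta) a2 a3; rewrite setTI probability_setT mul1e => e1.
    by rewrite setIC three_indep// e1 muleC.
  have v4 := freezing (@fX_m n) mid ind mS.
  apply: filterS (version_unique (@fX_m n) v3 v4) => w ->; congr (fine (P _)).
  by apply/seteqP; split=> v /=; rewrite /covS /cov pn.
have all_n : {ae P, forall w, forall n, (p <= n)%N -> h n w = fine (P [set v | Es (cov (x w) (xf w) n v)])}.
  apply: ae_foralln => n; have [pn|pn] := leqP p n; last by apply: aeW => w pn'; exfalso; move: pn pn'; rewrite ltnNge => /negP.
  by apply: filterS (version n pn) => w ->.
apply: filterS2 hd all_n => w hw e; apply: cvgR_near_eq (lim _ _ hw).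
by exists p => // n /= pn; rewrite e.
Qed.
End random_design.
End main.

Theorem corollary2 (R : realType) (d : measure_display)
  (Omega : measurableType d) (P : probability Omega R) (p : nat)
  (eps : nat -> {RV P >-> R}) (epsf : {RV P >-> R})
  (beta : 'cV[R]_p) (sigma : R)
  (p_gt0 : (0 < p)%N)
  (eps_indep : mutual_indep P (fun i => eps i : Omega -> R))
  (eps_ident : forall i (B : set R), measurable B ->
     distribution P (eps i) B = distribution P (eps 0%N) B)
  (eps_mean : ('E_P[eps 0%N] = 0)%E)
  (eps_var : ('V_P[eps 0%N] = (sigma ^+ 2)%R%:E)%E)
  (eps_ac : distribution P (eps 0%N) `<< (@lebesgue_measure R))
  (F_derivable : forall t, derivable (real_cdf (eps 0%N)) t 1)
  (F'_derivable : forall t, derivable (derive1 (real_cdf (eps 0%N))) t 1)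
  (F''_continuous : continuous (derive1n 2 (real_cdf (eps 0%N))))
  (F''_bounded : exists K, forall t, `|derive1n 2 (real_cdf (eps 0%N)) t| <= K)
  (eps_moment4 : ('E_P[fun w => (`|eps 0%N w| ^+ 4)%R] < +oo)%E)
  (epsf_indep : indep_fam P (fun _ : unit => epsf : Omega -> R)
                            (fun i => eps i : Omega -> R))
  (epsf_ident : forall B : set R, measurable B ->
     distribution P epsf B = distribution P (eps 0%N) B) :
  let F := real_cdf (eps 0%N) in
  let H := truncated_mean (eps 0%N) in
  let errors := join_fam (fun i => eps i : Omega -> R)
                         (fun _ : unit => epsf : Omega -> R) in
  (* fixed design *)
  (forall (x : nat -> 'cV[R]_p) (xf : 'cV[R]_p),
     design_assumptions F H sigma x xf ->
     forall alpha gamma delta : R,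
     0 < alpha < 1 -> 0 < gamma < 1 -> 0 < delta ->
     forall g : nat -> Omega -> R,
     (forall n, (p <= n)%N ->
        cond_prob_version P
          (sigma_of (@obs_fam _ _ _ _ eps beta (cst x) n))
          (coverage_event eps epsf beta (cst x) (cst xf)
             (1 - alpha) (1 - gamma) n)
          (g n)) ->
     (P [set w | `|g n w - (1 - alpha)| <= delta] @[n --> \oo] --> 1%:E) /\
     (P [set w | 1 - alpha <= g n w] @[n --> \oo] --> (1 - gamma)%:E)) /\
  (* random design *)
  (forall (x : Omega -> nat -> 'cV[R]_p) (xf : Omega -> 'cV[R]_p),
     (forall i j, measurable_fun setT (fun w => x w i j 0)) ->
     (forall j, measurable_fun setT (fun w => xf w j 0)) ->
     indep_fam P (xf_fam xf) errors ->
     indep_fam P (regressor_fam x) (join_fam errors (xf_fam xf)) ->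
     {ae P, forall w, design_assumptions F H sigma (x w) (xf w)} ->
     forall alpha gamma delta : R,
     0 < alpha < 1 -> 0 < gamma < 1 -> 0 < delta ->
     forall g h1 h2 : nat -> Omega -> R,
     let sigma_Xxf n :=
       sigma_of (join_fam (@design_fam _ _ _ _ x n) (xf_fam xf)) in
     let sigma_yXxf n :=
       sigma_of (join_fam (@obs_fam _ _ _ _ eps beta x n)
                   (join_fam (@design_fam _ _ _ _ x n) (xf_fam xf))) in
     (forall n, (p <= n)%N ->
        cond_prob_version P (sigma_yXxf n)
          (coverage_event eps epsf beta x xf (1 - alpha) (1 - gamma) n)
          (g n)) ->
     (forall n, (p <= n)%N ->
        cond_prob_version P (sigma_Xxf n)
          [set w | `|g n w - (1 - alpha)| <= delta] (h1 n)) ->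
     (forall n, (p <= n)%N ->
        cond_prob_version P (sigma_Xxf n)
          [set w | 1 - alpha <= g n w] (h2 n)) ->
     {ae P, forall w, h1 n w @[n --> \oo] --> (1 : R)} /\
     {ae P, forall w, h2 n w @[n --> \oo] --> 1 - gamma}).
Proof.
move=> F H errors; split.
  move=> x xf hd alpha gamma delta ha hg d0 g hver.
  have [l1 l2] := fixed_design_limits beta p_gt0 eps_indep eps_ident eps_mean eps_var eps_ac F_derivable
    eps_moment4 epsf_ident ha hg hd.
  split.
    exact: (fixed_transfer p_gt0 epsf_indep hg (interval_measurable alpha delta) hver (l1 delta d0)).
  exact: (fixed_transfer p_gt0 epsf_indep hg (ray_measurable alpha) hver l2).
move=> x xf mx mxf xf_indep x_indep hd alpha gamma delta ha hg d0 g h1 h2 sX syX hver hv1 hv2.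
have lim x0 xf0 := fixed_design_limits beta p_gt0 eps_indep eps_ident eps_mean eps_var eps_ac F_derivable
  eps_moment4 epsf_ident ha hg (x := x0) (xf := xf0).
split.
  apply: (random_transfer p_gt0 epsf_indep hg mx mxf xf_indep x_indep (interval_measurable alpha delta) hd hver hv1).
  by move=> x0 xf0 hd0; have [l1 _] := lim x0 xf0 hd0; exact: l1.
apply: (random_transfer p_gt0 epsf_indep hg mx mxf xf_indep x_indep (ray_measurable alpha) hd hver hv2).
by move=> x0 xf0 hd0; have [_ l2] := lim x0 xf0 hd0; exact: l2.
Qed.
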